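(* Let $\Omega\subset\mathbb R^3$ be a bounded Lipschitz domain that is simply connected with connected boundary. Then there is a stable direct sum decomposition $$\boldsymbol H(\operatorname{curl}\operatorname{curl},(K_0^c)')=\operatorname{spn}^{-1}\operatorname{skw}\boldsymbol H^0(\mathbf{div},\operatorname{dev}\operatorname{sym})\oplus K_0^c .$$ Stability means that every $\boldsymbol\phi\in\boldsymbol H(\operatorname{curl}\operatorname{curl},(K_0^c)')$ can be written $\boldsymbol\phi=\operatorname{spn}^{-1}\operatorname{skw}\boldsymbol\sigma+\boldsymbol w$ with $\boldsymbol\sigma\in\boldsymbol H^0(\mathbf{div},\operatorname{dev}\operatorname{sym})$, $\boldsymbol w\in K_0^c$ and $\|\boldsymbol\sigma\|_0+\|\boldsymbol w\|_{H(\operatorname{curl})}\le C\|\boldsymbol\phi\|_{\boldsymbol H(\operatorname{curl}\operatorname{curl},(K_0^c)')}$, with $C$ independent of $\boldsymbol\phi$.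
   Context: $\mathbb M$ is the space of $3\times3$ matrices; $\operatorname{sym}\boldsymbol\tau=(\boldsymbol\tau+\boldsymbol\tau^{\intercal})/2$, $\operatorname{skw}\boldsymbol\tau=(\boldsymbol\tau-\boldsymbol\tau^{\intercal})/2$, $\operatorname{dev}\boldsymbol\tau=\boldsymbol\tau-\tfrac13(\operatorname{tr}\boldsymbol\tau)\boldsymbol I$. For $\boldsymbol a=(a_1,a_2,a_3)^{\intercal}$, $\operatorname{spn}\boldsymbol a=\begin{pmatrix}0&-a_3&a_2\\ a_3&0&-a_1\\ -a_2&a_1&0\end{pmatrix}$; it is a bijection of $\mathbb R^3$ onto the skew-symmetric matrices, with inverse $\operatorname{spn}^{-1}$. $\boldsymbol L_0^2(\Omega;\mathbb M)=\{\boldsymbol\tau\in\boldsymbol L^2(\Omega;\mathbb M):\int_\Omega\operatorname{tr}\boldsymbol\tau=0\}$. $\boldsymbol H^0(\mathbf{div},\operatorname{dev}\operatorname{sym})=\{\boldsymbol\tau\in\boldsymbol L_0^2(\Omega;\mathbb M):\mathbf{div}\boldsymbol\tau=\boldsymbol0,\ \operatorname{dev}\operatorname{sym}\boldsymbol\tau=\boldsymbol0\}$ with norm $\|\cdot\|_0$, where $\mathbf{div}$ is the row-wise (distributional) divergence. $\boldsymbol H_0(\operatorname{curl},\Omega)$ is the space of $\boldsymbol L^2$ fields with $\boldsymbol L^2$ curl and vanishing tangential trace; $K_0^c=\{\boldsymbol\phi\in\boldsymbol H_0(\operatorname{curl},\Omega):\operatorname{div}\boldsymbol\phi=0\}$ with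 norm $\|\cdot\|_{H(\operatorname{curl})}$, and $(K_0^c)'$ is its dual. Since $\boldsymbol H_0(\operatorname{curl},\Omega)=K_0^c\oplus\nabla H_0^1(\Omega)$, an element of $(K_0^c)'$ is regarded as a functional on $\boldsymbol H_0(\operatorname{curl},\Omega)$ vanishing on $\nabla H_0^1(\Omega)$, hence as a (divergence-free) distribution; in this sense $\boldsymbol H(\operatorname{curl}\operatorname{curl},(K_0^c)')=\{\boldsymbol\phi\in\boldsymbol L^2(\Omega;\mathbb R^3):\operatorname{curl}\operatorname{curl}\boldsymbol\phi\in(K_0^c)'\}$, with squared norm $\|\boldsymbol\phi\|_0^2+\|\operatorname{curl}\operatorname{curl}\boldsymbol\phi\|_{(K_0^c)'}^2$. *)

(* Defs.v *)
From HB Require Import structures.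
From mathcomp Require Import all_boot all_order all_algebra.
From mathcomp Require Import all_classical all_reals all_analysis.

Set Implicit Arguments.
Unset Strict Implicit.
Unset Printing Implicit Defensive.

Import Order.TTheory GRing.Theory Num.Theory.
Import numFieldNormedType.Exports.

Local Open Scope classical_set_scope.
Local Open Scope ring_scope.

(** Points of the physical space are triples [R * R * R], which carry both the
    product topology and the product measurable structure; values of vector
    fields are row vectors ['rV[R]_3].  Fields are total functions, but only
    their restriction to the domain [D] matters, and they stand for their
    almost-everywhere classes. *)

Section Algebra.
Context {R : realType}.

Definition row3 (a b c : R) : 'rV[R]_3 := \row_j nth 0 [:: a; b; c] j.

Definition sym (A : 'M[R]_3) : 'M[R]_3 := 2^-1 *: (A + A^T).
Definition skw (A : 'M[R]_3) : 'M[R]_3 := 2^-1 *: (A - A^T).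
Definition dev (A : 'M[R]_3) : 'M[R]_3 := A - (3^-1 * \tr A)%:M.

Definition spn (a : 'rV[R]_3) : 'M[R]_3 :=
  let a1 := a 0 0 in let a2 := a 0 1 in let a3 := a 0 2 in
  \matrix_(i, j) nth 0 (nth [::] [:: [::   0; - a3;   a2];
                                     [::  a3;    0; - a1];
                                     [:: - a2;  a1;    0]] i) j.

(** Inverse of [spn] on skew-symmetric matrices: see [spnK] and [spn_invK]. *)
Definition spn_inv (A : 'M[R]_3) : 'rV[R]_3 := row3 (A 2 1) (A 0 2) (A 1 0).

Lemma spn_skew a : (spn a)^T = - spn a.
Proof.
apply/matrixP => i j; rewrite !mxE.
by case: i => [[|[|[|//]]] ?]; case: j => [[|[|[|//]]] ?];
  rewrite /= ?oppr0 ?opprK.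
Qed.

Lemma spnK : cancel spn spn_inv.
Proof.
move=> a; apply/rowP => j; rewrite !mxE.
by case: j => [[|[|[|//]]] ?] /=; congr (a _ _); apply: val_inj.
Qed.

Lemma spn_invK A : A^T = - A -> spn (spn_inv A) = A.
Proof.
move=> /matrixP sA; have {}sA i j : A j i = - A i j.
  by have := sA i j; rewrite !mxE.
have d0 i : A i i = 0.
  by have := mulrn_eq0 (A i i) 2; rewrite mulr2n {2}sA subrr eqxx => /esym/eqP.
apply/matrixP => i j; rewrite !mxE.
have [->|] := eqVneq i j; first by rewrite d0; case: j => [[|[|[|]]] ?].
case: i => [[|[|[|//]]] ?]; case: j => [[|[|[|//]]] ?] //= _; rewrite -?sA;
  by congr (A _ _); apply: val_inj.
Qed.

Definition dot m n (A B : 'M[R]_(m, n)) : R := \sum_i \sum_j A i j * B i j.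

Definition vec (x : R * R * R) : 'rV[R]_3 := row3 x.1.1 x.1.2 x.2.

End Algebra.

Section Domains.
Context {R : realType}.
Implicit Type D : set (R * R * R).
Local Notation I01 := `[0 : R, 1 : R]%classic.

Definition boundary D : set (R * R * R) := closure D `\` interior D.

(** Near each boundary point, after an isometry of the coordinates, [D] is the
    strict epigraph of a Lipschitz function. *)
Definition lipschitz_boundary D : Prop :=
  forall x0, boundary D x0 ->
  exists (Q : 'M[R]_3) (g : R * R -> R) (k : R),
    [/\ Q *m Q^T = 1%:M, k.-lipschitz g &
        \forall x \near x0, D x <->
          let y := vec x *m Q in g (y 0 0, y 0 1) < y 0 2].

Definition bounded_lipschitz_domain D : Prop :=
  [/\ D !=set0, open D, connected D, bounded_set D & lipschitz_boundary D].

Definition simply_connected D : Prop :=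
  (forall x y, D x -> D y -> exists p : R -> R * R * R,
    [/\ {within I01, continuous p}, p @` I01 `<=` D,
        p 0 = x & p 1 = y]) /\
  (forall p : R -> R * R * R,
    {within I01, continuous p} -> p @` I01 `<=` D -> p 0 = p 1 ->
    exists H : R * R -> R * R * R,
      [/\ {within I01 `*` I01, continuous H},
          H @` (I01 `*` I01) `<=` D,
          forall s : R, 0 <= s <= 1 -> H (s, 0) = p s,
          forall s : R, 0 <= s <= 1 -> H (s, 1) = p 0 &
          forall t : R, 0 <= t <= 1 -> H (0, t) = p 0 /\ H (1, t) = p 0]).

End Domains.

Section Fields.
Context {R : realType}.
Local Notation space := (R * R * R)%type.
Local Notation vfield := (space -> 'rV[R]_3).
Implicit Types (D : set space) (f q : space -> R) (u v w c : vfield).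

Definition leb3 :=
  ((@lebesgue_measure R \x @lebesgue_measure R) \x @lebesgue_measure R)%E.
HB.instance Definition _ := Measure.on leb3.

Definition basis (i : 'I_3) : space :=
  ((i == 0)%:R, (i == 1)%:R, (i == 2)%:R).

Definition partial (i : 'I_3) f : space -> R := 'D_(basis i) f.

Definition smooth f : Prop :=
  forall (s : seq 'I_3) x, differentiable (foldr partial f s) x.

Definition grad f : vfield := fun x => \row_i partial i f x.

Definition div v : space -> R :=
  fun x => \sum_i partial i (fun y => v y 0 i) x.

(** The indices in ['I_3] are added modulo 3. *)
Definition curl v : vfield := fun x => \row_i
  (partial (i + 1) (fun y => v y 0 (i + 2)) x -
   partial (i + 2) (fun y => v y 0 (i + 1)) x).

Definition test_fun D q : Prop :=
  let K := closure [set x | q x != 0] in [/\ smooth q, compact K & K `<=` D].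

Definition test_field D v : Prop := forall i, test_fun D (fun x => v x 0 i).

Definition L2fun D f : Prop :=
  measurable_fun D f /\ leb3.-integrable D (fun x => (f x ^+ 2)%:E).

Definition L2 D m n (u : space -> 'M[R]_(m, n)) : Prop :=
  forall i j, L2fun D (fun x => u x i j).

Definition ip D m n (u v : space -> 'M[R]_(m, n)) : R :=
  \int[leb3]_(x in D) dot (u x) (v x).

Definition norm0 D m n (u : space -> 'M[R]_(m, n)) : R := Num.sqrt (ip D u u).

Definition is_weak_grad D f (g : vfield) : Prop :=
  forall v, test_field D v -> ip D g v = - \int[leb3]_(x in D) (f x * div v x).

Definition is_weak_div D u f : Prop :=
  forall q, test_fun D q -> \int[leb3]_(x in D) (f x * q x) = - ip D u (grad q).

Definition is_weak_curl D u c : Prop :=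
  forall v, test_field D v -> ip D c v = ip D u (curl v).

(** The [L^2] weak gradient and curl, unique up to a null set when they
    exist. *)
Definition weak_grad D f : vfield :=
  xget (fun=> 0) [set g | L2 D g /\ is_weak_grad D f g].

Definition weak_curl D u : vfield :=
  xget (fun=> 0) [set c | L2 D c /\ is_weak_curl D u c].

Definition H1 D f : Prop :=
  L2fun D f /\ exists g, L2 D g /\ is_weak_grad D f g.

Definition H1field D v : Prop := forall i, H1 D (fun x => v x 0 i).

(** Closure of the test functions in the [H^1] norm. *)
Definition H1_0 D f : Prop :=
  H1 D f /\ forall e : R, 0 < e -> exists q, test_fun D q /\
    \int[leb3]_(x in D) ((f x - q x) ^+ 2) +
    norm0 D (fun x => weak_grad D f x - grad q x) ^+ 2 < e.

Definition Hcurl D u : Prop :=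
  L2 D u /\ exists c, L2 D c /\ is_weak_curl D u c.

Definition Hcurl_norm D u : R :=
  Num.sqrt (norm0 D u ^+ 2 + norm0 D (weak_curl D u) ^+ 2).

(** The tangential trace [n x u] as a functional on (the traces of) [H^1]
    fields, given by Green's formula. *)
Definition tangential_trace D u v : R :=
  ip D (weak_curl D u) v - ip D u (weak_curl D v).

Definition Hcurl0 D u : Prop :=
  Hcurl D u /\ forall v, H1field D v -> tangential_trace D u v = 0.

Definition K0c D u : Prop := Hcurl0 D u /\ is_weak_div D u (fun=> 0).

(** An element of the dual of [K0c], extended by zero on gradients of [H1_0]
    functions to a functional on [Hcurl0].  Only the values of [l] on [Hcurl0]
    matter; the bound on [K0c] makes them independent of representatives. *)
Definition K0c_dual D (l : vfield -> R) : Prop :=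
  [/\ forall (a : R) u v, Hcurl0 D u -> Hcurl0 D v ->
        l (fun x => a *: u x + v x) = a * l u + l v,
      exists M : R, forall w, K0c D w -> `|l w| <= M * Hcurl_norm D w &
      forall q, H1_0 D q -> l (weak_grad D q) = 0].

Definition K0c_dual_norm D (l : vfield -> R) : R :=
  sup [set `|l w| | w in [set w | K0c D w /\ Hcurl_norm D w <= 1]].

(** The distribution [curl curl u] is the restriction of [l] to test fields. *)
Definition is_curlcurl D u (l : vfield -> R) : Prop :=
  forall v, test_field D v -> l v = ip D u (curl (curl v)).

Definition Hcurlcurl D u : Prop :=
  L2 D u /\ exists l, K0c_dual D l /\ is_curlcurl D u l.

Definition curlcurl D u : vfield -> R :=
  xget (fun=> 0) [set l | K0c_dual D l /\ is_curlcurl D u l].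

Definition Hcurlcurl_norm D u : R :=
  Num.sqrt (norm0 D u ^+ 2 + K0c_dual_norm D (curlcurl D u) ^+ 2).

Definition H0_div_devsym D (s : space -> 'M[R]_3) : Prop :=
  [/\ L2 D s,
      \int[leb3]_(x in D) \tr (s x) = 0,
      forall i, is_weak_div D (fun x => row i (s x)) (fun=> 0) &
      (fun x => dev (sym (s x))) = (fun=> 0) %[ae leb3 in D]].

End Fields.

(* Main.v *)
Require Import Defs.
From HB Require Import structures.
From mathcomp Require Import all_boot all_order all_algebra.
From mathcomp Require Import all_classical all_reals all_analysis.
From mathcomp Require Import measurable_realfun lebesgue_integral ring lra.
From mathcomp Require finmap.
Set Implicit Arguments.
Unset Strict Implicit.
Unset Printing Implicit Defensive.
Import Order.TTheory GRing.Theory Num.Theory.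
Import numFieldNormedType.Exports.
Local Open Scope classical_set_scope.
Local Open Scope ring_scope.

(** Let [l] be [curl curl phi], a functional in the dual of [K0c].  A test field
    minus its projection on gradients ([proj_exists]) is divergence-free, so the
    Friedrichs inequality ([friedrichs_test], [friedrichs_proj]) bounds it by its
    curl, and [l], which vanishes on gradients, is bounded by the curl alone on
    test fields ([dual_tests]).  Riesz representation ([riesz_range],
    [curlcurl_solve]) gives a limit [w] of test fields in [K0c] with
    [curl curl w = l].

    Then [a = phi - w] satisfies [curl curl a = 0] weakly, so [curl a] is curl-free
    and divergence-free, hence harmonic: it is recovered from [a] by averaging
    against the Laplacian [rho] of a smoothed Newtonian potential, with interior
    bounds in terms of [a] ([hcurl_weak], [field_bound]).  As the domain is
    simply connected, [curl a] is the gradient of a function [q] ([monodromy]).  The distance to the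
    boundary times [curl a] is square integrable; hence so is [q], by transport
    along balls inside the domain and by comparing a boundary layer with its
    translates ([layer_bound], [sol_bound]).  Integration by parts ([weak_identity])
    reads [(a, curl v) = - (q, div v)] for test fields [v]: the tensor with skew part
    [spn a] and trace part [q], normalized to mean zero, has divergence zero
    ([tensor_H0]).

    Conversely such a tensor has a skew part with vanishing weak [curl curl]
    ([skw_orth]), which gives the other inclusion ([sum_curlcurl]).  Since fields
    with zero tangential trace are limits of test fields ([test_dense_curl]),
    a common element of the two spaces has zero curl, and the Friedrichs inequality
    makes it zero ([directness]). *)

Notation bas := Defs.basis.
Notation measf := measurable_fun.
Notation ballE := ball_normE.
Notation mEFinP := measurable_EFinP.
Notation mfunM := measurable_funM.
Notation mfcomp := measurableT_comp.
Notation leb1 := lebesgue_measure.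
Notation eq_int := eq_Rintegral.

Lemma abs_lt_sq {R : realDomainType} (e x : R) : 0 < e -> x ^+ 2 < e ^+ 2 -> `|x| < e.
by move=> e0 H; rewrite -(ltr_pXn2r (n := 2)) ?nnegrE ?normr_ge0 ?(ltW e0)//
 -normrX ger0_norm ?sqr_ge0.
Qed.

Lemma abs_le_sq {R : realDomainType} (e x : R) : 0 <= e -> x ^+ 2 <= e ^+ 2 -> `|x| <= e.
by move=> e0 H; rewrite -(ler_pXn2r (n := 2)) ?nnegrE ?normr_ge0// -normrX ger0_norm ?sqr_ge0.
Qed.

(** * Representation of functionals on a semi-inner product space *)
Section Hilbert.
Context {R : realType} {V W : lmodType R}.
Variables (L : set V) (b : V -> V -> R).
Hypothesis (L0 : L 0) (LP : forall a u v, L u -> L v -> L (a *: u + v)).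
Hypothesis bC : forall u v, L u -> L v -> b u v = b v u.
Hypothesis bP : forall a u v w, L u -> L v -> L w ->
 b (a *: u + v) w = a * b u w + b v w.
Hypothesis b_ge0 : forall u, L u -> 0 <= b u u.

Lemma ssip_D u v w : L u -> L v -> L w -> b (u + v) w = b u w + b v w.
by move=> Lu Lv Lw; rewrite -[u]scale1r bP// mul1r scale1r. Qed.

Lemma ssip_0 w : L w -> b 0 w = 0.
move=> Lw; have := ssip_D L0 L0 Lw; rewrite addr0 => /eqP.
by rewrite -subr_eq subrr => /eqP <-.
Qed.

Lemma ssip_Z a u w : L u -> L w -> b (a *: u) w = a * b u w.
by move=> Lu Lw; rewrite -[a *: u]addr0 bP// ssip_0// addr0. Qed.

Lemma ssip_LZ a u : L u -> L (a *: u).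
by move=> Lu; rewrite -[_ *: _]addr0; exact: LP. Qed.

Lemma ssip_LD u v : L u -> L v -> L (u + v).
by move=> Lu Lv; rewrite -[u]scale1r; exact: LP. Qed.

Lemma ssip_LB u v : L u -> L v -> L (u - v).
by move=> Lu Lv; rewrite addrC -scaleN1r; exact: LP. Qed.

Lemma ssip_B u v w : L u -> L v -> L w -> b (u - v) w = b u w - b v w.
by move=> Lu Lv Lw; rewrite addrC -scaleN1r bP// mulN1r addrC.
Qed.

Lemma ssip_sqP a u v : L u -> L v ->
 b (a *: u + v) (a *: u + v) = a ^+ 2 * b u u + a * b u v *+ 2 + b v v.
move=> Lu Lv; have La := ssip_LZ a Lu; have Luv := LP a Lu Lv.
rewrite bP// [b u _]bC// [b v _]bC// !bP// (bC Lv Lu); ring.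
Qed.

Lemma ssip_sqB u v : L u -> L v ->
 b (u - v) (u - v) = b u u - b u v *+ 2 + b v v.
move=> Lu Lv; rewrite addrC -scaleN1r ssip_sqP// (bC Lv Lu); ring.
Qed.

Lemma ssip_CS u v : L u -> L v -> b u v ^+ 2 <= b u u * b v v.
move=> Lu Lv.
have H a : 0 <= a ^+ 2 * b u u + a * b u v *+ 2 + b v v by rewrite -ssip_sqP//; apply: b_ge0; exact: LP.
have [u0|u0] := eqVneq (b u u) 0; last first.
 have up : 0 < b u u by rewrite lt_def u0 b_ge0. have := H (- b u v / b u u). rewrite -(pmulr_rge0 _ up).
 set x := b u u; set y := b u v; set z := b v v.
 have -> : x * ((- y / x) ^+ 2 * x + (- y / x * y) *+ 2 + z) = x * z - y ^+ 2 by field. by rewrite subr_ge0.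
rewrite u0 mul0r.
have [->|y0] := eqVneq (b u v) 0; first by rewrite expr0n.
have := H (- (b v v + 1) / (b u v *+ 2)).
rewrite u0 mulr0 add0r.
have -> : - (b v v + 1) / (b u v *+ 2) * b u v *+ 2 = - (b v v + 1) by field; rewrite y0.
lra.
Qed.

Lemma ssip_le u v : L u -> L v ->
 `|b u v| <= Num.sqrt (b u u) * Num.sqrt (b v v).
move=> Lu Lv; rewrite -sqrtr_sqr -sqrtrM ?b_ge0//.
by rewrite ler_wsqrtr// ssip_CS.
Qed.

Lemma ssip_triangle u v : L u -> L v ->
 Num.sqrt (b (u + v) (u + v)) <= Num.sqrt (b u u) + Num.sqrt (b v v).
move=> Lu Lv.
rewrite -[leRHS]ger0_norm ?addr_ge0 ?sqrtr_ge0// -sqrtr_sqr ler_wsqrtr//.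
have := ssip_sqP 1 Lu Lv; rewrite scale1r expr1n !mul1r => ->.
rewrite sqrrD !sqr_sqrtr ?b_ge0// lerD2r lerD2l.
by rewrite lerMn2r/= (le_trans (ler_norm _))// ssip_le.
Qed.

Definition ssip_cauchy (u : nat -> V) := forall e : R, 0 < e ->
 exists N, forall m n, (N <= m)%N -> (N <= n)%N -> b (u m - u n) (u m - u n) < e.
Definition ssip_lim (u : nat -> V) v := forall e : R, 0 < e ->
 exists N, forall n, (N <= n)%N -> b (u n - v) (u n - v) < e.

Hypothesis complete : forall u, (forall n, L (u n)) -> ssip_cauchy u ->
 exists2 v, L v & ssip_lim u v.

Lemma ssip_lim_cvg u v w : (forall n, L (u n)) -> L v -> L w ->
 ssip_lim u v -> (fun n => b (u n) w) @ \oo --> b v w.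
move=> Lu Lv Lw uv; apply/cvgrPdist_lt => e e0.
have B1 : 0 < b w w + 1 by rewrite ltr_wpDl// b_ge0.
have [|N HN] := uv (e ^+ 2 / (b w w + 1)); first by rewrite divr_gt0 ?exprn_gt0.
exists N => // n /= Nn.
rewrite distrC -ssip_B//; apply: abs_lt_sq => //.
have Lun : L (u n - v) by exact: ssip_LB.
apply: le_lt_trans (ssip_CS Lun Lw) _.
have := HN n Nn; rewrite ltr_pdivlMr// => H.
apply: le_lt_trans H.
by rewrite ler_wpM2l ?b_ge0// lerDl.
Qed.

Variables (S : set W) (A : W -> V) (l : W -> R) (M : R).
Hypothesis S0 : S 0.
Hypothesis SP : forall a s t, S s -> S t -> S (a *: s + t).
Hypothesis SA : forall t, S t -> L (A t).
Hypothesis AP : forall a s t, S s -> S t -> A (a *: s + t) = a *: A s + A t.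
Hypothesis lP : forall a s t, S s -> S t -> l (a *: s + t) = a * l s + l t.
Hypothesis lM : forall t, S t -> `|l t| <= M * Num.sqrt (b (A t) (A t)).

Let J t := b (A t) (A t) - l t *+ 2.

Let J_ge t : S t -> - M ^+ 2 <= J t.
move=> St; have := lM St; rewrite ler_norml => /andP[_ H].
have := sqr_sqrtr (b_ge0 (SA St)); rewrite /J.
set x := Num.sqrt _ in H * => E; rewrite -E.
have := sqr_ge0 (x - M); rewrite sqrrB; lra.
Qed.

Let JP a s t : S s -> S t ->
 J (a *: s + t) = a ^+ 2 * b (A s) (A s) + a * (b (A s) (A t) - l s) *+ 2 + J t.
by move=> Ss St; rewrite /J AP// lP// ssip_sqP//; [ring|exact: SA|exact: SA].
Qed.

(** The minimum of the energy [b (A t) (A t) - 2 l t] is approached along a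
    sequence that the parallelogram law makes Cauchy; its limit represents
    [l]. *)
Lemma riesz_range : exists psi, exists2 s : nat -> W, (forall n, S (s n)) &
 [/\ L psi, ssip_lim (A \o s) psi, (forall t, S t -> b psi (A t) = l t)
  & 0 <= M -> Num.sqrt (b psi psi) <= M].
pose E := J @` S.
have E0 : has_inf E by split; [exists (J 0), 0|exists (- M ^+ 2) => _ [t St <-]; exact: J_ge].
set d := inf E.
have dJ t : S t -> d <= J t by move=> St; apply: ge_inf; [case: E0|exists t].
have /choice[s Hs] : forall n, exists t, S t /\ J t < d + n.+1%:R^-1.
 move=> n; have n0 : 0 < n.+1%:R^-1 :> R by rewrite invr_gt0.
 by have [_ [t St <-] Jt] := inf_adherent n0 E0; exists t.
have Ss n : S (s n) by case: (Hs n).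
have LA n : L (A (s n)) by exact: SA.
have AN t : S t -> A (- t) = - A t.
 move=> St; have := AP (-1) St S0; rewrite !scaleN1r addr0 => ->.
 by have := AP (-1) S0 S0; rewrite scaleN1r oppr0 addr0 scaleN1r addNr => ->; rewrite addr0.
have par x y : S x -> S y -> b (A x - A y) (A x - A y) <= J x *+ 2 + J y *+ 2 - d *+ 4.
 move=> Sx Sy; have L1 := SA Sx; have L2 := SA Sy.
 have SZ : S (2^-1 *: x) by rewrite -[_ *: _]addr0; exact: SP.
 have Sh : S (2^-1 *: y + 2^-1 *: x) by exact: SP. have := dJ _ Sh; rewrite JP// -[2^-1 *: x]addr0 JP//.
 have A00 : A 0 = 0 by have := AP (-1) S0 S0; rewrite scaleN1r oppr0 addr0 scaleN1r addNr.
 have l00 : l 0 = 0 by have := lP (-1) S0 S0; rewrite scaleN1r oppr0 addr0 mulN1r addNr.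
 rewrite AP// A00 addr0 [b (A y) (_ *: _)]bC ?ssip_LZ//; last exact: ssip_LZ.
 rewrite ssip_Z// ssip_sqB// /J A00 l00 ssip_0//. rewrite [b (A x) 0]bC// ssip_0//.
 set a := b _ _; set c := b _ _; set e := b _ _; lra.
have cau : ssip_cauchy (A \o s).
 move=> e e0; pose N := Num.bound (e / 4)^-1.
 exists N => m n Nm Nn; apply: le_lt_trans (par _ _ _ _) _; rewrite ?Ss//.
 have bnd k : (N <= k)%N -> J (s k) < d + e / 4.
  move=> Nk; case: (Hs k) => _ /lt_le_trans; apply; rewrite lerD2l.
  rewrite -[leRHS]invrK lef_pV2 ?posrE ?invr_gt0 ?divr_gt0//.
  apply: le_trans (ltW (archi_boundP _)) _; first by rewrite invr_ge0 divr_ge0// ltW.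
  by rewrite ler_nat (leq_trans Nk).
 have := bnd m Nm; have := bnd n Nn; lra.
have [psi Lpsi lim] := complete LA cau.
have rep t : S t -> b psi (A t) = l t.
 move=> St; have LAt := SA St. have cv := ssip_lim_cvg LA Lpsi LAt lim.
 suff cl : (fun n => b (A (s n)) (A t)) @ \oo --> l t by exact: cvg_unique cv cl.
 apply/cvgrPdist_lt => e e0; set B := b (A t) (A t) + 1. have B0 : 0 < B by rewrite ltr_wpDl// b_ge0.
 exists (Num.bound (e ^+ 2 / B)^-1) => // n /= Nn. set D := b (A (s n)) (A t) - l t.
 have H : D ^+ 2 <= n.+1%:R^-1 * B.
  have := dJ _ (SP (- D / B) St (Ss n)); rewrite JP// (bC LAt (LA n)) -/D => H.
  have {H} : 0 <= (- D / B) ^+ 2 * b (A t) (A t) + (- D / B * D) *+ 2 + n.+1%:R^-1.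
   case: (Hs n) => _; rewrite -(ltrD2l ((- D / B) ^+ 2 * b (A t) (A t) + - D / B * D *+ 2)).
   by move=> /(le_lt_trans H)/ltW; rewrite addrCA lerDl.
  have -> : b (A t) (A t) = B - 1 by rewrite /B addrK. rewrite -(pmulr_lge0 _ B0).
  have B1 : B != 0 by rewrite gt_eqF. move: n.+1%:R^-1 => K.
  have -> : ((- D / B) ^+ 2 * (B - 1) + (- D / B * D) *+ 2 + K) * B =
   K * B - D ^+ 2 - (D ^+ 2 / B) by field.
  have : 0 <= D ^+ 2 / B by rewrite divr_ge0 ?sqr_ge0// ltW. lra.
 rewrite distrC; apply: abs_lt_sq => //. apply: le_lt_trans H _; rewrite -ltr_pdivlMr//.
 rewrite -[ltRHS]invrK ltf_pV2 ?posrE ?invr_gt0 ?divr_gt0 ?exprn_gt0//.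
 apply: lt_le_trans (archi_boundP _) _; first by rewrite invr_ge0 divr_ge0// ltW ?exprn_gt0.
 by rewrite ler_nat (leq_trans Nn).
exists psi, s => //; split => // M0.
have cv := ssip_lim_cvg LA Lpsi Lpsi lim.
have [->|p0] := eqVneq (b psi psi) 0; first by rewrite sqrtr0.
set x := Num.sqrt _.
have x0 : 0 < x by rewrite sqrtr_gt0 lt_def p0 b_ge0.
rewrite -(ler_pM2r x0) -expr2 sqr_sqrtr ?b_ge0//.
apply/ler_addgt0Pr => e e0; have e1 : 0 < e / (M + 1) by rewrite divr_gt0// ltr_wpDl.
have [N HN] := lim ((e / (M + 1)) ^+ 2) (exprn_gt0 _ e1).
have /cvgrPdist_lt/(_ _ e0)[N' _ HN'] := cv.
suff : forall e : R, 0 < e -> b psi psi <= M * x + e * (M + 1).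
 by move=> /(_ _ e1); rewrite divfK// gt_eqF// ltr_wpDl.
move=> {N HN N' HN' e1 e0 e}e e0.
have [N HN] := lim (e ^+ 2) (exprn_gt0 _ e0).
have /cvgrPdist_lt/(_ _ e0)[N' _ HN'] := cv.
pose n := maxn N N'.
have := HN' n (leq_maxr _ _); rewrite ltr_norml => /andP[_ h].
have {}h : b psi psi < b (A (s n)) psi + e by rewrite -ltrBlDl.
have h2 : b (A (s n)) psi <= M * (x + e).
 rewrite bC// rep//; apply: le_trans (ler_norm _) _. apply: le_trans (lM (Ss n)) _; apply: ler_wpM2l => //.
 rewrite -[A (s n)](subrK psi) addrC. apply: le_trans (ssip_triangle _ _) _ => //; first exact: ssip_LB.
 rewrite lerD2l -[leRHS](ger0_norm (ltW e0)) -sqrtr_sqr ler_wsqrtr// ltW//. exact: HN (leq_maxl _ _).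
lra.
Qed.

End Hilbert.

Notation itg mu D f := (mu.-integrable D (EFin \o f)).

(** * Square-integrable functions and their completeness *)
Section L2gen.
Context d (T : measurableType d) (R : realType) (mu : {measure set T -> \bar R}).
Variable D : set T.
Hypothesis mD : measurable D.
Implicit Types f g : T -> R.

Definition L2g (E : set T) f :=
 measf E f /\ mu.-integrable E (fun x => (f x ^+ 2)%:E).

Lemma itg_le f g : measf D f -> (forall x, D x -> `|f x| <= g x) ->
 itg mu D g -> itg mu D f.
move=> mf fg ig; apply: le_integrable ig => //; first exact/mEFinP.
by move=> x Dx /=; rewrite lee_fin (le_trans (fg _ Dx))// ler_norm.
Qed.

Lemma itg_meas f : itg mu D f -> measf D f.
by move=> /measurable_int/mEFinP. Qed.

Lemma itg0 : itg mu D (fun=> 0).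
exact: integrable0. Qed.

Lemma itgD f g : itg mu D f -> itg mu D g -> itg mu D (fun x => f x + g x).
by move=> fi gi; exact: (integrableD mD fi gi). Qed.

Lemma itgZ a f : itg mu D f -> itg mu D (fun x => a * f x).
by move=> fi; have := integrableZl mD a fi. Qed.

Lemma itgN f : itg mu D f -> itg mu D (fun x => - f x).
by move=> fi; have := integrableN fi. Qed.

Lemma itgB f g : itg mu D f -> itg mu D g -> itg mu D (fun x => f x - g x).
by move=> fi gi; exact: itgD fi (itgN gi). Qed.

Lemma itg_norm f : itg mu D f -> itg mu D (fun x => `|f x|).
by move=> fi; have := integrable_norm fi. Qed.

Lemma itg_sum I (r : seq I) (P : pred I) (F : I -> T -> R) :
 (forall i, P i -> itg mu D (F i)) -> itg mu D (fun x => \sum_(i <- r | P i) F i x).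
move=> h; rewrite (_ : (fun x => _) = \sum_(i <- r | P i) F i); last first.
 by apply/funext => x; rewrite fct_sumE.
elim/big_rec : _ => [|i f Pi fi]; first exact: itg0.
exact: itgD (h i Pi) fi.
Qed.

Lemma RintZ a f : itg mu D f ->
 \int[mu]_(x in D) (a * f x) = a * \int[mu]_(x in D) f x.
exact: RintegralZl. Qed.

Lemma RintN f : itg mu D f ->
 \int[mu]_(x in D) (- f x) = - \int[mu]_(x in D) f x.
move=> fi; rewrite -mulN1r -RintZ//.
by apply: eq_int => x _; rewrite mulN1r.
Qed.

Lemma Rint_sum I (r : seq I) (P : pred I) (F : I -> T -> R) :
 (forall i, P i -> itg mu D (F i)) -> \int[mu]_(x in D) (\sum_(i <- r | P i) F i x) =
 \sum_(i <- r | P i) \int[mu]_(x in D) F i x.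
move=> h; elim: r => [|i r IH].
 rewrite big_nil; under eq_int do rewrite big_nil. by rewrite /Rintegral integral0.
rewrite big_cons; under eq_int do rewrite big_cons.
case: ifPn => // Pi; rewrite RintegralD ?IH//; [exact: h|exact: itg_sum].
Qed.

Lemma EFin_Rint f : itg mu D f ->
 (\int[mu]_(x in D) (f x)%:E)%E = (\int[mu]_(x in D) f x)%:E.
by move=> fi; rewrite /Rintegral fineK//; exact: integrable_fin_num. Qed.

Lemma ge0_itg f M : measf D f -> (forall x, D x -> 0 <= f x) ->
 (\int[mu]_(x in D) (f x)%:E <= M%:E)%E -> itg mu D f.
move=> mf f0 fM; apply/integrableP; split; first exact/mEFinP.
apply: le_lt_trans (ltry M); apply: le_trans fM.
rewrite le_eqVlt; apply/orP; left; apply/eqP; apply: eq_integral => x /set_mem Dx.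
by rewrite /= ger0_norm// f0.
Qed.

Lemma ae_Rint f g : measf D f -> measf D g ->
 f = g %[ae mu in D] -> \int[mu]_(x in D) f x = \int[mu]_(x in D) g x.
move=> mf mg fg; congr fine; apply: ae_eq_integral => //; try exact/mEFinP.
by move: fg; apply: filterS => x fg Dx; rewrite /= fg.
Qed.

Lemma L2g_meas f : L2g D f -> measf D f. by case. Qed.

Lemma L2g_sq f : L2g D f -> itg mu D (fun x => f x ^+ 2). by case. Qed.

Lemma L2g_dom f g h a : measf D f -> L2g D g -> L2g D h ->
 (forall x, D x -> f x ^+ 2 <= a * (g x ^+ 2 + h x ^+ 2)) -> L2g D f.
move=> mf [mg gi] [mh hi] fgh; split => //.
apply: (itg_le (g := fun x => a * (g x ^+ 2 + h x ^+ 2))).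
- exact: measurable_funX.
- by move=> x Dx; rewrite ger0_norm ?sqr_ge0//; exact: fgh.
- by apply: itgZ; exact: itgD.
Qed.

Lemma L2g_dom1 f g : measf D f -> L2g D g ->
 (forall x, D x -> `|f x| <= `|g x|) -> L2g D f.
move=> mf Lg fg; apply: (@L2g_dom _ g g 1) => // x Dx.
rewrite mul1r -[f x ^+ 2]real_normK ?num_real// -[g x ^+ 2]real_normK ?num_real//.
by rewrite ler_wpDl ?sqr_ge0// lerXn2r ?nnegrE//; exact: fg.
Qed.

Lemma L2g_mul f g : L2g D f -> L2g D g -> itg mu D (fun x => f x * g x).
move=> [mf fi] [mg gi]; apply: (itg_le (g := fun x => f x ^+ 2 + g x ^+ 2)).
- exact: mfunM.
- move=> x _; rewrite normrM -[f x ^+ 2]real_normK ?num_real//.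
 rewrite -[g x ^+ 2]real_normK ?num_real//. by have := sqr_ge0 (`|f x| - `|g x|); rewrite sqrrB;
 have := mulr_ge0 (normr_ge0 (f x)) (normr_ge0 (g x)); lra.
- exact: itgD.
Qed.

Lemma L2g0 : L2g D (fun=> 0).
split; first exact: measurable_cst.
by under eq_fun do rewrite expr0n/=; exact: integrable0.
Qed.

Lemma L2gP a f g : L2g D f -> L2g D g -> L2g D (fun x => a * f x + g x).
move=> Lf Lg; apply: (@L2g_dom _ f g ((a ^+ 2 + 1) * 2)) => //.
- apply: measurable_funD; last by case: Lg.
 by apply: mfunM; [exact: measurable_cst|case: Lf].
- move=> x _; have := sqr_ge0 (a * f x - g x); have := sqr_ge0 (a * g x).
 have := sqr_ge0 (g x); have := sqr_ge0 (f x); rewrite sqrrB sqrrD !exprMn; lra.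
Qed.

Lemma L2gD f g : L2g D f -> L2g D g -> L2g D (fun x => f x + g x).
by move=> Lf Lg; have := L2gP 1 Lf Lg; under eq_fun do rewrite mul1r. Qed.

Lemma L2gZ a f : L2g D f -> L2g D (fun x => a * f x).
by move=> Lf; have := L2gP a Lf L2g0; under eq_fun do rewrite addr0. Qed.

Lemma L2gB f g : L2g D f -> L2g D g -> L2g D (fun x => f x - g x).
by move=> Lf Lg; have := L2gP (-1) Lg Lf; under eq_fun do rewrite mulN1r addrC.
Qed.

Lemma L2g_bound f g M : measf D f -> (forall x, D x -> `|f x| <= M) ->
 L2g D g -> L2g D (fun x => f x * g x).
move=> mf fM Lg; have LM := L2gZ M Lg.
apply: (L2g_dom1 _ LM); first by apply: mfunM => //; case: Lg.
by move=> x Dx; rewrite !normrM ler_wpM2r// (le_trans (fM x Dx))// ler_norm.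
Qed.

Definition sip f g : R := \int[mu]_(x in D) (f x * g x).

Lemma sipC f g : sip f g = sip g f.
by apply: eq_int => x _; rewrite mulrC. Qed.

Lemma sipP a f g h : L2g D f -> L2g D g -> L2g D h ->
 sip (fun x => a * f x + g x) h = a * sip f h + sip g h.
move=> Lf Lg Lh; rewrite /sip -RintZ; last exact: L2g_mul.
rewrite -RintegralD//; [|by apply: itgZ; exact: L2g_mul|exact: L2g_mul].
by apply: eq_int => x _; rewrite mulrDl mulrA.
Qed.

Lemma sip_ge0 f : 0 <= sip f f.
by apply: Rintegral_ge0 => x _; rewrite -expr2 sqr_ge0. Qed.

Lemma sipE f : sip f f = \int[mu]_(x in D) (f x ^+ 2).
by apply: eq_int => x _. Qed.

(** A sequence that is Cauchy in mean square has a subsequence whose increments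
    have squares summable against growing weights, hence converges
    geometrically outside a null set; Fatou's lemma transfers the Cauchy bound
    to the limit. *)
Lemma L2g_complete (u : nat -> T -> R) : (forall n, L2g D (u n)) ->
 (forall e : R, 0 < e -> exists N, forall m n, (N <= m)%N -> (N <= n)%N ->
  sip (fun x => u m x - u n x) (fun x => u m x - u n x) < e) ->
 exists2 v, L2g D v & forall e : R, 0 < e -> exists N, forall n, (N <= n)%N ->
  sip (fun x => u n x - v x) (fun x => u n x - v x) < e.
move=> Lu cau.
have Lmn m n : L2g D (fun x => u m x - u n x) by exact: L2gB.
have /choice[N HN] : forall k, exists N, forall m n, (N <= m)%N -> (N <= n)%N ->
  sip (fun x => u m x - u n x) (fun x => u m x - u n x) < 8^-1 ^+ k.
 by move=> k; apply: cau; rewrite exprn_gt0.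
pose n_ k := (\sum_(i < k.+1) N i)%N.
have nN k : (N k <= n_ k)%N by rewrite /n_ big_ord_recr/= leq_addl.
have nS k : (n_ k <= n_ k.+1)%N by rewrite {2}/n_ big_ord_recr/= leq_addr.
have n_ge k j : (k <= j)%N -> (N k <= n_ j)%N.
 move=> kj; apply: leq_trans (nN k) _; elim: j kj => [|j IH].
  by rewrite leqn0 => /eqP ->.
 case: (ltngtP k j.+1) => // [kj _|-> _ //]. by apply: leq_trans _ (nS j); apply: IH; exact: kj.
pose w k := u (n_ k).
pose dd k x : R := 4 ^+ k * (w k.+1 x - w k x) ^+ 2.
have mdd k : measf D (dd k).
 apply: mfunM; first exact: measurable_cst. by apply: measurable_funX; apply: L2g_meas; exact: Lmn.
have dd0 k x : 0 <= dd k x by apply: mulr_ge0; [rewrite exprn_ge0|exact: sqr_ge0].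
have idd k : (\int[mu]_(x in D) (dd k x)%:E <= (2^-1 ^+ k)%:E)%E.
 rewrite EFin_Rint; last by apply: itgZ; apply: L2g_sq; exact: Lmn.
 rewrite lee_fin RintZ; last by apply: L2g_sq; exact: Lmn.
 rewrite -sipE (_ : 2^-1 ^+ k = 4 ^+ k * 8^-1 ^+ k).
  by rewrite ler_wpM2l ?exprn_ge0// ltW// HN ?n_ge.
 by rewrite -exprMn; congr (_ ^+ _); field.
pose F x := (\sum_(0 <= k <oo) (dd k x)%:E)%E.
have F0 x : (0 <= F x)%E by apply: nneseries_ge0 => k _ _; rewrite lee_fin.
have mF : measf D F.
 apply: ge0_emeasurable_sum => [k x Dx _|k _]; first by rewrite lee_fin. exact/mEFinP.
have iF : mu.-integrable D F.
 apply/integrableP; split => //. under eq_integral do rewrite gee0_abs//.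
 rewrite integral_nneseries//; last by move=> k x Dx; rewrite lee_fin.
  apply: (@le_lt_trans _ _ (\sum_(0 <= k <oo) (2^-1 ^+ k)%:E)%E).
   by apply: lee_nneseries => k *; [apply: integral_ge0 => x Dx; rewrite lee_fin|exact: idd].
  have -> : (fun n => \sum_(0 <= k < n) (2^-1 ^+ k)%:E)%E =
   EFin \o series (geometric 1 2^-1) :> (nat -> \bar R).
   apply/funext => n /=; rewrite /series/= sumEFin; congr (_%:E). by apply: eq_bigr => i _; rewrite mul1r.
  rewrite EFin_lim; last by apply: is_cvg_geometric_series; rewrite ger0_norm ?invf_lt1 ?ltr1n. exact: ltry.
 by move=> k; exact/mEFinP.
pose A := D `&` [set x | (F x < +oo)%E].
have mA : measurable A by exact: emeasurable_fun_infty_o.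
pose W k x := w k x * \1_A x.
have mW k : measf D (W k) by apply: mfunM; [exact: L2g_meas (Lu _)|exact: measurable_indic].
have cW x : D x -> cvgn (W^~ x).
 move=> Dx; have [Ax|nAx] := pselect (A x); last first.
  rewrite (_ : W^~ x = fun=> 0); first exact: is_cvg_cst.
  by apply/funext => k; rewrite /W indicE memNset// mulr0.
 have -> : W^~ x = w^~ x by apply/funext => k; rewrite /W indicE mem_set// mulr1. pose M := fine (F x).
 have MF : F x = M%:E by rewrite /M fineK// ge0_fin_numE//; case: Ax.
 have M0 : 0 <= M by rewrite -lee_fin -MF. have bd k : `|w k.+1 x - w k x| <= geometric (M + 1) 2^-1 k.
  have ddM : dd k x <= M.
   rewrite -lee_fin -MF /F. apply: le_trans (nneseries_lim_ge k.+1 _) => [|j _ _]; last by rewrite lee_fin.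
   rewrite big_nat_recr//= leeDr//. by apply: sume_ge0 => j _; rewrite lee_fin.
  apply: abs_le_sq; first by rewrite /= mulr_ge0 ?exprn_ge0 ?addr_ge0 ?invr_ge0.
  have p4 : 0 < 4 ^+ k :> R by rewrite exprn_gt0.
  rewrite -(ler_pM2l p4) -/(dd k x) (le_trans ddM)// /= exprMn -exprM mulnC exprM.
  rewrite mulrCA -exprMn (_ : 4 * 2^-1 ^+ 2 = 1 :> R) ?expr1n; last by field.
  have := sqr_ge0 M; rewrite mulr1 sqrrD; lra.
 have -> : w^~ x = fun n => w 0%N x + series (fun k => w k.+1 x - w k x) n by apply/funext => n; rewrite /series/= telescope_sumr// addrC subrK.
 apply: is_cvgD; first exact: is_cvg_cst.
 apply: normed_cvg; apply: (@series_le_cvg _ _ (geometric (M + 1) 2^-1)).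
 - by move=> k; exact: normr_ge0.
 - by move=> k; apply: le_trans (bd k).
 - exact: bd.
 - by apply: is_cvg_geometric_series; rewrite ger0_norm ?invf_lt1 ?ltr1n ?invr_ge0.
pose v x := limn (W^~ x).
have mv : measf D v by apply: measurable_fun_cvg mW _ => x /cW.
have aeW : {ae mu, forall x, D x -> forall k, W k x = w k x}.
 have := integrable_ae mD iF; apply: filterS => x + Dx k.
 move=> /(_ Dx) Fx; rewrite /W indicE mem_set ?mulr1//; split => //=. by rewrite -ge0_fin_numE.
have bnd k n : (N k <= n)%N ->
 (\int[mu]_(x in D) ((u n x - v x) ^+ 2)%:E <= (8^-1 ^+ k)%:E)%E. move=> kn.
 have mf j : measf D (fun x => ((u n x - W j x) ^+ 2)%:E).
  apply/mEFinP; apply: measurable_funX; apply: measurable_funB => //. exact: L2g_meas.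
 have f0 j x : D x -> (0 <= ((u n x - W j x) ^+ 2)%:E)%E by rewrite lee_fin sqr_ge0.
 have -> : (\int[mu]_(x in D) ((u n x - v x) ^+ 2)%:E =
  \int[mu]_(x in D) limn_einf (fun j => ((u n x - W j x) ^+ 2)%:E))%E.
  apply: eq_integral => x /set_mem Dx; apply/esym. apply: (@cvg_limn_einf_sup _ _ _ _).1.
  apply: cvg_EFin; first exact: nearW. apply: (@cvg_comp _ _ _ (fun j => u n x - W j x) (fun z => z ^+ 2)).
   by apply: cvgB; [exact: cvg_cst|exact: cW].
  exact: exprn_continuous.
 apply: le_trans (fatou mu mD mf f0) _.
 have H j : (k <= j)%N -> (\int[mu]_(x in D) ((u n x - W j x) ^+ 2)%:E <= (8^-1 ^+ k)%:E)%E.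
  move=> kj; have -> : (\int[mu]_(x in D) ((u n x - W j x) ^+ 2)%:E =
    \int[mu]_(x in D) ((u n x - w j x) ^+ 2)%:E)%E.
   apply: ae_eq_integral => //.
    by apply/mEFinP; apply: measurable_funX; apply: L2g_meas; exact: Lmn.
   by move: aeW; apply: filterS => x + Dx; move=> /(_ Dx j) ->.
  rewrite EFin_Rint; last by apply: L2g_sq; exact: Lmn. by rewrite lee_fin -sipE ltW// HN// n_ge.
 rewrite limn_einf_lim; apply: lime_le; first exact: is_cvg_einfs. near=> i.
 have ki : (k <= i)%N by near: i; exact: nbhs_infty_ge. apply: le_trans (H i ki); apply: ereal_inf_lbound.
 by exists i => //=.
have Lnv : exists n0, forall n, (n0 <= n)%N -> L2g D (fun x => u n x - v x).
 exists (N 0%N) => n n0; split; first by apply: measurable_funB => //; exact: L2g_meas.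
 apply: (@ge0_itg _ (8^-1 ^+ 0)) => //.
 - by apply: measurable_funX; apply: measurable_funB => //; exact: L2g_meas.
 - by move=> x _; exact: sqr_ge0.
 - exact: bnd.
exists v.
 have [n0 /(_ n0 (leqnn _)) Ln0] := Lnv. have := L2gB (Lu n0) Ln0; congr (L2g _ _); apply/funext => x; ring.
move=> e e0; have [n0 Hn0] := Lnv.
have [k ke] : exists k, 8^-1 ^+ k < e.
 have /cvgrPdist_lt/(_ _ e0)[k _ Hk] := @cvg_geometric R 1 8^-1 ltac:(by rewrite ger0_norm ?invr_ge0// invf_lt1 ?ltr1n).
 by exists k; have := Hk k (leqnn k); rewrite /= mul1r sub0r normrN ger0_norm// exprn_ge0// invr_ge0.
exists (maxn (N k) n0) => n; rewrite geq_max => /andP[kn n0n].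
apply: le_lt_trans ke; rewrite -lee_fin sipE -EFin_Rint; first exact: bnd.
exact: L2g_sq (Hn0 n n0n).
Unshelve. all: by end_near.
Qed.

Lemma sip_CS f g : L2g D f -> L2g D g -> sip f g ^+ 2 <= sip f f * sip g g.
move=> Lf Lg; apply: (@ssip_CS R (T -> R) (L2g D) sip) => //.
- exact: L2g0.
- by move=> a u v Lu Lv; exact: L2gP.
- by move=> u v _ _; exact: sipC.
- by move=> a u v w Lu Lv Lw; exact: sipP.
- by move=> u _; exact: sip_ge0.
Qed.

Lemma sip_le f g : L2g D f -> L2g D g ->
 `|sip f g| <= Num.sqrt (sip f f) * Num.sqrt (sip g g).
move=> Lf Lg; rewrite -sqrtr_sqr -sqrtrM ?sip_ge0//.
by rewrite ler_wsqrtr// sip_CS.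
Qed.

End L2gen.

Lemma sigma_finite_prod d1 d2 (T1 : measurableType d1) (T2 : measurableType d2) (R : realType)
 (m1 : {sigma_finite_measure set T1 -> \bar R}) (m2 : {sigma_finite_measure set T2 -> \bar R}) :
 sigma_finite setT (m1 \x m2)%E.
have /sigma_finiteP[F [TF ndF Foo]] := sigma_finiteT m1.
have /sigma_finiteP[G [TG ndG Goo]] := sigma_finiteT m2.
exists (fun n => F n `*` G n).
 apply/esym/seteqP; split => // -[x y] _. have [n _ Fx] : (\bigcup_n F n) x by rewrite -TF.
 have [k _ Gy] : (\bigcup_n G n) y by rewrite -TG. exists (maxn n k) => //; split => /=.
  by move: x Fx; exact/subsetPset/ndF/leq_maxl.
 by move: y Gy; exact/subsetPset/ndG/leq_maxr.
move=> k; have [mF Ff] := Foo k; have [mG Gf] := Goo k.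
by split; [exact: measurableX | rewrite product_measure1E// lte_mul_pinfty// ge0_fin_numE].
Qed.

(** The product measure under a name of its own: on the bare product the
    sub-probability instance shadows the sigma-finite one. *)
Definition sfprod d1 d2 (T1 : measurableType d1) (T2 : measurableType d2) (R : realType)
 (m1 : {sigma_finite_measure set T1 -> \bar R}) (m2 : {sigma_finite_measure set T2 -> \bar R}) :=
 (m1 \x m2)%E.
HB.instance Definition _ d1 d2 (T1 : measurableType d1) (T2 : measurableType d2) (R : realType)
 (m1 : {sigma_finite_measure set T1 -> \bar R}) (m2 : {sigma_finite_measure set T2 -> \bar R}) :=
Measure.on (sfprod m1 m2).
HB.instance Definition _ d1 d2 (T1 : measurableType d1) (T2 : measurableType d2) (R : realType)
 (m1 : {sigma_finite_measure set T1 -> \bar R}) (m2 : {sigma_finite_measure set T2 -> \bar R}) :=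
Measure_isSigmaFinite.Build _ _ _ (sfprod m1 m2) (sigma_finite_prod m1 m2).

HB.instance Definition _ (R : realType) := Measure_isSigmaFinite.Build _ _ _ (@leb3 R)
 (@sigma_finiteT _ _ _ (sfprod
  (sfprod (@leb1 R) (@leb1 R)) (@leb1 R))).

(** * Lebesgue measure of space under affine maps *)
Section Scaling.
Local Open Scope ereal_scope.
Context {R : realType}.

Definition scales d (T : measurableType d) (m : {measure set T -> \bar R}) (k : R)
 (f : T -> T) := [/\ (0 <= k)%R, measf setT f & forall A, measurable A -> m A = k%:E * m (f @^-1` A)].

Definition image_measure d d' (T : measurableType d) (T' : measurableType d')
 (m : {measure set T -> \bar R}) (f : T -> T') (mf : measf setT f) : {measure set T' -> \bar R} :=
 measure_function_pushforward__canonical__measure_function_Measure m mf.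

Lemma scales_integral d (T : measurableType d) (m : {measure set T -> \bar R}) k f :
 scales m k f -> forall F : T -> \bar R, measf setT F -> (forall x, 0 <= F x) ->
 \int[m]_x F x = k%:E * \int[m]_x F (f x).
move=> [k0 mf fm] F mF F0.
transitivity (\int[mscale (NngNum k0) (image_measure m mf)]_x F x).
 by apply: eq_measure_integral => A mA _; rewrite fm.
rewrite ge0_integral_mscale//; congr (_ * _).
by rewrite [LHS]ge0_integral_pushforward.
Qed.

Lemma scales_prod d1 d2 (T1 : measurableType d1) (T2 : measurableType d2)
  (m1 : {sigma_finite_measure set T1 -> \bar R})
  (m2 : {sigma_finite_measure set T2 -> \bar R}) k1 k2 f1 f2 :
 scales m1 k1 f1 -> scales m2 k2 f2 -> scales (sfprod m1 m2) (k1 * k2)%R (fun x => (f1 x.1, f2 x.2)).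
move=> [k10 mf1 s1] [k20 mf2 s2]; have k0 : (0 <= k1 * k2)%R by rewrite mulr_ge0.
have mf : measf setT (fun x : T1 * T2 => (f1 x.1, f2 x.2)).
 apply: measurable_fun_pair; exact: mfcomp.
split => // A mA.
rewrite -[RHS]/(mscale (NngNum k0) (image_measure (sfprod m1 m2) mf) A).
apply: product_measure_unique => // A1 A2 mA1 mA2.
transitivity ((k1 * k2)%:E * (m1 \x m2) ((f1 @^-1` A1) `*` (f2 @^-1` A2))) => //.
rewrite product_measure1E//; last 2 first.
- by rewrite -[X in measurable X]setTI; exact: mf1.
- by rewrite -[X in measurable X]setTI; exact: mf2.
by rewrite EFinM muleACA -s1// -s2.
Qed.

Lemma scales_leb1 (c h : R) (c0 : (c != 0)%R) :
 scales (@leb1 R) `|c|%R (fun x => c * x + h)%R.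
have mf : @measf _ _ (measurableTypeR R) (measurableTypeR R) setT
  (fun x : R => c * x + h)%R.
 by apply: measurable_funD => //; apply: mfunM.
split => // A mA.
pose m : {measure set (measurableTypeR R) -> \bar R} :=
 mscale (NngNum (normr_ge0 c))
  (@image_measure _ _ (measurableTypeR R) (measurableTypeR R) (@leb1 R) _ mf).
suff : forall X, ocitv X -> leb1 X = m X.
 move=> H; have := @lebesgue_measure_unique _ m H A mA; exact.
move=> _ [[a b]] _ <-.
transitivity (`|c|%:E * leb1 ((fun x => c * x + h)%R @^-1` `]a, b]%classic)) => //.
have [cp|cn|] := ltgtP 0%R c; last by move=> E; rewrite -E eqxx in c0.
 rewrite (_ : _ @^-1` _ = `]((a - h) / c)%R, ((b - h) / c)%R]%classic); last first.
  apply/seteqP; split => x /=; rewrite !in_itv/= ltr_pdivrMr// ler_pdivlMr//;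
   by rewrite ltrBlDr lerBrDr (mulrC x).
 rewrite !lebesgue_measure_itv/= !lte_fin (gtr0_norm cp). rewrite ltr_pM2r ?invr_gt0// ltrD2r.
 case: ifPn => ab; last by rewrite mule0. by rewrite -!EFinB -EFinM; congr (_%:E); field.
rewrite (_ : _ @^-1` _ = `[((b - h) / c)%R, ((a - h) / c)%R[%classic); last first.
 apply/seteqP; split => x /=; rewrite !in_itv/= ltr_ndivlMr// ler_ndivrMr//;
  by rewrite ltrBlDr lerBrDr (mulrC x) andbC.
rewrite !lebesgue_measure_itv/= !lte_fin (ltr0_norm cn).
rewrite ltr_nM2r ?invr_lt0// ltrD2r.
case: ifPn => ab; last by rewrite mule0.
by rewrite -!EFinB -EFinM; congr (_%:E); field.
Qed.

Lemma scales_leb3 (c : R) (h : R * R * R) (c0 : (c != 0)%R) :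
 scales (@leb3 R) (`|c| ^+ 3)%R (fun x => c *: x + h)%R.
have [_ a b] := scales_prod (scales_prod (scales_leb1 h.1.1 c0) (scales_leb1 h.1.2 c0))
 (scales_leb1 h.2 c0).
split => [||A mA]; [by rewrite exprn_ge0|exact: a|].
have -> : (`|c| ^+ 3)%R = (`|c| * `|c| * `|c|)%R by rewrite -mulrA !exprS expr0 mulr1.
exact: b A mA.
Qed.

End Scaling.

Notation Lsq := (L2g leb3).
Notation itg3 D f := (itg leb3 D f).

Section Space.
Context {R : realType}.
Local Notation sp := (R * R * R)%type.
Implicit Types (A U D : set sp) (x y h : sp).

Lemma ball_spE x (r : R) y : ball x r y <->
 [/\ `|x.1.1 - y.1.1| < r, `|x.1.2 - y.1.2| < r & `|x.2 - y.2| < r].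
by split=> [[[]]|[]]; [|split => //; split]. Qed.

Lemma norm_spE x : `|x| = Num.max (Num.max `|x.1.1| `|x.1.2|) `|x.2|.
by rewrite prod_normE/= prod_normE. Qed.

Lemma mball x (r : R) : measurable (ball x r).
rewrite (_ : ball x r = (ball x.1.1 r `*` ball x.1.2 r) `*` ball x.2 r); last first.
 by apply/seteqP; split => y [[]].
by apply: measurableX; [apply: measurableX|]; exact: measurable_ball.
Qed.

Lemma mopen U : open U -> measurable U.
move=> oU.
pose q3 (p : rat * rat * rat * nat) : sp :=
 (ratr p.1.1.1, ratr p.1.1.2, ratr p.1.2).
pose B p := ball (q3 p) p.2.+1%:R^-1.
rewrite (_ : U = \bigcup_(p in setT) (if asbool (B p `<=` U) then B p else set0)).
 apply: countable_bigcupT_measurable => // p. by case: asboolP => // _; exact: mball.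
apply/seteqP; split => [x Ux|x [p _]]; last by case: asboolP => // pU /pU.
have /nbhs_ballP[e/= e0 eU] : nbhs x U by exact: open_nbhs_nbhs.
pose n := Num.bound (e / 2)^-1.
have ne : 2 * n.+1%:R^-1 < e.
 rewrite mulrC -ltr_pdivlMr// -[ltRHS]invrK ltf_pV2 ?posrE ?invr_gt0 ?divr_gt0//.
 apply: lt_le_trans (archi_boundP _) _; first by rewrite invr_ge0 divr_ge0// ltW. by rewrite ler_nat.
have n0 : 0 < n.+1%:R^-1 :> R by rewrite invr_gt0.
have [u uE] : exists u : R, u = n.+1%:R^-1 by exists n.+1%:R^-1.
rewrite -uE in ne n0.
have ap (t : R) : exists q : rat, `|ratr q - t| < u.
 have /rat_in_itvoo[q] : t - u < t + u by lra. rewrite in_itv/= => /andP[h1 h2]; exists q.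
 by rewrite ltr_norml; apply/andP; split; lra.
have [q1 H1] := ap x.1.1; have [q2 H2] := ap x.1.2; have [q3' H3] := ap x.2.
exists (q1, q2, q3', n) => //.
have BU : B (q1, q2, q3', n) `<=` U.
 move=> y /ball_spE/=; rewrite -uE => -[h1 h2 h3]; apply: eU; apply/ball_spE.
 have tr (a b c : R) : `|a - b| < u -> `|a - c| < u -> `|b - c| < e.
  move=> ab ac; rewrite (le_lt_trans (ler_distD a _ _))//. by rewrite (distrC b a); lra.
 by split; [exact: tr h1|exact: tr h2|exact: tr h3].
by case: asboolP => // _; apply/ball_spE; rewrite -uE; split.
Qed.

Lemma cont_meas3 (f : sp -> R) D : continuous f -> measurable D -> measf D f.
move=> cf mD; apply: (measurability _ (RGenOpens.measurableE R)).
move=> _ [_ [a [b ->]] <-]; apply: measurableI => //.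
apply: mopen; apply: open_comp; last exact: interval_open.
by move=> x _; exact: cf.
Qed.

Lemma ocont_meas3 (f : sp -> R) U : open U -> {in U, continuous f} -> measf U f.
move=> oU cf; apply: (measurability _ (RGenOpens.measurableE R)).
move=> _ [_ [a [b ->]] <-].
apply: mopen; rewrite openE => x [Ux fx].
apply: filterI; first exact: open_nbhs_nbhs.
by apply: (cf x (mem_set Ux)); apply: open_nbhs_nbhs; split => //; exact: interval_open.
Qed.

Lemma leb3_ball x (r : R) : 0 <= r -> leb3 (ball x r) = ((2 * r) ^+ 3)%:E.
move=> r0.
rewrite (_ : ball x r = (ball x.1.1 r `*` ball x.1.2 r) `*` ball x.2 r); last first.
 by apply/seteqP; split => y [[]].
have mb (t : R) : measurable (ball t r) by exact: measurable_ball.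
transitivity (leb1 (ball x.1.1 r) * leb1 (ball x.1.2 r) *
  leb1 (ball x.2 r))%E.
 transitivity ((leb1 \x leb1) (ball x.1.1 r `*` ball x.1.2 r) *
  leb1 (ball x.2 r))%E. by apply: (product_measure1E (sfprod (@leb1 R)
   (@leb1 R))); [apply: measurableX; exact: mb|exact: mb].
 by congr (_ * _)%E; apply: product_measure1E; exact: mb.
rewrite !lebesgue_measure_ball//.
rewrite -!EFinM; congr (_%:E); rewrite -mulr_natr; ring.
Qed.

Lemma leb3_bounded_fin D : bounded_set D -> measurable D -> (leb3 D < +oo)%E.
move=> [M [_ HM]] mD; pose r := `|M| + 2.
have r0 : 0 <= r by rewrite addr_ge0.
apply: (@le_lt_trans _ _ (leb3 (ball (0 : sp) r))); last by rewrite leb3_ball// ltry.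
apply: le_measure; rewrite ?inE//; first exact: mball.
move=> y Dy; rewrite -ballE/= sub0r normrN.
have := HM (`|M| + 1) _ y Dy; rewrite (le_lt_trans (ler_norm _)) ?ltrDl// => /(_ isT).
by move/le_lt_trans; apply; rewrite ltrD2l ltr1n.
Qed.

Lemma ge0_int_affine (c : R) h (F : sp -> \bar R) : c != 0 ->
 measf (setT : set sp) F -> (forall x, 0 <= F x)%E ->
 (\int[leb3]_x F x = (`|c| ^+ 3)%:E * \int[leb3]_x F (c *: x + h)%R)%E.
by move=> c0 mF F0; rewrite (scales_integral (scales_leb3 h c0)). Qed.

Lemma meas_affine (c : R) h : measf (setT : set sp) (fun x : sp => c *: x + h).
have [->|c0] := eqVneq c 0; last by case: (scales_leb3 h c0).
by under eq_fun do rewrite scale0r add0r; exact: measurable_cst.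
Qed.

Lemma int_affine (c : R) h (f : sp -> R) : c != 0 -> itg3 setT f ->
 itg3 setT (fun x => f (c *: x + h)) /\ \int[leb3]_x f x = `|c| ^+ 3 * \int[leb3]_x f (c *: x + h).
move=> c0 fi; have mf := itg_meas fi.
have mf' : measf (setT : set sp) (fun x => f (c *: x + h)) by apply: mfcomp => //; exact: meas_affine.
have cp : 0 < `|c| ^+ 3 by rewrite exprn_gt0// normr_gt0.
have fi' : itg3 setT (fun x => f (c *: x + h)).
 apply/integrableP; split; first exact/mEFinP.
 have /integrableP[_] := fi; rewrite (ge0_int_affine h c0)//=; last first.
  by apply/mEFinP; apply: mfcomp.
 move=> H; rewrite -(@lte_pmul2l _ (`|c| ^+ 3)%:E)// [ltRHS]gt0_muley//.
split => //; rewrite /Rintegral [X in fine X = _]integralE [X in _ = _ * fine X]integralE.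
rewrite (ge0_int_affine h c0)//=; last by apply/measurable_funepos/mEFinP.
rewrite (@ge0_int_affine c h (fun x => (fun x => (f x)%:E)^\- x)%E c0)//=; last first.
 by apply/measurable_funeneg/mEFinP.
have P := integrable_pos_fin_num measurableT fi'.
have N := integrable_neg_fin_num measurableT fi'.
move: (fineK P) (fineK N); set p := fine _; set n := fine _ => EP EN.
transitivity (`|c| ^+ 3 * (p - n)).
 transitivity (fine ((`|c| ^+ 3)%:E * p%:E - (`|c| ^+ 3)%:E * n%:E)%E).
  rewrite EP EN; congr (fine (_ * _ - _ * _)%E); apply: eq_integral => x _.
   by rewrite funepos.unlock.
  by rewrite funeneg.unlock.
 by rewrite -!EFinM -EFinB/= mulrBr.
transitivity (`|c| ^+ 3 * fine (p%:E - n%:E)%E) => //.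
by rewrite EP EN.
Qed.

End Space.

(** * Smooth functions and cutoffs *)
Section Smooth.
Context {R : realType}.
Local Notation sp := (R * R * R)%type.
Implicit Types (f g phi : sp -> R) (x y h : sp).

Lemma sm_coind (P : set (sp -> R)) :
 (forall f, P f -> forall x, differentiable f x) ->
 (forall f i, P f -> P (partial i f)) -> forall f, P f -> smooth f.
move=> Pd Pp f Pf s x; apply: Pd.
by elim: s => //= i s; exact: Pp.
Qed.

Lemma sm_diff f x : smooth f -> differentiable f x.
by move=> /(_ [::] x). Qed.

Lemma sm_pd f i : smooth f -> smooth (partial i f).
by move=> sf s x; have := sf (rcons s i) x; rewrite foldr_rcons. Qed.

Lemma sm_cont f : smooth f -> continuous f.
by move=> sf x; apply: differentiable_continuous; exact: sm_diff. Qed.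

Lemma sm_derivable f x v : smooth f -> derivable f x v.
by move=> sf; apply: diff_derivable; exact: sm_diff. Qed.

Lemma pdD f g x i : differentiable f x -> differentiable g x ->
 partial i (fun x => f x + g x) x = partial i f x + partial i g x.
by move=> df dg; rewrite /partial deriveD//; exact: diff_derivable. Qed.

Lemma pdM f g x i : differentiable f x -> differentiable g x ->
 partial i (fun x => f x * g x) x = f x * partial i g x + g x * partial i f x.
by move=> df dg; rewrite /partial deriveM//; exact: diff_derivable. Qed.

Lemma pd_cst (c : R) x i : partial i (fun=> c) x = 0.
by rewrite /partial derive_cst. Qed.

Lemma pdZ (c : R) f x i : differentiable f x ->
 partial i (fun x => c * f x) x = c * partial i f x.
by move=> df; rewrite pdM// pd_cst mulr0 addr0.
Qed.

Inductive alg (B : set (sp -> R)) : (sp -> R) -> Prop :=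
| alg_base f : B f -> alg B f
| alg_cst (c : R) : alg B (fun=> c)
| alg_add f g : alg B f -> alg B g -> alg B (fun x => f x + g x)
| alg_mul f g : alg B f -> alg B g -> alg B (fun x => f x * g x).

(** A set of functions whose partial derivatives are polynomial expressions in
    the set generates an algebra stable under differentiation. *)
Lemma alg_smooth (B : set (sp -> R)) :
 (forall f, B f -> (forall x, differentiable f x) /\ forall i, alg B (partial i f)) ->
 forall f, alg B f -> smooth f.
move=> HB.
have dB f : alg B f -> forall x, differentiable f x.
 elim=> [{}f /HB[]//|c x|{}f g _ df _ dg x|{}f g _ df _ dg x].
 - exact: differentiable_cst.
 - exact: differentiableD.
 - exact: differentiableM.
apply: sm_coind => // f i.
elim=> [{}f /HB[_]//|c|{}f g Af If Ag Ig|{}f g Af If Ag Ig].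
- rewrite (_ : partial i _ = fun=> 0); first exact: alg_cst.
 by apply/funext => x; rewrite pd_cst.
- rewrite (_ : partial i _ = fun x => partial i f x + partial i g x).
  exact: alg_add.
 by apply/funext => x; rewrite pdD//; exact: dB.
- rewrite (_ : partial i _ = fun x => f x * partial i g x + g x * partial i f x).
  by apply: alg_add; exact: alg_mul.
 by apply/funext => x; rewrite pdM//; exact: dB.
Qed.

Lemma alg_of_smooth f : alg (@smooth R) f -> smooth f.
apply: alg_smooth => {}f sf; split=> [x|i]; first exact: sm_diff.
by apply: alg_base; exact: sm_pd.
Qed.

Lemma sm_cst (c : R) : smooth (fun _ : sp => c).
by apply: alg_of_smooth; exact: alg_cst. Qed.

Lemma smoothD f g : smooth f -> smooth g -> smooth (fun x => f x + g x).
by move=> sf sg; apply: alg_of_smooth; apply: alg_add; exact: alg_base. Qed.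

Lemma smoothM f g : smooth f -> smooth g -> smooth (fun x => f x * g x).
by move=> sf sg; apply: alg_of_smooth; apply: alg_mul; exact: alg_base. Qed.

Lemma smoothZ (c : R) f : smooth f -> smooth (fun x => c * f x).
by move=> sf; apply: smoothM => //; exact: sm_cst. Qed.

Lemma smoothN f : smooth f -> smooth (fun x => - f x).
by move=> /(smoothZ (-1)); under eq_fun do rewrite mulN1r. Qed.

Lemma smoothB f g : smooth f -> smooth g -> smooth (fun x => f x - g x).
by move=> sf sg; apply: smoothD => //; exact: smoothN. Qed.

Lemma sm_sum I (r : seq I) (P : pred I) (F : I -> sp -> R) :
 (forall i, P i -> smooth (F i)) -> smooth (fun x => \sum_(i <- r | P i) F i x).
move=> sF; rewrite (_ : (fun x => _) = \sum_(i <- r | P i) F i); last first.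
 by apply/funext => x; rewrite fct_sumE.
elim/big_rec : _ => [|i f Pi sf]; first exact: sm_cst.
by apply: smoothD => //; exact: sF.
Qed.

Lemma near_pd f g x i : (\forall y \near x, f y = g y) ->
 partial i f x = partial i g x.
by move=> fg; rewrite /partial; exact: near_eq_derive. Qed.

Lemma near_diff f g x : (\forall y \near x, f y = g y) ->
 differentiable g x -> differentiable f x.
move=> fg dg; have fx : f x = g x by exact: nbhs_singleton fg.
have /diff_locallyP[c E] := dg.
have {}E : f \o shift x = cst (f x) + 'd g x +o_ (0 : sp) id.
 apply/eqaddoP => e e0; move/eqaddoP : E => /(_ e e0) H.
 have N : \forall y \near (0 : sp), f (y + x) = g (y + x).
  move: fg => /nbhs_ballP[r/= r0 rfg]; apply/nbhs_ballP; exists r => //= y ry.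
  apply: rfg; move: ry; rewrite -!ballE/= sub0r normrN. by rewrite opprD addrCA subrr addr0 normrN.
 apply: filterS2 H N => y Hy Ny; move: Hy.
 rewrite [X in `|X| <= _ -> _](_ : _ = f (y + x) - (f x + 'd g x y))//. by rewrite fx Ny.
have D := diff_unique c E.
by apply/diff_locallyP; rewrite D.
Qed.

Lemma locally_smooth f :
 (forall x, exists2 g, smooth g & \forall y \near x, f y = g y) -> smooth f.
pose P := [set f : sp -> R | forall x, exists2 g, smooth g & \forall y \near x, f y = g y].
apply: (@sm_coind P) => {f}.
 by move=> f Pf x; have [g sg fg] := Pf x; apply: (near_diff fg); exact: sm_diff.
move=> f i Pf x; have [g sg fg] := Pf x.
exists (partial i g); first exact: sm_pd.
have := near_join fg; apply: filterS => y; exact: near_pd.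
Qed.

Lemma sp_ext x y : x.1.1 = y.1.1 -> x.1.2 = y.1.2 -> x.2 = y.2 -> x = y.
by case: x y => [[a b] c] [[a' b'] c']/= -> -> ->. Qed.

Lemma basis_sum x :
 x = x.1.1 *: bas 0 + x.1.2 *: bas 1 + x.2 *: bas 2 :> sp.
have Z (a b : R) : a *: b = a * b by [].
by apply: sp_ext; rewrite /= ?Z ?mulr1 ?mulr0 ?addr0 ?add0r.
Qed.

Definition crd (x : sp) (i : 'I_3) : R := nth 0 [:: x.1.1; x.1.2; x.2] i.

Lemma sum3 (F : 'I_3 -> R) : \sum_i F i = F 0 + F 1 + F 2.
rewrite !big_ord_recr big_ord0/= add0r.
by congr (F _ + F _ + F _); apply: val_inj.
Qed.

Lemma crdE x : (crd x 0 = x.1.1) * (crd x 1 = x.1.2) * (crd x 2 = x.2).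
by []. Qed.

Lemma derive_pd f x v : differentiable f x ->
 'D_v f x = \sum_i crd v i * partial i f x.
move=> df; rewrite sum3 !crdE deriveE// {1}[v]basis_sum !linearD !linearZ/=.
by rewrite /partial !deriveE.
Qed.

Lemma line_derive f x h (t : R) : derivable f (x + t *: h) h ->
 is_derive t 1 (fun s : R => f (x + s *: h)) ('D_h f (x + t *: h)).
move=> df.
have E : (fun k : R => k^-1 *: (f (x + (k *: (1 : R) + t) *: h) - f (x + t *: h))) =
 (fun k => k^-1 *: (f (k *: h + (x + t *: h)) - f (x + t *: h))). apply/funext => k; congr (_ *: (f _ - _)).
 by rewrite -[k *: 1]/(k * 1) mulr1 scalerDl addrCA.
by apply: DeriveDef; rewrite /derivable /derive/= E.
Qed.

Lemma ord3 (P : 'I_3 -> Prop) : P 0 -> P 1 -> P 2 -> forall i, P i.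
move=> P0 P1 P2; case=> [[|[|[|//]]] p].
- by rewrite (_ : Ordinal p = 0)//; exact: val_inj.
- by rewrite (_ : Ordinal p = 1)//; exact: val_inj.
- by rewrite (_ : Ordinal p = 2)//; exact: val_inj.
Qed.

Lemma abs_crd x i : `|crd x i| <= `|x|.
rewrite norm_spE; elim/ord3 : i; rewrite !crdE !le_max lexx ?orbT//.
Qed.

Lemma sum3_abs_le (F : 'I_3 -> R) (a b c : R) : `|F 0| <= a -> `|F 1| <= b ->
 `|F 2| <= c -> `|\sum_i F i| <= a + b + c.
move=> Fa Fb Fc; rewrite sum3; apply: le_trans (ler_normD _ _) _.
by apply: lerD => //; apply: le_trans (ler_normD _ _) _; exact: lerD.
Qed.

Lemma mvt_eq f x h : (forall t : R, 0 <= t <= 1 -> differentiable f (x + t *: h)) ->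
 exists2 c : R, 0 <= c <= 1 & f (x + h) - f x = 'D_h f (x + c *: h).
move=> df; pose g (s : R) := f (x + s *: h).
have dg (t : R) : 0 <= t <= 1 -> is_derive t 1 g ('D_h f (x + t *: h)) by move=> t01; apply: line_derive; apply: diff_derivable; exact: df.
have [c c01] : exists2 c : R, c \in `[0, 1] & g 1 - g 0 = 'D_h f (x + c *: h) * (1 - 0).
 apply: MVT_segment => //.
  by move=> t; rewrite in_itv/= => /andP[t0 t1]; apply: dg; rewrite !ltW.
 apply: derivable_within_continuous => t; rewrite in_itv/= => t01. by have [] := dg t t01.
rewrite /g scale1r scale0r addr0 subr0 mulr1 => ->.
by exists c; move: c01; rewrite // in_itv.
Qed.

Lemma mvt_le f (M : R) x h : (forall t : R, 0 <= t <= 1 -> differentiable f (x + t *: h)) ->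
 (forall t : R, 0 <= t <= 1 -> forall i, `|partial i f (x + t *: h)| <= M) ->
 `|f (x + h) - f x| <= 3 * M * `|h|.
move=> df bM; have [c c01 ->] := mvt_eq df.
rewrite derive_pd; last exact: df.
have T i : `|crd h i * partial i f (x + c *: h)| <= M * `|h| by rewrite normrM mulrC; apply: ler_pM => //; [exact: bM|exact: abs_crd].
rewrite (_ : 3 * M * `|h| = M * `|h| + M * `|h| + M * `|h|); last by move: `|h| => u; ring.
exact: sum3_abs_le (T 0) (T 1) (T 2).
Qed.

Definition Cc f := smooth f /\ exists r : R, forall x, r < `|x| -> f x = 0.

Lemma Cc_sm f : Cc f -> smooth f. by case. Qed.

Lemma CcM f g : Cc f -> smooth g -> Cc (fun x => f x * g x).
move=> [sf [r fr]] sg; split; first exact: smoothM.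
by exists r => x /fr ->; rewrite mul0r.
Qed.

Lemma CcZ (c : R) f : Cc f -> Cc (fun x => c * f x).
move=> [sf [r fr]]; split; first exact: smoothZ.
by exists r => x /fr ->; rewrite mulr0.
Qed.

Lemma CcD f g : Cc f -> Cc g -> Cc (fun x => f x + g x).
move=> [sf [r fr]] [sg [s gs]]; split; first exact: smoothD.
by exists (Num.max r s) => x; rewrite gt_max => /andP[/fr -> /gs ->]; rewrite addr0.
Qed.

Lemma CcN f : Cc f -> Cc (fun x => - f x).
by move=> /(CcZ (-1)); under eq_fun do rewrite mulN1r. Qed.

Lemma CcB f g : Cc f -> Cc g -> Cc (fun x => f x - g x).
by move=> sf sg; apply: CcD => //; exact: CcN. Qed.

Lemma Cc_sum I (r : seq I) (P : pred I) (F : I -> sp -> R) :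
 (forall i, P i -> Cc (F i)) -> Cc (fun x => \sum_(i <- r | P i) F i x).
move=> sF; rewrite (_ : (fun x => _) = \sum_(i <- r | P i) F i); last first.
 by apply/funext => x; rewrite fct_sumE.
elim/big_rec : _ => [|i f Pi sf].
 by split; [exact: sm_cst|exists 0].
by apply: CcD => //; exact: sF.
Qed.

Lemma open_norm_gt (r : R) : open [set x : sp | r < `|x|].
rewrite (_ : [set _ | _] = (fun x : sp => `|x|) @^-1` [set y | r < y])//.
by apply: open_comp; [move=> x _; exact: norm_continuous|exact: open_gt].
Qed.

Lemma Cc_pd f i : Cc f -> Cc (partial i f).
move=> [sf [r fr]]; split; first exact: sm_pd.
exists r => x rx; rewrite (@near_pd _ (fun=> 0)) ?pd_cst//.
by have := open_nbhs_nbhs (conj (@open_norm_gt r) (rx : [set x : sp | r < `|x|] x));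
 apply: filterS => y /fr.
Qed.

Lemma diff_affine (c : R) h x :
 is_diff x (fun x : sp => c *: x + h) ( *:%R c).
have H : is_diff x (c \*: (@id sp) + cst h) (c \*: (@id sp) + 0) by exact: is_diffD.
have E : (c \*: (@id sp) + 0) = *:%R c :> (sp -> sp) by rewrite addr0.
by rewrite E in H; exact: H.
Qed.

Lemma diff_affineE (c : R) h x v : 'd (fun x : sp => c *: x + h) x v = c *: v.
by have [_ ->] := diff_affine c h x. Qed.

Lemma sm_affine f (c : R) h : smooth f -> smooth (fun x => f (c *: x + h)).
pose P := [set g | exists f (k : R), smooth f /\ g = fun x => k * f (c *: x + h)].
have dA x : differentiable (fun x : sp => c *: x + h) x by have [] := diff_affine c h x.
have dP g0 x : smooth g0 -> differentiable (fun x => g0 (c *: x + h)) x.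
 move=> sg0; apply: (@differentiable_comp _ _ _ _ (fun x : sp => c *: x + h) g0) => //. exact: sm_diff.
move=> sf; apply: (@sm_coind P); last 1 first.
- by exists f, 1; split => //; apply/funext => x; rewrite mul1r.
- move=> _ [g [k [sg ->]]] x; apply: differentiableM; first exact: differentiable_cst.
 exact: dP.
- move=> _ i [g [k [sg ->]]]; exists (partial i g), (k * c); split.
  exact: sm_pd.
 apply/funext => x; rewrite pdZ; last exact: dP.
 rewrite -mulrA; congr (_ * _); rewrite /partial deriveE; last exact: dP.
 rewrite (@diff_comp _ _ _ _ (fun x : sp => c *: x + h) g)//=; last exact: sm_diff.
 rewrite deriveE; last exact: sm_diff. by rewrite diff_affineE linearZ.
Qed.

Lemma pd_affine f (c : R) h x i : smooth f ->
 partial i (fun x => f (c *: x + h)) x = c * partial i f (c *: x + h).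
move=> sf.
have dA : differentiable (fun x : sp => c *: x + h) x by have [] := diff_affine c h x.
rewrite /partial deriveE; last exact: sm_diff (sm_affine c h sf).
rewrite (@diff_comp _ _ _ _ (fun x : sp => c *: x + h) f)//=; last exact: sm_diff.
rewrite deriveE; last exact: sm_diff.
by rewrite diff_affineE linearZ.
Qed.

Lemma Cc_affine f (c : R) h : c != 0 -> Cc f -> Cc (fun x => f (c *: x + h)).
move=> c0 [sf [r fr]]; split; first exact: sm_affine.
have cp : 0 < `|c| by rewrite normr_gt0.
exists ((r + `|h|) / `|c|) => x; rewrite ltr_pdivrMr// => H; apply: fr.
have := ler_normB (c *: x + h) h; rewrite addrK normrZ mulrC; lra.
Qed.

Lemma compact_cball (r : R) : compact [set x : sp | `|x| <= r].
have -> : [set x : sp | `|x| <= r] =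
 (`[- r, r]%classic `*` `[- r, r]%classic) `*` `[- r, r]%classic.
 apply/seteqP; split => x /=; rewrite norm_spE !ge_max !in_itv/= !ler_norml.
  by move=> /andP[/andP[-> ->] ->].
 by move=> [[-> ->] ->].
by apply: compact_setX; [apply: compact_setX|]; exact: segment_compact.
Qed.

Lemma Cc_bd f : Cc f -> exists2 M, 0 <= M & forall x, `|f x| <= M.
move=> [sf [r fr]].
have K : compact (f @` [set x : sp | `|x| <= r]).
 apply: continuous_compact; last exact: compact_cball. by apply: continuous_subspaceT; exact: sm_cont.
have [M [_ HM]] := compact_bounded K.
exists (`|M| + 1) => [|x]; first by rewrite addr_ge0.
have [xr|/fr ->] := leP `|x| r; last by rewrite normr0 addr_ge0.
apply: HM; first by rewrite (le_lt_trans (ler_norm _))// ltrDl.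
by exists x.
Qed.

Lemma Cc_lip f : Cc f -> exists2 M, 0 <= M & forall x h, `|f (x + h) - f x| <= M * `|h|.
move=> cf; have H i := Cc_bd (Cc_pd i cf).
have [M0 M00 H0] := H 0; have [M1 M10 H1] := H 1; have [M2 M20 H2] := H 2.
exists (3 * (M0 + M1 + M2)) => [|x h]; first by rewrite mulr_ge0// !addr_ge0.
apply: mvt_le => t _; first by apply: sm_diff; case: cf.
by elim/ord3; [apply: le_trans (H0 _) _|apply: le_trans (H1 _) _|apply: le_trans (H2 _) _];
 clear -M00 M10 M20; lra.
Qed.

Lemma Cc_taylor f : Cc f -> exists2 M, 0 <= M & forall x h,
 `|f (x + h) - f x - \sum_i crd h i * partial i f x| <= M * `|h| ^+ 2.
move=> cf; have H i := Cc_lip (Cc_pd i cf).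
have [M0 M00 H0] := H 0; have [M1 M10 H1] := H 1; have [M2 M20 H2] := H 2.
exists (M0 + M1 + M2) => [|x h]; first by rewrite !addr_ge0.
have df y : differentiable f y by apply: sm_diff; case: cf.
have [c /andP[c0 c1] ->] := mvt_eq (fun t _ => df (x + t *: h)).
rewrite derive_pd// -sumrB !mulrDl.
have T i M' : (forall x h, `|partial i f (x + h) - partial i f x| <= M' * `|h|) -> 0 <= M' ->
  `|crd h i * partial i f (x + c *: h) - crd h i * partial i f x| <= M' * `|h| ^+ 2.
 move=> HM M'0; rewrite -mulrBr normrM expr2 mulrCA; apply: ler_pM => //; first exact: abs_crd.
 by apply: le_trans (HM _ _) _; rewrite ler_wpM2l// normrZ ger0_norm// ler_piMl.
exact: sum3_abs_le (T 0 _ H0 M00) (T 1 _ H1 M10) (T 2 _ H2 M20).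
Qed.

Lemma Cc_pdC f i j : Cc f -> partial i (partial j f) = partial j (partial i f).
move=> cf; apply/funext => x.
suff H k l : exists2 M, 0 <= M & forall t : R, 0 < t -> t <= 1 ->
  `|f (x + t *: bas k + t *: bas l) - f (x + t *: bas k)
   - f (x + t *: bas l) + f x - t ^+ 2 * partial k (partial l f) x| <= M * t ^+ 3.
 have [M M0 HM] := H i j; have [N N0 HN] := H j i.
 apply/eqP; rewrite -subr_eq0 -normr_eq0; apply/eqP/le_anti; rewrite normr_ge0 andbT.
 apply/ler_addgt0Pr => e e0; rewrite add0r. pose t := Num.min 1 (e / (M + N + 1)).
 have MN : 0 < M + N + 1 by rewrite ltr_wpDl// addr_ge0. have t0 : 0 < t by rewrite lt_min ltr01 divr_gt0.
 have t1 : t <= 1 by rewrite ge_min lexx. have te : t * (M + N) <= e.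
  apply: (@le_trans _ _ (t * (M + N + 1))); first by rewrite ler_wpM2l ?(ltW t0)// lerDl.
  by rewrite -ler_pdivlMr// ge_min lexx orbT.
 apply: le_trans te; rewrite -(ler_pM2l (exprn_gt0 2 t0)).
 have -> : t ^+ 2 * (t * (M + N)) = M * t ^+ 3 + N * t ^+ 3 by ring. have := HM t t0 t1; have := HN t t0 t1.
 rewrite (addrAC x (t *: bas j)). set a := f _; set b := f _; set c := f _; set d := f _.
 set p := partial i _ _; set q := partial j _ _ => hq hp. rewrite -[t ^+ 2]ger0_norm ?sqr_ge0// -normrM.
 have -> : t ^+ 2 * (p - q) = (a - b - c + d - t ^+ 2 * q) - (a - c - b + d - t ^+ 2 * p) by ring.
 by rewrite (le_trans (ler_normB _ _))// addrC lerD.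
have nb (m : 'I_3) : `|bas m : sp| <= 1 by rewrite norm_spE/= !ge_max !ger0_norm ?ler0n// !lern1; elim/ord3 : m.
have sumb (m : 'I_3) (F : 'I_3 -> R) (t : R) : \sum_i crd (t *: bas m) i * F i = t * F m.
 rewrite sum3 !crdE; elim/ord3 : m; rewrite /bas/=; rewrite -?[t *: _]/(t * _) ?eqxx/=; ring.
have cg m := Cc_pd m cf.
have mvtb g (m : 'I_3) y (t : R) : smooth g -> exists2 c : R, 0 <= c <= 1 &
  g (y + t *: bas m) - g y = t * partial m g (y + c *: (t *: bas m)).
 move=> sg; have [c c01 ->] := mvt_eq (fun s _ => sm_diff (y + s *: (t *: bas m)) sg).
 by exists c => //; rewrite derive_pd ?sumb//; exact: sm_diff.
have [M M0 HM] := Cc_taylor (cg l).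
have [N N0 HN] := Cc_lip (Cc_pd l (cg l)).
exists (N + M) => [|t t0 t1]; first by rewrite addr_ge0.
have nt : `|t *: bas k : sp| <= t by rewrite normrZ gtr0_norm// ler_piMr// ltW.
have ntl : `|t *: bas l : sp| <= t by rewrite normrZ gtr0_norm// ler_piMr// ltW.
pose g y := f (1 *: y + t *: bas k) - f y.
have cgk : Cc g by apply: CcB => //; apply: Cc_affine => //; exact: oner_neq0.
have pg y : partial l g y = partial l f (y + t *: bas k) - partial l f y.
 have sf := Cc_sm cf. rewrite /g pdD; [|exact: sm_diff (sm_affine _ _ sf)|exact: sm_diff (smoothN sf)].
 rewrite pd_affine// scale1r mul1r; congr (_ + _).
 by under [in LHS]eq_fun do rewrite -mulN1r; rewrite pdZ ?mulN1r//; exact: sm_diff.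
have ppg y : `|partial l (partial l g) y| <= N * t.
 have sf := sm_pd l (Cc_sm cf).
 have -> : partial l g = fun y => partial l f (1 *: y + t *: bas k) + (-1) * partial l f y by apply/funext => z; rewrite pg scale1r mulN1r.
 rewrite pdD; [|exact: sm_diff (sm_affine _ _ sf)|exact: sm_diff (smoothZ _ sf)].
 rewrite pd_affine// scale1r mul1r pdZ ?mulN1r; last exact: sm_diff.
 by apply: le_trans (HN _ _) _; rewrite ler_wpM2l.
have [c c01 E1] := mvtb g l x t (Cc_sm cgk).
have [c' c'01 E2] := mvtb (partial l g) l x (c * t) (sm_pd l (Cc_sm cgk)).
rewrite scalerA in E1.
have E3 := HM x (t *: bas k); rewrite sumb in E3.
have E4 : `|t * (partial l g (x + (c * t) *: bas l) - partial l g x)| <= N * t ^+ 3.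
 rewrite E2 !normrM (gtr0_norm t0) (_ : N * t ^+ 3 = t * (t * (N * t))); last by ring.
 rewrite (ler_wpM2l (ltW t0))//; apply: ler_pM => //; first by rewrite mulr_ge0// ltW.
 case/andP: c01 => c0 c1; rewrite (ger0_norm c0) ler_piMl// ltW//.
have E5 : t * `|partial l f (x + t *: bas k) - partial l f x
   - t * partial k (partial l f) x| <= M * t ^+ 3.
 rewrite (_ : M * t ^+ 3 = t * (M * t ^+ 2)); last by ring.
 by rewrite (ler_wpM2l (ltW t0))//; apply: le_trans E3 _; rewrite ler_wpM2l// lerXn2r ?nnegrE// ltW//.
rewrite -[in X in t * X]pg in E5.
have E6 : g (x + t *: bas l) - g x = f (x + t *: bas k + t *: bas l)
 - f (x + t *: bas k) - f (x + t *: bas l) + f x. by rewrite /g !scale1r (addrAC x (t *: bas l)); ring.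
rewrite -E6 E1.
rewrite (_ : _ - _ = t * (partial l g (x + (c * t) *: bas l) - partial l g x) +
 t * (partial l g x - t * partial k (partial l f) x)); last by ring.
rewrite mulrDl; apply: le_trans (ler_normD _ _) _; apply: lerD => //.
by rewrite normrM (gtr0_norm t0).
Qed.

End Smooth.

Section Bump.
Context {R : realType}.
Local Notation sp := (R * R * R)%type.
Implicit Types (f g phi l : sp -> R) (x y h : sp) (t u : R).

Definition flat (k : nat) t : R := if 0 < t then t^-1 ^+ k * expR (- t^-1) else 0.

Lemma flat0 k t : t <= 0 -> flat k t = 0.
by rewrite /flat ltNge => ->. Qed.

Lemma flat_gt0 k t : 0 < t -> 0 < flat k t.
by move=> t0; rewrite /flat t0 mulr_gt0 ?expR_gt0// exprn_gt0// invr_gt0. Qed.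

Lemma flat_ge0 k t : 0 <= flat k t.
by have [/flat0->//|/flat_gt0/ltW] := leP t 0. Qed.

Lemma flat_le k t : `|flat k t| <= k.+2`!%:R * t ^+ 2.
rewrite ger0_norm ?flat_ge0// /flat; case: ifPn => t0; last by rewrite mulr_ge0 ?sqr_ge0.
have ti : 0 < t^-1 by rewrite invr_gt0.
have := expR_ge1Dxn k.+1 (ltW ti); set e := expR (t^-1) => H.
have e0 : 0 < e by exact: expR_gt0.
have f0 : 0 < (k.+2)`!%:R :> R by rewrite ltr0n fact_gt0.
rewrite expRN -/e ler_pdivrMr//.
have {}H : t^-1 ^+ k.+2 <= e * (k.+2)`!%:R by rewrite -ler_pdivrMr// (le_trans _ H)// lerDr.
have -> : t^-1 ^+ k = t ^+ 2 * t^-1 ^+ k.+2.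
 have -> : t^-1 ^+ k.+2 = t^-1 ^+ k * t^-1 ^+ 2 by rewrite -exprD addn2.
 by rewrite mulrCA -exprMn divff ?gt_eqF// expr1n mulr1.
by rewrite -[leRHS]mulrA [leRHS]mulrCA ler_wpM2l ?sqr_ge0// [leRHS]mulrC.
Qed.

Lemma flat_derive k t : is_derive t 1 (flat k) (- k%:R * flat k.+1 t + flat k.+2 t).
have [t0|t0|->] := ltgtP t 0.
- rewrite !flat0 ?ltW// mulr0 addr0.
 apply: (near_eq_is_derive _ (is_derive_cst (0 : R) t 1)).
 by near=> u; rewrite flat0// ltW//; near: u; exact: lt_nbhsl.
- have t1 : t != 0 by rewrite gt_eqF.
 have : is_derive t 1 (fun u => u^-1 ^+ k * expR (- u^-1))
   (- k%:R * flat k.+1 t + flat k.+2 t).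
  have dV : is_derive t 1 (fun u : R => u^-1) (- t^-1 ^+ 2).
   have H := is_deriveV (t1 : (@id R) t != 0) (is_derive_id t 1).
   by apply: is_derive_eq; rewrite -[_ *: _]/(_ * _) mulr1 exprVn.
  have dX : is_derive t 1 (fun u : R => u^-1 ^+ k) (- k%:R * t^-1 ^+ k.+1).
   elim: k => [|k IH]; first by rewrite oppr0 mul0r; exact: is_derive_cst. under eq_fun do rewrite exprS.
   have H := is_deriveM dV IH; apply: is_derive_eq.
   rewrite -[X in X + _ = _]/(_ * _) -[X in _ + X = _]/(_ * _) -natr1 !exprS; ring.
  have dE : is_derive t 1 (fun u : R => expR (- u^-1)) (t^-1 ^+ 2 * expR (- t^-1)).
   have dN : is_derive t 1 (fun u : R => - u^-1) (t^-1 ^+ 2) by have H := is_deriveN dV; apply: is_derive_eq; rewrite opprK.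
   have H := @is_derive1_comp _ expR (fun u => - u^-1) t _ _ (is_derive_expR _) dN.
   by apply: is_derive_eq; rewrite -?[_ *: _]/(_ * _) mulrC.
  have H := is_deriveM dX dE.
  apply: is_derive_eq; rewrite /flat t0 -[_ *: _]/(_ * _) -[_ *: _]/(_ * _) !exprS; ring.
 apply: near_eq_is_derive. by near=> u; rewrite /flat ifT//; near: u; exact: lt_nbhsr.
- rewrite !flat0// mulr0 addr0.
 have c : (fun z : R => z^-1 *: (flat k (z *: 1 + 0) - flat k 0)) @ 0^' --> (0 : R).
  apply/cvgrPdist_le => e e0; near=> z. have z0 : z != 0 by near: z; exact: nbhs_dnbhs_neq.
  rewrite sub0r normrN (flat0 _ (lexx 0)) subr0 addr0 -[z *: 1]/(z * 1) mulr1.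
  rewrite -[z^-1 *: _]/(z^-1 * _) normrM normfV ler_pdivrMl ?normr_gt0//. apply: le_trans (flat_le k z) _.
  rewrite -[z ^+ 2]real_normK ?num_real// expr2 mulrA [leLHS]mulrC ler_wpM2l//.
  rewrite -ler_pdivlMl ?ltr0n ?fact_gt0//.
  near: z; apply: dnbhs0_le; rewrite mulr_gt0// invr_gt0 ltr0n fact_gt0//.
 apply: DeriveDef; first by apply: cvgP c. exact: cvg_lim c.
Unshelve. all: by end_near.
Qed.

Definition sstep t : R := flat 0 t / (flat 0 t + flat 0 (1 - t)).

Lemma sstep_den t : 0 < flat 0 t + flat 0 (1 - t).
have [t0|t0] := ltP 0 t; first by rewrite ltr_pwDl ?flat_gt0 ?flat_ge0.
by rewrite ltr_wpDl ?flat_ge0// flat_gt0// subr_gt0 (le_lt_trans t0).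
Qed.

Lemma sstep0 t : t <= 0 -> sstep t = 0.
by move=> /flat0 h; rewrite /sstep h mul0r. Qed.

Lemma sstep1 t : 1 <= t -> sstep t = 1.
move=> t1; rewrite /sstep (@flat0 0 (1 - t)) ?subr_le0// addr0 divff// gt_eqF//.
by rewrite flat_gt0// (lt_le_trans _ t1).
Qed.

Lemma sstep_ge0 t : 0 <= sstep t.
by rewrite divr_ge0 ?flat_ge0// ltW// sstep_den. Qed.

Lemma sstep_le1 t : sstep t <= 1.
by rewrite ler_pdivrMr ?sstep_den// mul1r lerDl flat_ge0. Qed.

Lemma sstep_gt0 t : 0 < t -> 0 < sstep t.
by move=> t0; rewrite divr_gt0 ?flat_gt0// sstep_den. Qed.

Lemma flat0E t : 0 < t -> flat 0 t = expR (- t^-1).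
by rewrite /flat => ->; rewrite mul1r. Qed.

Lemma flat_homo t u : t <= u -> flat 0 t <= flat 0 u.
move=> tu; have [t0|t0] := leP t 0; first by rewrite flat0// flat_ge0.
rewrite !flat0E ?(lt_le_trans t0)// ler_expR lerN2 lef_pV2//.
by rewrite posrE (lt_le_trans t0).
Qed.

Lemma sstep_homo t u : t <= u -> sstep t <= sstep u.
move=> tu; rewrite ler_pdivrMr ?sstep_den// mulrAC ler_pdivlMr ?sstep_den//.
rewrite !mulrDr mulrC lerD2l ler_pM ?flat_ge0//; first exact: flat_homo.
by apply: flat_homo; rewrite lerD2l lerN2.
Qed.

Let B := [set f : sp -> R | [\/ smooth f,
 (exists2 l, smooth l & exists k, f = flat k \o l) |
 (exists2 l, smooth l & f = fun x => (flat 0 (l x) + flat 0 (1 - l x))^-1)]].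

Lemma diff_comp1 (F : R -> R) (dF : R) l x : is_derive (l x) 1 F dF -> differentiable l x ->
 differentiable (F \o l) x /\ forall i, partial i (F \o l) x = partial i l x * dF.
move=> [dF1 dF2] dl.
have dFd : differentiable F (l x) by exact/derivable1_diffP.
have dc : differentiable (F \o l) x by exact: differentiable_comp.
split=> // i; rewrite /partial deriveE// diff_comp//=.
have dFE (v : R) : 'd F (l x) v = v * dF by rewrite -[v in LHS]mulr1 -[v * 1]/(v *: 1) linearZ/= -deriveE// dF2.
by rewrite dFE deriveE.
Qed.

Lemma sm_sstep l : smooth l -> smooth (sstep \o l).
move=> sl; have sl1 l0 : smooth l0 -> smooth (fun x => 1 - l0 x).
 by move=> s0; apply: smoothB => //; exact: sm_cst.
suff H f : alg B f -> smooth f.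
 apply: H; apply: alg_mul; apply: alg_base; first by apply: Or32; exists l => //; exists 0%N.
 by apply: Or33; exists l.
have afl k l0 : smooth l0 -> alg B (flat k \o l0) by move=> s0; apply: alg_base; apply: Or32; exists l0 => //; exists k.
have asm f0 : smooth f0 -> alg B f0 by move=> s0; apply: alg_base; apply: Or31.
apply: alg_smooth => {}f [sf|[l0 s0 [k ->]]|[l0 s0 ->]].
- split=> [x|i]; first exact: sm_diff.
 by apply: asm; exact: sm_pd.
- have H x := diff_comp1 (flat_derive k (l0 x)) (sm_diff x s0).
 split=> [x|i]; first by case: (H x). rewrite (_ : partial i _ = fun x => partial i l0 x *
  (- k%:R * (flat k.+1 \o l0) x + (flat k.+2 \o l0) x)). apply: alg_mul; first by apply: asm; exact: sm_pd.
  by apply: alg_add; [apply: alg_mul; [exact: alg_cst|exact: afl]|exact: afl].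
 by apply/funext => x; have [_ ->] := H x.
- pose den x := flat 0 (l0 x) + flat 0 (1 - l0 x).
 have dn x : den x != 0 by rewrite gt_eqF// sstep_den.
 have H x := diff_comp1 (flat_derive 0 (l0 x)) (sm_diff x s0).
 have H1 x := diff_comp1 (flat_derive 0 (1 - l0 x)) (sm_diff x (sl1 _ s0)).
 have dd x : differentiable den x by apply: differentiableD; [case: (H x)|case: (H1 x)].
 split=> [x|i]; first by apply: differentiableV; [exact: dd|exact: dn].
 rewrite (_ : partial i _ = fun x => (-1) * ((den x)^-1 * (den x)^-1) *
  (partial i l0 x * (flat 2 \o l0) x +
  partial i (fun x => 1 - l0 x) x * (flat 2 \o (fun x => 1 - l0 x)) x)).
  have ad : alg B (fun x => (den x)^-1) by apply: alg_base; apply: Or33; exists l0.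
  apply: alg_mul; first by apply: alg_mul; [exact: alg_cst|exact: alg_mul].
  apply: alg_add; (apply: alg_mul; first by apply: asm; apply: sm_pd; auto).
   exact: afl.
  by apply: afl; exact: sl1.
 apply/funext => x; rewrite /partial -/den deriveV//; last exact: diff_derivable.
 have := @pdD _ (flat 0 \o l0) (flat 0 \o (fun x => 1 - l0 x)) x i.
 rewrite /partial => ->; [|by case: (H x)|by case: (H1 x)].
 have [_ Hx] := H x; have [_ H1x] := H1 x; rewrite /partial in Hx H1x.
 rewrite Hx H1x oppr0 !mul0r !add0r -[_ *: _]/(_ * _) expr2 invfM mulN1r. by [].
exact: dn.
Qed.

Lemma crd_linear i : linear (fun x : sp => crd x i).
by move=> a x y; elim/ord3 : i. Qed.

Lemma crdZ a x i : crd (a *: x) i = a * crd x i.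
by elim/ord3 : i. Qed.

Lemma crdD x y i : crd (x + y) i = crd x i + crd y i.
by elim/ord3 : i. Qed.

Lemma crd_diff i x : differentiable (fun x : sp => crd x i) x /\
 forall v, 'd (fun x : sp => crd x i) x v = crd v i.
pose L : {linear sp -> R} := HB.pack (fun x : sp => crd x i)
 (GRing.isLinear.Build _ _ _ _ _ (crd_linear i)).
have cL : continuous L.
 move=> y; apply/cvgrPdist_le => e e0; near=> z. rewrite -linearB/=; apply: le_trans (abs_crd _ _) _.
 by near: z; apply: cvgr_dist_le => //; exact: cvg_id.
have dL := @diff_lin _ _ _ L x cL.
split; last by move=> v; rewrite -[LHS]/('d L x v) dL.
by have := @linear_differentiable _ _ _ L x cL.
Unshelve. all: by end_near.
Qed.

Lemma pd_crd i k x : partial k (fun x : sp => crd x i) x = crd (bas k) i.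
by have [d E] := crd_diff i x; rewrite /partial deriveE// E. Qed.

Lemma sm_crd i : smooth (fun x : sp => crd x i).
apply: (@sm_coind _ [set f | (exists i, f = fun x => crd x i) \/ exists c : R, f = fun=> c]); last by left; exists i.
 move=> _ [[j ->] x|[c ->] x]; last exact: differentiable_cst. by have [] := crd_diff j x.
move=> _ k [[j ->]|[c ->]]; right; last by exists 0; apply/funext => x; rewrite pd_cst.
by exists (crd (bas k) j); apply/funext => x; rewrite pd_crd.
Qed.

Definition plateau1 t := sstep (2 - t) * sstep (2 + t).

Definition plateau (x : sp) : R := \prod_i plateau1 (crd x i).

Lemma plateau1_1 t : `|t| <= 1 -> plateau1 t = 1.
by rewrite ler_norml => /andP[t1 t2]; rewrite /plateau1 !sstep1 ?mulr1//; lra.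
Qed.

Lemma plateau1_0 t : 2 <= `|t| -> plateau1 t = 0.
rewrite ler_normr => /orP[t2|t2]; rewrite /plateau1.
 by rewrite sstep0 ?mul0r//; lra.
by rewrite [X in _ * X]sstep0 ?mulr0//; lra.
Qed.

Lemma plateau1_ge0 t : 0 <= plateau1 t.
by rewrite mulr_ge0 ?sstep_ge0. Qed.

Lemma plateau1_le1 t : plateau1 t <= 1.
by rewrite mulr_ile1 ?sstep_ge0 ?sstep_le1. Qed.

Lemma plateau_ge0 x : 0 <= plateau x.
by apply: prodr_ge0 => i _; exact: plateau1_ge0. Qed.

Lemma plateau_le1 x : plateau x <= 1.
by apply: prodr_ile1 => i _; rewrite plateau1_ge0 plateau1_le1. Qed.

Lemma norm_crd_le x (r : R) : (forall i, `|crd x i| <= r) -> `|x| <= r.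
by move=> H; rewrite norm_spE !ge_max (H 0) (H 1) (H 2). Qed.

Lemma plateau_1 x : `|x| <= 1 -> plateau x = 1.
move=> x1; rewrite /plateau big1// => i _; apply: plateau1_1.
exact: le_trans (abs_crd _ _) x1.
Qed.

Lemma plateau_0 x : 2 <= `|x| -> plateau x = 0.
move=> x2; have [i xi] : exists i, 2 <= `|crd x i|.
 move: x2; rewrite norm_spE !le_max => /orP[/orP[h|h]|h]; first by exists 0.
  by exists 1.
 by exists 2.
by rewrite /plateau (bigD1 i)//= plateau1_0// mul0r.
Qed.

Lemma sm_plateau : smooth plateau.
have s1 i : smooth (fun x : sp => plateau1 (crd x i)).
 apply: smoothM; apply: (@sm_sstep (fun x => _)).
  by apply: smoothB; [exact: sm_cst|exact: sm_crd].
 by apply: smoothD; [exact: sm_cst|exact: sm_crd].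
have -> : plateau = fun x => plateau1 (crd x 0) * plateau1 (crd x 1) * plateau1 (crd x 2).
 apply/funext => x; rewrite /plateau !big_ord_recr big_ord0/= mul1r.
 by congr (_ * _ * _); congr plateau1; congr crd; apply: val_inj.
by apply: smoothM; [apply: smoothM|]; exact: s1.
Qed.

Lemma Cc_plateau : Cc plateau.
by split; [exact: sm_plateau|exists 2 => x x2; rewrite plateau_0// ltW].
Qed.

Definition cut (c : sp) (r : R) x := plateau ((2 / r) *: x - (2 / r) *: c).

Lemma Cc_cut c r : 0 < r -> Cc (cut c r).
move=> r0; apply: Cc_affine; last exact: Cc_plateau.
by rewrite mulf_neq0// invr_neq0// gt_eqF.
Qed.

Lemma cut_ge0 c r x : 0 <= cut c r x. exact: plateau_ge0. Qed.
Lemma cut_le1 c r x : cut c r x <= 1. exact: plateau_le1. Qed.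

Lemma cut_1 c r x : 0 < r -> `|x - c| <= r / 2 -> cut c r x = 1.
move=> r0 xc; rewrite /cut -scalerBr plateau_1// normrZ gtr0_norm ?divr_gt0//.
by rewrite mulrC mulrA ler_pdivrMr// mul1r -ler_pdivlMr.
Qed.

Lemma cut_0 c r x : 0 < r -> r <= `|x - c| -> cut c r x = 0.
move=> r0 xc; rewrite /cut -scalerBr plateau_0// normrZ gtr0_norm ?divr_gt0//.
by rewrite mulrAC ler_pdivlMr// ler_pM2l.
Qed.

End Bump.
Lemma pdE {R : realType} (f : R * R * R -> R) x i : differentiable f x ->
 partial i f x = 'd f x (bas i).
by move=> df; rewrite /partial deriveE. Qed.
#[global] Opaque partial.

(** * Parametric integrals, integration by parts, test functions *)
Section IntSmooth.
Context {R : realType}.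
Local Notation sp := (R * R * R)%type.
Implicit Types (phi F : sp -> R) (x y h : sp).

Lemma diff_of_bound F y (L : 'I_3 -> R) (C : R) : 0 <= C ->
 (forall h, `|F (y + h) - F y - \sum_i crd h i * L i| <= C * `|h| ^+ 2) ->
 differentiable F y /\ forall i, partial i F y = L i.
move=> C0 H.
have lin : linear (fun h : sp => \sum_i crd h i * L i).
 move=> a u v; rewrite scaler_sumr -big_split/=; apply: eq_bigr => i _. by rewrite crdD crdZ mulrDl -mulrA.
pose A : {linear sp -> R} := HB.pack (fun h : sp => \sum_i crd h i * L i)
 (GRing.isLinear.Build _ _ _ _ _ lin).
have AE h : A h = \sum_i crd h i * L i by [].
pose K := `|L 0| + `|L 1| + `|L 2|.
have AK h : `|A h| <= K * `|h|.
 rewrite AE /K !mulrDl; apply: sum3_abs_le; by rewrite normrM mulrC ler_wpM2l// abs_crd.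
have cA : continuous A.
 move=> z; apply/cvgrPdist_le => e e0. have K1 : 0 < K + 1 by rewrite ltr_wpDl// !addr_ge0.
 suff : nbhs (z : sp) [set t | `|A z - A t| <= e] by [].
 apply/nbhs_ballP; exists (e / (K + 1)); first by rewrite /= divr_gt0. move=> w; rewrite -ballE => /= zw.
 suff : `|A (z - w)| <= e by rewrite linearB. apply: le_trans (AK _) _.
 apply: (@le_trans _ _ (K * (e / (K + 1)))); first by rewrite ler_wpM2l ?addr_ge0// ltW.
 by rewrite mulrA ler_pdivrMr// mulrC ler_wpM2l// ?(ltW e0)// lerDl.
have E : F \o shift y = cst (F y) + A +o_ (0 : sp) id.
 apply/eqaddoP => e e0. apply/nbhs_ballP; exists (e / (C + 1)) => /=; first by rewrite divr_gt0// ltr_wpDl.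
 move=> h; rewrite -ballE/= sub0r normrN ltr_pdivlMr ?ltr_wpDl// => he.
 rewrite [X in `|X| <= _](_ : _ = F (y + h) - F y - A h); last first.
  by rewrite -[LHS]/(F (h + y) - (F y + A h)) (addrC h) opprD addrA.
 apply: le_trans (H h) _; rewrite expr2 mulrA ler_wpM2r//.
 by apply: le_trans (ltW he); rewrite mulrC ler_wpM2l// lerDl.
have D := diff_unique cA E.
have dF : differentiable F y by apply/diff_locallyP; rewrite D.
split=> // i; rewrite pdE// D AE.
by rewrite sum3; elim/ord3 : i; rewrite /crd/= !mul0r mul1r ?addr0 ?add0r.
Qed.

Section param.
Context d (T : measurableType d) (mu : {measure set T -> \bar R}).
Variables (E : set T) (al : T -> R) (ga : T -> sp).
Hypothesis mE : measurable E.
Hypothesis mal : measf E al.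
Hypothesis al1 : forall s, E s -> `|al s| <= 1.
Hypothesis mcomp : forall (phi : sp -> R) y, continuous phi ->
 measf E (fun s => phi (al s *: y + ga s)).

Definition pint (f : T -> R) phi y : R := \int[mu]_(s in E) (f s * phi (al s *: y + ga s)).

Lemma pint_itg f phi y : itg mu E f -> Cc phi ->
 itg mu E (fun s => f s * phi (al s *: y + ga s)).
move=> fi cphi; have [M M0 HM] := Cc_bd cphi.
apply: (@itg_le _ _ _ _ _ mE _ (fun s => M * `|f s|)) => //.
- apply: mfunM; first exact: itg_meas fi.
 by apply: mcomp; apply: sm_cont; case: cphi.
- by move=> s _; rewrite normrM mulrC ler_wpM2r.
- by apply: itgZ => //; exact: itg_norm.
Qed.

Lemma itg_al f : itg mu E f -> itg mu E (fun s => f s * al s).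
move=> fi; apply: (@itg_le _ _ _ _ _ mE _ (fun s => `|f s|)) => //.
- by apply: mfunM => //; exact: itg_meas fi.
- by move=> s Es; rewrite normrM ler_piMr// al1.
- exact: itg_norm.
Qed.

Lemma pint_diff f phi y : itg mu E f -> Cc phi ->
 differentiable (pint f phi) y /\
 forall i, partial i (pint f phi) y = pint (fun s => f s * al s) (partial i phi) y.
move=> fi cphi; have [M M0 HM] := Cc_taylor cphi.
have I0 : 0 <= \int[mu]_(s in E) `|f s| by apply: Rintegral_ge0.
apply: (@diff_of_bound _ _ _ (M * \int[mu]_(s in E) `|f s|)); first by rewrite mulr_ge0.
move=> h.
have fii i : itg mu E (fun s => f s * al s * partial i phi (al s *: y + ga s)) by apply: pint_itg; [exact: itg_al|exact: Cc_pd].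
have -> : pint f phi (y + h) - pint f phi y -
  \sum_i crd h i * pint (fun s => f s * al s) (partial i phi) y =
 \int[mu]_(s in E) (f s * (phi (al s *: y + ga s + al s *: h) - phi (al s *: y + ga s)
  - \sum_i crd (al s *: h) i * partial i phi (al s *: y + ga s))).
 have EQ s : f s * (phi (al s *: y + ga s + al s *: h) - phi (al s *: y + ga s)
  - \sum_i crd (al s *: h) i * partial i phi (al s *: y + ga s)) =
  (f s * phi (al s *: (y + h) + ga s) - f s * phi (al s *: y + ga s)) -
  \sum_i crd h i * (f s * al s * partial i phi (al s *: y + ga s)).
  rewrite scalerDr [al s *: y + al s *: h + ga s]addrAC !mulrBr mulr_sumr; congr (_ - _).
  by apply: eq_bigr => i _; rewrite crdZ; ring.
 under [RHS]eq_int do rewrite EQ. rewrite [RHS]RintegralB//; last 2 first.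
 - by apply: itgB => //; exact: pint_itg.
 - by apply: itg_sum => // i _; exact: itgZ.
 rewrite [X in _ = X - _]RintegralB//; [|exact: pint_itg|exact: pint_itg].
 congr (_ - _); rewrite Rint_sum//; last by move=> i _; exact: itgZ.
 by apply: eq_bigr => i _; rewrite RintZ.
have fI : itg mu E (fun s => f s * (phi (al s *: y + ga s + al s *: h) - phi (al s *: y + ga s)
  - \sum_i crd (al s *: h) i * partial i phi (al s *: y + ga s))).
 apply: (@itg_le _ _ _ _ _ mE _ (fun s => M * `|h| ^+ 2 * `|f s|)) => //.
 - apply: mfunM; first exact: itg_meas fi.
  apply: measurable_funB; first apply: measurable_funB.
  + have := mcomp (y + h) (sm_cont (Cc_sm cphi)).
   by under eq_fun do rewrite scalerDr addrAC.
  + exact: (mcomp y (sm_cont (Cc_sm cphi))).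
  + apply: measurable_sum => i; apply: mfunM; last first.
    exact: (mcomp y (sm_cont (Cc_sm (Cc_pd i cphi)))).
   have -> : (fun s => crd (al s *: h) i) = fun s => al s * crd h i by apply/funext => s; elim/ord3 : i.
   by apply: mfunM.
 - move=> s Es; rewrite normrM mulrC ler_wpM2r//.
  apply: le_trans (HM _ _) _; rewrite ler_wpM2l// normrZ exprMn ler_piMl ?sqr_ge0//.
  by rewrite expr_le1// al1.
 - by apply: itgZ => //; exact: itg_norm.
apply: le_trans (le_normr_Rintegral mE fI) _.
rewrite mulrAC -RintZ//; last exact: itg_norm.
apply: le_Rintegral => //; [exact: itg_norm|by apply: itgZ => //; exact: itg_norm|].
move=> s Es; rewrite normrM mulrC ler_wpM2r//.
apply: le_trans (HM _ _) _; rewrite ler_wpM2l// normrZ exprMn ler_piMl ?sqr_ge0//.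
by rewrite expr_le1// al1.
Qed.

Lemma pint_pd f phi i : itg mu E f -> Cc phi ->
 partial i (pint f phi) = pint (fun s => f s * al s) (partial i phi).
by move=> fi cp; apply/funext => y; have [_ ->] := pint_diff y fi cp. Qed.

(** Differentiation under the integral sign: the second-order Taylor bound is
    uniform in the parameter. *)
Lemma pint_smooth f phi : itg mu E f -> Cc phi -> smooth (pint f phi).
move=> fi cp; apply: (@sm_coind _ [set F | exists f phi, [/\ itg mu E f, Cc phi &
  F = pint f phi]]); last by exists f, phi.
- by move=> _ [f0 [p0 [f0i cp0 ->]]] x; have [] := pint_diff x f0i cp0.
- move=> _ i [f0 [p0 [f0i cp0 ->]]]; exists (fun s => f0 s * al s), (partial i p0).
 by split; [exact: itg_al|exact: Cc_pd|exact: pint_pd].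
Qed.

End param.
End IntSmooth.

Section Integrals.
Context {R : realType}.
Local Notation sp := (R * R * R)%type.
Implicit Types (phi q F f g : sp -> R) (x y h : sp) (D U : set sp).

Lemma itg3_le D f g : measurable D -> measf D f ->
 (forall x, D x -> `|f x| <= g x) -> itg3 D g -> itg3 D f.
by move=> mD; exact: (@itg_le _ _ _ leb3 D mD f g). Qed.

Lemma zextE D f : (EFin \o f) \_ D = (EFin \o (f \_ D)).
by apply/funext => x; rewrite /= !patchE; case: ifP. Qed.

Lemma itg_zext D f : measurable D -> itg3 D f -> itg3 setT (f \_ D).
by move=> mD fi; have := (@integrable_mkcond _ _ _ leb3 D (EFin \o f) mD).1 fi; rewrite zextE. Qed.

Lemma itg_ball x (r : R) : 0 <= r -> itg3 setT (\1_(ball x r) : sp -> R).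
move=> r0; have mB : measurable (ball x r : set sp) by exact: mball.
apply/integrableP; split; first by apply/mEFinP.
under eq_integral do rewrite /= ger0_norm//.
by rewrite integral_indic// setIT [ltLHS]leb3_ball ?ltry.
Qed.

Lemma itg_bsupp f (M r : R) : measf (setT : set sp) f ->
 (forall x, `|f x| <= M) -> (forall x, r < `|x| -> f x = 0) -> itg3 setT f.
move=> mf fM fr; pose B : set sp := ball 0 (`|r| + 1).
have mB : measurable B by exact: mball.
have iB : itg3 setT (\1_B : sp -> R) by apply: itg_ball; rewrite addr_ge0.
apply: (@itg3_le _ _ (fun x => M * \1_B x)) => //.
 move=> x _; rewrite indicE; case: (boolP (x \in B)) => xB; first by rewrite mulr1.
 rewrite fr ?normr0 ?mulr0//; move: xB; rewrite notin_setE /B -ballE/= sub0r normrN.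
 by move=> /negP; rewrite -leNgt; apply: lt_le_trans; rewrite (le_lt_trans (ler_norm r))// ltrDl.
by apply: itgZ.
Qed.

Lemma Cc_meas phi D : Cc phi -> measurable D -> measf D phi.
by move=> cp mD; apply: cont_meas3 => //; apply: sm_cont; case: cp. Qed.

Lemma Cc_itg phi : Cc phi -> itg3 setT phi.
move=> cp; have [M M0 HM] := Cc_bd cp; have [_ [r Hr]] := cp.
by apply: (itg_bsupp _ HM Hr); exact: Cc_meas.
Qed.

Lemma Cc_L2 phi : Cc phi -> Lsq setT phi.
move=> cp; split; first exact: Cc_meas.
by apply: (Cc_itg (CcM cp (Cc_sm cp))).
Qed.

Lemma int_shift h f : itg3 setT f ->
 itg3 setT (fun x => f (x + h)) /\ \int[leb3]_x f (x + h) = \int[leb3]_x f x.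
move=> fi; have [a b] := int_affine h (oner_neq0 R) fi.
have E : (fun x => f (1 *: x + h)) = (fun x => f (x + h)) by apply/funext => x; rewrite scale1r.
by rewrite E in a b; split => //; rewrite b normr1 expr1n mul1r.
Qed.

Lemma int_pd0 phi i : Cc phi -> \int[leb3]_x partial i phi x = 0.
move=> cp; have cpi := Cc_pd i cp.
have [M M0 HM] := Cc_taylor cp; have [_ [r Hr]] := cp; have [_ [r' Hr']] := cpi.
pose B : set sp := ball 0 (`|r| + `|r'| + 2).
have mB : measurable B by exact: mball.
have iB : itg3 setT (\1_B : sp -> R) by apply: itg_ball; rewrite !addr_ge0.
set V := \int[leb3]_x (\1_B x : R).
have sumb (m : 'I_3) (F : 'I_3 -> R) (t : R) : \sum_i crd (t *: bas m) i * F i = t * F m.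
 rewrite sum3 !crdE; elim/ord3 : m; rewrite /bas/=; rewrite -?[t *: _]/(t * _) ?eqxx/=; ring.
have nb (m : 'I_3) : `|bas m : sp| <= 1 by rewrite norm_spE/= !ge_max !ger0_norm ?ler0n// !lern1; elim/ord3 : m.
have V0 : 0 <= V by apply: Rintegral_ge0 => x _; rewrite indicE ler0n.
have key t : 0 < t -> t <= 1 -> `|\int[leb3]_x partial i phi x| <= t * (M * V).
 move=> t0 t1. have nt : `|t *: bas i : sp| <= t by rewrite normrZ gtr0_norm// ler_piMr// ltW.
 have [s1 s2] := int_shift (t *: bas i) (Cc_itg cp). have E : t * \int[leb3]_x partial i phi x =
  - \int[leb3]_x (phi (x + t *: bas i) - phi x - t * partial i phi x). rewrite RintegralB//; last 2 first.
  - by apply: itgB => //; exact: Cc_itg.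
  - by apply: itgZ => //; exact: Cc_itg. rewrite RintegralB//; last exact: Cc_itg.
  by rewrite s2 subrr sub0r opprK RintZ//; exact: Cc_itg.
 rewrite -(ler_pM2l t0) -[X in X * _](gtr0_norm t0) -normrM E normrN.
 have I1 : itg3 setT (fun x => phi (x + t *: bas i) - phi x - t * partial i phi x) by apply: itgB => //; [apply: itgB => //; exact: Cc_itg|apply: itgZ => //; exact: Cc_itg].
 apply: le_trans (le_normr_Rintegral measurableT I1) _.
 have -> : t * (t * (M * V)) = \int[leb3]_x (t ^+ 2 * M * \1_B x) by rewrite RintZ//; rewrite -/V; ring.
 apply: le_Rintegral => //; [exact: itg_norm|exact: itgZ|].
 move=> x _; rewrite indicE; case: (boolP (x \in B)) => xB.
  rewrite mulr1; have := HM x (t *: bas i); rewrite sumb.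
  move=> /le_trans; apply; rewrite mulrC ler_wpM2r//. by rewrite lerXn2r ?nnegrE// ltW.
 have xb : `|r| + `|r'| + 2 <= `|x|.
  move: xB; rewrite notin_setE /B -ballE/= sub0r normrN. by move=> /negP; rewrite -leNgt.
 rewrite mulr0 (Hr x) ?(Hr' x) ?Hr ?mulr0 ?subrr ?subr0 ?normr0//.
 - have := ler_normB (x + t *: bas i) (t *: bas i); rewrite addrK.
  by have := ler_norm r; have := normr_ge0 r'; lra.
 - by have := ler_norm r; have := ler_norm r'; have := normr_ge0 r; have := normr_ge0 r'; lra.
 - by have := ler_norm r; have := ler_norm r'; have := normr_ge0 r; have := normr_ge0 r'; lra.
apply/eqP; rewrite -normr_eq0; apply/eqP/le_anti; rewrite normr_ge0 andbT.
apply/ler_addgt0Pr => e e0; rewrite add0r.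
have MV : 0 < M * V + 1 by rewrite ltr_wpDl// mulr_ge0.
pose t := Num.min 1 (e / (M * V + 1)).
have t0 : 0 < t by rewrite lt_min ltr01 divr_gt0.
have t1 : t <= 1 by rewrite ge_min lexx.
apply: le_trans (key t t0 t1) _.
apply: (@le_trans _ _ (t * (M * V + 1))); first by rewrite ler_wpM2l ?(ltW t0)// lerDl.
by rewrite -ler_pdivlMr// ge_min lexx orbT.
Qed.

Lemma ibp phi F i : Cc phi -> smooth F ->
 \int[leb3]_x (phi x * partial i F x) = - \int[leb3]_x (F x * partial i phi x).
move=> cp sF; have := int_pd0 i (CcM cp sF).
have E : partial i (fun x => phi x * F x) = fun x => phi x * partial i F x + F x * partial i phi x by apply/funext => x; rewrite pdM//; apply: sm_diff => //; case: cp.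
have c1 : Cc (fun x => phi x * partial i F x) by apply: CcM => //; exact: sm_pd.
have c2 : Cc (fun x => F x * partial i phi x).
 under eq_fun do rewrite mulrC. by apply: CcM => //; exact: Cc_pd.
rewrite E RintegralD//; [|exact: Cc_itg|exact: Cc_itg].
by move=> /eqP; rewrite addr_eq0 => /eqP.
Qed.

Lemma test_funP D q (K : set sp) : smooth q -> compact K -> K `<=` D ->
 (forall x, ~ K x -> q x = 0) -> test_fun D q.
move=> sq cK KD qK.
have cl : closure [set x | q x != 0] `<=` K.
 apply: (@subset_trans _ (closure K)).
  apply: closureS => x /= /eqP qx; apply: contrapT => nK; apply: qx; exact: qK.
 by rewrite -((closure_id K).1 (compact_closed (@norm_hausdorff _ sp) cK)).
split => //; last exact: subset_trans cl KD.
by apply: subclosed_compact cl => //; exact: closed_closure.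
Qed.

Lemma test_out D q x : test_fun D q -> ~ D x -> q x = 0.
move=> [_ _ qD] nD; apply: contrapT => /eqP qx; apply: nD; apply: qD.
exact: subset_closure.
Qed.

Lemma test_Cc D q : test_fun D q -> Cc q.
move=> [sq cK qD]; split => //; have [M [_ HM]] := compact_bounded cK.
exists (`|M| + 1) => x xM; apply: contrapT => /eqP qx.
have : `|x| <= `|M| + 1.
 apply: HM; first by rewrite (le_lt_trans (ler_norm _))// ltrDl. exact: subset_closure.
by rewrite leNgt xM.
Qed.

Lemma test_sm D q : test_fun D q -> smooth q. by case. Qed.

Lemma test_near0 D q x : test_fun D q -> ~ closure [set x | q x != 0] x ->
 \forall y \near x, q y = 0.
move=> tq nx.
have o : open (~` closure [set x | q x != 0]) by apply: closed_openC; exact: closed_closure.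
have := open_nbhs_nbhs (conj o (nx : (~` closure [set x | q x != 0]) x)).
apply: filterS => y ny; apply: contrapT => /eqP qy; apply: ny; exact: subset_closure.
Qed.

Lemma test_pd D q i : test_fun D q -> test_fun D (partial i q).
move=> tq; have [sq cK qD] := tq; apply: (test_funP _ cK qD); first exact: sm_pd.
move=> x nx; rewrite (@near_pd _ _ (fun=> 0)) ?pd_cst//.
exact: test_near0 tq nx.
Qed.

Lemma test_mul D q f : test_fun D q -> smooth f -> test_fun D (fun x => q x * f x).
move=> [sq cK qD] sf; apply: (test_funP _ cK qD); first exact: smoothM.
move=> x nx; rewrite (_ : q x = 0) ?mul0r//.
by apply: contrapT => /eqP qx; apply: nx; exact: subset_closure.
Qed.

Lemma test_add D q f : test_fun D q -> test_fun D f -> test_fun D (fun x => q x + f x).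
move=> [sq cK qD] [sf cL fD].
apply: (@test_funP _ _ (closure [set x | q x != 0] `|` closure [set x | f x != 0])).
- exact: smoothD.
- exact: compactU.
- by move=> x [/qD|/fD].
- move=> x /not_orP[nq nf].
 have -> : q x = 0 by apply: contrapT => /eqP qx; apply: nq; exact: subset_closure.
 by rewrite add0r; apply: contrapT => /eqP qx; apply: nf; exact: subset_closure.
Qed.

Lemma test_0 D : test_fun D (fun=> 0).
apply: (@test_funP _ _ set0); [exact: sm_cst|exact: compact0|by []|by []].
Qed.

Lemma test_scale D (a : R) q : test_fun D q -> test_fun D (fun x => a * q x).
move=> tq; have -> : (fun x => a * q x) = (fun x => q x * a) by apply/funext => x; rewrite mulrC.
by apply: test_mul => //; exact: sm_cst.
Qed.

Lemma test_P D (a : R) q f : test_fun D q -> test_fun D f -> test_fun D (a *: q + f).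
by move=> tq tf; apply: test_add => //; exact: test_scale. Qed.

Lemma test_sub D U q : D `<=` U -> test_fun D q -> test_fun U q.
by move=> DU [sq cK qD]; split => //; exact: subset_trans DU. Qed.

Lemma int_test D q f : test_fun D q -> \int[leb3]_(x in D) (f x * q x) = \int[leb3]_x (f x * q x).
move=> tq; rewrite Rintegral_mkcond; apply: eq_int => x _; rewrite patchE.
case: ifPn => // nD; rewrite (test_out tq) ?mulr0//.
by move=> Dx; rewrite (mem_set Dx) in nD.
Qed.

Lemma int_ibp_test D q F i : test_fun D q -> smooth F ->
 \int[leb3]_(x in D) (partial i F x * q x) = - \int[leb3]_(x in D) (F x * partial i q x).
move=> tq sF; rewrite !int_test//; last exact: test_pd.
rewrite -ibp//; last exact: test_Cc tq.
by apply: eq_int => x _; rewrite mulrC.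
Qed.

Lemma cball_compact (c : sp) (r : R) : compact [set y : sp | `|y - c| <= r].
rewrite (_ : [set y | _] = (fun z : sp => z + c) @` [set z : sp | `|z| <= r]).
 apply: continuous_compact; last exact: compact_cball.
 by apply: continuous_subspaceT => z; apply: cvgD; [exact: cvg_id|exact: cvg_cst].
apply/seteqP; split => [y /= yr|_ [z /= zr <-]]; last by rewrite /= addrK.
by exists (y - c) => //; rewrite subrK.
Qed.

Lemma open_ball_sub U x : open U -> U x -> exists2 r : R, 0 < r &
 [set y : sp | `|y - x| <= r] `<=` U.
move=> oU Ux; have /nbhs_ballP[e/= e0 eU] : nbhs x U by exact: open_nbhs_nbhs.
exists (e / 2); first by rewrite divr_gt0.
move=> y /= yx; apply: eU; rewrite -ballE/= distrC (le_lt_trans yx)//.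
by rewrite ltr_pdivrMr// ltr_pMr// ltr1n.
Qed.

(** The indicator of an open set is the pointwise limit of test functions:
    countably many cutoffs are glued one after the other. *)
Lemma open_test_approx U : open U -> exists u : nat -> sp -> R,
 [/\ forall n, test_fun U (u n), forall n x, 0 <= u n x <= 1 &
   forall x, U x -> exists N, forall n, (N <= n)%N -> u n x = 1].
move=> oU.
pose q3 (p : rat * rat * rat * nat) : sp := (ratr p.1.1.1, ratr p.1.1.2, ratr p.1.2).
pose rr (p : rat * rat * rat * nat) : R := p.2.+1%:R^-1.
pose good p := [set y : sp | `|y - q3 p| <= rr p] `<=` U.
pose psi k : sp -> R := if unpickle k is Some p then
 if asbool (good p) then cut (q3 p) (rr p) else fun=> 0 else fun=> 0.
have rr0 p : 0 < rr p by rewrite invr_gt0.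
have tpsi k : test_fun U (psi k).
 rewrite /psi; case: unpickle => [p|]; last exact: test_0. case: asboolP => [gp|_]; last exact: test_0.
 apply: (@test_funP _ _ [set y : sp | `|y - q3 p| <= rr p]) => //.
 - exact: Cc_sm (Cc_cut _ _).
 - exact: cball_compact.
 - by move=> x /negP; rewrite -ltNge => /ltW h; rewrite cut_0.
have psi01 k x : 0 <= psi k x <= 1.
 rewrite /psi; case: unpickle => [p|]; last by rewrite lexx ler01.
 by case: asboolP => [_|_]; rewrite ?cut_ge0 ?cut_le1 ?lexx ?ler01.
pose u := fix u n : sp -> R := if n is k.+1 then fun x => u k x + psi k x * (1 - u k x) else fun=> 0.
have u01 n x : 0 <= u n x <= 1.
 elim: n => [|n /= /andP[a b]]; first by rewrite /= lexx ler01. have /andP[c d] := psi01 n x.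
 have h0 : 0 <= 1 - u n x by rewrite subr_ge0. rewrite addr_ge0 ?mulr_ge0//= -lerBrDl -[leRHS]mul1r.
 exact: ler_pM.
have tu n : test_fun U (u n).
 elim: n => [|n IH] /=; first exact: test_0.
 apply: test_add => //; apply: test_mul => //; apply: smoothB; first exact: sm_cst. exact: test_sm IH.
exists u; split => // x Ux.
have [e e0 eU] := open_ball_sub oU Ux.
pose n := Num.bound (e / 4)^-1.
have [w wE] : exists w : R, w = n.+1%:R^-1 by exists n.+1%:R^-1.
have w0 : 0 < w by rewrite wE invr_gt0.
have ne : w < e / 4.
 rewrite wE -[ltRHS]invrK ltf_pV2 ?posrE ?invr_gt0 ?divr_gt0//.
 apply: lt_le_trans (archi_boundP _) _; first by rewrite invr_ge0 divr_ge0// ltW. by rewrite ler_nat.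
have ap (t : R) : exists q : rat, `|t - ratr q| <= w / 2.
 have /rat_in_itvoo[q] : t - w / 2 < t + w / 2 by lra. rewrite in_itv/= => /andP[h1 h2]; exists q.
 by rewrite ler_norml; apply/andP; split; lra.
have [q1 H1] := ap x.1.1; have [q2 H2] := ap x.1.2; have [q3' H3] := ap x.2.
pose p := (q1, q2, q3', n).
have xp : `|x - q3 p| <= w / 2 by rewrite norm_spE !ge_max H1 H2 H3.
have gp : good p.
 move=> y /=; rewrite /rr/= -wE => yp; apply: eU => /=.
 have := ler_distD (q3 p) y x; rewrite (distrC (q3 p) x); lra.
have px : psi (pickle p) x = 1 by rewrite /psi pickleK; case: asboolP => // _; rewrite cut_1// /rr/= -wE.
have uS k y : u k.+1 y = u k y + psi k y * (1 - u k y) by [].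
move: px; clearbody u; move: (pickle p) => N px; exists N.+1 => m; elim: m => // m IH.
rewrite ltnS leq_eqVlt uS => /predU1P[<-|/IH ->]; first by rewrite px mul1r addrC subrK.
by rewrite subrr mulr0 addr0.
Qed.

Lemma space_sigma_open (A : set sp) : measurable A -> <<s (@open sp) >> A.
pose T0 : measurableType _ := g_sigma_algebraType (@open sp).
have mO (f : sp -> R) : continuous f -> measf (setT : set T0) (f : T0 -> R).
 move=> cf; apply: (measurability _ (RGenOpens.measurableE R)).
 move=> _ [_ [a [b ->]] <-]; rewrite setTI; apply: sub_sigma_algebra.
 by apply: open_comp; [move=> x _; exact: cf|exact: interval_open].
have cc i : continuous (fun x : sp => crd x i) by apply: sm_cont; exact: sm_crd.
have mid : measf (setT : set T0) (id : T0 -> sp).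
 rewrite (_ : id = fun x : T0 => ((crd x 0, crd x 1), crd x 2)); last first.
  by apply/funext => -[[a b] c].
 apply: measurable_fun_pair; last exact: mO (cc 2).
 by apply: measurable_fun_pair; [exact: mO (cc 0)|exact: mO (cc 1)].
by move=> mA; have := mid measurableT A mA; rewrite setTI.
Qed.

(** A locally integrable function orthogonal to all test functions vanishes
    almost everywhere: its integral over every open set is zero, and open sets
    generate the measurable ones. *)
Lemma fundamental_lemma D f : open D -> itg3 D f ->
 (forall q, test_fun D q -> \int[leb3]_(x in D) (f x * q x) = 0) -> f = (fun=> 0) %[ae leb3 in D].
move=> oD fi Hf; have mD := mopen oD; have mf := itg_meas fi.
have intU U : open U -> U `<=` D -> (\int[leb3]_(x in U) (f x)%:E = 0)%E.
 move=> oU UD; have [u [tu u01 u1]] := open_test_approx oU. have mU := mopen oU.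
 have cv : (fun n => \int[leb3]_(x in D) (f x * u n x)%:E)%E @ \oo -->
   (\int[leb3]_(x in D) (f x * \1_U x)%:E)%E.
  have [] := @dominated_convergence _ _ _ leb3 D mD (fun n x => (f x * u n x)%:E)
   (fun x => (f x * \1_U x)%:E) (fun x => `|f x|%:E) => //.
  - move=> n; apply/mEFinP; apply: mfunM => //.
   by apply: Cc_meas => //; exact: test_Cc (tu n).
  - by apply/mEFinP; apply: mfunM.
  - apply: aeW => x Dx; apply: cvg_EFin; first exact: nearW.
   apply: cvg_near_cst; have [Ux|nUx] := pselect (U x).
    have [N HN] := u1 x Ux; exists N => // n /= Nn. by rewrite HN// indicE mem_set.
   by apply: nearW => n; rewrite /= (test_out (tu n))// indicE memNset.
  - exact: itg_norm.
  - apply: aeW => x n Dx; rewrite /= lee_fin normrM ler_piMr//.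
   by have /andP[a b] := u01 n x; rewrite ger0_norm.
 have z n : (\int[leb3]_(x in D) (f x * u n x)%:E = 0)%E.
  rewrite EFin_Rint ?Hf//; first exact: test_sub (tu n). apply: (@itg3_le _ _ (fun x => `|f x|)) => //.
  - apply: mfunM => //; apply: Cc_meas => //; exact: test_Cc (tu n).
  - move=> x Dx; rewrite normrM ler_piMr//.
   by have /andP[a b] := u01 n x; rewrite ger0_norm.
  - exact: itg_norm.
 have e0 : (\int[leb3]_(x in D) (f x * \1_U x)%:E = 0)%E.
  have E : (fun n => \int[leb3]_(x in D) (f x * u n x)%:E)%E = (fun=> 0%E) by apply/funext => n; exact: z.
  by rewrite E in cv; exact: (cvg_unique (@ereal_hausdorff R) cv (cvg_cst 0%E)).
 rewrite -[RHS]e0 -(setIidr UD) integral_mkcondr; apply: eq_integral => x _.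
 by rewrite patchE indicE setIidr//; case: ifP => _; rewrite ?mulr1 ?mulr0.
pose g := f \_ D.
have gi : itg3 setT g by exact: itg_zext.
have gE A : measurable A -> (\int[leb3]_(x in A) (g x)%:E = \int[leb3]_(x in A `&` D) (f x)%:E)%E.
 move=> mA; rewrite integral_mkcondr; apply: eq_integral => x _. by rewrite /g !patchE; case: ifP.
have giA A : measurable A -> itg3 A g by move=> mA; apply: integrableS gi.
pose H := [set A : set sp | measurable A /\ \int[leb3]_(x in A) g x = 0].
have HO : @open sp `<=` H.
 move=> U oU; split; first exact: mopen. rewrite /Rintegral gE; last exact: mopen.
 by rewrite intU//; exact: openI.
have lamH : lambda_system setT H.
 apply/dynkin_lambda_system; split.
 - by apply: HO; exact: openT.
 - move=> A [mA A0]; split; first exact: measurableC.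
  have [_] := HO _ (@openT sp). rewrite -(setUv A) Rintegral_setU//; first by rewrite A0 add0r.
  + exact: measurableC.
  + by rewrite setUv.
  + exact/disj_setPCl.
 - move=> F tF HF; have mF k : measurable (F k) by have [] := HF k.
  split; first exact: bigcupT_measurable.
  rewrite /Rintegral integral_bigcup//; last by apply: giA; exact: bigcupT_measurable.
  rewrite eseries0// => i _ _; have [mi] := HF i. by rewrite EFin_Rint ?giA// => ->.
have all0 A : measurable A -> (\int[leb3]_(x in A) (g x)%:E = 0)%E.
 move=> mA; suff [_] : H A by rewrite EFin_Rint ?giA// => ->.
 apply: (lambda_system_subset _ lamH HO) (space_sigma_open mA) => //. by move=> U V; exact: openI.
pose z0 : sp -> R := cst 0.
have m0 : measf D (EFin \o z0) by apply/mEFinP; exact: measurable_cst.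
have E : forall E, E `<=` D -> measurable E ->
  (\int[leb3]_(x in E) (f x)%:E = \int[leb3]_(x in E) (EFin \o z0) x)%E.
 move=> E ED mE; rewrite [RHS]integral0_eq//. by have := all0 E mE; rewrite gE// setIidl.
have := @integral_ae_eq _ _ _ leb3 D mD (EFin \o z0) (EFin \o f) fi m0 E.
by apply: filterS => y /[apply]; case.
Qed.

End Integrals.

(** * Square norms and averages *)
Section SquareNorm.
Context {R : realType}.
Local Notation sp := (R * R * R)%type.
Implicit Types (f g : sp -> R) (x y h : sp) (D U : set sp).

Definition nsq D f : R := \int[leb3]_(x in D) (f x ^+ 2).

Lemma nsq_sip D f : nsq D f = sip leb3 D f f. by rewrite sipE. Qed.

Lemma nsq_ge0 D f : 0 <= nsq D f. by rewrite nsq_sip sip_ge0. Qed.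

Lemma L2_itg D f : Lsq D f -> itg3 D (fun x => f x ^+ 2). by case. Qed.

Lemma nsq_mono D f g : measurable D -> measf D f -> Lsq D g ->
 (forall x, D x -> f x ^+ 2 <= g x ^+ 2) -> nsq D f <= nsq D g.
move=> mD mf Lg fg; apply: le_Rintegral => //; last exact: L2_itg.
apply: (@itg3_le _ _ _ (fun x => g x ^+ 2)) => //; last exact: L2_itg.
 exact: measurable_funX.
by move=> x Dx; rewrite ger0_norm ?sqr_ge0// fg.
Qed.

Lemma sq_add2 (a b : R) : (a + b) ^+ 2 <= 2 * a ^+ 2 + 2 * b ^+ 2.
by have := sqr_ge0 (a - b); rewrite !expr2; lra. Qed.

Lemma nsq_add D f g : measurable D -> Lsq D f -> Lsq D g ->
 nsq D (fun x => f x + g x) <= 2 * nsq D f + 2 * nsq D g.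
move=> mD Lf Lg; rewrite /nsq -!RintZ//; try exact: L2_itg.
rewrite -RintegralD//; try by apply: itgZ => //; exact: L2_itg.
apply: le_Rintegral => //; first by apply: L2_itg; exact: L2gD.
- by apply: itgD => //; apply: itgZ => //; exact: L2_itg.
- by move=> x _; exact: sq_add2.
Qed.

Lemma nsqZ D a f : measurable D -> Lsq D f -> nsq D (fun x => a * f x) = a ^+ 2 * nsq D f.
move=> mD Lf; rewrite /nsq -RintZ//; last exact: L2_itg.
by apply: eq_int => x _; rewrite exprMn.
Qed.

Lemma nsq_sub D f g : measurable D -> Lsq D f -> Lsq D g ->
 nsq D (fun x => f x - g x) <= 2 * nsq D f + 2 * nsq D g.
move=> mD Lf Lg; have L : Lsq D (fun x => -1 * g x) by exact: L2gZ.
have -> : 2 * nsq D g = 2 * nsq D (fun x => -1 * g x) by rewrite nsqZ// sqrrN expr1n mul1r.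
have -> : (fun x => f x - g x) = (fun x => f x + -1 * g x) by apply/funext => x; rewrite mulN1r.
exact: nsq_add.
Qed.

Lemma zext_sq D f : (fun x => (f \_ D) x ^+ 2) = (fun x => f x ^+ 2) \_ D.
by apply/funext => x; rewrite !patchE; case: ifP; rewrite ?expr0n. Qed.

Lemma zext_meas D f : measurable D -> measf D f -> measf (setT : set sp) (f \_ D).
by move=> mD mf; apply/(measurable_restrictT _ mD). Qed.

Lemma int_zext D f : measurable D -> \int[leb3]_x (f \_ D) x = \int[leb3]_(x in D) f x.
by move=> mD; rewrite [RHS]/Rintegral integral_mkcond zextE.
Qed.

Lemma L2_zext D f : measurable D -> Lsq D f -> Lsq setT (f \_ D).
move=> mD [mf fi]; split; first exact: zext_meas.
by have := itg_zext mD fi; rewrite -zext_sq.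
Qed.

Lemma nsq_zext D f : measurable D -> nsq setT (f \_ D) = nsq D f.
by move=> mD; rewrite /nsq zext_sq int_zext. Qed.

Lemma L2_sub D U f : measurable D -> measurable U -> U `<=` D -> Lsq D f -> Lsq U f.
move=> mD mU UD [mf fi]; split; first exact: measurable_funS mf.
exact: integrableS fi.
Qed.

Lemma nsqS D U f : measurable D -> measurable U -> U `<=` D -> Lsq D f ->
 nsq U f <= nsq D f.
move=> mD mU UD Lf; rewrite -(nsq_zext _ mU) -(nsq_zext _ mD).
apply: nsq_mono => //; [|exact: L2_zext|].
 by apply: zext_meas => //; have [] := L2_sub mD mU UD Lf.
move=> x _; rewrite !patchE; case: ifPn => xU; last by rewrite expr0n sqr_ge0.
by rewrite (mem_set (UD _ (set_mem xU))).
Qed.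

Lemma L2_affine (c : R) h f : c != 0 -> Lsq setT f ->
 Lsq setT (fun x => f (c *: x + h)) /\ nsq setT f = `|c| ^+ 3 * nsq setT (fun x => f (c *: x + h)).
move=> c0 [mf fi]; have [a b] := int_affine h c0 fi.
split => //; split => //.
by apply: (mfcomp mf); exact: meas_affine.
Qed.

Lemma L2_shift h f : Lsq setT f ->
 Lsq setT (fun x => f (x + h)) /\ nsq setT (fun x => f (x + h)) = nsq setT f.
move=> Lf; have [] := L2_affine h (oner_neq0 R) Lf.
have -> : (fun x => f (1 *: x + h)) = (fun x => f (x + h)) by apply/funext => x; rewrite scale1r.
by rewrite normr1 expr1n mul1r.
Qed.

Section Jensen.
Context d (T : measurableType d) (mu : {sigma_finite_measure set T -> \bar R}).
Variables (E : set T) (B : set sp) (w : T -> R) (F : T -> sp -> R) (W K : R).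
Hypotheses (mE : measurable E) (mB : measurable B) (W0 : 0 < W)
 (mF : measf (setT : set (T * sp)) (fun p : T * sp => F p.1 p.2)).
Hypotheses (wi : itg mu E w) (w0 : forall s, E s -> 0 <= w s)
 (wW : \int[mu]_(s in E) w s <= W) (K0 : 0 <= K).
Hypothesis FK : forall s, E s -> (\int[leb3]_(y in B) (F s y ^+ 2)%:E <= K%:E)%E.
Hypothesis mG : measf B (fun y => \int[mu]_(s in E) (w s * F s y)).

Let jensen_pt y : B y -> itg mu E (fun s => w s * F s y) ->
 (((\int[mu]_(s in E) (w s * F s y)) ^+ 2)%:E <= W%:E * \int[mu]_(s in E) (w s * F s y ^+ 2)%:E)%E.
move=> By wF; have mw := itg_meas wi.
have mFy : measf E (fun s => F s y).
 apply: (@measurable_funTS _ _ _ _ E (fun s => F s y)). exact: (mfcomp mF (@measurable_pair2 _ _ T sp y)).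
have m2 : measf E (fun s => w s * F s y ^+ 2) by apply: mfunM => //; exact: measurable_funX.
have [fin|] := boolP (\int[mu]_(s in E) (w s * F s y ^+ 2)%:E < +oo)%E; last first.
 by rewrite -leNgt leye_eq => /eqP ->; rewrite gt0_muley ?lte_fin// leey.
have wF2 : itg mu E (fun s => w s * F s y ^+ 2).
 apply/integrableP; split; first exact/mEFinP. apply: le_lt_trans fin; apply: ge0_le_integral => //.
 - by apply: mfcomp => //; exact/mEFinP.
 - exact/mEFinP.
 - by move=> s Es; rewrite /= lee_fin ger0_norm// mulr_ge0 ?sqr_ge0// w0.
rewrite EFin_Rint// -EFinM lee_fin.
have ms : measf E (fun s => Num.sqrt (w s)).
 have c : measf (setT : set (measurableTypeR R)) (Num.sqrt : R -> R) by apply: continuous_measurable_fun; exact: sqrt_continuous.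
 exact: (mfcomp c mw).
have L1 : L2g mu E (fun s => Num.sqrt (w s)).
 split => //; apply: eq_integrable wi => // s; rewrite inE => Es /=. by rewrite sqr_sqrtr// w0.
have L2 : L2g mu E (fun s => Num.sqrt (w s) * F s y).
 split; first exact: mfunM. apply: eq_integrable wF2 => // s; rewrite inE => Es /=.
 by rewrite exprMn sqr_sqrtr// w0.
have := sip_CS mE L1 L2; rewrite /sip.
have -> : \int[mu]_(s in E) (Num.sqrt (w s) * (Num.sqrt (w s) * F s y)) =
  \int[mu]_(s in E) (w s * F s y).
 by apply: eq_int => s; rewrite inE => Es; rewrite mulrA -expr2 sqr_sqrtr// w0.
have -> : \int[mu]_(s in E) (Num.sqrt (w s) * Num.sqrt (w s)) = \int[mu]_(s in E) w s by apply: eq_int => s; rewrite inE => Es; rewrite -expr2 sqr_sqrtr// w0.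
have -> : \int[mu]_(s in E) (Num.sqrt (w s) * F s y * (Num.sqrt (w s) * F s y)) =
  \int[mu]_(s in E) (w s * F s y ^+ 2).
 by apply: eq_int => s; rewrite inE => Es; rewrite -expr2 exprMn sqr_sqrtr// w0.
move=> /le_trans; apply; rewrite ler_wpM2r//; apply: Rintegral_ge0 => // s Es.
by rewrite mulr_ge0 ?sqr_ge0// w0.
Qed.

(** The square of a weighted mean is at most the weighted mean of the
    squares; integrating in [y] and exchanging the integrals bounds the mean
    square norm of an average by that of its terms. *)
Lemma L2_average : (forall y, B y -> itg mu E (fun s => w s * F s y)) ->
 Lsq B (fun y => \int[mu]_(s in E) (w s * F s y)) /\
 nsq B (fun y => \int[mu]_(s in E) (w s * F s y)) <= W ^+ 2 * K.
move=> wF; have mw := itg_meas wi.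
pose w1 := w \_ E; have w10 s : 0 <= w1 s.
 by rewrite /w1 patchE; case: ifP => // /set_mem; exact: w0.
have mw1 : measf setT w1 by apply/(measurable_restrictT _ mE).
pose G (p : T * sp) : \bar R := (w1 p.1 * (F p.1 p.2 ^+ 2 * \1_B p.2))%:E.
have mGG : measf setT G.
 apply/mEFinP; apply: mfunM; first exact: mfcomp mw1 _. apply: mfunM; first exact: measurable_funX.
 by apply: (mfcomp (measurable_indic mB)).
have G0 p : (0 <= G p)%E by rewrite lee_fin mulr_ge0// mulr_ge0 ?sqr_ge0// indicE ler0n.
have key : (\int[leb3]_(y in B) ((\int[mu]_(s in E) (w s * F s y)) ^+ 2)%:E <=
  (W ^+ 2 * K)%:E)%E.
 apply: (@le_trans _ _ (W%:E * \int[leb3]_y \int[mu]_s G (s, y))%E).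
  rewrite -ge0_integralZl//; last 3 first.
  - by apply: measurable_fun_fubini_tonelli_G.
  - by move=> y _; exact: integral_ge0.
  - by rewrite lee_fin ltW. rewrite [leLHS]integral_mkcond; apply: ge0_le_integral => //.
  - by move=> y _; rewrite patchE; case: ifP => // _; rewrite lee_fin sqr_ge0.
  - apply/(measurable_restrictT _ mB)/mEFinP; exact: measurable_funX.
  - by apply: measurable_funeM; apply: measurable_fun_fubini_tonelli_G.
  - move=> y _; rewrite patchE; case: ifPn => [/set_mem By|_]; last first.
    by rewrite mule_ge0 ?integral_ge0// lee_fin ltW.
   apply: le_trans (jensen_pt By (wF y By)) _.
   rewrite lee_wpmul2l ?lee_fin ?(ltW W0)// integral_mkcond le_eqVlt; apply/orP; left.
   apply/eqP; apply: eq_integral => s _; rewrite /G /w1 !patchE/= indicE (mem_set By) mulr1.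
   by case: ifP; rewrite ?mul0r.
 rewrite expr2 -mulrA EFinM lee_wpmul2l ?lee_fin ?(ltW W0)//.
 rewrite -(@fubini_tonelli _ _ _ _ _ mu leb3)//. apply: (@le_trans _ _ (\int[mu]_s (w1 s * K)%:E)%E).
  apply: ge0_le_integral => //.
  - by move=> s _; exact: integral_ge0.
  - by apply: measurable_fun_fubini_tonelli_F.
  - by apply/mEFinP; apply: mfunM.
  - move=> s _; have [Es|nEs] := pselect (E s); last first.
    by rewrite integral0_eq ?lee_fin ?mulr_ge0// => y _; rewrite /G /w1 patchE/= memNset// mul0r.
   have mFs : measf setT (fun y => F s y).
    exact: (mfcomp mF (@measurable_pair1 _ _ T sp s)).
   rewrite (_ : (fun y => _) = (fun y => (w1 s)%:E * (F s y ^+ 2 * \1_B y)%:E)%E); last first.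
    by apply/funext => y; rewrite /G EFinM.
   rewrite ge0_integralZl//; last 3 first.
   + by apply/mEFinP; apply: mfunM; [exact: measurable_funX|].
   + by move=> y _; rewrite lee_fin mulr_ge0 ?sqr_ge0// indicE ler0n.
   + by rewrite lee_fin. rewrite EFinM lee_wpmul2l ?lee_fin//; apply: le_trans (FK Es).
   rewrite [leRHS]integral_mkcond le_eqVlt; apply/orP; left; apply/eqP.
   apply: eq_integral => y _; rewrite patchE indicE; case: ifP => _; rewrite ?mulr1 ?mulr0//.
 rewrite (_ : (\int[mu]_s (w1 s * K)%:E = (\int[mu]_(s in E) (w s * K)%:E))%E); last first.
  rewrite [RHS]integral_mkcond; apply: eq_integral => s _; rewrite /w1 !patchE.
  by case: ifP; rewrite ?mul0r.
 under eq_integral do rewrite mulrC. rewrite EFin_Rint//; last exact: itgZ.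
 by rewrite RintZ// lee_fin mulrC ler_wpM2r.
have L : Lsq B (fun y => \int[mu]_(s in E) (w s * F s y)).
 split => //; apply: (@ge0_itg _ _ _ leb3 B _ (W ^+ 2 * K)) => //; first exact: measurable_funX.
 by move=> y _; exact: sqr_ge0.
by split => //; rewrite -lee_fin /nsq -EFin_Rint//; exact: L2_itg.
Qed.

End Jensen.
End SquareNorm.

(** * Density of test functions, translations *)
Section Density.
Context {R : realType}.
Local Notation sp := (R * R * R)%type.
Implicit Types (f g q : sp -> R) (x y h : sp) (D U : set sp).

Lemma ae3S (P Q : set sp) : (forall x, P x -> Q x) ->
 (\forall x \ae leb3, P x) -> \forall x \ae leb3, Q x.
move=> PQ; apply: (@filterS _ _ (ae_filter_ringOfSetsType (@leb3 R))) => x.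
exact: PQ.
Qed.

Lemma nsq_ae D f g : measurable D -> Lsq D f -> Lsq D g ->
 f = g %[ae leb3 in D] -> nsq D f = nsq D g.
move=> mD [mf _] [mg _] fg; apply: ae_Rint => //; [exact: measurable_funX|exact: measurable_funX|].
by move: fg; apply: ae3S => x fg Dx; rewrite fg.
Qed.

Lemma test_L2 D q : open D -> test_fun D q -> Lsq D q.
move=> oD tq; have mD := mopen oD.
by apply: (@L2_sub _ setT) => //; apply: Cc_L2; exact: test_Cc tq.
Qed.

Lemma L2_itg_loc D f : leb3 D \is a fin_num -> measurable D -> Lsq D f -> itg3 D f.
move=> fD mD [mf fi]; apply: (@itg3_le _ _ _ (fun x => 1 + f x ^+ 2)) => //.
 move=> x _; have := sqr_ge0 (`|f x| - 1); rewrite sqrrB real_normK ?num_real//.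
 by have := normr_ge0 (f x); nra.
apply: itgD => //; apply/integrableP; split; first by apply/mEFinP.
rewrite (eq_integral (fun=> 1%E)); last by move=> x _; rewrite /= normr1.
by rewrite integral_cst// mul1e ltey_eq fD.
Qed.

Lemma L2_zero D f : open D -> Lsq D f ->
 (forall q, test_fun D q -> \int[leb3]_(x in D) (f x * q x) = 0) -> f = (fun=> 0) %[ae leb3 in D].
move=> oD Lf Hf; have mD := mopen oD.
have H n : f = (fun=> 0) %[ae leb3 in D `&` ball 0 n.+1%:R].
 have oU : open (D `&` ball (0 : sp) n.+1%:R) by apply: openI => //; exact: ball_open. have mU := mopen oU.
 have Lu : Lsq (D `&` ball 0 n.+1%:R) f by apply: L2_sub Lf. apply: fundamental_lemma => //.
  apply: L2_itg_loc => //; rewrite ge0_fin_numE//. apply: (@le_lt_trans _ _ (leb3 (ball (0 : sp) n.+1%:R))).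
   by apply: le_measure => //; rewrite inE//; exact: mball.
  by rewrite leb3_ball ?ltry.
 move=> q tq; rewrite int_test//. have tD : test_fun D q by apply: test_sub tq => x [].
 by rewrite -(int_test f tD) Hf.
have /ae_foralln : forall n, \forall x \ae leb3, (D `&` ball 0 n.+1%:R) x -> f x = 0 by [].
apply: ae3S => x Hx Dx.
apply: (Hx (Num.bound `|x|)); split => //; rewrite -ballE/= sub0r normrN.
by apply: lt_le_trans (archi_boundP _) _ => //; rewrite ler_nat.
Qed.

(** Test functions are dense in mean square: the projection of [f] on their
    closure differs from [f] by a function orthogonal to all of them. *)
Lemma test_dense D f : open D -> Lsq D f -> forall e : R, 0 < e ->
 exists2 q, test_fun D q & nsq D (fun x => f x - q x) < e.
move=> oD Lf e e0; have mD := mopen oD.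
have tL q : test_fun D q -> Lsq D q by exact: test_L2.
have [psi [s Ss [Lpsi lims Hpsi _]]] : exists psi : sp -> R, exists2 s : nat -> sp -> R, (forall n, test_fun D (s n)) &
 [/\ Lsq D psi, ssip_lim (sip leb3 D) (id \o s) psi, (forall t, test_fun D t -> sip leb3 D psi t = sip leb3 D f t)
  & 0 <= Num.sqrt (sip leb3 D f f) -> Num.sqrt (sip leb3 D psi psi) <= Num.sqrt (sip leb3 D f f)].
 apply: (@riesz_range R (sp -> R) (sp -> R) (Lsq D) (sip leb3 D)) => //.
 - exact: L2g0.
 - by move=> a u v Lu Lv; exact: L2gP.
 - by move=> u v _ _; exact: sipC.
 - by move=> a u v w Lu Lv Lw; exact: sipP.
 - by move=> u _; exact: sip_ge0.
 - by move=> u Lu cu; have [v] := @L2g_complete _ _ _ leb3 D mD u Lu cu; exists v.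
 - exact: test_0.
 - by move=> a u v; exact: test_P.
 - move=> a u v tu tv; have C g : sip leb3 D f g = sip leb3 D g f by exact: sipC.
  by rewrite !C; apply: sipP => //; exact: tL.
 - by move=> t tt; apply: sip_le => //; exact: tL.
have E : (fun x => f x - psi x) = (fun=> 0) %[ae leb3 in D].
 apply: L2_zero => //; first exact: L2gB. move=> q tq; have := Hpsi q tq; rewrite /sip => Eq.
 under eq_int do rewrite mulrBl. by rewrite RintegralB ?Eq ?subrr//; apply: L2g_mul => //; exact: tL.
have [N /(_ N (leqnn _))] := lims e e0.
rewrite -[sip _ _ _ _]nsq_sip => HN; exists (s N) => //.
apply: le_lt_trans HN; rewrite le_eqVlt; apply/orP; left; apply/eqP.
have -> : nsq D ((id \o s) N - psi) = nsq D (fun x => psi x - s N x) by apply: eq_int => x _; rewrite -sqrrN opprB.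
apply: nsq_ae => //; [by apply: L2gB => //; exact: tL|by apply: L2gB => //; exact: tL|].
by move: E; apply: ae3S => x /[apply] /eqP; rewrite subr_eq0 => /eqP ->.
Qed.

Lemma L2_translation f : Lsq setT f -> forall e : R, 0 < e ->
 exists2 r : R, 0 < r & forall h, `|h| < r -> nsq setT (fun x => f (x + h) - f x) <= e.
move=> Lf e e0; have e8 : 0 < e / 10 by rewrite divr_gt0.
have [q tq qf] := test_dense (@openT sp) Lf e8.
have cq := test_Cc tq; have Lq := Cc_L2 cq.
have [M M0 HM] := Cc_lip cq; have [_ [r0 Hr0]] := cq.
pose B : set sp := ball 0 (`|r0| + 2).
have mB : measurable B by exact: mball.
have LB : Lsq setT (\1_B : sp -> R).
 split => //; have r2 : 0 <= `|r0| + 2 by rewrite addr_ge0.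
 have := itg_ball (0 : sp) r2; apply: eq_integrable => // x _ /=.
 by rewrite indicE; case: (x \in B); rewrite ?expr1n ?expr0n.
pose V := nsq setT (\1_B : sp -> R); have V0 : 0 <= V by exact: nsq_ge0.
have M1 : 0 < M + 1 by rewrite ltr_wpDl.
have K0 : 0 < (M + 1) ^+ 2 * (V + 1) by rewrite mulr_gt0 ?exprn_gt0// ltr_wpDl.
pose k := e / 10 / ((M + 1) ^+ 2 * (V + 1)).
have k0 : 0 < k by rewrite divr_gt0.
exists (Num.min 1 k); first by rewrite lt_min ltr01.
move=> h; rewrite lt_min => /andP[h1 hk].
have [L1 N1] := L2_shift h (L2gB measurableT Lf Lq).
have [Lqh _] := L2_shift h Lq.
have L2' : Lsq setT (fun x => q (x + h) - q x) by exact: L2gB.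
have L3 : Lsq setT (fun x => q x - f x) by exact: L2gB.
have N3 : nsq setT (fun x => q x - f x) = nsq setT (fun x => f x - q x) by apply: eq_int => x _; rewrite -sqrrN opprB.
have N2 : nsq setT (fun x => q (x + h) - q x) <= e / 10.
 apply: (@le_trans _ _ (nsq setT (fun x => (M * `|h|) * \1_B x))).
  apply: nsq_mono => //; [by case: L2'|by apply: L2gZ|].
  move=> x _; rewrite -[leLHS]real_normK ?num_real// lerXn2r ?nnegrE ?mulr_ge0//.
  rewrite indicE; case: (boolP (x \in B)) => xB; first by rewrite mulr1. have xb : `|r0| + 2 <= `|x|.
   move: xB; rewrite notin_setE /B -ballE/= sub0r normrN. by move=> /negP; rewrite -leNgt.
  have n0 := ler_norm r0. have t := lerB_normD x h.
  by rewrite (Hr0 x) ?(Hr0 (x + h)) ?subrr ?normr0 ?mulr0//; lra.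
 rewrite nsqZ//. apply: (@le_trans _ _ ((M + 1) ^+ 2 * k * (V + 1))).
  apply: ler_pM => //; [by rewrite sqr_ge0| |by rewrite lerDl].
  rewrite exprMn; apply: ler_pM; rewrite ?sqr_ge0//.
   by rewrite lerXn2r ?nnegrE// ?(ltW M1)// lerDl.
  apply: le_trans (ltW hk); rewrite expr2 ler_piMr// ltW//.
 by rewrite mulrAC /k mulrC divfK// gt_eqF.
have E : (fun x => f (x + h) - f x) =
 (fun x => (f (x + h) - q (x + h)) + ((q (x + h) - q x) + (q x - f x))). by apply/funext => x; ring.
rewrite E.
have B1 := nsq_add measurableT L1 (L2gD measurableT L2' L3).
have B2 := nsq_add measurableT L2' L3; rewrite N1 in B1; rewrite N3 in B2.
have fin (A A' A'' N E' : R) : A < E' -> A' <= E' -> A'' <= 2 * A' + 2 * A ->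
 N <= 2 * A + 2 * A'' -> N <= 10 * E' by lra.
by have := fin _ _ _ _ _ qf N2 B2 B1; rewrite [10 * _]mulrC divfK ?pnatr_eq0.
Qed.

Definition moll f b := pint leb3 setT (fun=> 1) (fun s : sp => - s) f b.

Lemma mollE f b z : moll f b z = \int[leb3]_x (f x * b (z - x)).
by rewrite /moll /pint; apply: eq_int => x _; rewrite scale1r. Qed.

Lemma meas_conv (phi : sp -> R) y : continuous phi ->
 measf (setT : set sp) (fun s => phi (1 *: y + - s)).
move=> cp; apply: cont_meas3 => // s; apply: continuous_comp; last exact: cp.
by apply: cvgD; [exact: cvg_cst|apply: cvgN; exact: cvg_id].
Qed.

Lemma moll_smooth f b : itg3 setT f -> Cc b -> smooth (moll f b).
move=> fi cb; apply: pint_smooth => //; first by move=> s _; rewrite normr1.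
by move=> phi y; exact: meas_conv.
Qed.

Lemma moll_pd f b i : itg3 setT f -> Cc b ->
 partial i (moll f b) = moll f (partial i b).
move=> fi cb; rewrite /moll pint_pd//.
- by congr (pint _ _ _ _ _ _); apply/funext => s; rewrite mulr1.
- by move=> s _; rewrite normr1.
- by move=> phi y; exact: meas_conv.
Qed.

Lemma int_reflect z f : itg3 setT f ->
 itg3 setT (fun x => f (z - x)) /\ \int[leb3]_x f (z - x) = \int[leb3]_x f x.
move=> fi; have n1 : (-1 : R) != 0 by rewrite oppr_eq0 oner_eq0.
have [a b] := int_affine z n1 fi.
have E : (fun x => f (-1 *: x + z)) = (fun x => f (z - x)) by apply/funext => x; rewrite scaleN1r addrC.
by rewrite E in a b; split => //; rewrite b normrN1 expr1n mul1r.
Qed.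

Lemma meas_sub3 : measf (setT : set (sp * sp)) (fun p : sp * sp => p.2 - p.1).
have m1 (i j : sp -> R) : measf (setT : set sp) i -> measf (setT : set sp) j ->
 measf (setT : set (sp * sp)) (fun p : sp * sp => i p.2 - j p.1). move=> mi mj; apply: measurable_funB.
  exact: (mfcomp mi measurable_snd).
 exact: (mfcomp mj measurable_fst).
have mc (i : 'I_3) : measf (setT : set sp) (fun x : sp => crd x i) by apply: cont_meas3 => //; apply: sm_cont; exact: sm_crd.
apply: measurable_fun_pair; last exact: (m1 _ _ (mc 2) (mc 2)).
apply: measurable_fun_pair; [exact: (m1 _ _ (mc 0) (mc 0))|exact: (m1 _ _ (mc 1) (mc 1))].
Qed.

Lemma moll_close f b (r K : R) : itg3 setT f -> Lsq setT f -> Cc b ->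
 (forall x, 0 <= b x) -> \int[leb3]_x b x = 1 -> (forall x, r <= `|x| -> b x = 0) ->
 (forall h, `|h| < r -> nsq setT (fun x => f (x + h) - f x) <= K) ->
 Lsq setT (fun z => moll f b z - f z) /\ nsq setT (fun z => moll f b z - f z) <= K.
move=> fi Lf cb b0 b1 br HK; have Lb := Cc_L2 cb.
have ib := Cc_itg cb.
have mf : measf (setT : set sp) f by case: Lf.
have L2r z g : Lsq setT g -> Lsq setT (fun x => g (z - x)).
 move=> Lg; have n1 : (-1 : R) != 0 by rewrite oppr_eq0 oner_eq0. have [+ _] := L2_affine z n1 Lg.
 have -> : (fun x => g (-1 *: x + z)) = (fun x => g (z - x)) by apply/funext => x; rewrite scaleN1r addrC.
 by [].
have fb z : itg3 setT (fun x => f x * b (z - x)) by apply: L2g_mul => //; exact: L2r.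
have bf z : itg3 setT (fun s => b s * f (z - s)) by apply: L2g_mul => //; exact: L2r.
pose S : set sp := ball 0 r; have mS : measurable S by exact: mball.
have Sout x : ~ S x -> b x = 0 by rewrite /S -ballE/= sub0r normrN => /negP; rewrite -leNgt; exact: br.
have intS g : \int[leb3]_(s in S) (b s * g s) = \int[leb3]_s (b s * g s).
 rewrite Rintegral_mkcond; apply: eq_int => x _; rewrite patchE.
 by case: ifPn => // /negP nx; rewrite Sout ?mul0r// => Sx; apply: nx; exact: mem_set.
have E z : moll f b z - f z = \int[leb3]_(s in S) (b s * (f (z - s) - f z)).
 rewrite mollE (intS (fun s => f (z - s) - f z)). have [_ <-] := int_reflect z (fb z).
 have -> : f z = \int[leb3]_s (f z * b s) by rewrite RintZ// b1 mulr1. rewrite -RintegralB//; last 2 first.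
 - by have [] := int_reflect z (fb z).
 - exact: itgZ. apply: eq_int => s _; rewrite RintZ// b1 mulr1 subKr; ring.
have Lm z : itg3 S (fun s => b s * (f (z - s) - f z)).
 apply: (@integrableS _ _ _ leb3 setT) => //.
 have : itg3 setT (fun s => b s * f (z - s) - f z * b s) by apply: itgB => //; exact: itgZ.
 by apply: eq_integrable => // s _ /=; congr EFin; ring.
have EE : (fun z => moll f b z - f z) = (fun z => \int[leb3]_(s in S) (b s * (f (z - s) - f z))) by apply/funext => z; exact: E.
have mm : measf (setT : set sp) (fun z => moll f b z) by apply: cont_meas3 => //; apply: sm_cont; exact: moll_smooth.
have [N0|r0] := leP r 0.
 move: b1; rewrite (_ : b = fun=> 0); first by rewrite /Rintegral integral0 => /esym/eqP; rewrite oner_eq0.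
 by apply/funext => x; rewrite br// (le_trans N0).
have K0 : 0 <= K by apply: le_trans (HK 0 _); rewrite ?nsq_ge0// normr0.
have := @L2_average R _ _ leb3 S setT b (fun s z => f (z - s) - f z) 1 K mS measurableT ltr01.
rewrite -EE expr1n mul1r; apply => //.
- apply: measurable_funB; first exact: (mfcomp mf meas_sub3).
 exact: (mfcomp mf measurable_snd).
- by apply: (@integrableS _ _ _ leb3 setT).
- have := intS (fun=> 1); under eq_int do rewrite mulr1.
 by move=> ->; under eq_int do rewrite mulr1; rewrite b1.
- move=> s; rewrite /S -ballE/= sub0r normrN => sr.
 have [L _] := L2_shift (- s) Lf. rewrite EFin_Rint; last by apply: L2_itg; exact: L2gB.
 by rewrite lee_fin; apply: HK; rewrite normrN.
- by apply: measurableT.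
- by apply: measurable_funB.
Qed.

Lemma partition_of_unity (K : set sp) (r : sp -> R) : compact K ->
 (forall x, K x -> 0 < r x) -> exists n (c : nat -> sp) (chi : nat -> sp -> R),
 [/\ forall i, (i < n)%N -> K (c i), forall i, (i < n)%N -> Cc (chi i),
  forall i x, (i < n)%N -> r (c i) <= `|x - c i| -> chi i x = 0 &
  forall x, K x -> \sum_(i < n) chi i x = 1].
move=> cK r0; have := eq_ind _ (fun F : set sp -> Prop => F K) cK _ (@compact_cover (sp : normedModType R)).
move=> /(_ sp K (fun x => ball x (r x / 2))) [].
- by move=> x _; exact: ball_open.
- by move=> x Kx; exists x => //; apply: ballxx; rewrite divr_gt0// r0.
move=> F FK Kcov; pose c i := nth 0 (finmap.enum_fset F) i; pose n := size (finmap.enum_fset F).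
have Kc i : (i < n)%N -> K (c i) by move=> i_n; have /FK := mem_nth 0 i_n; rewrite inE.
pose psi i := cut (c i) (r (c i)).
have cpsi i : (i < n)%N -> Cc (psi i) by move=> /Kc/r0 ri; exact: Cc_cut.
exists n, c, (fun i x => psi i x * \prod_(j < i) (1 - psi j x)); split => //.
- move=> i i_n; apply: CcM; first exact: cpsi.
 have : forall m, (m <= n)%N -> smooth (fun x => \prod_(j < m) (1 - psi j x)).
  elim=> [|m IH] mn.
   by under eq_fun do rewrite big_ord0; exact: sm_cst.
  under eq_fun do rewrite big_ord_recr/=. apply: smoothM; first by apply: IH; exact: ltnW.
  by apply: smoothB; [exact: sm_cst|apply: Cc_sm; exact: cpsi].
 by apply; exact: ltnW.
- by move=> i x /Kc/r0 ri xc; rewrite /psi cut_0// mul0r.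
- move=> x Kx.
 have -> : forall m, \sum_(i < m) psi i x * \prod_(j < i) (1 - psi j x) = 1 - \prod_(j < m) (1 - psi j x).
  elim=> [|m IH]; first by rewrite !big_ord0 subrr. by rewrite !big_ord_recr/= IH; ring.
 have [y /= yF xy] := Kcov x Kx. have i_n : (index y (finmap.enum_fset F) < n)%N by rewrite index_mem.
 rewrite (bigD1 (Ordinal i_n))//= /psi /c nth_index// cut_1 ?subrr ?mul0r ?subr0//.
  by apply: r0; have /FK := yF; rewrite inE.
 by move: xy; rewrite -ballE/= distrC => /ltW.
Qed.

End Density.

(** * Primitives along lines and the Poincare inequality *)
Section Lines.
Context {R : realType}.
Local Notation sp := (R * R * R)%type.
Local Notation leb := (@leb1 R).
Implicit Types (f g phi : sp -> R) (x y h e z : sp) (D U : set sp).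

Lemma nsqE3 D f : measurable D -> Lsq D f ->
 (\int[leb3]_(x in D) (f x ^+ 2)%:E = (nsq D f)%:E)%E.
by move=> mD Lf; rewrite EFin_Rint//; exact: L2_itg. Qed.

Lemma crdN x k : crd (- x) k = - crd x k.
by rewrite -scaleN1r crdZ mulN1r. Qed.

Lemma Rint_len (T : R) : 0 < T -> \int[leb]_(s in `[0, T]) (1 : R) = T.
move=> T0; rewrite /Rintegral integral_cst//= mul1e.
by rewrite [X in fine X](@lebesgue_measure_itv R `[0, T])/= lte_fin T0/= oppr0 addr0.
Qed.

Lemma cont_line x h : continuous (fun s : R => x + s *: h).
by move=> s; apply: cvgD; [exact: cvg_cst|apply: cvgZr_tmp; exact: cvg_id].
Qed.

Lemma cont_itg01 (T : R) (g : R -> R) : continuous g -> itg leb `[0, T] g.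
move=> cg; apply: continuous_compact_integrable; first exact: segment_compact.
exact: continuous_subspaceT.
Qed.

Lemma ftc_line phi x h (T : R) : 0 <= T -> smooth phi ->
 \int[leb]_(s in `[0, T]) (\sum_k crd h k * partial k phi (x + s *: h)) = phi (x + T *: h) - phi x.
rewrite le_eqVlt => /predU1P[<-|T0] sphi.
 by rewrite set_itv1 Rintegral_set1 scale0r addr0 subrr.
pose g (s : R) := \sum_k crd h k * partial k phi (x + s *: h).
have cl := @cont_line x h.
have cg : continuous g.
 have -> : g = fun s => crd h 0 * partial 0 phi (x + s *: h) + crd h 1 * partial 1 phi (x + s *: h)
   + crd h 2 * partial 2 phi (x + s *: h) by apply/funext => s; rewrite /g sum3.
 have ck k : continuous (fun s : R => crd h k * partial k phi (x + s *: h)).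
  move=> s; apply: cvgM; first exact: cvg_cst.
  by apply: (continuous_comp (cl s)); apply: sm_cont; exact: sm_pd.
 by move=> s; apply: cvgD; [apply: cvgD|]; exact: ck.
pose F (s : R) := phi (x + s *: h).
have dF (s : R) : is_derive s (1 : R) F (g s).
 have df : derivable phi (x + s *: h) h by exact: sm_derivable. have := line_derive df.
 by rewrite derive_pd//; exact: sm_diff.
have cF : continuous F by move=> s; apply: (continuous_comp (cl s)); exact: sm_cont.
have := @continuous_FTC2 R g F 0 T T0.
rewrite /Rintegral => ->//.
- by rewrite /F/= scale0r addr0.
- exact: continuous_subspaceT.
- split; first by move=> s _; have [] := dF s.
 + exact/cvg_at_right_filter/cF.
 + exact/cvg_at_left_filter/cF.
- by move=> s _; rewrite derive1E; have [_ ->] := dF s.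
Qed.

Lemma meas_affine_pair (c : R -> R) (w : R -> sp) :
 measf (setT : set R) c -> (forall i, measf (setT : set R) (fun s => crd (w s) i)) ->
 measf (setT : set (R * sp)) (fun p : R * sp => c p.1 *: p.2 + w p.1).
move=> mc mw.
have m1 (i : 'I_3) : measf (setT : set (R * sp))
  (fun p : R * sp => c p.1 * crd p.2 i + crd (w p.1) i).
 apply: measurable_funD; last exact: (mfcomp (mw i) measurable_fst).
 apply: mfunM; first exact: (mfcomp mc measurable_fst).
 have mc3 : measf (setT : set sp) (fun x : sp => crd x i) by apply: cont_meas3 => //; apply: sm_cont; exact: sm_crd.
 exact: (mfcomp mc3 measurable_snd).
apply: measurable_fun_pair; last exact: (m1 2).
by apply: measurable_fun_pair; [exact: (m1 0)|exact: (m1 1)].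
Qed.

(** Integral over a segment of length [h] ending at the point. *)
Definition vp e (h : R) phi := pint leb `[0, h] (fun=> 1) (fun s : R => - (s *: e)) (fun=> 1) phi.

Lemma vpE e (h : R) phi y : vp e h phi y = \int[leb]_(s in `[0, h]) phi (y - s *: e).
by apply: eq_int => s _; rewrite mul1r scale1r. Qed.

Let vpm e (h : R) phi y : continuous phi ->
 measf (`[0, h]%classic : set R) (fun s : R => phi (1 *: y + - (s *: e))).
move=> cp; apply: measurable_funTS; apply: continuous_measurable_fun => s.
have := @cont_line (1 *: y) (- e) s; move=> cl.
apply: (@continuous_comp _ _ _ (fun s : R => 1 *: y + - (s *: e)) phi); last exact: cp.
by move: cl; under eq_fun do rewrite scalerN.
Qed.

Let i1 (h : R) : itg leb `[0, h] (fun=> 1 : R).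
by apply: cont_itg01 => s; exact: cvg_cst. Qed.

Lemma vp_smooth e (h : R) phi : Cc phi -> smooth (vp e h phi).
move=> cp; apply: pint_smooth => //.
- by move=> s _; rewrite normr1.
- by move=> *; exact: vpm.
Qed.

Lemma vp_pd e (h : R) phi k : Cc phi -> partial k (vp e h phi) = vp e h (partial k phi).
move=> cp; rewrite /vp pint_pd//.
- by congr (pint _ _ _ _ _ _); apply/funext => s; rewrite mulr1.
- by move=> s _; rewrite normr1.
- by move=> *; exact: vpm.
Qed.

Lemma vp_itg e (h : R) phi y : Cc phi -> itg leb `[0, h] (fun s => phi (y - s *: e)).
move=> cp.
have H : itg leb `[0, h] (fun s => 1 * phi (1 *: y + - (s *: e))) by apply: pint_itg => // *; exact: vpm.
by apply: eq_integrable H => // s _; rewrite /= mul1r scale1r.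
Qed.

Lemma vp_ftc e (h : R) phi y : 0 <= h -> Cc phi ->
 vp e h (fun y => \sum_k crd e k * partial k phi y) y = phi y - phi (y - h *: e).
move=> h0 cp; rewrite vpE.
have -> : y - h *: e = y + h *: (- e) by rewrite scalerN.
have F := @ftc_line phi y (- e) h h0 (Cc_sm cp).
rewrite -[RHS]opprB -F -RintN//; last first.
 apply: itg_sum => // k _; apply: itgZ => //. have := vp_itg e h y (Cc_pd k cp).
 by apply: eq_integrable => // s _; rewrite /= scalerN.
apply: eq_int => s _; rewrite -sumrN; apply: eq_bigr => k _.
by rewrite scalerN crdN mulNr opprK.
Qed.

Lemma vp_lin e (h : R) (f : 'I_3 -> sp -> R) y : (forall k, Cc (f k)) ->
 vp e h (fun y => \sum_k f k y) y = \sum_k vp e h (f k) y.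
move=> cf; rewrite vpE Rint_sum//; last by move=> k _; exact: vp_itg.
by apply: eq_bigr => k _; rewrite vpE.
Qed.

Lemma vp_nsq e (h : R) phi : 0 < h -> Cc phi ->
 Lsq setT (vp e h phi) /\ nsq setT (vp e h phi) <= h ^+ 2 * nsq setT phi.
move=> h0 cp; have Lp := Cc_L2 cp.
have E : vp e h phi = fun y => \int[leb]_(s in `[0, h]) (1 * phi (y - s *: e)) by apply/funext => y; rewrite vpE; apply: eq_int => s _; rewrite mul1r.
have mi : measurable (`[0, h]%classic : set R) by exact: measurable_itv.
have := @L2_average R _ _ leb `[0, h]%classic setT (fun=> 1) (fun s y => phi (y - s *: e)) h
 (nsq setT phi) mi measurableT h0.
rewrite -E => H; apply H => //; last 5 first.
- by rewrite Rint_len.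
- exact: nsq_ge0.
- move=> s _; have [L N] := L2_shift (- (s *: e)) Lp.
 by rewrite (nsqE3 measurableT L) N.
- by apply: cont_meas3 => //; apply: sm_cont; exact: vp_smooth.
- by move=> y _; apply: eq_integrable (vp_itg e h y cp) => // s _; rewrite /= mul1r.
- have mp : measf (setT : set sp) phi by case: Lp.
 have := @meas_affine_pair (fun=> 1) (fun s => - (s *: e)) (measurable_cst _) _.
 move=> /(_ _)/(mfcomp mp) mm.
 have : measf (setT : set (R * sp)) (fun p : R * sp => phi (1 *: p.2 + - (p.1 *: e))).
  apply: mm => i; under eq_fun do rewrite -scalerN crdZ. by apply: mfunM.
 by under eq_fun do rewrite scale1r.
Qed.

Lemma L2_dom D f g : measurable D -> measf D f -> Lsq D g ->
 (forall x, D x -> f x ^+ 2 <= g x ^+ 2) -> Lsq D f.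
move=> mD mf Lg fg; split => //; apply: (@itg3_le _ _ _ (fun x => g x ^+ 2)) => //.
- exact: measurable_funX.
- by move=> x Dx; rewrite ger0_norm ?sqr_ge0// fg.
- exact: L2_itg.
Qed.

Lemma sm_L2_ball f x (r : R) : 0 < r -> smooth f -> Lsq (ball x r) f.
move=> r0 sf; have mB : measurable (ball x r : set sp) by exact: mball.
have r2 : 0 < r * 2 by rewrite mulr_gt0.
have L := @L2_sub _ setT (ball x r) _ measurableT mB (fun _ _ => I) (Cc_L2 (CcM (Cc_cut x r2) sf)).
have mf : measf (ball x r : set sp) f by apply: cont_meas3 => //; exact: sm_cont.
apply: (L2_dom mB mf L) => y; rewrite -ballE/= distrC => /ltW xy.
by rewrite cut_1 ?mul1r// mulfK ?pnatr_eq0.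
Qed.

Lemma nsq_contract f x z (r c : R) B : 0 < c -> measurable B -> Lsq B f ->
 (forall y, ball x r y -> B (c *: y + z)) -> measf (ball x r) (fun y => f (c *: y + z)) ->
 Lsq (ball x r) (fun y => f (c *: y + z)) /\ nsq (ball x r) (fun y => f (c *: y + z)) <= c ^- 3 * nsq B f.
move=> c0 mB Lf QB mf; have mQ : measurable (ball x r : set sp) by exact: mball.
have cn : c != 0 by rewrite gt_eqF.
have [L1 E1] := L2_affine z cn (L2_zext mB Lf).
have LQ := L2_sub measurableT mQ (fun _ _ => I) L1.
have Q1 y : ball x r y -> f (c *: y + z) ^+ 2 = ((f \_ B) (c *: y + z)) ^+ 2 by move=> /QB/mem_set By; rewrite patchE By.
split.
 by apply: (L2_dom mQ mf LQ) => y /Q1 ->.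
rewrite -(nsq_zext _ mB) E1 gtr0_norm// mulrA mulVf ?mul1r ?expf_neq0//.
apply: (@le_trans _ _ (nsq (ball x r) (fun y => (f \_ B) (c *: y + z)))); last exact: nsqS.
by apply: nsq_mono => // y /Q1 ->.
Qed.

Lemma sq_sum3 (a b c : R) : (a + b + c) ^+ 2 <= 3 * (a ^+ 2 + b ^+ 2 + c ^+ 2).
have := sqr_ge0 (a - b); have := sqr_ge0 (b - c); have := sqr_ge0 (a - c).
rewrite !expr2; lra.
Qed.

Lemma nsq_lin3 D (a : R) (c : 'I_3 -> sp -> R) (g : 'I_3 -> sp -> R) (N : R) :
 measurable D -> 0 <= a ->
 (forall k x, D x -> c k x ^+ 2 <= a) -> (forall k, Lsq D (g k)) -> (forall k, nsq D (g k) <= N) ->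
 measf D (fun x => \sum_k c k x * g k x) -> Lsq D (fun x => \sum_k c k x * g k x) /\
 nsq D (fun x => \sum_k c k x * g k x) <= 9 * a * N.
move=> mD a0 ca Lg gN mS.
pose F x := 3 * a * (g 0 x ^+ 2 + g 1 x ^+ 2 + g 2 x ^+ 2).
have iF : itg3 D F by apply: itgZ => //; apply: itgD => //; [apply: itgD => //|]; exact: L2_itg.
have le x : D x -> (\sum_k c k x * g k x) ^+ 2 <= F x.
 move=> Dx; rewrite sum3; apply: le_trans (sq_sum3 _ _ _) _. rewrite /F -mulrA ler_pM2l// !mulrDr !exprMn.
 by apply: lerD; [apply: lerD|]; rewrite ler_wpM2r ?sqr_ge0// ca.
have iS : itg3 D (fun x => (\sum_k c k x * g k x) ^+ 2).
 apply: (itg3_le mD _ _ iF); first exact: measurable_funX. by move=> x Dx; rewrite ger0_norm ?sqr_ge0// le.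
split; first by split.
apply: (@le_trans _ _ (\int[leb3]_(x in D) F x)); first exact: le_Rintegral.
rewrite /F RintZ//; last by apply: itgD => //; [apply: itgD => //|]; exact: L2_itg.
rewrite RintegralD//; [|by apply: itgD => //; exact: L2_itg|exact: L2_itg].
rewrite RintegralD//; [|exact: L2_itg|exact: L2_itg].
have := gN 0; have := gN 1; have := gN 2; rewrite /nsq.
move: (Rintegral _ _ _) (Rintegral _ _ _) (Rintegral _ _ _) => A B C h1 h2 h3.
rewrite (_ : 9 * a * N = 3 * a * (3 * N)); last by ring.
by rewrite ler_wpM2l ?mulr_ge0//; lra.
Qed.

(** Poincare inequality on a ball, with the mean square on a smaller ball in
    place of the mean: the balls are joined by the affine contractions
    [y |-> (1 - s) y + s (z + c (y - x))]. *)
Lemma poincare x (r : R) z (c : R) : 0 < r -> 0 < c -> c <= 1 ->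
 ball z (c * r) `<=` ball x r -> exists2 C : R, 0 <= C & forall f (N : R), smooth f ->
 (forall k, nsq (ball x r) (partial k f) <= N) -> nsq (ball z (c * r)) f <= N -> nsq (ball x r) f <= C * N.
move=> r0 c0 c1 BQ; pose Q : set sp := ball x r.
have mQ : measurable Q by exact: mball.
pose B : set sp := ball z (c * r); have mB : measurable B by exact: mball.
pose al (s : R) := 1 - s + s * c; pose w (s : R) : sp := s *: (z - c *: x).
have alc (s : R) : 0 <= s <= 1 -> c <= al s by move=> /andP[s0 s1]; rewrite /al -subr_ge0 (_ : _ - _ = (1 - s) * (1 - c)); [rewrite mulr_ge0 ?subr_ge0|ring].
have QB y : Q y -> B (c *: y + (z - c *: x)).
 rewrite /Q /B -!ballE/= => xy. rewrite (_ : z - (c *: y + (z - c *: x)) = c *: (x - y)); last first.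
  by apply: sp_ext => /=; rewrite -?[_ *: _ : R]/(_ * _)/=; ring.
 by rewrite normrZ gtr0_norm// ltr_pM2l.
have QQ s y : 0 <= s <= 1 -> Q y -> Q (al s *: y + w s).
 move=> /andP[s0 s1] Qy; have := BQ _ (QB y Qy); move: Qy; rewrite /Q -!ballE/= => h1 h2.
 rewrite (_ : x - (al s *: y + w s) = (1 - s) *: (x - y) + s *: (x - (c *: y + (z - c *: x)))); last first.
  rewrite /al /w; apply: sp_ext => /=; rewrite -?[_ *: _ : R]/(_ * _)/=; ring.
 apply: le_lt_trans (ler_normD _ _) _; rewrite !normrZ ger0_norm ?subr_ge0// [`|s|]ger0_norm//.
 have [->|sn] := eqVneq s 0; first by rewrite subr0 mul1r mul0r addr0.
 have sp0 : 0 < s by rewrite lt_neqAle eq_sym sn.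
 rewrite -[ltRHS](_ : (1 - s) * r + s * r = r); last by ring.
 by apply: ler_ltD; [rewrite ler_wpM2l ?subr_ge0// ltW|rewrite ltr_pM2l].
have wc : forall i, measf (setT : set R) (fun s => crd (w s) i).
 move=> i; have -> : (fun s => crd (w s) i) = fun s => s * crd (z - c *: x) i.
  by apply/funext => s; rewrite /w crdZ.
 exact: mfunM.
have mal : measf (setT : set R) al by apply: measurable_funD; [apply: measurable_funB|apply: mfunM].
pose d (y : sp) : sp := c *: y + (z - c *: x) - y.
have dr y k : Q y -> crd (d y) k ^+ 2 <= (2 * r) ^+ 2.
 move=> Qy; rewrite -real_normK ?num_real// lerXn2r ?nnegrE ?mulr_ge0 ?(ltW r0)//.
 apply: le_trans (abs_crd _ _) _; have := BQ _ (QB y Qy); move: Qy; rewrite /Q -!ballE/= => h1 h2.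
 have := ler_distD x (c *: y + (z - c *: x)) y; rewrite (distrC _ x) -/(d y); lra.
have c3 : 0 <= c ^- 3 by rewrite invr_ge0 exprn_ge0// ltW.
exists (2 * c ^- 3 + 2 * (9 * (2 * r) ^+ 2 * c ^- 3)).
 by rewrite addr_ge0// ?mulr_ge0 ?exprn_ge0 ?mulr_ge0// ?(ltW r0).
move=> f N sf Hk HB.
have N0 : 0 <= N by apply: le_trans HB; exact: nsq_ge0.
have Lf : Lsq Q f by exact: sm_L2_ball.
have mco g (s : R) v : smooth g -> measf Q (fun y => g (s *: y + v)) by move=> sg; apply: cont_meas3 => //; apply: sm_cont; exact: sm_affine.
have [L1 N1] := nsq_contract c0 mB (L2_sub mQ mB BQ Lf) QB (mco _ _ _ sf).
pose F (s : R) y := \sum_k crd (d y) k * partial k f (al s *: y + w s).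
have FE s y : F s y = \sum_k crd (d y) k * partial k f (y + s *: d y).
 apply: eq_bigr => k _; congr (_ * partial k f _); rewrite /al /w /d.
 by apply: sp_ext => /=; rewrite -?[_ *: _ : R]/(_ * _)/=; ring.
have ftc y : \int[leb]_(s in `[0, 1]) (1 * F s y) = f (c *: y + (z - c *: x)) - f y.
 have := @ftc_line f y (d y) 1 ler01 sf.
 have -> : y + 1 *: d y = c *: y + (z - c *: x) by rewrite scale1r /d addrC subrK. move=> <-.
 by apply: eq_int => s _; rewrite mul1r FE.
have Fm : measf (setT : set (R * sp)) (fun p : R * sp => F p.1 p.2).
 rewrite /F; under eq_fun do rewrite sum3.
 have md k : measf (setT : set (R * sp)) (fun p : R * sp => crd (d p.2) k).
  have m3 : measf (setT : set sp) (fun y => crd (d y) k).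
   have -> : (fun y => crd (d y) k) = fun y => (c - 1) * crd y k + crd (z - c *: x) k by apply/funext => y; rewrite /d !crdD !crdN !crdZ; ring.
   apply: measurable_funD => //; apply: mfunM => //.
   by apply: cont_meas3 => //; apply: sm_cont; exact: sm_crd.
  exact: (mfcomp m3 measurable_snd).
 have mp k : measf (setT : set (R * sp)) (fun p : R * sp => partial k f (al p.1 *: p.2 + w p.1)).
  have m3 : measf (setT : set sp) (partial k f) by apply: cont_meas3 => //; apply: sm_cont; exact: sm_pd.
  exact: (mfcomp m3 (meas_affine_pair mal wc)).
 by apply: measurable_funD; [apply: measurable_funD|]; apply: mfunM.
have Fs s : 0 <= s <= 1 -> Lsq Q (F s) /\ nsq Q (F s) <= 9 * (2 * r) ^+ 2 * (c ^- 3 * N).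
 move=> s01; have as0 : 0 < al s by apply: lt_le_trans c0 (alc s s01).
 have H k : Lsq Q (fun y => partial k f (al s *: y + w s)) /\
  nsq Q (fun y => partial k f (al s *: y + w s)) <= c ^- 3 * N. have sk := sm_pd k sf.
  have [A1 A2] := nsq_contract as0 mQ (sm_L2_ball x r0 sk) (fun y Qy => QQ s y s01 Qy) (mco _ (al s) (w s) sk).
  split => //; apply: le_trans A2 _; apply: ler_pM => //; rewrite ?nsq_ge0// ?invr_ge0 ?exprn_ge0 ?(ltW as0)//.
  by rewrite lef_pV2 ?posrE ?exprn_gt0// lerXn2r ?nnegrE ?(ltW as0) ?(ltW c0)// alc.
 apply: (@nsq_lin3 Q ((2 * r) ^+ 2) (fun k y => crd (d y) k) (fun k y => partial k f (al s *: y + w s))) => //.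
 - by rewrite sqr_ge0.
 - by move=> k y; exact: dr.
 - by move=> k; have [] := H k.
 - by move=> k; have [] := H k.
 - exact: (measurable_funTS (mfcomp Fm (@measurable_pair1 _ _ R sp s))).
have mi : measurable (`[0, 1]%classic : set R) by exact: measurable_itv.
have dN : 0 <= 9 * (2 * r) ^+ 2 * (c ^- 3 * N) by apply: mulr_ge0; [rewrite mulr_ge0 ?sqr_ge0|exact: mulr_ge0].
have := @L2_average R _ _ leb `[0, 1]%classic Q (fun=> 1) F 1
 (9 * (2 * r) ^+ 2 * (c ^- 3 * N)) mi mQ ltr01 Fm (i1 1) (fun _ _ => ler01) _ dN.
have E : (fun y => \int[leb]_(s in `[0, 1]) (1 * F s y)) = fun y => f (c *: y + (z - c *: x)) - f y by apply/funext.
rewrite E => H; have [||||L2' N2] := H.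
- by rewrite Rint_len.
- move=> s; rewrite /= in_itv/= => s01; have [A1 A2] := Fs s s01.
 by rewrite (nsqE3 mQ A1) lee_fin.
- by apply: measurable_funB; [exact: mco|case: Lf].
- move=> y Qy; have cF : continuous (fun s : R => 1 * F s y).
  have -> : (fun s : R => 1 * F s y) = fun s => crd (d y) 0 * partial 0 f (y + s *: d y) +
   crd (d y) 1 * partial 1 f (y + s *: d y) + crd (d y) 2 * partial 2 f (y + s *: d y).
   by apply/funext => s; rewrite mul1r FE sum3.
  have ck k : continuous (fun s : R => crd (d y) k * partial k f (y + s *: d y)).
   move=> s; apply: cvgM; first exact: cvg_cst.
   by apply: (continuous_comp (@cont_line y (d y) s)); apply: sm_cont; exact: sm_pd.
  by move=> s; apply: cvgD; [apply: cvgD|]; exact: ck.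
 exact: cont_itg01.
have EE : f = fun y => f (c *: y + (z - c *: x)) - (f (c *: y + (z - c *: x)) - f y) by apply/funext => y; rewrite subKr.
rewrite {1}EE; apply: le_trans (nsq_sub mQ L1 L2') _.
rewrite expr1n mul1r in N2.
have N1' : nsq Q (fun y => f (c *: y + (z - c *: x))) <= c ^- 3 * N by apply: le_trans N1 _; rewrite ler_wpM2l.
rewrite [leRHS](_ : _ = 2 * (c ^- 3 * N) + 2 * (9 * (2 * r) ^+ 2 * (c ^- 3 * N))); last first.
 by move: (c ^- 3) => i; ring.
by apply: lerD; rewrite ler_wpM2l.
Qed.

End Lines.

(** * Lipschitz charts and the Friedrichs inequality *)
Section Charts.
Context {R : realType}.
Local Notation sp := (R * R * R)%type.
Implicit Types (f g phi : sp -> R) (x y h e z : sp) (D U : set sp).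

Lemma compact_margin (K : set sp) U : compact K -> open U -> K `<=` U ->
 exists2 eta : R, 0 < eta & forall z z', K z -> `|z - z'| < eta -> U z'.
move=> cK oU KU.
pose F := globally [set eta : R | 0 < eta].
have H : \forall eta \near (0 : R)^'+, K `<=` [set z | forall z', `|z - z'| < eta -> U z'].
 have /compact_near_coveringP nc := cK. apply: nc => x Kx. have [r r0 rU] := open_ball_sub oU (KU x Kx).
 have r2 : 0 < r / 2 by rewrite divr_gt0. exists (ball x (r / 2), [set eta : R | eta < r / 2]) => /=.
  by split; [exact: nbhsx_ballx|exact: nbhs_right_lt].
 move=> [z eta] /= []; rewrite -ballE/= => xz er z' zz'; apply: rU => /=.
 rewrite distrC; have := ler_distD z x z'; lra.
near (0 : R)^'+ => eta.
have e0 : 0 < eta by near: eta; exact: nbhs_right_gt.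
exists eta => // z z' Kz; have /(_ z Kz) : K `<=` [set z | forall z', `|z - z'| < eta -> U z'] by near: eta.
by apply.
Unshelve. all: by end_near. Qed.

Lemma vec_crd x i : vec x 0 i = crd x i.
by rewrite mxE. Qed.

(** The boundary as a graph without rotated coordinates: [c_ht] is the height
    above the graph and grows at unit rate along [c_dir]. *)
Record chart D x0 := Chart {
 c_dir : sp; c_ht : sp -> R; c_lip : R; c_rad : R;
 c_dir1 : `|c_dir| <= 1;
 c_htD : forall y (s : R), c_ht (y + s *: c_dir) = c_ht y + s;
 c_lip1 : 1 <= c_lip;
 c_ht_lip : forall y z, `|c_ht y - c_ht z| <= c_lip * `|y - z|;
 c_ht0 : c_ht x0 = 0;
 c_rad0 : 0 < c_rad;
 c_dom : forall y, `|y - x0| < c_rad -> (D y <-> 0 < c_ht y) }.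

Lemma charts D x0 : open D -> lipschitz_boundary D -> boundary D x0 -> inhabited (chart D x0).
move=> oD LD bx; have [Q [g [k [QQ gk Hx]]]] := LD x0 bx.
have QQ' : Q^T *m Q = 1%:M by apply: mulmx1C.
pose e : sp := (Q 0 2, Q 1 2, Q 2 2).
pose Y (x : sp) i := (vec x *m Q) 0 i.
have YE x i : Y x i = crd x 0 * Q 0 i + crd x 1 * Q 1 i + crd x 2 * Q 2 i by rewrite /Y mxE sum3 !vec_crd.
have YD x z i : Y (x + z) i = Y x i + Y z i by rewrite !YE !crdD; ring.
have YZ (s : R) x i : Y (s *: x) i = s * Y x i by rewrite !YE !crdZ; ring.
have YB x z i : Y x i - Y z i = Y (x - z) i by rewrite !YE !crdD !crdN; ring.
have QE i j : Q 0 i * Q 0 j + Q 1 i * Q 1 j + Q 2 i * Q 2 j = (i == j)%:R.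
 have /matrixP/(_ i j) := QQ'; rewrite !mxE sum3 !mxE => ->. by [].
have Ye i : Y e i = (i == 2)%:R by rewrite YE !crdE /e/= -(QE i 2); ring.
have Qle j i : `|Q j i| <= 1.
 have : Q j i ^+ 2 <= 1.
  have QQi : Q 0 i ^+ 2 + Q 1 i ^+ 2 + Q 2 i ^+ 2 = 1 by rewrite !expr2 QE eqxx.
  have h0 := sqr_ge0 (Q 0 i); have h1 := sqr_ge0 (Q 1 i); have h2 := sqr_ge0 (Q 2 i).
  by move: QQi h0 h1 h2; elim/ord3 : j; move: (Q 0 i ^+ 2) (Q 1 i ^+ 2) (Q 2 i ^+ 2) => a b c'; lra.
 by rewrite -real_normK ?num_real// expr_le1.
have Yle x i : `|Y x i| <= 3 * `|x|.
 rewrite YE -(sum3 (fun j => crd x j * Q j i)). rewrite (_ : 3 * `|x| = `|x| + `|x| + `|x|); last by ring.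
 apply: sum3_abs_le; rewrite normrM -[leRHS]mulr1 ler_pM// ?abs_crd//.
pose t x := Y x 2 - g (Y x 0, Y x 1).
pose K : R := 3 + `|k| * 3.
have K1 : 1 <= K by rewrite /K -[leLHS]addr0 lerD ?mulr_ge0// ler1n.
have tl y z : `|t y - t z| <= K * `|y - z|.
 rewrite /t (_ : _ - _ = (Y y 2 - Y z 2) - (g (Y y 0, Y y 1) - g (Y z 0, Y z 1))); last by ring.
 apply: le_trans (ler_normB _ _) _; rewrite mulrDl lerD// ?YB//.
 have := gk ((Y y 0, Y y 1), (Y z 0, Y z 1)) (conj I I) => /= h.
 apply: le_trans h _; apply: (@le_trans _ _ (`|k| * `|(Y y 0, Y y 1) - (Y z 0, Y z 1)|)).
  by rewrite ler_wpM2r// ler_norm.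
 rewrite -mulrA ler_wpM2l// (prod_normE _) ge_max /=. by rewrite !YB !Yle.
have te y (s : R) : t (y + s *: e) = t y + s by rewrite /t !YD !YZ !Ye/= !mulr0 !addr0 mulr1; ring.
have [rho rho0 Hrho] : exists2 rho : R, 0 < rho & forall y, `|y - x0| < rho -> (D y <-> 0 < t y).
 have /nbhs_ballP[rho/= r0 H] := Hx; exists rho => // y yx.
 have {}H := H y; rewrite H; last by rewrite -ballE/= distrC. by rewrite /t /Y subr_gt0.
have tx0 : t x0 = 0.
 have [cx nx] := bx; apply/eqP; rewrite eq_le; apply/andP; split.
  rewrite leNgt; apply/negP => tp; apply: nx. rewrite ((interior_id D).1 oD); apply: (Hrho x0 _).2 => //.
  by rewrite subrr normr0.
 rewrite leNgt; apply/negP => tn.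
 have d0 : 0 < Num.min rho (- t x0 / K) by rewrite lt_min rho0 divr_gt0 ?oppr_gt0// (lt_le_trans ltr01).
 have [y [Dy]] := cx _ (nbhsx_ballx x0 _ d0). rewrite -ballE/= lt_min distrC => /andP[h1 h2].
 have := tl y x0; have [/(_ Dy) ty _] := Hrho y h1. rewrite ltr_pdivlMr ?(lt_le_trans ltr01)// in h2.
 have := ler_norm (t y - t x0); move: h2; rewrite mulrC; lra.
constructor; apply: (@Chart D x0 e t K rho) => //.
apply: norm_crd_le => i; rewrite /e; elim/ord3 : i; rewrite crdE/=; exact: Qle.
Qed.

Lemma chart_exterior D x0 (c : chart D x0) (eps : R) : 0 < eps ->
 exists z rho, [/\ 0 < rho, ball z rho `<=` ball x0 eps & forall y, ball z rho y -> ~ D y].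
move=> e0; pose m := Num.min eps (c_rad c); have m0 : 0 < m by rewrite lt_min e0 c_rad0.
have K0 : 0 < c_lip c by apply: lt_le_trans (c_lip1 c).
pose d := m / 2; have d0 : 0 < d by rewrite divr_gt0.
pose z := x0 + (- d) *: c_dir c; pose rho := d / 2 / c_lip c.
have rho0 : 0 < rho by rewrite !divr_gt0.
have rd : rho <= d / 2 by rewrite ler_pdivrMr// ler_peMr ?c_lip1// ltW// divr_gt0.
have zx : `|z - x0| <= d by rewrite /z addrC addKr normrZ normrN gtr0_norm// ler_piMr ?c_dir1// ltW.
have yx y : ball z rho y -> `|y - x0| < m.
 rewrite -ballE/= => zy; have := ler_distD z y x0; rewrite (distrC y z).
 have : m = d * 2 by rewrite /d divfK. lra.
exists z, rho; split => //.
 move=> y /yx; rewrite -ballE/= distrC => h; apply: lt_le_trans h _. by rewrite ge_min lexx.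
move=> y zy; have := yx y zy; rewrite lt_min => /andP[_ yr].
move=> /(c_dom yr) ty; have := c_ht_lip c y z.
rewrite {2}/z c_htD c_ht0 add0r opprK; move: zy; rewrite -ballE/= distrC => zy.
have : c_lip c * `|y - z| < d / 2 by rewrite mulrC -ltr_pdivlMr.
have := ler_norm (c_ht c y + d); lra.
Qed.

Definition rot (u : 'I_3 -> sp -> R) k l x := partial k (u l) x - partial l (u k) x.

Lemma Cc_rot (u : 'I_3 -> sp -> R) k l : (forall i, Cc (u i)) -> Cc (rot u k l).
by move=> cu; apply: CcB; exact: Cc_pd. Qed.

Definition vpot e (h : R) (u : 'I_3 -> sp -> R) := vp e h (fun y => \sum_l crd e l * u l y).

Lemma Cc_lin e (u : 'I_3 -> sp -> R) : (forall i, Cc (u i)) ->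
 Cc (fun y => \sum_l crd e l * u l y).
by move=> cu; apply: Cc_sum => l _; exact: CcZ. Qed.

Lemma vpot_smooth e (h : R) u : (forall i, Cc (u i)) -> smooth (vpot e h u).
by move=> cu; apply: vp_smooth; exact: Cc_lin. Qed.

Lemma vpD e (h : R) f g y : Cc f -> Cc g ->
 vp e h (fun y => f y + g y) y = vp e h f y + vp e h g y.
by move=> cf cg; rewrite !vpE RintegralD//; exact: vp_itg. Qed.

Lemma vpZ e (h a : R) f y : Cc f -> vp e h (fun y => a * f y) y = a * vp e h f y.
by move=> cf; rewrite !vpE RintZ//; exact: vp_itg. Qed.

(** The primitive of [u . e] along the direction [e] is a potential of [u] up
    to the value of [u] at the other end of the segment and a primitive of its
    curl. *)
Lemma vpot_pd e (h : R) u k y : 0 <= h -> (forall i, Cc (u i)) ->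
 u k y - partial k (vpot e h u) y = u k (y - h *: e) - \sum_l crd e l * vp e h (rot u k l) y.
move=> h0 cu; rewrite /vpot vp_pd; last exact: Cc_lin.
have E : partial k (fun y => \sum_l crd e l * u l y) =
 fun y => (\sum_l crd e l * rot u k l y) + (\sum_l crd e l * partial l (u k) y).
 have E3 : (fun y => \sum_l crd e l * u l y) =
  fun y => crd e 0 * u 0 y + crd e 1 * u 1 y + crd e 2 * u 2 y by apply/funext => z; rewrite sum3.
 have dz z l : differentiable (fun y => crd e l * u l y) z by apply: sm_diff; apply: Cc_sm; exact: CcZ.
 apply/funext => z; rewrite E3 pdD//; last first.
  by apply: sm_diff; apply: smoothD; apply: Cc_sm; exact: CcZ.
 rewrite pdD// !pdZ; [|exact: sm_diff (Cc_sm _)..].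
 by rewrite -big_split/= sum3 /rot; congr (_ + _ + _); ring.
rewrite E vpD; last 2 first.
- by apply: Cc_sum => l _; apply: CcZ; exact: Cc_rot.
- by apply: Cc_sum => l _; apply: CcZ; exact: Cc_pd.
rewrite vp_ftc// vp_lin; last by move=> l; apply: CcZ; exact: Cc_rot.
have -> : \sum_l vp e h (fun y => crd e l * rot u k l y) y = \sum_l crd e l * vp e h (rot u k l) y by apply: eq_bigr => l _; rewrite vpZ//; exact: Cc_rot.
ring.
Qed.

Lemma vpot_nsq e (h N : R) u k B : `|e| <= 1 -> 0 < h -> (forall i, Cc (u i)) ->
 (forall k l, nsq setT (rot u k l) <= N) -> measurable B ->
 (forall y, B y -> u k (y - h *: e) = 0) ->
 nsq B (fun y => u k y - partial k (vpot e h u) y) <= 9 * h ^+ 2 * N.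
move=> e1 h0 cu uN mB uB.
have H l := vp_nsq e h0 (Cc_rot k l cu).
have [||||L1 N1] := @nsq_lin3 _ setT 1 (fun l _ => crd e l) (fun l => vp e h (rot u k l)) (h ^+ 2 * N) measurableT ler01.
- move=> l y _; rewrite -real_normK ?num_real// expr_le1//.
 by apply: le_trans (abs_crd _ _) e1.
- by move=> l; have [] := H l.
- by move=> l; have [_ h2] := H l; apply: le_trans h2 _; rewrite ler_wpM2l ?sqr_ge0.
- apply: measurable_sum => l; apply: mfunM => //.
 by have [[]] := H l.
rewrite mulr1 mulrA in N1; apply: le_trans N1.
apply: (@le_trans _ _ (nsq B (fun y => \sum_l crd e l * vp e h (rot u k l) y))); last first.
 by apply: nsqS => //.
apply: nsq_mono => //.
- apply: cont_meas3 => //; apply: sm_cont; apply: smoothB; first exact: Cc_sm.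
 by apply: sm_pd; exact: vpot_smooth.
- exact: L2_sub L1.
- by move=> y By; rewrite (vpot_pd e k y (ltW h0) cu) uB// sub0r sqrrN.
Qed.

(** Primitives taken from outside along the chart direction vanish outside [D],
    because the part of a line below a point outside [D] stays outside. *)
Lemma chart_potential D x0 (c : chart D x0) : open D -> exists2 r : R, 0 < r <= 1 &
 exists2 C : R, 0 <= C & forall u (N : R), (forall i, test_fun D (u i)) ->
 (forall k l, nsq setT (rot u k l) <= N) -> exists P, [/\ smooth P,
  forall y, ~ D y -> `|y - x0| < r -> \forall y' \near y, P y' = 0 &
  forall k, nsq (ball x0 r) (fun y => u k y - partial k P y) <= C * N].
move=> oD; have K1 := c_lip1 c; have rad0 := c_rad0 c; have e1 := c_dir1 c.
pose e := c_dir c; pose h := c_rad c / 2; have h0 : 0 < h by rewrite divr_gt0.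
have K0 : 0 < c_lip c by apply: lt_le_trans (c_lip1 c).
pose r := Num.min 1 (h / 2 / c_lip c).
have r0 : 0 < r by rewrite lt_min ltr01 !divr_gt0.
have rK : c_lip c * r <= h / 2 by rewrite mulrC -ler_pdivlMr// ge_min lexx orbT.
have rh : r <= h / 2 by apply: le_trans rK; rewrite ler_peMl// ltW.
have inch y (s : R) : `|y - x0| < r -> 0 <= s <= h -> `|y - s *: e - x0| < c_rad c.
 move=> yr /andP[s0 sh]; rewrite addrAC; apply: le_lt_trans (ler_normB _ _) _.
 have : `|s *: e| <= h by rewrite normrZ ger0_norm// -[leRHS]mulr1 ler_pM.
 have : c_rad c = h * 2 by rewrite /h divfK. lra.
have tye y (s : R) : c_ht c (y - s *: e) = c_ht c y - s by rewrite -scaleNr c_htD.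
exists r; first by rewrite r0 ge_min lexx.
exists (9 * h ^+ 2); first by rewrite mulr_ge0// sqr_ge0.
move=> u N tu uN; have cu i := test_Cc (tu i).
exists (vpot e h u); split; first exact: vpot_smooth.
- move=> y nD yr.
 have mg l : exists2 eta : R, 0 < eta & forall z z', u l z != 0 -> `|z - z'| < eta -> D z'.
  have [_ cK KD] := tu l; have [eta eta0 H] := compact_margin cK oD KD.
  by exists eta => // z z' uz; apply: H; exact: subset_closure.
 have [e0 e00 H0] := mg 0; have [e1' e10 H1] := mg 1; have [e2 e20 H2] := mg 2.
 pose eta := Num.min e0 (Num.min e1' e2). have eta0 : 0 < eta by rewrite !lt_min e00 e10.
 apply/nbhs_ballP; exists eta => //= y'; rewrite -ballE/= !lt_min => /and3P[y0 y1 y2]. rewrite /vpot vpE.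
 have key l (s : R) : `|y - y'| < (if l == 0 :> 'I_3 then e0 else if l == 1 then e1' else e2) ->
  0 <= s <= h -> u l (y' - s *: e) = 0. move=> yl sh; apply: contrapT => /eqP ul. have : D (y - s *: e).
   have nn : `|y' - s *: e - (y - s *: e)| = `|y - y'| by rewrite distrC opprB addrA subrK distrC.
   by move: l yl ul; elim/ord3 => /= yl ul; [apply: H0 ul _|apply: H1 ul _|apply: H2 ul _]; rewrite nn.
  move=> /(c_dom (inch y s yr sh)); rewrite tye => ts.
  have := (c_dom (inch y 0 yr _)); rewrite lexx (ltW h0) scale0r subr0 => /(_ isT)[_ Dy].
  by apply: nD; apply: Dy; case/andP: sh => s0 _; lra.
 rewrite (_ : Rintegral _ _ _ = \int[leb1]_(s in `[0, h]) (0 : R)).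
  by rewrite /Rintegral integral0.
 apply: eq_int => s; rewrite inE/= in_itv/= => sh. by rewrite sum3 !key ?mulr0 ?addr0.
- move=> k; apply: vpot_nsq => //; first exact: mball.
 move=> y; rewrite -ballE/= distrC => yr; apply: (test_out (tu k)).
 have hh : 0 <= h <= h by rewrite lexx ltW. move=> /(c_dom (inch y h yr hh)); rewrite tye => th.
 have := c_ht_lip c y x0; rewrite c_ht0 subr0 => tl. have := ler_norm (c_ht c y).
 have : c_lip c * `|y - x0| <= c_lip c * r by rewrite ler_pM2l// ltW. lra.
Qed.

Lemma test_crit D P : Cc P -> (forall y, ~ D y -> \forall y' \near y, P y' = 0) -> test_fun D P.
move=> [sP [r Pr]] HP.
have cD : closure [set x | P x != 0] `<=` D.
 move=> x cx; apply: contrapT => nD; have [y [/= Py Pz]] := cx _ (HP x nD). by rewrite Pz eqxx in Py.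
split => //; apply: (subclosed_compact _ (@compact_cball R (`|r| + 1))); first exact: closed_closure.
move=> x cx /=; rewrite leNgt; apply/negP => rx.
have [y [/= Py ry]] := cx _ (open_nbhs_nbhs (conj (@open_norm_gt R (`|r| + 1)) rx)).
move: Py; rewrite Pr ?eqxx//; apply: le_lt_trans (ler_norm r) _.
by apply: lt_trans ry; rewrite ltrDl.
Qed.

Lemma nsq_bigsum D n (F : nat -> sp -> R) (K : R) : measurable D -> 0 <= K ->
 (forall i, (i < n)%N -> Lsq D (F i) /\ nsq D (F i) <= K) ->
 Lsq D (fun x => \sum_(i < n) F i x) /\ nsq D (fun x => \sum_(i < n) F i x) <= 4 ^+ n * K.
move=> mD K0; elim: n => [|n IH] HF.
 have -> : (fun x => \sum_(i < 0) F i x) = (fun=> 0) by apply/funext => x; rewrite big_ord0.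
 split; first exact: L2g0. rewrite /nsq; under eq_int do rewrite expr0n/=.
 by rewrite /Rintegral integral0 expr0 mul1r.
have [|L N] := IH; first by move=> i i_n; apply: HF; exact: ltnW.
have [Ln Nn] := HF n (ltnSn n).
have -> : (fun x => \sum_(i < n.+1) F i x) = fun x => \sum_(i < n) F i x + F n x by apply/funext => x; rewrite big_ord_recr.
split; first exact: L2gD.
apply: le_trans (nsq_add mD L Ln) _.
have p1 : 1 <= 4 ^+ n :> R by rewrite exprn_ege1// ler1n.
have pK : K <= 4 ^+ n * K by rewrite ler_peMl.
rewrite exprS -mulrA; move: N Nn pK; move: (nsq _ _) (nsq _ _) (4 ^+ n * K) => A B p; lra.
Qed.

Section Friedrichs.
Variable D : set sp.
Hypotheses (oD : open D) (bD : bounded_set D) (D0 : D !=set0)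
 (LD : lipschitz_boundary D) (cbD : connected (boundary D)).

Let e3 : sp := bas 2.

Lemma closure_bd x : closure D x -> D x \/ boundary D x.
move=> cx; have [Dx|nD] := pselect (D x); [by left|right; split => //].
by rewrite ((interior_id D).1 oD).
Qed.

Lemma cl_bounded : exists2 M : R, 1 <= M & forall x, closure D x -> `|x| <= M.
have [M0 [_ HM]] := bD; exists (`|M0| + 1); first by rewrite lerDr.
move=> x cx; rewrite leNgt; apply/negP => Mx.
have [y [Dy]] := cx _ (open_nbhs_nbhs (conj (@open_norm_gt R (`|M0| + 1)) Mx)).
rewrite /= ltNge; apply/negP; rewrite negbK; apply: HM => //.
by rewrite (le_lt_trans (ler_norm M0))// ltrDl.
Qed.

Lemma closure_compact : compact (closure D).
have [M _ HM] := cl_bounded.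
by apply: (subclosed_compact _ (@compact_cball R M)) HM; exact: closed_closure.
Qed.

(** The potential along the third axis vanishes below [D]; the local
    potentials vanish outside [D].  Their difference has a gradient controlled
    by the curl, so that smallness outside [D] propagates along the connected
    boundary from its lowest point. *)
Lemma friedrichs_test : exists2 C : R, 0 <= C & forall u (N : R), (forall i, test_fun D (u i)) ->
 (forall k l, nsq setT (rot u k l) <= N) ->
 exists2 P, test_fun D P & forall k, nsq D (fun y => u k y - partial k P y) <= C * N.
have low3 y (s : R) : crd (y - s *: e3) 2 = crd y 2 - s by rewrite crdD crdN crdZ /e3 [crd (bas 2) 2]crdE/= mulr1.
have arith (a b c2 k c1 n : R) : a <= c1 * n -> b <= k * n -> 0 <= c2 * n ->
  2 * a + 2 * b <= (c2 + 2 * k + 2 * c1) * n by lra.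
have [M M1 HM] := cl_bounded.
have M0 : 0 < M by apply: lt_le_trans M1.
pose h := 4 * M; have h0 : 0 < h by rewrite mulr_gt0.
pose p u := vpot e3 h u.
have e31 : `|e3| <= 1 by rewrite norm_spE/= !ge_max !ger0_norm ?ler0n// lexx ler01.
have pN u (N : R) x (r : R) k : (forall i, test_fun D (u i)) -> (forall k l, nsq setT (rot u k l) <= N) ->
  closure D x -> r <= 1 -> nsq (ball x r) (fun y => u k y - partial k (p u) y) <= 9 * h ^+ 2 * N.
 move=> tu uN cx r1; apply: vpot_nsq => //; [by move=> i; exact: test_Cc (tu i)|exact: mball|].
 move=> y; rewrite -ballE/= => xy; apply: (test_out (tu k)) => Dy.
 have := HM _ (subset_closure Dy); apply/negP; rewrite -ltNge.
 apply: lt_le_trans (abs_crd _ 2); rewrite crdD crdN crdZ {1}/e3 crdE/= mulr1. have h1 : `|crd y 2| < 2 * M.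
  apply: le_lt_trans (abs_crd _ _) _; have := ler_distD x y 0; rewrite !subr0 distrC.
  by have := HM x cx; lra.
 rewrite -normrN opprB; apply: lt_le_trans (ler_norm _). by have := ler_norm (crd y 2); rewrite /h; lra.
pose loc x (r : R) := exists2 C : R, 0 <= C & forall u (N : R), (forall i, test_fun D (u i)) ->
 (forall k l, nsq setT (rot u k l) <= N) -> exists P, [/\ smooth P,
  forall y, ~ D y -> `|y - x| < r -> \forall y' \near y, P y' = 0 &
  forall k, nsq (ball x r) (fun y => u k y - partial k P y) <= C * N].
(* Balls outside [D] accumulate at each boundary point. *)
pose ext x := forall eps : R, 0 < eps ->
 exists z rho, [/\ 0 < rho, ball z rho `<=` ball x eps & forall y, ball z rho y -> ~ D y].
have /choice[rad Hrad] : forall x, exists r : R, boundary D x -> [/\ 0 < r, r <= 1, loc x r & ext x].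
 move=> x; have [bx|nb] := pselect (boundary D x); last by exists 0.
 have [c] := charts oD LD bx; have [r /andP[r0 r1] H] := chart_potential c oD.
 by exists r => _; split => //; move=> eps; exact: chart_exterior.
(* A known bound of [p u] on some ball outside [D] near [x]. *)
pose anch x (r : R) := exists z (rho C : R), [/\ 0 < rho, ball z rho `<=` ball x r,
 forall y, ball z rho y -> ~ D y & forall u (N : R), (forall i, test_fun D (u i)) ->
 (forall k l, nsq setT (rot u k l) <= N) -> nsq (ball z rho) (p u) <= C * N].
pose good x (r : R) := exists2 C : R, 0 <= C &
  forall u (N : R), (forall i, test_fun D (u i)) ->
  (forall k l, nsq setT (rot u k l) <= N) -> exists P, [/\ smooth P,
  forall y, ~ D y -> `|y - x| < r -> \forall y' \near y, P y' = 0,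
  forall k, nsq (ball x r) (fun y => u k y - partial k P y) <= C * N &
  nsq (ball x r) (fun y => p u y - P y) <= C * N].
have cmp x : boundary D x -> anch x (rad x) -> good x (rad x).
 move=> bx; have [r0 r1 [C1 C10 H1] _] := Hrad x bx; have [cx _] := bx.
 move=> [z [rho [C2 [rho0 zB zD H2]]]]. pose c := Num.min 1 (rho / rad x).
 have c0 : 0 < c by rewrite lt_min ltr01 divr_gt0. have c1 : c <= 1 by rewrite ge_min lexx.
 have cr : c * rad x <= rho by rewrite -ler_pdivlMr// ge_min lexx orbT.
 have sB : ball z (c * rad x) `<=` ball z rho by exact: le_ball.
 have [C3 C30 H3] := poincare r0 c0 c1 (subset_trans sB zB).
 pose k9 := 9 * h ^+ 2; have k90 : 0 <= k9 by rewrite mulr_ge0// sqr_ge0.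
 pose CC := `|C2| + 2 * k9 + 2 * C1.
 have CC0 : 0 <= CC by apply: addr_ge0; [apply: addr_ge0 => //; exact: mulr_ge0|exact: mulr_ge0].
 exists (C1 + C3 * CC); first by rewrite addr_ge0// mulr_ge0.
 move=> u N tu uN; have [P [sP P0 NP]] := H1 u N tu uN; exists P.
 have N0 : 0 <= N by apply: le_trans (uN 0 0); exact: nsq_ge0.
 have cu i : Cc (u i) by exact: test_Cc (tu i). have sp' : smooth (p u) by exact: vpot_smooth.
 have mB : measurable (ball x (rad x) : set sp) by exact: mball. split => //.
  by move=> k; apply: le_trans (NP k) _; rewrite ler_wpM2r// lerDl mulr_ge0.
 have sR : smooth (fun y => p u y - P y) by exact: smoothB.
 have LC k Q : smooth Q -> Lsq (ball x (rad x)) (fun y => u k y - partial k Q y).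
  move=> sQ; apply: sm_L2_ball => //; apply: smoothB; first exact: Cc_sm. exact: sm_pd.
 apply: (@le_trans _ _ (C3 * (CC * N))); last by rewrite mulrA ler_wpM2r// lerDr. apply: H3 => //.
 - move=> k; have E : partial k (fun y => p u y - P y) = fun y => (u k y - partial k P y) - (u k y - partial k (p u) y).
   apply/funext => y; rewrite (_ : (fun y => _) = fun y => p u y + -1 * P y); last first.
    by apply/funext => ?; rewrite mulN1r.
   rewrite pdD ?pdZ; [by ring|exact: sm_diff..|]. by apply: sm_diff; exact: smoothZ.
  rewrite E; apply: le_trans (nsq_sub mB (LC k _ sP) (LC k _ sp')) _.
  have A := pN u N x (rad x) k tu uN cx r1; have B := NP k. have C2N : 0 <= `|C2| * N by rewrite mulr_ge0.
  exact: (arith _ _ `|C2| k9 C1 N B A C2N).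
 - have zm : measurable (ball z (c * rad x) : set sp) by exact: mball.
  have rm : measurable (ball z rho : set sp) by exact: mball.
  have -> : nsq (ball z (c * rad x)) (fun y => p u y - P y) = nsq (ball z (c * rad x)) (p u).
   apply: eq_int => y; rewrite inE => yz.
   have nD := zD y (sB y yz); have := zB y (sB y yz); rewrite -ballE/= distrC => yx.
   by rewrite (nbhs_singleton (P0 y nD yx)) subr0.
  apply: le_trans (nsqS rm zm sB (sm_L2_ball z rho0 sp')) _.
  apply: le_trans (H2 u N tu uN) _; rewrite ler_wpM2r//.
  by rewrite /CC -addrA (le_trans (ler_norm C2))// lerDl; apply: addr_ge0; exact: mulr_ge0.
(* Neighbouring balls share a ball outside [D], where the local potentials
   vanish. *)
have trans x y : boundary D x -> boundary D y -> anch x (rad x) ->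
  (`|x - y| < rad x \/ `|x - y| < rad y) -> anch y (rad y).
 move=> bx by' ax xy; have [rx0 _ _ ex] := Hrad x bx; have [ry0 _ _ ey] := Hrad y by'.
 have [C C0 HC] := cmp x bx ax.
 have [z [rho [rho0 zx zy zD]]] : exists z rho, [/\ 0 < rho, ball z rho `<=` ball x (rad x),
   ball z rho `<=` ball y (rad y) & forall w, ball z rho w -> ~ D w].
  case: xy => xy.
   have m0 : 0 < Num.min (rad y) (rad x - `|x - y|) by rewrite lt_min ry0 subr_gt0.
   have [z [rho [rho0 zz zD]]] := ey _ m0.
   exists z, rho; split => // w /zz; rewrite -!ballE/= lt_min => /andP[//] h1 h2.
   by have := ler_distD y x w; lra.
  have m0 : 0 < Num.min (rad x) (rad y - `|x - y|) by rewrite lt_min rx0 subr_gt0.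
  have [z [rho [rho0 zz zD]]] := ex _ m0.
  exists z, rho; split => // w /zz; rewrite -!ballE/= lt_min => /andP[//] h1 h2.
  by have := ler_distD x y w; rewrite (distrC y x); lra.
 exists z, rho, C; split => // u N tu uN; have [P [sP P0 _ NP]] := HC u N tu uN. apply: le_trans NP.
 have -> : nsq (ball z rho) (p u) = nsq (ball z rho) (fun y => p u y - P y).
  apply: eq_int => w; rewrite inE => wz. have := zx w wz; rewrite -ballE/= distrC => wx.
  by rewrite (nbhs_singleton (P0 w (zD w wz) wx)) subr0.
 apply: nsqS => //; [exact: mball|exact: mball|].
 apply: sm_L2_ball => //; apply: smoothB => //; apply: vpot_smooth => i. exact: test_Cc (tu i).
have [x0 [bx0 ax0]] : exists x0, boundary D x0 /\ anch x0 (rad x0).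
 have cc : continuous (fun x : sp => crd x 2) by apply: sm_cont; exact: sm_crd.
 have [x0 cx0 Hx0] : exists2 x0, closure D x0 & forall y, closure D y -> crd x0 2 <= crd y 2.
  have cne : closure D !=set0 by have [y Dy] := D0; exists y; exact: subset_closure.
  have [] := @compact_EVT_min _ _ (fun x : sp => crd x 2) (closure D) cne closure_compact.
   exact: continuous_subspaceT.
  by move=> x0; rewrite inE => cx0 H; exists x0 => // y cy; apply: H; rewrite inE.
 have low y : D y -> crd x0 2 <= crd y 2 by move=> /subset_closure; exact: Hx0.
 have lowe (s : R) : crd (x0 - s *: e3) 2 = crd x0 2 - s by rewrite crdD crdN crdZ {1}/e3 crdE/= mulr1.
 have bx0 : boundary D x0.
  have [Dx|//] := closure_bd cx0; have [r r0 rD] := open_ball_sub oD Dx.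
  have /rD/low : `|x0 - r *: e3 - x0| <= r by rewrite addrAC subrr add0r normrN normrZ gtr0_norm// ler_piMr// ltW.
  by rewrite lowe; lra.
 have [r0 r1 _ _] := Hrad x0 bx0; exists x0; split => //. have r2 : 0 < rad x0 / 4 by rewrite divr_gt0.
 have zlow y : ball (x0 - (rad x0 / 2) *: e3) (rad x0 / 4) y -> crd y 2 < crd x0 2.
  rewrite -ballE/= => yz; have := le_lt_trans (abs_crd _ 2) yz.
  by rewrite crdD crdN lowe ltr_norml => /andP[+ _]; move: r2; move: (crd y 2) (crd x0 2) (rad x0) => a b c'; lra.
 have zo y (s : R) : 0 <= s -> ball (x0 - (rad x0 / 2) *: e3) (rad x0 / 4) y -> ~ D (y - s *: e3).
  move=> s0 /zlow yl /low; rewrite low3; move: yl s0; move: (crd y 2) (crd x0 2) => a b; lra.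
 exists (x0 - (rad x0 / 2) *: e3), (rad x0 / 4), 0; split => //.
 - move=> y; rewrite -!ballE/= => yz.
  have := ler_distD (x0 - (rad x0 / 2) *: e3) x0 y.
  have : `|x0 - (x0 - (rad x0 / 2) *: e3)| <= rad x0 / 2 by rewrite subKr normrZ gtr0_norm ?divr_gt0// ler_piMr// divr_ge0// ltW.
  lra.
 - by move=> y yz Dy; apply: (zo y 0) => //; rewrite scale0r subr0.
 - move=> u N tu uN; rewrite mul0r /nsq.
  rewrite (_ : Rintegral _ _ _ = \int[leb3]_(y in ball (x0 - (rad x0 / 2) *: e3) (rad x0 / 4)) (0 : R)).
   by rewrite /Rintegral integral0.
  apply: eq_int => y; rewrite inE => yz.
  rewrite /p /vpot vpE (_ : Rintegral _ _ _ = \int[leb1]_(s in `[0, h]) (0 : R)).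
   by rewrite /Rintegral integral0 expr0n.
  apply: eq_int => s; rewrite inE/= in_itv/= => /andP[s0 _].
  by rewrite sum3 !(test_out (tu _) (zo y s s0 yz)) !mulr0 !addr0.
(* Connectedness of the boundary. *)
have all x : boundary D x -> good x (rad x).
 move=> bx; apply: cmp => //; pose A := [set x | boundary D x /\ anch x (rad x)].
 suff : A = boundary D by move=> E; have [] : A x by rewrite E. apply: cbD; first by exists x0.
 - exists (\bigcup_(y in A) ball y (rad y)); first by apply: bigcup_open => y _; exact: ball_open.
  apply/seteqP; split => [y Ay|y [by' [z [bz az] zy]]].
   split; first by case: Ay. by exists y => //; apply: ballxx; have [] := Hrad y (Ay.1).
  split => //; apply: (trans z) => //; left; by move: zy; rewrite -ballE.
 - exists (~` \bigcup_(y in boundary D `\` A) ball y (rad y)).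
   by apply: open_closedC; apply: bigcup_open => y _; exact: ball_open.
  apply/seteqP; split => [y [by' ay]|y [by' Hy]].
   split => // -[z [bz nz]]; rewrite -ballE/= => zy; apply: nz; split => //.
   by apply: (trans y) => //; right; rewrite distrC.
  apply: contrapT => nA; apply: Hy; exists y => //. by apply: ballxx; have [] := Hrad y by'.
have gloc x : closure D x -> exists2 r : R, 0 < r & good x r.
 move=> cx; have [Dx|bx] := closure_bd cx; last first.
  by exists (rad x); [have [] := Hrad x bx|exact: all].
 have [r r0 rD] := open_ball_sub oD Dx; pose r' := Num.min 1 r. have r'0 : 0 < r' by rewrite lt_min ltr01.
 have r'1 : r' <= 1 by rewrite ge_min lexx.
 exists r' => //; have k90 : 0 <= 9 * h ^+ 2 by rewrite mulr_ge0// sqr_ge0.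
 exists (9 * h ^+ 2) => // u N tu uN; exists (p u).
 have N0 : 0 <= N by apply: le_trans (uN 0 0); exact: nsq_ge0. split.
 - by apply: vpot_smooth => i; exact: test_Cc (tu i).
 - move=> y nD yx; exfalso; apply: nD; apply: rD => /=.
  by apply: ltW; apply: lt_le_trans yx _; rewrite ge_min lexx orbT.
 - by move=> k; exact: pN.
 - rewrite /nsq (_ : Rintegral _ _ _ = \int[leb3]_(y in ball x r') (0 : R)).
   by rewrite /Rintegral integral0 mulr_ge0.
  by apply: eq_int => y _; rewrite subrr expr0n.
have /choice[r Hr] : forall x, exists r : R, closure D x -> 0 < r /\ good x r.
 move=> x; have [cx|nx] := pselect (closure D x); last by exists 0.
 by have [r r0 gr] := gloc x cx; exists r.
(* The gradient of the glued potential contains [grad chi_i] times [p u - P_i],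
   hence the need for a bound of [p u - P_i]. *)
have [n [c [chi [Kc cchi chi0 chi1]]]] := @partition_of_unity R (closure D) (fun x => r x / 2)
 closure_compact (fun x cx => divr_gt0 (Hr x cx).1 (ltr0Sn _ 1)).
have mD := mopen oD.
have [Mc Mc0 HMc] : exists2 Mc : R, 0 <= Mc & forall i, (i < n)%N -> (forall x, `|chi i x| <= Mc) /\
  forall k x, `|partial k (chi i) x| <= Mc.
 have ex i : exists m : R, 0 <= m /\ ((i < n)%N -> (forall x, `|chi i x| <= m) /\
   forall k x, `|partial k (chi i) x| <= m).
  have [i_n|ni] := boolP (i < n)%N; last by exists 0. have [a a0 Ha] := Cc_bd (cchi i i_n).
  have Hb k := Cc_bd (Cc_pd k (cchi i i_n)).
  have [b0 b00 H0] := Hb 0; have [b1 b10 H1] := Hb 1; have [b2 b20 H2] := Hb 2.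
  exists (a + (b0 + b1 + b2)); split; first by rewrite !addr_ge0.
  move=> _; split=> [x|k x]; first by rewrite (le_trans (Ha x))// lerDl !addr_ge0.
  elim/ord3 : k; [rewrite (le_trans (H0 x))//|rewrite (le_trans (H1 x))//|rewrite (le_trans (H2 x))//]; lra.
 have /choice[m Hm] := ex. exists (\sum_(i < n) m i); first by apply: sumr_ge0 => i _; have [] := Hm i.
 move=> i i_n; have [_ /(_ i_n)[h1 h2]] := Hm i. have mi : m i <= \sum_(i < n) m i.
  rewrite (bigD1 (Ordinal i_n))//= lerDl; apply: sumr_ge0 => j _; by have [] := Hm j.
 by split=> [x|k x]; [apply: le_trans (h1 x) mi|apply: le_trans (h2 k x) mi].
have /choice[Cg HCg] : forall i, exists C : R, 0 <= C /\ ((i < n)%N ->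
  forall u (N : R), (forall i, test_fun D (u i)) ->
  (forall k l, nsq setT (rot u k l) <= N) -> exists P, [/\ smooth P,
  forall y, ~ D y -> `|y - c i| < r (c i) -> \forall y' \near y, P y' = 0,
  forall k, nsq (ball (c i) (r (c i))) (fun y => u k y - partial k P y) <= C * N &
  nsq (ball (c i) (r (c i))) (fun y => p u y - P y) <= C * N]).
 move=> i; have [i_n|ni] := boolP (i < n)%N; last by exists 0.
 by have [_ [C C0 HC]] := Hr _ (Kc i i_n); exists C.
pose Ct := \sum_(i < n) Cg i.
have Ct0 : 0 <= Ct by apply: sumr_ge0 => i _; have [] := HCg i.
have CgC i : (i < n)%N -> Cg i <= Ct by move=> i_n; rewrite /Ct (bigD1 (Ordinal i_n))//= lerDl; apply: sumr_ge0 => j _; have [] := HCg j.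
pose B := 4 * Mc ^+ 2 * Ct.
have B0 : 0 <= B by rewrite !mulr_ge0 ?sqr_ge0.
exists (4 ^+ n * B); first by rewrite mulr_ge0// exprn_ge0.
move=> u N tu uN.
have N0 : 0 <= N by apply: le_trans (uN 0 0); exact: nsq_ge0.
have cu i : Cc (u i) by exact: test_Cc (tu i).
have sp' : smooth (p u) by exact: vpot_smooth.
have /choice[P HP] : forall i, exists P, (i < n)%N -> [/\ smooth P,
  forall y, ~ D y -> `|y - c i| < r (c i) -> \forall y' \near y, P y' = 0,
  forall k, nsq (ball (c i) (r (c i))) (fun y => u k y - partial k P y) <= Ct * N &
  nsq (ball (c i) (r (c i))) (fun y => p u y - P y) <= Ct * N].
 move=> i; have [i_n|ni] := boolP (i < n)%N; last by exists (fun=> 0).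
 have [_ /(_ i_n u N tu uN)[P [a1 a2 a3 a4]]] := HCg i; exists P => _; split => //.
  by move=> k; apply: le_trans (a3 k) _; rewrite ler_wpM2r// CgC.
 by apply: le_trans a4 _; rewrite ler_wpM2r// CgC.
have sP i : (i < n)%N -> smooth (P i) by move=> /HP[].
have cchiP i : (i < n)%N -> Cc (fun y => chi i y * P i y) by move=> i_n; apply: CcM; [exact: cchi|exact: sP].
exists (fun y => \sum_(i < n) chi i y * P i y).
 apply: test_crit; first by apply: Cc_sum => i _; apply: cchiP. move=> y nD.
 have H i : (i < n)%N -> \forall y' \near y, chi i y' * P i y' = 0.
  move=> i_n; have [ri _] := Hr _ (Kc i i_n); have [_ P0 _ _] := HP i i_n.
  have [yc|yc] := ltP `|y - c i| (r (c i)).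
   by move: (P0 y nD yc); apply: filterS => y' ->; rewrite mulr0.
  apply/nbhs_ballP; exists (r (c i) / 2); first by rewrite /= divr_gt0.
  move=> y'; rewrite -ballE/= => yy; rewrite chi0 ?mul0r//. by have := ler_distD y' y (c i); lra.
 have Hm : forall m, (m <= n)%N -> \forall y' \near y, \sum_(i < m) chi i y' * P i y' = 0.
  elim=> [_|m IH mn]; first by apply/nbhs_ballP; exists 1 => //= z _; rewrite big_ord0.
  have /nbhs_ballP[a /= a0 Ha] := IH (ltnW mn); have /nbhs_ballP[b /= b0 Hb] := H m mn.
  apply/nbhs_ballP; exists (Num.min a b) => /=; first by rewrite lt_min a0.
  move=> z; rewrite -ballE/= lt_min => /andP[h1 h2]. by rewrite big_ord_recr/= Ha ?Hb ?addr0// -ballE.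
 exact: Hm.
move=> k.
pose G i y := chi i y * (u k y - partial k (P i) y) + partial k (chi i) y * (p u y - P i y).
have GE y : D y -> u k y - partial k (fun y => \sum_(i < n) chi i y * P i y) y = \sum_(i < n) G i y.
 move=> Dy; have cy := subset_closure Dy.
 have dsum m : (m <= n)%N -> (forall g : nat -> sp -> R, (forall i, (i < n)%N -> smooth (g i)) ->
   smooth (fun y => \sum_(i < m) g i y) /\
   partial k (fun y => \sum_(i < m) g i y) y = \sum_(i < m) partial k (g i) y).
  elim: m => [_ g sg|m IH mn g sg].
   have -> : (fun y => \sum_(i < 0) g i y) = (fun=> 0) by apply/funext => z; rewrite big_ord0.
   by rewrite pd_cst big_ord0; split => //; exact: sm_cst.
  have [a b] := IH (ltnW mn) g sg.
  have -> : (fun y => \sum_(i < m.+1) g i y) = (fun y => \sum_(i < m) g i y + g m y) by apply/funext => z; rewrite big_ord_recr.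
  split; first by apply: smoothD => //; exact: sg.
  rewrite pdD ?b ?big_ord_recr//; apply: sm_diff => //; exact: sg.
 have [_ ->] := dsum n (leqnn n) (fun i y => chi i y * P i y) (fun i i_n => Cc_sm (cchiP i i_n)).
 have [_ s1] := dsum n (leqnn n) chi (fun i i_n => Cc_sm (cchi i i_n)).
 have s0 : \sum_(i < n) partial k (chi i) y = 0.
  rewrite -s1 (@near_pd _ _ (fun=> 1)) ?pd_cst//. have : nbhs y D by exact: open_nbhs_nbhs.
  by apply: filterS => z Dz; apply: chi1; exact: subset_closure.
 have -> : u k y = \sum_(i < n) chi i y * u k y - \sum_(i < n) partial k (chi i) y * - p u y by rewrite -!mulr_suml chi1// s0 mul0r subr0 mul1r.
 rewrite -!sumrB; apply: eq_bigr => i _; rewrite pdM /G.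
 - ring.
 - by apply: sm_diff; apply: Cc_sm; exact: cchi.
 - by apply: sm_diff; exact: sP.
have LG i : (i < n)%N -> Lsq D (G i) /\ nsq D (G i) <= B * N.
 move=> i_n; have [sPi _ N1 N2] := HP i i_n; have [m1 m2] := HMc i i_n. have [ri _] := Hr _ (Kc i i_n).
 have mB : measurable (ball (c i) (r (c i)) : set sp) by exact: mball. have ci := cchi i i_n.
 have half (q g : sp -> R) : Cc q -> (forall x, `|q x| <= Mc) -> smooth g ->
  (forall x, r (c i) / 2 < `|x - c i| -> q x = 0) -> nsq (ball (c i) (r (c i))) g <= Ct * N ->
  Lsq D (fun y => q y * g y) /\ nsq D (fun y => q y * g y) <= Mc ^+ 2 * (Ct * N).
  move=> cq qM sg q0 gN; have cqg := CcM cq sg; have Lqg := Cc_L2 cqg. split; first exact: L2_sub Lqg.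
  apply: (@le_trans _ _ (nsq setT (fun y => q y * g y))); first exact: nsqS.
  have E : nsq setT (fun y => q y * g y) = nsq (ball (c i) (r (c i))) (fun y => q y * g y).
   rewrite -(nsq_zext _ mB); congr nsq; apply/funext => y; rewrite patchE.
   case: ifPn => // nb; rewrite q0 ?mul0r//.
   move: nb; rewrite notin_setE -ballE/= distrC => /negP; rewrite -leNgt; lra.
  rewrite E; apply: (@le_trans _ _ (Mc ^+ 2 * nsq (ball (c i) (r (c i))) g)).
   have Lg := sm_L2_ball (c i) ri sg. rewrite -nsqZ//; apply: nsq_mono => //.
   - by apply: (measurable_funS measurableT) => //; have [] := Lqg.
   - exact: L2gZ.
   - move=> y _; rewrite !exprMn ler_wpM2r ?sqr_ge0//.
    by rewrite -real_normK ?num_real// lerXn2r ?nnegrE.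
  by rewrite ler_wpM2l ?sqr_ge0.
 have q0 x : r (c i) / 2 < `|x - c i| -> chi i x = 0 by move=> /ltW; exact: chi0.
 have [La Na] := half (chi i) (fun y => u k y - partial k (P i) y) ci m1
  (smoothB (Cc_sm (cu k)) (sm_pd k sPi)) q0 (N1 k).
 have [|Lb Nb] := half (partial k (chi i)) (fun y => p u y - P i y) (Cc_pd k ci) (m2 k)
  (smoothB sp' sPi) _ N2. move=> x xc; rewrite (@near_pd _ _ (fun=> 0)) ?pd_cst//.
  apply/nbhs_ballP; exists (`|x - c i| - r (c i) / 2); first by rewrite /= subr_gt0.
  move=> y; rewrite -ballE/= => xy; apply: q0. by have := ler_distD y x (c i); lra.
 split; first exact: L2gD. apply: le_trans (nsq_add mD La Lb) _.
 by rewrite (_ : B * N = 4 * (Mc ^+ 2 * (Ct * N))); [lra|rewrite /B; ring].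
have [_ NS] := @nsq_bigsum D n G (B * N) mD (mulr_ge0 B0 N0) LG.
rewrite -mulrA; apply: le_trans NS; rewrite le_eqVlt; apply/orP; left; apply/eqP.
by apply: eq_int => y; rewrite inE => Dy; rewrite GE.
Qed.

End Friedrichs.
End Charts.

Lemma ord3E : ((0 + 1)%R = 1%R :> 'I_3) * ((0 + 2)%R = 2%R :> 'I_3) * ((1 + 1)%R = 2%R :> 'I_3) *
 ((1 + 2)%R = 0%R :> 'I_3) * ((2 + 1)%R = 0%R :> 'I_3) * ((2 + 2)%R = 1%R :> 'I_3).
by do ![split]; apply: val_inj. Qed.

Lemma cross3 (R : realType) (i : 'I_3) (q a : 'I_3 -> R) :
 a 0 * ((2 == i)%:R * q 1 - (1 == i)%:R * q 2) + a 1 * ((0 == i)%:R * q 2 - (2 == i)%:R * q 0) +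
 a 2 * ((1 == i)%:R * q 0 - (0 == i)%:R * q 1) = a (i + 1) * q (i + 2) - a (i + 2) * q (i + 1).
by elim/ord3 : i; rewrite !ord3E /=; move: (q 0) (q 1) (q 2) (a 0) (a 1) (a 2) => *;
 rewrite ?mul1r ?mul0r ?mulr0 ?addr0 ?add0r ?subr0 ?sub0r; ring.
Qed.

(** * Density of test fields among fields with zero tangential trace *)
Section Mollification.
Context {R : realType}.
Local Notation sp := (R * R * R)%type.
Implicit Types (f g phi : sp -> R) (x y h e z : sp) (D U : set sp).
Implicit Types (w c v : 'I_3 -> sp -> R).

Definition cu v (i : 'I_3) x := partial (i + 1) (v (i + 2)) x - partial (i + 2) (v (i + 1)) x.

Lemma Cc_cu v i : (forall i, Cc (v i)) -> Cc (cu v i).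
by move=> cv; apply: CcB; exact: Cc_pd. Qed.

Lemma test_cu D v i : (forall i, test_fun D (v i)) -> test_fun D (cu v i).
move=> tv; have -> : cu v i = fun x => partial (i + 1) (v (i + 2)) x + -1 * partial (i + 2) (v (i + 1)) x.
 by apply/funext => x; rewrite mulN1r.
by apply: test_add; [|apply: test_scale]; exact: test_pd.
Qed.

Lemma int_cut_gt0 x (r : R) : 0 < r -> 0 < \int[leb3]_y cut x r y.
move=> r0; have r2 : 0 < r / 2 by rewrite divr_gt0.
have mB : measurable (ball x (r / 2) : set sp) by exact: mball.
have iB := itg_ball x (ltW r2).
apply: (@lt_le_trans _ _ (\int[leb3]_y (\1_(ball x (r / 2)) y : R))).
 rewrite /Rintegral integral_indic// setIT [X in fine X](leb3_ball x (ltW r2))/=.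
 by rewrite exprn_gt0// mulr_gt0.
apply: le_Rintegral => //; first exact: Cc_itg (Cc_cut x r0).
move=> y _; rewrite indicE; case: (boolP (y \in _)) => [|_]; last exact: cut_ge0.
by rewrite inE -ballE/= distrC => /ltW yr; rewrite cut_1.
Qed.

Lemma bump_exists x (r : R) : 0 < r -> exists b, [/\ Cc b, forall y, 0 <= b y,
 \int[leb3]_y b y = 1 & forall y, r <= `|y - x| -> b y = 0].
move=> r0; have I0 := int_cut_gt0 x r0; set I := Rintegral _ _ _ in I0.
exists (fun y => I^-1 * cut x r y); split.
- by apply: CcZ; exact: Cc_cut.
- by move=> y; rewrite mulr_ge0 ?cut_ge0// invr_ge0 ltW.
- by rewrite RintZ ?mulVf ?gt_eqF//; exact: Cc_itg (Cc_cut x r0).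
- by move=> y yr; rewrite cut_0 ?mulr0.
Qed.

(** Bumps that push the points of [D] near a point of its closure into [D]:
    near the boundary they are centred slightly above the origin in the chart
    direction. *)
Lemma inward_bump D x0 : open D -> lipschitz_boundary D -> closure D x0 ->
 exists2 r : R, 0 < r & forall tau : R, 0 < tau -> exists b (eps : R), [/\ 0 < eps,
  [/\ Cc b, forall y, 0 <= b y, \int[leb3]_y b y = 1 & forall y, tau <= `|y| -> b y = 0] &
  forall x z' z, D x -> `|x - x0| < r -> b (z' - x) != 0 -> `|z' - z| < eps -> D z].
move=> oD LD cx; have [Dx|nD] := pselect (D x0).
 have [r r0 rD] := open_ball_sub oD Dx. have r2 : 0 < r / 2 by rewrite divr_gt0.
 exists (r / 2) => // tau t0; pose t := Num.min tau (r / 4). have t00 : 0 < t by rewrite lt_min t0 divr_gt0.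
 have [b [cb b0 b1 bs]] := bump_exists 0 t00. exists b, (r / 4); split; [by rewrite divr_gt0| |].
  by split => // y ty; apply: bs; rewrite subr0; apply: le_trans ty; rewrite ge_min lexx.
 move=> x z' z _ xr bz zz; apply: rD => /=. have hz : `|z' - x| < r / 4.
  rewrite ltNge; apply/negP => h; move: bz; rewrite bs ?eqxx// subr0.
  by apply: le_trans h; rewrite ge_min lexx orbT.
 have := ler_distD z' z x0; have := ler_distD x z' x0; rewrite (distrC z z'); lra.
have bx : boundary D x0 by split => //; rewrite ((interior_id D).1 oD).
have [c] := charts oD LD bx.
have r2 : 0 < c_rad c / 2 by rewrite divr_gt0// c_rad0.
have K0 : 0 < c_lip c by apply: lt_le_trans (c_lip1 c).
exists (c_rad c / 2) => // tau t0; pose s := Num.min (tau / 2) (c_rad c / 8).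
have s0 : 0 < s by rewrite lt_min !divr_gt0// c_rad0.
pose eta := s / 4 / c_lip c.
have eta0 : 0 < eta by rewrite !divr_gt0.
have es : eta <= s / 4 by rewrite ler_pdivrMr// ler_peMr ?c_lip1// ltW// divr_gt0.
have Keta : c_lip c * eta = s / 4 by rewrite /eta mulrC divfK// gt_eqF.
have [b [cb b0 b1 bs]] := bump_exists (s *: c_dir c) eta0.
have ns : `|s *: c_dir c| <= s by rewrite normrZ gtr0_norm// ler_piMr ?c_dir1// ltW.
exists b, eta; split => //.
 split => // y ty; apply: bs. have := ler_distD (s *: c_dir c) y 0; rewrite !subr0.
 have : s <= tau / 2 by rewrite ge_min lexx. lra.
move=> x z' z Dx xr bz zz.
have hz : `|z' - x - s *: c_dir c| < eta by rewrite ltNge; apply/negP => h; move: bz; rewrite bs ?eqxx.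
have s8 : s <= c_rad c / 8 by rewrite ge_min lexx orbT.
have hz' : `|z' - x| <= s + s / 4.
 have := ler_distD (s *: c_dir c) (z' - x) 0; rewrite !subr0; lra.
have rr : `|x - x0| < c_rad c by apply: lt_trans xr _; rewrite ltr_pdivrMr// ltr_pMr ?c_rad0// ltr1n.
have tx := (c_dom rr).1 Dx.
apply/(c_dom (c := c)).
 by have := ler_distD z' z x0; have := ler_distD x z' x0; rewrite (distrC z z'); lra.
have h1 : `|c_ht c z' - (c_ht c x + s)| <= c_lip c * `|z' - x - s *: c_dir c| by have := c_ht_lip c z' (x + s *: c_dir c); rewrite c_htD (opprD x) addrA.
have h2 := c_ht_lip c z' z.
have k1 : c_lip c * `|z' - x - s *: c_dir c| < s / 4 by rewrite -Keta ltr_pM2l.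
have k2 : c_lip c * `|z' - z| < s / 4 by rewrite -Keta ltr_pM2l.
have := ler_norm (c_ht c z' - c_ht c z); have := ler_norm (- (c_ht c z' - (c_ht c x + s))).
rewrite normrN; lra.
Qed.

Section Approx.
Variables (D : set sp) (w c : 'I_3 -> sp -> R).
Hypotheses (oD : open D) (bD : bounded_set D) (LD : lipschitz_boundary D).
Hypotheses (Lw : forall i, Lsq D (w i)) (Lc : forall i, Lsq D (c i)).
Hypothesis trace : forall psi : 'I_3 -> sp -> R, (forall i, Cc (psi i)) ->
 \int[leb3]_(x in D) (\sum_i c i x * psi i x) = \int[leb3]_(x in D) (\sum_i w i x * cu psi i x).

Let mD := mopen oD.

Lemma L2_csmooth f chi : Lsq D f -> Cc chi -> Lsq D (fun x => chi x * f x).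
move=> Lf cc; have [M M0 HM] := Cc_bd cc.
have LM : Lsq D (fun x => M * f x) by exact: L2gZ.
apply: (L2_dom mD _ LM).
 by apply: mfunM; [exact: Cc_meas|case: Lf].
move=> x _; rewrite !exprMn ler_wpM2r ?sqr_ge0//.
by rewrite -real_normK ?num_real// lerXn2r ?nnegrE.
Qed.

Lemma fin_D : leb3 D \is a fin_num.
by rewrite ge0_fin_numE//; exact: leb3_bounded_fin. Qed.

Definition loc_curl (chi : sp -> R) i x :=
 chi x * c i x + partial (i + 1) chi x * w (i + 2) x - partial (i + 2) chi x * w (i + 1) x.

Lemma L2_loc_curl chi i : Cc chi -> Lsq D (loc_curl chi i).
move=> cc; apply: L2gB => //; first apply: L2gD => //; apply: L2_csmooth => //;
exact: Cc_pd.
Qed.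

Lemma curl_moll chi b i z : Cc chi -> Cc b ->
 cu (fun j => moll ((fun x => chi x * w j x) \_ D) b) i z = moll (loc_curl chi i \_ D) b z.
move=> cc cb.
have iF j : itg3 setT ((fun x => chi x * w j x) \_ D).
 apply: itg_zext => //; apply: L2_itg_loc => //; [exact: fin_D|exact: L2_csmooth].
have n1 : (-1 : R) != 0 by rewrite oppr_eq0 oner_eq0.
pose be x := b (-1 *: x + z).
have cbe : Cc be by exact: Cc_affine.
have dbe k x : partial k be x = - partial k b (z - x) by rewrite /be pd_affine ?mulN1r ?scaleN1r ?[- x + z]addrC//; exact: Cc_sm.
pose g x := chi x * be x.
have cg : Cc g by apply: CcM => //; exact: Cc_sm.
have dg k x : partial k g x = chi x * - partial k b (z - x) + be x * partial k chi x by rewrite /g pdM ?dbe//; apply: sm_diff; exact: Cc_sm.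
have tr := trace (psi := fun j => if j == i then g else fun=> 0).
have mE f (h : sp -> R) : moll (f \_ D) h z = \int[leb3]_(x in D) (f x * h (z - x)).
 rewrite mollE -(int_zext _ mD); apply: eq_int => x _. by rewrite !patchE; case: ifP; rewrite ?mul0r.
have Lb k : Lsq D (fun x => partial k b (z - x)).
 have L := @L2_sub _ setT D _ measurableT mD (fun _ _ => I) (Cc_L2 (Cc_pd k cbe)).
 have {}L : Lsq D (fun x => -1 * partial k be x) by exact: L2gZ.
 have -> // : (fun x => partial k b (z - x)) = (fun x => -1 * partial k be x).
 by apply/funext => x; rewrite dbe mulN1r opprK.
have Lbe : Lsq D be by apply: (@L2_sub _ setT) => //; exact: Cc_L2.
have I1 j k : itg3 D (fun x => chi x * w j x * partial k b (z - x)) by apply: L2g_mul => //; exact: L2_csmooth.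
rewrite /cu !moll_pd// !mE.
have -> : \int[leb3]_(x in D) (loc_curl chi i x * b (z - x)) = \int[leb3]_(x in D) (loc_curl chi i x * be x) by apply: eq_int => x _; rewrite /be scaleN1r addrC.
have S : (fun x => \sum_j c j x * (if j == i then g else fun=> 0) x) = (fun x => c i x * g x).
 apply/funext => x; rewrite (bigD1 i)//= eqxx big1 ?addr0// => j /negPf ->. by rewrite mulr0.
have tr' : \int[leb3]_(x in D) (c i x * g x) =
 \int[leb3]_(x in D) (w (i + 1) x * partial (i + 2) g x - w (i + 2) x * partial (i + 1) g x).
 rewrite -S tr; last by move=> j; case: ifP => _ //; split; [exact: sm_cst|exists 0].
 apply: eq_int => x _; rewrite sum3 /cu.
 have P k j : partial k (if j == i then g else fun=> 0) x = (j == i)%:R * partial k g x by case: (j == i); rewrite ?mul1r ?mul0r ?pd_cst.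
 by rewrite !P !ord3E (cross3 i (fun k => partial k g x) (fun k => w k x)).
have Lg k : Lsq D (partial k g) by apply: (@L2_sub _ setT) => //; apply: Cc_L2; exact: Cc_pd.
have Lgg : Lsq D g by apply: (@L2_sub _ setT) => //; exact: Cc_L2.
apply/eqP; rewrite -subr_eq0 -RintegralB//.
rewrite -RintegralB//; last 2 first.
- by apply: itgB.
- by apply: L2g_mul => //; exact: L2_loc_curl.
have -> : (fun x => chi x * w (i + 2) x * partial (i + 1) b (z - x) -
  chi x * w (i + 1) x * partial (i + 2) b (z - x) - loc_curl chi i x * be x) =
 (fun x => (w (i + 1) x * partial (i + 2) g x - w (i + 2) x * partial (i + 1) g x) - c i x * g x).
 by apply/funext => x; rewrite !dg /loc_curl /g; ring.
rewrite RintegralB//; last 2 first.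
- by apply: itgB => //; exact: L2g_mul.
- exact: L2g_mul.
by rewrite tr' subrr.
Qed.

Lemma moll_out f b z : (forall x, f x * b (z - x) = 0) -> moll f b z = 0.
move=> H; rewrite mollE; under eq_int do rewrite H.
by rewrite /Rintegral integral0.
Qed.

Lemma moll_local x0 : closure D x0 -> exists2 r : R, 0 < r &
 forall chi, Cc chi -> (forall x, r <= `|x - x0| -> chi x = 0) -> forall e : R, 0 < e ->
 exists v, [/\ forall i, test_fun D (v i), forall i, nsq D (fun x => v i x - chi x * w i x) <= e &
  forall i, nsq D (fun x => cu v i x - loc_curl chi i x) <= e].
move=> cx; have [r r0 Hr] := inward_bump oD LD cx; exists r => // chi cc chi0 e e0.
pose F i := (fun x => chi x * w i x) \_ D; pose G i := loc_curl chi i \_ D.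
have LF i : Lsq D (fun x => chi x * w i x) by exact: L2_csmooth.
have LG i : Lsq D (loc_curl chi i) by exact: L2_loc_curl.
have iz f : Lsq D f -> itg3 setT (f \_ D) by move=> Lf; apply: itg_zext => //; apply: L2_itg_loc => //; exact: fin_D.
have TF i := L2_translation (L2_zext mD (LF i)) e0.
have TG i := L2_translation (L2_zext mD (LG i)) e0.
have [a0 a00 A0] := TF 0; have [a1 a10 A1] := TF 1; have [a2 a20 A2] := TF 2.
have [b0 b00 B0] := TG 0; have [b1 b10 B1] := TG 1; have [b2 b20 B2] := TG 2.
pose tau := Num.min (Num.min a0 (Num.min a1 a2)) (Num.min b0 (Num.min b1 b2)).
have tau0 : 0 < tau by rewrite !lt_min a00 a10 a20 b00 b10.
have [b [eps [eps0 [cb bge0 b_1 bt] Hb]]] := Hr tau tau0.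
have out i z' z : ~ D z -> `|z' - z| < eps -> moll (F i) b z' = 0.
 move=> nD zz; apply: moll_out => x; rewrite /F patchE; case: ifPn => [/set_mem Dx|_]; last by rewrite mul0r.
 have [xr|xr] := ltP `|x - x0| r; last by rewrite chi0 ?mul0r.
 have [->|bz] := eqVneq (b (z' - x)) 0; first by rewrite mulr0. by exfalso; apply: nD; exact: Hb bz zz.
have sm i : smooth (moll (F i) b) by apply: moll_smooth => //; exact: iz.
exists (fun i => moll (F i) b); split.
- move=> i; apply: test_crit.
  split => //; have [M M1 HM] := cl_bounded bD; exists M => z Mz.
  apply: (out i z z); last by rewrite subrr normr0. by move=> /subset_closure /HM; rewrite leNgt Mz.
 move=> z nD; apply/nbhs_ballP; exists eps => //= z'; rewrite -ballE/= distrC. exact: out.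
- move=> i.
 have HK h : `|h| < tau -> nsq setT (fun x => F i (x + h) - F i x) <= e.
  rewrite !lt_min => /andP[/and3P[h0 h1 h2] _]; clear -A0 A1 A2 h0 h1 h2.
  by elim/ord3 : i; [exact: A0|exact: A1|exact: A2].
 have [L N] := moll_close (iz _ (LF i)) (L2_zext mD (LF i)) cb bge0 b_1 bt HK.
 apply: le_trans N; apply: le_trans (nsqS measurableT mD (fun _ _ => I) L).
 by rewrite le_eqVlt; apply/orP; left; apply/eqP; apply: eq_int => x xD; rewrite patchE xD.
- move=> i.
 have HK h : `|h| < tau -> nsq setT (fun x => G i (x + h) - G i x) <= e.
  rewrite !lt_min => /andP[_ /and3P[h0 h1 h2]]; clear -B0 B1 B2 h0 h1 h2.
  by elim/ord3 : i; [exact: B0|exact: B1|exact: B2].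
 have [L N] := moll_close (iz _ (LG i)) (L2_zext mD (LG i)) cb bge0 b_1 bt HK.
 apply: le_trans N; apply: le_trans (nsqS measurableT mD (fun _ _ => I) L).
 rewrite le_eqVlt; apply/orP; left; apply/eqP; apply: eq_int => x xD.
 congr (_ ^+ 2); rewrite curl_moll//; congr (_ - _). by rewrite patchE xD.
Qed.

(** Fields with vanishing tangential trace are limits of test fields, in the
    graph norm of the curl. *)
Lemma test_dense_curl (e : R) : 0 < e -> exists v, [/\ forall i, test_fun D (v i),
 forall i, nsq D (fun x => v i x - w i x) <= e & forall i, nsq D (fun x => cu v i x - c i x) <= e].
move=> e0.
have /choice[r Hr] : forall x, exists r : R, closure D x -> 0 < r /\
 forall chi, Cc chi -> (forall y, r <= `|y - x| -> chi y = 0) -> forall e : R, 0 < e ->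
 exists v, [/\ forall i, test_fun D (v i), forall i, nsq D (fun x => v i x - chi x * w i x) <= e &
  forall i, nsq D (fun x => cu v i x - loc_curl chi i x) <= e].
 move=> x; have [cx|nx] := pselect (closure D x); last by exists 0.
 by have [r r0 H] := moll_local cx; exists r.
have [n [ce [chi [Kc cchi chi0 chi1]]]] := partition_of_unity (closure_compact bD) (fun x cx => (Hr x cx).1).
have en : 0 < e / 4 ^+ n by rewrite divr_gt0// exprn_gt0.
have /choice[v Hv] : forall m, exists v, (m < n)%N -> [/\ forall i, test_fun D (v i),
  forall i, nsq D (fun x => v i x - chi m x * w i x) <= e / 4 ^+ n &
  forall i, nsq D (fun x => cu v i x - loc_curl (chi m) i x) <= e / 4 ^+ n].
 move=> m; have [mn|nm] := boolP (m < n)%N; last by exists (fun _ _ => 0).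
 have [_ H] := Hr _ (Kc m mn); have H0 x : r (ce m) <= `|x - ce m| -> chi m x = 0 by exact: chi0.
 have [v Hv] := H _ (cchi m mn) H0 _ en. by exists v.
have e4 : 4 ^+ n * (e / 4 ^+ n) = e by rewrite mulrC divfK// expf_neq0.
pose V i x := \sum_(m < n) v m i x.
have tV i m : (m <= n)%N -> test_fun D (fun x => \sum_(j < m) v j i x).
 elim: m => [_|m IH mn].
  have -> : (fun x => \sum_(j < 0) v j i x) = (fun=> 0) by apply/funext => x; rewrite big_ord0.
  exact: test_0.
 have -> : (fun x => \sum_(j < m.+1) v j i x) = fun x => \sum_(j < m) v j i x + v m i x by apply/funext => x; rewrite big_ord_recr.
 by apply: test_add; [exact: IH (ltnW mn)|have [] := Hv m mn].
have dsum k m (g : nat -> sp -> R) x : (m <= n)%N -> (forall i, (i < n)%N -> smooth (g i)) ->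
   smooth (fun y => \sum_(i < m) g i y) /\
   partial k (fun y => \sum_(i < m) g i y) x = \sum_(i < m) partial k (g i) x.
 move=> + sg; elim: m => [_|m IH mn].
  have -> : (fun y => \sum_(i < 0) g i y) = (fun=> 0) by apply/funext => z; rewrite big_ord0.
  by rewrite pd_cst big_ord0; split => //; exact: sm_cst.
 have [a b] := IH (ltnW mn).
 have -> : (fun y => \sum_(i < m.+1) g i y) = (fun y => \sum_(i < m) g i y + g m y) by apply/funext => z; rewrite big_ord_recr.
 split; first by apply: smoothD => //; exact: sg.
 rewrite pdD ?b ?big_ord_recr//; apply: sm_diff => //; exact: sg.
have sv i m : (m < n)%N -> smooth (v m i) by move=> mn; have [/(_ i)/test_sm] := Hv m mn.
exists V; split.
- by move=> i; exact: tV.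
- move=> i; rewrite -e4.
 have H m : (m < n)%N -> Lsq D (fun x => v m i x - chi m x * w i x) /\
   nsq D (fun x => v m i x - chi m x * w i x) <= e / 4 ^+ n.
  move=> mn; have [tv N _] := Hv m mn; split; last exact: N.
  by apply: L2gB => //; [exact: test_L2|apply: L2_csmooth => //; exact: cchi].
 have [_ N] := nsq_bigsum mD (ltW en) H; apply: le_trans N.
 rewrite le_eqVlt; apply/orP; left; apply/eqP; apply: eq_int => x; rewrite inE => Dx.
 by rewrite sumrB -mulr_suml chi1 ?mul1r//; exact: subset_closure.
- move=> i; rewrite -e4.
 have H m : (m < n)%N -> Lsq D (fun x => cu (v m) i x - loc_curl (chi m) i x) /\
   nsq D (fun x => cu (v m) i x - loc_curl (chi m) i x) <= e / 4 ^+ n.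
  move=> mn; have [tv _ N] := Hv m mn; split; last exact: N.
  by apply: L2gB => //; [apply: test_L2 => //; exact: test_cu|apply: L2_loc_curl; exact: cchi].
 have [_ N] := nsq_bigsum mD (ltW en) H; apply: le_trans N.
 rewrite le_eqVlt; apply/orP; left; apply/eqP; apply: eq_int => x; rewrite inE => Dx.
 have s0 k : \sum_(m < n) partial k (chi m) x = 0.
  have [_ <-] := dsum k n chi x (leqnn n) (fun m mn => Cc_sm (cchi m mn)).
  rewrite (@near_pd _ _ (fun=> 1)) ?pd_cst//. have : nbhs x D by exact: open_nbhs_nbhs.
  by apply: filterS => z Dz; apply: chi1; exact: subset_closure.
 congr (_ ^+ 2); rewrite sumrB; congr (_ - _).
  rewrite /cu sumrB; congr (_ - _).
   by have [_ ->] := dsum (i + 1) n (fun m => v m (i + 2)) x (leqnn n) (fun m mn => sv _ m mn).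
  by have [_ ->] := dsum (i + 2) n (fun m => v m (i + 1)) x (leqnn n) (fun m mn => sv _ m mn).
 rewrite /loc_curl sumrB big_split/= -!mulr_suml !s0 !mul0r addr0 subr0 chi1 ?mul1r//.
 exact: subset_closure.
Qed.

End Approx.
End Mollification.

(** * The smoothed Newtonian potential *)
Section Newton.
Context {R : realType}.
Local Notation sp := (R * R * R)%type.
Implicit Types (f g phi : sp -> R) (x y h e z : sp) (D U : set sp).

Definition rsq (x : sp) : R := \sum_i crd x i ^+ 2.

Lemma sm_rsq : smooth rsq.
apply: (@sm_sum _ _ _ _ (fun i x => crd x i ^+ 2)) => i _.
by under eq_fun do rewrite expr2; apply: smoothM; exact: sm_crd.
Qed.

Lemma rsq_ge0 x : 0 <= rsq x. by apply: sumr_ge0 => i _; exact: sqr_ge0. Qed.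

Lemma rsqZ (a : R) x : rsq (a *: x) = a ^+ 2 * rsq x.
by rewrite /rsq mulr_sumr; apply: eq_bigr => i _; rewrite crdZ exprMn. Qed.

Lemma pd_rsq k x : partial k rsq x = 2 * crd x k.
have d i : differentiable (fun x : sp => crd x i) x by have [] := crd_diff i x.
have E : rsq = fun x => crd x 0 * crd x 0 + crd x 1 * crd x 1 + crd x 2 * crd x 2 by apply/funext => y; rewrite /rsq sum3 !expr2.
have dd i : differentiable (fun x : sp => crd x i * crd x i) x by exact: differentiableM.
rewrite E !pdD//; last by apply: differentiableD.
rewrite !pdM// !pd_crd.
elim/ord3 : k; rewrite !crdE /bas/= ?mulr1 ?mulr0 ?addr0 ?add0r; ring.
Qed.

Lemma norm_rsq x : `|x| ^+ 2 <= rsq x.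
have H i : crd x i ^+ 2 <= rsq x by rewrite /rsq (bigD1 i)//= lerDl; apply: sumr_ge0 => j _; exact: sqr_ge0.
have : `|x| <= Num.sqrt (rsq x) by apply: norm_crd_le => i; rewrite -sqrtr_sqr ler_wsqrtr.
by move=> h; rewrite -[leRHS]sqr_sqrtr ?rsq_ge0// lerXn2r ?nnegrE ?sqrtr_ge0.
Qed.

Definition pot_den x := rsq x + sstep (2 - rsq x).

Lemma pot_den_gt0 x : 0 < pot_den x.
rewrite /pot_den; have [r1|r1] := ltP (rsq x) 1.
 by rewrite ltr_wpDl ?rsq_ge0// sstep_gt0; lra.
by rewrite ltr_pwDl ?sstep_ge0// (lt_le_trans ltr01).
Qed.

Lemma sm_pot_den : smooth pot_den.
apply: smoothD; first exact: sm_rsq.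
apply: (@sm_sstep _ (fun x => 2 - rsq x)); apply: smoothB; [exact: sm_cst|exact: sm_rsq].
Qed.

(** The Newtonian potential, smoothed near the origin. *)
Definition newton x : R := expR (- ln (pot_den x) / 2).

Lemma newton_gt0 x : 0 < newton x. exact: expR_gt0. Qed.

Lemma newton_sq x : newton x ^+ 2 = (pot_den x)^-1.
have E (a : R) : - a / 2 + - a / 2 = - a by lra.
rewrite /newton expr2 -expRD E.
by rewrite expRN lnK// posrE pot_den_gt0.
Qed.

Lemma newton_diff x : differentiable newton x /\
 forall i, partial i newton x = - 2^-1 * newton x ^+ 3 * partial i pot_den x.
have S0 := pot_den_gt0 x.
have H : is_derive (pot_den x) (1 : R) (fun s : R => expR (- ln s / 2)) (- 2^-1 * newton x ^+ 3).
 have D1 := @is_derive1_ln R _ S0.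
 have D2 : is_derive (pot_den x) (1 : R) (fun s : R => - ln s / 2) (- (pot_den x)^-1 / 2).
  have -> : (fun s : R => - ln s / 2) = (fun s => (- 2^-1) *: ln s) by apply/funext => s; rewrite -[RHS]/(- 2^-1 * ln s); ring.
  have -> : - (pot_den x)^-1 / 2 = (- 2^-1) *: (pot_den x)^-1 by rewrite -[RHS]/(- 2^-1 * (pot_den x)^-1); ring.
  exact: is_deriveZ.
 have := @is_derive1_comp R expR (fun s : R => - ln s / 2) (pot_den x) _ _ (is_derive_expR _) D2.
 have -> // : expR (- ln (pot_den x) / 2) * (- (pot_den x)^-1 / 2) = - 2^-1 * newton x ^+ 3.
 by rewrite -newton_sq -/(newton x); ring.
have [d p] := diff_comp1 H (sm_diff x sm_pot_den).
by split=> [|i]; [exact: d|rewrite [LHS]p mulrC].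
Qed.

Lemma sm_newton : smooth newton.
apply: (@alg_smooth _ [set f | f = newton \/ smooth f]); last by apply: alg_base; left.
move=> f [->|sf]; last first.
 split=> [x|i]; first exact: sm_diff. by apply: alg_base; right; exact: sm_pd.
split=> [x|i]; first by have [] := newton_diff x.
have -> : partial i newton = fun x => - 2^-1 * (newton x * (newton x * newton x)) * partial i pot_den x by apply/funext => x; have [_ ->] := newton_diff x; rewrite !exprS expr0 mulr1.
have N : alg [set f | f = newton \/ smooth f] newton by apply: alg_base; left.
apply: alg_mul; last by apply: alg_base; right; apply: sm_pd; exact: sm_pot_den.
by apply: alg_mul; [exact: alg_cst|apply: alg_mul => //; exact: alg_mul].
Qed.

Lemma pot_den_far x : 2 <= rsq x -> pot_den x = rsq x.
by move=> r2; rewrite /pot_den sstep0 ?addr0// subr_le0. Qed.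

Lemma near_far x : 2 < rsq x -> \forall y \near x, 2 < rsq y.
move=> r2; have c : continuous rsq by apply: sm_cont; exact: sm_rsq.
have o : open [set y : sp | 2 < rsq y].
 rewrite (_ : [set _ | _] = rsq @^-1` [set s | 2 < s])//.
 by apply: open_comp; [move=> y _; exact: c|exact: open_gt].
exact: (open_nbhs_nbhs (conj o r2)).
Qed.

Lemma pd_newton_far x i : 2 < rsq x -> partial i newton x = - newton x ^+ 3 * crd x i.
move=> r2; have [_ ->] := newton_diff x.
rewrite (@near_pd _ _ rsq) ?pd_rsq; last first.
 by move: (near_far r2); apply: filterS => y /ltW; exact: pot_den_far.
by field.
Qed.

Definition lap f x := \sum_i partial i (partial i f) x.

Lemma crd_basis i : crd (bas i : sp) i = 1.
by rewrite /crd; elim/ord3 : i. Qed.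

Lemma lap_newton_far x : 2 < rsq x -> lap newton x = 0.
move=> r2.
have dn y : differentiable newton y by apply: sm_diff; exact: sm_newton.
have H i : partial i (partial i newton) x = - newton x ^+ 3 + 3 * newton x ^+ 5 * crd x i ^+ 2.
 rewrite (@near_pd _ _ (fun y => - (newton y * (newton y * newton y)) * crd y i)); last first.
  by move: (near_far r2); apply: filterS => y /(pd_newton_far i) ->; rewrite !exprS expr0 mulr1.
 have d2 : differentiable (fun y => newton y * newton y) x by exact: differentiableM.
 have d3 : differentiable (fun y => newton y * (newton y * newton y)) x by exact: differentiableM.
 have dc : differentiable (fun x : sp => crd x i) x by have [] := crd_diff i x.
 have -> : (fun y => - (newton y * (newton y * newton y)) * crd y i) =
  fun y => -1 * ((newton y * (newton y * newton y)) * crd y i) by apply/funext => y; ring.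
 rewrite pdZ; last exact: differentiableM. rewrite pdM// pdM// pdM// pd_crd (pd_newton_far i r2).
 rewrite crd_basis. ring.
have S : newton x ^+ 2 * rsq x = 1 by rewrite newton_sq pot_den_far ?ltW// mulVf// gt_eqF// (lt_trans _ r2).
rewrite /lap sum3 !H.
rewrite (_ : _ + _ = 3 * newton x ^+ 3 * (newton x ^+ 2 * rsq x - 1)); last first.
 by rewrite /rsq sum3; ring.
by rewrite S subrr mulr0.
Qed.

Definition rho : sp -> R := lap newton.

Lemma rsq_far x : 2 <= `|x| -> 2 < rsq x.
by move=> x2; apply: lt_le_trans (norm_rsq x); rewrite expr2; nra. Qed.

Lemma rho_0 x : 2 <= `|x| -> rho x = 0.
by move=> /rsq_far /lap_newton_far. Qed.

Lemma sm_lap f : smooth f -> smooth (lap f).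
move=> sf; apply: (@sm_sum _ _ _ _ (fun i => partial i (partial i f))) => i _.
by apply: sm_pd; exact: sm_pd.
Qed.

Lemma Cc_rho : Cc rho.
split; first by apply: sm_lap; exact: sm_newton.
by exists 2 => x /ltW; exact: rho_0.
Qed.

Definition eta16 x := sstep (16 - rsq x).

Lemma Cc_eta16 : Cc eta16.
split.
 apply: (@sm_sstep _ (fun x => 16 - rsq x)); apply: smoothB; [exact: sm_cst|exact: sm_rsq].
exists 4 => x x4; rewrite /eta16 sstep0// subr_le0.
by apply: le_trans (norm_rsq x); rewrite expr2; nra.
Qed.

Lemma eta16_radial x : \sum_i crd x i * partial i eta16 x <= 0.
rewrite leNgt; apply/negP => d0; set d := \sum_i _ in d0.
have [M M0 HM] := Cc_taylor Cc_eta16.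
pose s := Num.min 1 (d / 2 / (M * `|x| ^+ 2 + 1)).
have k0 : 0 < M * `|x| ^+ 2 + 1 by rewrite ltr_wpDl// mulr_ge0// sqr_ge0.
have s0 : 0 < s by rewrite lt_min ltr01 !divr_gt0.
have sk : s * (M * `|x| ^+ 2 + 1) <= d / 2 by rewrite -ler_pdivlMr// ge_min lexx orbT.
have := HM x (s *: x).
have -> : \sum_i crd (s *: x) i * partial i eta16 x = s * d by rewrite mulr_sumr; apply: eq_bigr => i _; rewrite crdZ mulrA.
have mono : eta16 (x + s *: x) <= eta16 x.
 rewrite /eta16; apply: sstep_homo; rewrite lerB// -{2}[x]scale1r -scalerDl rsqZ.
 by rewrite ler_peMl ?rsq_ge0// expr2; nra.
rewrite normrZ exprMn gtr0_norm// mulrCA => h.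
have h1 : s * d <= s * (s * (M * `|x| ^+ 2)).
 have := ler_norm (- (eta16 (x + s *: x) - eta16 x - s * d)); rewrite normrN.
 by move: h mono; rewrite [s * (s * _)]mulrA -expr2; lra.
by rewrite ler_pM2l// in h1; rewrite mulrDr mulr1 in sk; lra.
Qed.

Lemma Cc_int0 f : Cc f -> (forall x, 0 <= f x) -> \int[leb3]_x f x = 0 ->
 forall x, f x = 0.
move=> cf f0 If x; apply/eqP; rewrite eq_le f0 andbT leNgt; apply/negP => fx.
 have [M M0 HM] := Cc_lip cf. pose r := f x / 2 / (M + 1); have M1 : 0 < M + 1 by rewrite ltr_wpDl.
 have r0 : 0 < r by rewrite !divr_gt0. have iB := itg_ball x (ltW r0).
 have : \int[leb3]_y (f x / 2 * \1_(ball x r) y) <= \int[leb3]_y f y.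
  apply: le_Rintegral => //; [by apply: itgZ|exact: Cc_itg|].
  move=> y _; rewrite indicE; case: (boolP (y \in _)) => [|_]; last by rewrite mulr0.
  rewrite inE -ballE/= distrC mulr1 => yr.
  have := HM x (y - x); have -> : x + (y - x) = y by rewrite addrC subrK. move=> h.
  have h2 : M * `|y - x| <= f x / 2.
   apply: (@le_trans _ _ ((M + 1) * r)); last by rewrite /r mulrC divfK// gt_eqF.
   by apply: ler_pM => //; [rewrite lerDl|exact: ltW].
  have := ler_norm (- (f y - f x)); rewrite normrN; lra.
 have V := RintZ measurableT (f x / 2) iB; rewrite If V leNgt => /negP; apply.
 rewrite mulr_gt0 ?divr_gt0// /Rintegral integral_indic// ?setIT; last exact: mball.
 by rewrite [X in fine X](leb3_ball x (ltW r0))/= exprn_gt0// mulr_gt0.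
Qed.

(** The total mass of [rho] is the flux of the Newtonian potential. *)
Lemma kappa_neq0 : \int[leb3]_x rho x != 0.
apply/eqP => k0.
pose f x := \sum_i partial i newton x * partial i eta16 x.
have ci i : Cc (fun x => partial i newton x * partial i eta16 x).
 have -> : (fun x => partial i newton x * partial i eta16 x) = (fun x => partial i eta16 x * partial i newton x) by apply/funext => x; rewrite mulrC.
 apply: CcM; first by apply: Cc_pd; exact: Cc_eta16. by apply: sm_pd; exact: sm_newton.
have cf : Cc f by apply: Cc_sum.
have eta1 x : rsq x <= 15 -> eta16 x = 1 by move=> h; rewrite /eta16 sstep1//; lra.
have detax x i : rsq x < 15 -> partial i eta16 x = 0.
 move=> h; rewrite (@near_pd _ _ (fun=> 1)) ?pd_cst//.
 have c : continuous rsq by apply: sm_cont; exact: sm_rsq. have o : open [set y : sp | rsq y < 15].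
  rewrite (_ : [set _ | _] = rsq @^-1` [set s | s < 15])//.
  by apply: open_comp; [move=> y _; exact: c|exact: open_lt].
 by move: (open_nbhs_nbhs (conj o h)); apply: filterS => y /ltW; exact: eta1.
have If : \int[leb3]_x f x = 0.
 have ib i : \int[leb3]_x (partial i newton x * partial i eta16 x) =
  - \int[leb3]_x (eta16 x * partial i (partial i newton) x).
  rewrite (ibp i Cc_eta16 (sm_pd i sm_newton)) opprK. by apply: eq_int => x _.
 rewrite /f Rint_sum//; last by move=> i _; exact: Cc_itg. under eq_bigr do rewrite ib.
 rewrite sumrN -Rint_sum//; last first.
  move=> i _; apply: Cc_itg; apply: CcM; first exact: Cc_eta16.
  by apply: sm_pd; apply: sm_pd; exact: sm_newton.
 have E : \int[leb3]_x (\sum_i eta16 x * partial i (partial i newton) x) = \int[leb3]_x rho x.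
  apply: eq_int => x _; rewrite -mulr_sumr -/(lap newton x).
  have [h|h] := ltP 2 (rsq x); first by rewrite /rho lap_newton_far// mulr0. by rewrite eta1 ?mul1r//; lra.
 by rewrite E k0 oppr0.
have f0 x : 0 <= f x.
 have [h|h] := ltP 2 (rsq x); last first.
  by rewrite /f big1// => i _; rewrite detax ?mulr0//; lra.
 have -> : f x = - (newton x ^+ 3 * \sum_i crd x i * partial i eta16 x).
  rewrite /f mulr_sumr -sumrN; apply: eq_bigr => i _; rewrite pd_newton_far//; ring.
 by rewrite oppr_ge0 mulr_ge0_le0 ?eta16_radial// exprn_ge0// ltW// newton_gt0.
have fz := Cc_int0 cf f0 If.
have e1n (s : R) : rsq (s *: bas 0) = s ^+ 2 by rewrite rsqZ /rsq sum3 !crdE/=; rewrite expr1n !expr0n/= !addr0 mulr1.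
have dz (s : R) : 3 <= s -> partial 0 eta16 (s *: bas 0) = 0.
 move=> s3; have := fz (s *: bas 0). have far : 2 < rsq (s *: bas 0) by rewrite e1n expr2; nra.
 have [c0 c1 c2] : [/\ crd (s *: bas 0) 0 = s, crd (s *: bas 0) 1 = 0 &
   crd (s *: bas 0) 2 = 0].
  by rewrite !crdZ !crdE /bas/= mulr1 !mulr0.
 rewrite /f sum3 (pd_newton_far 0 far) (pd_newton_far 1 far) (pd_newton_far 2 far) c0 c1 c2.
 move: (newton_gt0 (s *: bas 0)); move: (newton _) (partial 0 eta16 _) (partial 1 eta16 _) (partial 2 eta16 _).
 move=> n p0 p1 p2 n0 E; have : n ^+ 3 * s * p0 = 0.
  by move: E; rewrite !mulr0 !mul0r !addr0 !mulNr => /eqP; rewrite oppr_eq0 => /eqP.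
 move/eqP; rewrite mulf_eq0 mulf_eq0 expf_eq0/= (gt_eqF n0)/= gt_eqF/= ?(lt_le_trans _ s3)//.
 by move=> /eqP.
have [t /andP[t0 t1]] : exists2 c : R, 0 <= c <= 1 &
  eta16 (3 *: bas 0 + 1 *: bas 0) - eta16 (3 *: bas 0) =
  'D_(1 *: bas 0) eta16 (3 *: bas 0 + c *: (1 *: bas 0)).
 by apply: mvt_eq => t _; apply: sm_diff; apply: Cc_sm; exact: Cc_eta16.
rewrite -scalerDl !scale1r -scalerDl.
rewrite derive_pd; last by apply: sm_diff; apply: Cc_sm; exact: Cc_eta16.
have [c0 c1 c2] : [/\ crd (bas 0 : sp) 0 = 1, crd (bas 0 : sp) 1 = 0 &
  crd (bas 0 : sp) 2 = 0] by rewrite !crdE.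
rewrite sum3 c0 c1 c2 dz; last by rewrite lerDl.
have Z (a b : R) : 1 * 0 + 0 * a + 0 * b = 0 by ring.
have A : eta16 ((3 + 1) *: bas 0) = 0 by rewrite /eta16 e1n sstep0// expr2; lra.
have B : eta16 (3 *: bas 0) = 1 by rewrite /eta16 e1n sstep1// expr2; lra.
rewrite Z; move: A B; move: (eta16 ((3 + 1) *: bas 0)) (eta16 (3 *: bas 0)).
by move=> X Y -> ->; rewrite sub0r => /eqP; rewrite oppr_eq0 oner_eq0.
Qed.

End Newton.

Lemma cucu_alg (R : realType) (i k : 'I_3) (p : 'I_3 -> 'I_3 -> R) : (forall m j, p m j = p j m) ->
 (((i + 2) + 2 == k)%:R * p (i + 1) ((i + 2) + 1) - ((i + 2) + 1 == k)%:R * p (i + 1) ((i + 2) + 2)) -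
 (((i + 1) + 2 == k)%:R * p (i + 2) ((i + 1) + 1) - ((i + 1) + 1 == k)%:R * p (i + 2) ((i + 1) + 2)) =
 p i k - (i == k)%:R * (p 0 0 + p 1 1 + p 2 2).
move=> S; have s1 := S 1 0; have s2 := S 2 0; have s3 := S 2 1.
elim/ord3 : i; elim/ord3 : k; rewrite !ord3E /= ?s1 ?s2 ?s3;
 move: (p 0 0) (p 0 1) (p 0 2) (p 1 1) (p 1 2) (p 2 2) => *;
 rewrite ?mul1r ?mul0r ?addr0 ?add0r ?subr0 ?sub0r; ring.
Qed.

Lemma Am_alg (R : realType) (i : 'I_3) (p : 'I_3 -> 'I_3 -> 'I_3 -> R) :
 p 0 0 i + p 1 1 i + p 2 2 i = p 0 i 0 + p 1 i 1 + p 2 i 2 ->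
 p (i + 1) i (i + 1) - p (i + 1) (i + 1) i = p (i + 2) (i + 2) i - p (i + 2) i (i + 2).
elim/ord3 : i; rewrite !ord3E => /eqP; rewrite -subr_eq0 => /eqP H; apply/eqP; rewrite -subr_eq0; apply/eqP;
 rewrite -[RHS]oppr0 -[X in _ = - X]H; ring.
Qed.

(** * Harmonicity of the curl *)
Section Convolution.
Context {R : realType}.
Local Notation sp := (R * R * R)%type.
Implicit Types (f g phi zeta : sp -> R) (x y h e z : sp) (D U : set sp).

Lemma L2_reflect z g : Lsq setT g -> Lsq setT (fun x => g (z - x)).
move=> Lg; have n1 : (-1 : R) != 0 by rewrite oppr_eq0 oner_eq0.
have [+ _] := L2_affine z n1 Lg.
have -> // : (fun x => g (-1 *: x + z)) = (fun x => g (z - x)).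
by apply/funext => x; rewrite scaleN1r addrC.
Qed.

Lemma moll_pt f phi z : Lsq setT f -> Cc phi ->
 moll f phi z ^+ 2 <= nsq setT f * nsq setT phi.
move=> Lf cp; have Lp := Cc_L2 cp.
rewrite mollE !nsq_sip; apply: le_trans (sip_CS measurableT Lf (L2_reflect z Lp)) _.
rewrite ler_wpM2l ?sip_ge0// -!nsq_sip.
by rewrite /nsq (int_reflect z (L2_itg Lp)).2.
Qed.

(** Cauchy-Schwarz over the support of the kernel, of volume [(2 d)^3], and
    exchange of the integrals. *)
Lemma moll_bound f phi (d M : R) L L' : itg3 setT f -> Lsq setT f -> Cc phi ->
 0 < d -> 0 <= M -> (forall h, `|phi h| <= M) -> (forall h, d <= `|h| -> phi h = 0) ->
 measurable L -> measurable L' -> (forall z x, L z -> `|x - z| < d -> L' x) -> Lsq L (moll f phi) /\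
 nsq L (moll f phi) <= ((2 * d) ^+ 3) ^+ 2 * (M ^+ 2 * nsq L' f).
move=> fi Lf cp d0 M0 phiM phid mL mL' LL.
have Lp := Cc_L2 cp.
have mf : measf (setT : set sp) f by case: Lf.
have mp : measf (setT : set sp) phi by case: Lp.
pose S : set sp := ball 0 d; have mS : measurable S by exact: mball.
have Sout x : ~ S x -> phi x = 0 by rewrite /S -ballE/= sub0r normrN => /negP; rewrite -leNgt; exact: phid.
have I1 z : itg3 setT (fun x => f x * phi (z - x)) by apply: L2g_mul => //; exact: L2_reflect.
have I2 z : itg3 setT (fun s => phi s * f (z - s)) by apply: L2g_mul => //; exact: L2_reflect.
have E z : moll f phi z = \int[leb3]_(s in S) (1 * (phi s * f (z - s))).
 rewrite mollE; have [_ <-] := int_reflect z (I1 z).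
 rewrite [RHS]Rintegral_mkcond; apply: eq_int => x _; rewrite patchE subKr mul1r mulrC.
 by case: ifPn => // /negP nx; rewrite Sout ?mul0r// => Sx; apply: nx; exact: mem_set.
have EE : moll f phi = (fun z => \int[leb3]_(s in S) (1 * (phi s * f (z - s)))) by apply/funext => z; exact: E.
have vol : \int[leb3]_(s in S) (1 : R) = (2 * d) ^+ 3 by rewrite /Rintegral integral_cst//= mul1e [X in fine X](leb3_ball 0 (ltW d0)).
have iS : itg3 S (fun=> 1 : R).
 apply/integrableP; split; first by apply/mEFinP.
 rewrite (eq_integral (fun=> 1%E)); last by move=> x _; rewrite /= normr1.
 by rewrite integral_cst// mul1e [ltLHS](leb3_ball 0 (ltW d0)) ltry.
have W0 : 0 < (2 * d) ^+ 3 by rewrite exprn_gt0// mulr_gt0.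
have LL' : Lsq L' f by exact: L2_sub Lf.
have := @L2_average R _ _ leb3 S L (fun=> 1) (fun s z => phi s * f (z - s)) ((2 * d) ^+ 3)
 (M ^+ 2 * nsq L' f) mS mL W0.
rewrite -EE; apply => //.
- apply: mfunM; first exact: (mfcomp mp measurable_fst).
 exact: (mfcomp mf meas_sub3).
- by rewrite vol.
- by rewrite mulr_ge0 ?sqr_ge0// nsq_ge0.
- move=> s; rewrite /S -ballE/= sub0r normrN => sd.
 have [Ls Ns] := L2_shift (- s) (L2_zext mL' LL').
 have LG : Lsq L (fun z => phi s * (f \_ L') (z - s)) by apply: L2gZ => //; exact: (@L2_sub _ setT).
 have EG : forall z, L z -> phi s * f (z - s) = phi s * (f \_ L') (z - s).
  move=> z Lz; rewrite patchE mem_set//; apply: (LL z) => //. by rewrite addrAC subrr add0r normrN.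
 have -> : (\int[leb3]_(y in L) ((phi s * f (y - s)) ^+ 2)%:E =
   \int[leb3]_(y in L) ((phi s * (f \_ L') (y - s)) ^+ 2)%:E)%E.
  by apply: eq_integral => z; rewrite inE => Lz; rewrite EG.
 rewrite (nsqE3 mL LG) lee_fin nsqZ//; last exact: (@L2_sub _ setT).
 apply: ler_pM; rewrite ?sqr_ge0 ?nsq_ge0//.
  by rewrite -real_normK ?num_real// lerXn2r ?nnegrE.
 rewrite -(nsq_zext _ mL') -Ns; exact: nsqS.
- by apply: cont_meas3 => //; apply: sm_cont; exact: moll_smooth.
- move=> z _; apply: (@integrableS _ _ _ leb3 setT) => //.
 by apply: eq_integrable (I2 z) => // x _; rewrite /= mul1r.
Qed.

Lemma Cc_lap f : Cc f -> Cc (lap f).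
by move=> cf; apply: Cc_sum => i _; apply: Cc_pd; exact: Cc_pd. Qed.

Lemma pd_lin (a b : R) f g k x : smooth f -> smooth g ->
 partial k (fun x => a * f x - b * g x) x = a * partial k f x - b * partial k g x.
move=> sf sg; have -> : (fun x => a * f x - b * g x) = fun x => a * f x + (- b) * g x.
 by apply/funext => y; rewrite mulNr.
rewrite pdD ?pdZ ?mulNr//; try exact: sm_diff;
by apply: sm_diff; exact: smoothZ.
Qed.

Lemma pd_diff f g k : smooth f -> smooth g ->
 partial k (fun x => f x - g x) = fun x => partial k f x - partial k g x.
move=> sf sg; apply/funext => y; have := pd_lin 1 1 k y sf sg; rewrite !mul1r => <-.
by congr (partial k _ y); apply/funext => w; rewrite !mul1r.
Qed.

Lemma pd_lap k f : Cc f -> partial k (lap f) = lap (partial k f).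
move=> cf; apply/funext => x.
have E : lap f = fun x => partial 0 (partial 0 f) x + partial 1 (partial 1 f) x + partial 2 (partial 2 f) x by apply/funext => y; rewrite /lap sum3.
have sf : smooth f by exact: Cc_sm.
have s2 i : smooth (partial i (partial i f)) by apply: sm_pd; exact: sm_pd.
rewrite E !pdD; try exact: sm_diff; last by apply: sm_diff; exact: smoothD.
rewrite /lap sum3.
have C i : partial k (partial i (partial i f)) = partial i (partial i (partial k f)) by rewrite Cc_pdC ?(Cc_pdC k i cf)//; exact: Cc_pd.
have CC i := congr1 (fun F : sp -> R => F x) (C i).
exact: (f_equal2 +%R (f_equal2 +%R (CC 0) (CC 1)) (CC 2)).
Qed.

Lemma cucu zeta k i x : Cc zeta ->
 cu (cu (fun j => if j == k then zeta else fun=> 0)) i x =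
 partial i (partial k zeta) x - (i == k)%:R * lap zeta x.
move=> cz; pose v (j : 'I_3) : sp -> R := if j == k then zeta else fun=> 0.
have pv m j : partial m (v j) = fun x => (j == k)%:R * partial m zeta x by apply/funext => y; rewrite /v; case: (j == k); rewrite ?mul1r ?mul0r ?pd_cst.
have cuv m : cu v m = fun x => (m + 2 == k)%:R * partial (m + 1) zeta x - (m + 1 == k)%:R * partial (m + 2) zeta x by apply/funext => y; rewrite /cu !pv.
have sp1 m : smooth (partial m zeta) by apply: sm_pd; exact: Cc_sm.
rewrite -/v {1}/cu !cuv !pd_lin//.
have S m j : partial m (partial j zeta) x = partial j (partial m zeta) x by rewrite Cc_pdC.
by rewrite /lap sum3; exact: (cucu_alg i k (p := fun m j => partial m (partial j zeta) x) S).
Qed.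

Section Field.
Variables (D : set sp) (a : 'I_3 -> sp -> R).
Hypotheses (oD : open D) (bD : bounded_set D) (La : forall i, Lsq D (a i)).

Let mD := mopen oD.

Definition Am phi l := moll (a l \_ D) phi.

Lemma a_itg l : itg3 setT (a l \_ D).
by apply: itg_zext => //; apply: L2_itg_loc => //; exact: fin_D. Qed.

Lemma a_L2 l : Lsq setT (a l \_ D). exact: L2_zext. Qed.

Lemma Am_smooth phi l : Cc phi -> smooth (Am phi l).
by move=> cp; apply: moll_smooth => //; exact: a_itg. Qed.

Lemma Am_pd phi l k : Cc phi -> partial k (Am phi l) = Am (partial k phi) l.
by move=> cp; rewrite /Am moll_pd//; exact: a_itg. Qed.

Lemma Am_int phi l z : Cc phi -> itg3 setT (fun x => (a l \_ D) x * phi (z - x)).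
by move=> cp; apply: L2g_mul => //; [exact: a_L2|apply: L2_reflect; exact: Cc_L2]. Qed.

Lemma AmE phi l z : Am phi l z = \int[leb3]_(x in D) (a l x * phi (z - x)).
rewrite /Am mollE -(int_zext _ mD); apply: eq_int => x _.
by rewrite !patchE; case: ifP; rewrite ?mul0r.
Qed.

Lemma AmB phi psi l z : Cc phi -> Cc psi ->
 Am (fun x => phi x - psi x) l z = Am phi l z - Am psi l z.
move=> cp cs; rewrite /Am !mollE -RintegralB//; [|exact: Am_int|exact: Am_int].
by apply: eq_int => x _; ring.
Qed.

#[local] Opaque Am.

Definition Wm k l phi z := Am (partial k phi) l z - Am (partial l phi) k z.

Hypothesis cca : forall v, (forall i, test_fun D (v i)) ->
 \int[leb3]_(x in D) (\sum_i a i x * cu (cu v) i x) = 0.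

(** The equation [curl curl a = 0] tested with translates of [zeta]. *)
Lemma Am_lap zeta k z : Cc zeta -> test_fun D (fun x => zeta (z - x)) ->
 Am (lap zeta) k z = \sum_i Am (partial i (partial k zeta)) i z.
move=> cz tz; pose g x := zeta (-1 *: x + z).
have gE : g = fun x => zeta (z - x) by apply/funext => x; rewrite /g scaleN1r addrC.
have n1 : (-1 : R) != 0 by rewrite oppr_eq0 oner_eq0.
have cg : Cc g by exact: Cc_affine.
have sz := Cc_sm cz.
have dg m x : partial m g x = - partial m zeta (z - x) by rewrite /g pd_affine// mulN1r scaleN1r [- x + z]addrC.
have ddg m j x : partial j (partial m g) x = partial j (partial m zeta) (z - x).
 have -> : partial m g = fun x => -1 * partial m zeta (-1 *: x + z) by apply/funext => y; rewrite dg mulN1r scaleN1r [- y + z]addrC.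
 have sm : smooth (partial m zeta) by exact: sm_pd. rewrite pdZ; last by apply: sm_diff; exact: sm_affine.
 by rewrite pd_affine// mulrA mulrNN !mul1r scaleN1r [- x + z]addrC.
have /(_ (fun j => if j == k then g else fun=> 0)) := cca.
have -> : (fun x => \sum_i a i x * cu (cu (fun j => if j == k then g else fun=> 0)) i x) =
 fun x => \sum_i a i x * partial i (partial k zeta) (z - x) - a k x * lap zeta (z - x).
 apply/funext => x; under eq_bigr do rewrite cucu// ddg mulrBr.
 rewrite sumrB; congr (_ - _); rewrite (bigD1 k)//= eqxx mul1r big1 ?addr0; last first.
  by move=> j /negPf ->; rewrite mul0r mulr0.
 by rewrite /lap; congr (_ * _); apply: eq_bigr => i _; rewrite ddg.
have I (h : sp -> R) i : Cc h -> itg3 D (fun x => a i x * h (z - x)).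
 move=> ch; apply: L2g_mul => //; apply: (@L2_sub _ setT) => //. by apply: L2_reflect; exact: Cc_L2.
have cp i j : Cc (partial i (partial j zeta)) by apply: Cc_pd; exact: Cc_pd.
rewrite RintegralB//; last 2 first.
- by apply: itg_sum => // i _; exact: I.
- by apply: I; exact: Cc_lap.
rewrite Rint_sum//; last by move=> i _; exact: I.
move=> H; rewrite AmE; under [RHS]eq_bigr do rewrite AmE.
apply/esym/eqP; rewrite -subr_eq0; apply/eqP; apply: H => i; case: ifP => _; last exact: test_0.
by rewrite gE.
Qed.

Lemma test_reflect zeta z k : Cc zeta -> test_fun D (fun x => zeta (z - x)) ->
 test_fun D (fun x => partial k zeta (z - x)).
move=> cz /(test_pd k)/(test_scale (-1)).
have -> // : (fun x => -1 * partial k (fun x => zeta (z - x)) x) = (fun x => partial k zeta (z - x)).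
apply/funext => x; have -> : (fun x => zeta (z - x)) = fun x => zeta (-1 *: x + z).
 by apply/funext => y; rewrite scaleN1r addrC.
by rewrite (@pd_affine _ zeta (-1) z x k (Cc_sm cz)) mulrA mulrNN !mul1r scaleN1r [- x + z]addrC.
Qed.

Lemma Wm_lap zeta k l z : Cc zeta -> test_fun D (fun x => zeta (z - x)) ->
 Wm k l (lap zeta) z = 0.
move=> cz tz; rewrite /Wm (pd_lap k cz) (pd_lap l cz).
have E1 := Am_lap l (Cc_pd k cz) (test_reflect k cz tz).
have E2 := Am_lap k (Cc_pd l cz) (test_reflect l cz tz).
have E3 := congr1 (fun F => \sum_i Am (partial i F) i z) (Cc_pdC l k cz).
by apply/eqP; rewrite subr_eq0; apply/eqP; exact: (etrans E1 (etrans E3 (esym E2))).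
Qed.

Lemma Wm_curl i zeta z : Cc zeta -> test_fun D (fun x => zeta (z - x)) ->
 partial (i + 1) (Wm i (i + 1) zeta) z = partial (i + 2) (Wm (i + 2) i zeta) z.
move=> cz tz; have H := Am_lap i cz tz.
have P m k l : partial m (Wm k l zeta) z = Am (partial m (partial k zeta)) l z - Am (partial m (partial l zeta)) k z.
 have ck j : Cc (partial j zeta) by exact: Cc_pd.
 have E : Wm k l zeta = fun y => 1 * Am (partial k zeta) l y - 1 * Am (partial l zeta) k y.
  have Q (p q : R) : p - q = 1 * p - 1 * q by rewrite !mul1r. by apply/funext => y; exact: Q.
 have E1 := congr1 (fun F : sp -> R => F z) (Am_pd l m (ck k)).
 have E2 := congr1 (fun F : sp -> R => F z) (Am_pd k m (ck l)).
 have E3 := pd_lin 1 1 m z (Am_smooth l (ck k)) (Am_smooth k (ck l)).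
 have Q (p q p' q' s : R) : s = 1 * p - 1 * q -> p = p' -> q = q' -> s = p' - q' by move=> -> -> ->; rewrite !mul1r.
 rewrite E; exact: Q E3 E1 E2.
have P1 := P (i + 1) i (i + 1); have P2 := P (i + 2) (i + 2) i.
have L : Am (lap zeta) i z = \sum_j Am (partial j (partial j zeta)) i z.
 rewrite AmE; under [RHS]eq_bigr do rewrite AmE. rewrite -Rint_sum//; last first.
  move=> j _; apply: L2g_mul => //; apply: (@L2_sub _ setT) => //; apply: L2_reflect.
  by apply: Cc_L2; apply: Cc_pd; exact: Cc_pd.
 by apply: eq_int => x _; rewrite mulr_sumr.
pose p m j l := Am (partial m (partial j zeta)) l z.
have HL : p 0 0 i + p 1 1 i + p 2 2 i = p 0 i 0 + p 1 i 1 + p 2 i 2 :=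
 etrans (esym (sum3 (fun j => p j j i))) (etrans (etrans (esym L) H) (sum3 (fun j => p j i j))).
exact: (etrans P1 (etrans (Am_alg HL) (esym P2))).
Qed.

Lemma pd_scale (b c : R) f i : smooth f ->
 partial i (fun x => b * f (c *: x)) = fun x => b * c * partial i f (c *: x).
move=> sf; apply/funext => x.
have E : (fun x => f (c *: x)) = fun x => f (c *: x + 0) by apply/funext => y; rewrite addr0.
have s1 : smooth (fun x => f (c *: x)) by rewrite E; exact: sm_affine.
rewrite pdZ; last exact: sm_diff.
by rewrite E pd_affine// addr0 mulrA.
Qed.

Lemma sm_scale (b c : R) f : smooth f -> smooth (fun x => b * f (c *: x)).
move=> sf; apply: smoothZ; have := sm_affine c 0 sf.
by have -> : (fun x => f (c *: x + 0)) = fun x => f (c *: x) by apply/funext => y; rewrite addr0.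
Qed.

Definition newt_d (d : R) x := d^-1 * newton (d^-1 *: x).
Definition rho_d (d : R) x := d^-1 ^+ 3 * rho (d^-1 *: x).

Lemma lap_newt_d d : lap (newt_d d) = rho_d d.
apply/funext => x; have sn := @sm_newton R.
have E i : partial i (partial i (newt_d d)) x = d^-1 ^+ 3 * partial i (partial i newton) (d^-1 *: x).
 rewrite /newt_d pd_scale// pd_scale; last exact: sm_pd. by rewrite !exprS expr0 mulr1 mulrA.
by rewrite /lap (eq_bigr _ (fun i _ => E i)) -mulr_sumr.
Qed.

Lemma rho_d0 d h : 0 < d -> 2 * d <= `|h| -> rho_d d h = 0.
move=> d0 hd; rewrite /rho_d rho_0 ?mulr0// normrZ gtr0_norm ?invr_gt0//.
by rewrite mulrC ler_pdivlMr.
Qed.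

Lemma Cc_rho_d d : 0 < d -> Cc (rho_d d).
move=> d0; split; first by apply: sm_scale; exact: Cc_sm (@Cc_rho R).
by exists (2 * d) => x /ltW; exact: rho_d0.
Qed.

Lemma newt_d_far (d d' : R) h : 0 < d -> 0 < d' -> 2 * d <= `|h| -> 2 * d' <= `|h| ->
 newt_d d h = newt_d d' h.
have H (t : R) : 0 < t -> 2 * t <= `|h| -> newt_d t h ^+ 2 = (rsq h)^-1.
 move=> t0 ht; rewrite /newt_d exprMn newton_sq pot_den_far; last first.
  by apply/ltW/rsq_far; rewrite normrZ gtr0_norm ?invr_gt0// mulrC ler_pdivlMr.
 rewrite rsqZ invfM mulrA -exprVn invrK -exprMn mulVf ?gt_eqF// expr1n mul1r//.
move=> d0 d'0 h1 h2; have p (t : R) : 0 < t -> 0 <= newt_d t h.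
 by move=> t0; rewrite mulr_ge0 ?invr_ge0 ?(ltW t0)// ltW// newton_gt0.
have Q (u v : R) : 0 <= u -> 0 <= v -> u ^+ 2 = v ^+ 2 -> u = v by move=> u0 v0 /eqP; rewrite eqrXn2// => /eqP.
exact: Q (p _ d0) (p _ d'0) (etrans (H _ d0 h1) (esym (H _ d'0 h2))).
Qed.

Definition adm z (d : R) := 0 < d /\ forall x, `|x - z| <= 2 * d -> D x.

Lemma test_ball z d zeta : adm z d -> Cc zeta -> (forall h, 2 * d <= `|h| -> zeta h = 0) ->
 test_fun D (fun x => zeta (z - x)).
move=> [d0 dD] cz z0; apply: (@test_funP _ _ _ [set x | `|x - z| <= 2 * d]).
- have -> : (fun x => zeta (z - x)) = fun x => zeta (-1 *: x + z).
  by apply/funext => y; rewrite scaleN1r addrC.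
 by apply: sm_affine; exact: Cc_sm.
- exact: cball_compact.
- by move=> x; exact: dD.
- by move=> x /negP; rewrite -ltNge => /ltW xz; apply: z0; rewrite distrC.
Qed.

Let kappa : R := \int[leb3]_x rho x.

(** Up to a universal factor the mollified curl of [a]; by harmonicity it does
    not depend on the radius. *)
Definition cc (d : R) (i : 'I_3) z := kappa^-1 * Wm (i + 1) (i + 2) (rho_d d) z.

Lemma Wm_smooth k l phi : Cc phi -> smooth (Wm k l phi).
by move=> cp; apply: smoothB; apply: Am_smooth; exact: Cc_pd. Qed.

Lemma cc_smooth d i : 0 < d -> smooth (cc d i).
by move=> d0; apply: smoothZ; apply: Wm_smooth; exact: Cc_rho_d. Qed.

(** Both radii give the mean of the same harmonic function: the difference of
    the two kernels is the Laplacian of a test function. *)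
Lemma cc_indep z d d' i : adm z d -> adm z d' -> cc d i z = cc d' i z.
wlog dd : d d' / d <= d'.
 move=> H h1 h2; have [|/ltW] := leP d d'; first by move=> ?; exact: H. by move=> ?; apply/esym; exact: H.
move=> h1 h2; have [d0 _] := h1; have [d'0 _] := h2.
suff E : Wm (i + 1) (i + 2) (rho_d d) z = Wm (i + 1) (i + 2) (rho_d d') z.
 exact: (congr1 (fun t => kappa^-1 * t) E).
pose zeta x := newt_d d x - newt_d d' x.
have sn t : smooth (newt_d t) by apply: sm_scale; exact: sm_newton.
have z0 h : 2 * d' <= `|h| -> zeta h = 0.
 move=> hd; rewrite /zeta (newt_d_far d0 d'0) ?subrr//. by apply: le_trans hd; rewrite ler_pM2l.
have cz : Cc zeta by split; [exact: smoothB|exists (2 * d') => x /ltW; exact: z0].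
have L : lap zeta = fun x => rho_d d x - rho_d d' x.
 apply/funext => x; rewrite -!lap_newt_d /lap -sumrB; apply: eq_bigr => j _.
 by rewrite /zeta pd_diff// pd_diff//; exact: sm_pd.
have W0 := Wm_lap (i + 1) (i + 2) cz (test_ball h2 cz z0).
have cr t : 0 < t -> Cc (rho_d t) by exact: Cc_rho_d.
have AL k l : Am (partial k (lap zeta)) l z = Am (partial k (rho_d d)) l z - Am (partial k (rho_d d')) l z.
 rewrite -AmB; [|exact: Cc_pd (cr _ d0)|exact: Cc_pd (cr _ d'0)].
 congr (Am _ l z); rewrite L; exact: pd_diff (Cc_sm (cr _ d0)) (Cc_sm (cr _ d'0)).
have Q (p q p' q' s t : R) : s - t = 0 -> s = p - p' -> t = q - q' -> p - q = p' - q' by move=> H E1 E2; rewrite E1 E2 in H; lra.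
exact: Q W0 (AL _ _) (AL _ _).
Qed.

Lemma cc_curl z d k l : adm z d -> partial k (cc d l) z = partial l (cc d k) z.
move=> hz; have [d0 _] := hz; have cr := Cc_rho_d d0.
have tr := test_ball hz cr (fun h => rho_d0 d0).
have H i : partial (i + 1) (cc d (i + 2)) z = partial (i + 2) (cc d (i + 1)) z.
 have s k' l' : differentiable (Wm k' l' (rho_d d)) z by apply: sm_diff; exact: Wm_smooth.
 have W := Wm_curl i cr tr. have I2 : (i + 2) + 1 = i :> 'I_3 by apply: val_inj; elim/ord3 : (i).
 have I3 : (i + 2) + 2 = i + 1 :> 'I_3 by apply: val_inj; elim/ord3 : (i).
 have I4 : (i + 1) + 1 = i + 2 :> 'I_3 by apply: val_inj; elim/ord3 : (i).
 have I5 : (i + 1) + 2 = i :> 'I_3 by apply: val_inj; elim/ord3 : (i).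
 have E1 : partial (i + 1) (cc d (i + 2)) z = kappa^-1 * partial (i + 1) (Wm ((i + 2) + 1) ((i + 2) + 2) (rho_d d)) z by apply: pdZ; exact: s.
 have E2 : partial (i + 2) (cc d (i + 1)) z = kappa^-1 * partial (i + 2) (Wm ((i + 1) + 1) ((i + 1) + 2) (rho_d d)) z by apply: pdZ; exact: s.
 rewrite I2 I3 in E1; rewrite I4 I5 in E2. exact: (etrans E1 (etrans (congr1 ( *%R kappa^-1) W) (esym E2))).
have H0 := H 0; have H1 := H 1; have H2 := H 2; rewrite !ord3E in H0 H1 H2.
elim/ord3 : k; elim/ord3 : l; [exact: erefl|exact: H2|exact: esym H1|exact: esym H2|
 exact: erefl|exact: H0|exact: H1|exact: esym H0|exact: erefl].
Qed.

Lemma adm_local z : D z -> exists2 d : R, 0 < d & forall y, `|y - z| <= d -> adm y d.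
move=> Dz; have [r r0 rD] := open_ball_sub oD Dz.
have r4 : 0 < r / 4 by rewrite divr_gt0.
exists (r / 4) => // y yz; split => // x xy; apply: rD => /=.
by have := ler_distD y x z; lra.
Qed.

End Field.
End Convolution.

(** * Potentials on simply connected domains *)
Section Potentials.
Context {R : realType}.
Local Notation sp := (R * R * R)%type.
Local Notation leb := (@leb1 R).
Implicit Types (f g phi : sp -> R) (x y h e z : sp) (D U : set sp).

Lemma ftc1 (F g : R -> R) : (forall s : R, is_derive s (1 : R) F (g s)) -> continuous g ->
 \int[leb]_(s in `[0, 1]) g s = F 1 - F 0.
move=> dF cg; have cF : continuous F.
 move=> s; apply: differentiable_continuous; apply/derivable1_diffP. by have [] := dF s.
rewrite /Rintegral (@continuous_FTC2 R g F 0 1 ltr01)//.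
- exact: continuous_subspaceT.
- split; first by move=> s _; have [] := dF s.
 + exact/cvg_at_right_filter/cF.
 + exact/cvg_at_left_filter/cF.
- by move=> s _; rewrite derive1E; have [_ ->] := dF s.
Qed.

Lemma cont_comp_line phi x h : continuous phi -> continuous (fun s : R => phi (x + s *: h)).
by move=> cp s; apply: (continuous_comp (@cont_line _ x h s)); exact: cp. Qed.

Lemma cont_sum3 (F : 'I_3 -> R -> R) : (forall k, continuous (F k)) -> continuous (fun s => \sum_k F k s).
move=> cF; have -> : (fun s => \sum_k F k s) = fun s => F 0 s + F 1 s + F 2 s.
 by apply/funext => s; rewrite sum3.
by move=> s; apply: cvgD; [apply: cvgD|]; exact: cF.
Qed.

Definition lin_int (c : 'I_3 -> sp -> R) x y : R :=
 \int[leb]_(s in `[0, 1]) (\sum_k crd (y - x) k * c k (x + s *: (y - x))).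

Lemma ball_seg z (r : R) x y (s : R) : ball z r x -> ball z r y -> 0 <= s <= 1 -> ball z r (x + s *: (y - x)).
rewrite -!ballE/= => zx zy /andP[s0 s1].
rewrite (_ : z - (x + s *: (y - x)) = (1 - s) *: (z - x) + s *: (z - y)); last first.
 by apply: sp_ext => /=; rewrite -?[_ *: _ : R]/(_ * _)/=; ring.
apply: le_lt_trans (ler_normD _ _) _; rewrite !normrZ ger0_norm ?subr_ge0// ger0_norm//.
have [->|sn] := eqVneq s 0; first by rewrite subr0 mul1r mul0r addr0.
have sp0 : 0 < s by rewrite lt_neqAle eq_sym sn.
rewrite -[ltRHS](_ : (1 - s) * r + s * r = r); last by ring.
by apply: ler_ltD; [rewrite ler_wpM2l ?subr_ge0// ltW|rewrite ltr_pM2l].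
Qed.

Lemma lin_int_grad c z (r : R) G x y : smooth G -> (forall w, ball z r w -> forall k, partial k G w = c k w) ->
 ball z r x -> ball z r y -> lin_int c x y = G y - G x.
move=> sG Gc zx zy; have := @ftc_line R G x (y - x) 1 ler01 sG.
have -> : x + 1 *: (y - x) = y by rewrite scale1r addrC subrK.
move=> <-; apply: eq_int => s; rewrite inE/= in_itv/= => s01.
by apply: eq_bigr => k _; rewrite Gc//; exact: ball_seg.
Qed.

(** Poincare lemma on a ball. *)
Lemma local_potential (C : 'I_3 -> sp -> R) z (r : R) : 0 < r -> (forall k, smooth (C k)) ->
 (forall y, ball z r y -> forall k l, partial l (C k) y = partial k (C l) y) ->
 exists2 G, smooth G & forall y, ball z r y -> forall k, partial k G y = C k y.
move=> r0 sC curl; have r2 : 0 < r * 2 by rewrite mulr_gt0.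
pose B k y := cut z (r * 2) y * C k y.
have cB k : Cc (B k) by apply: CcM => //; exact: Cc_cut.
have BC y : ball z r y -> \forall w \near y, forall k, B k w = C k w.
 move=> zy; have : nbhs y (ball z r : set sp) by apply: open_nbhs_nbhs; split => //; exact: ball_open.
 apply: filterS => w; rewrite -ballE/= distrC => /ltW zw k. by rewrite /B cut_1 ?mul1r// mulfK.
have BC1 y k : ball z r y -> B k y = C k y by move=> /BC /nbhs_singleton.
have dB y k l : ball z r y -> partial l (B k) y = partial l (C k) y by move=> /BC H; apply: near_pd; move: H; apply: filterS => w; exact.
pose E := (`[0, 1]%classic : set R); have mE : measurable E by exact: measurable_itv.
have i1 : itg leb E (fun=> 1 : R) by apply: cont_itg01 => s; exact: cvg_cst.
pose ga (s : R) : sp := (1 - s) *: z.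
have gaE (s : R) y : s *: y + ga s = z + s *: (y - z) by apply: sp_ext => /=; rewrite -?[_ *: _ : R]/(_ * _)/=; ring.
have mal : measf E (fun s : R => s) by exact: measurable_id.
have al1 (s : R) : E s -> `|s| <= 1 by rewrite /E/= in_itv/= => /andP[s0 s1]; rewrite ger0_norm.
have mc phi y : continuous phi -> measf E (fun s : R => phi (s *: y + ga s)).
 move=> cp; apply: measurable_funTS; apply: continuous_measurable_fun.
 have -> : (fun s : R => phi (s *: y + ga s)) = fun s : R => phi (z + s *: (y - z)) by apply/funext => s; rewrite gaE.
 exact: cont_comp_line.
pose P k := pint leb E (fun s : R => s) ga (fun=> 1) (B k).
have sP k : smooth (P k) by apply: pint_smooth.
have PE k y : P k y = \int[leb]_(s in `[0, 1]) B k (z + s *: (y - z)) by apply: eq_int => s _; rewrite mul1r gaE.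
have dP i k y : partial i (P k) y = \int[leb]_(s in `[0, 1]) (s * partial i (B k) (z + s *: (y - z))).
 have Q : partial i (P k) = pint leb E (fun s : R => s) ga (fun s => 1 * s) (partial i (B k)).
  exact: pint_pd.
 by rewrite Q; apply: eq_int => s _; rewrite mul1r gaE.
pose G y := \sum_k (crd y k - crd z k) * P k y.
have slin k : smooth (fun y => crd y k - crd z k) by apply: smoothB; [exact: sm_crd|exact: sm_cst].
exists G; first by apply: sm_sum => k _; apply: smoothM.
move=> y zy i.
have plin k : partial i (fun y => crd y k - crd z k) y = (k == i)%:R.
 rewrite (@pdD _ (crd^~ k) (fun=> - crd z k)) ?pd_cst ?addr0 ?pd_crd; [|by have [] := crd_diff k y|exact: differentiable_cst].
 by clear; elim/ord3 : k; elim/ord3 : i; rewrite crdE.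
have dG : partial i G y = \sum_k ((crd y k - crd z k) * partial i (P k) y + P k y * (k == i)%:R).
 have dM k : differentiable (fun y => (crd y k - crd z k) * P k y) y by apply: sm_diff; exact: smoothM.
 have -> : G = fun y => (crd y 0 - crd z 0) * P 0 y + (crd y 1 - crd z 1) * P 1 y + (crd y 2 - crd z 2) * P 2 y by apply/funext => w; rewrite /G sum3.
 have d01 : differentiable (fun y => (crd y 0 - crd z 0) * P 0 y + (crd y 1 - crd z 1) * P 1 y) y by apply: sm_diff; apply: smoothD; exact: smoothM.
 rewrite (pdD i d01 (dM 2)) (pdD i (dM 0) (dM 1)) sum3.
 have M k : partial i (fun y => (crd y k - crd z k) * P k y) y =
   (crd y k - crd z k) * partial i (P k) y + P k y * (k == i)%:R.
  by rewrite pdM ?plin//; exact: sm_diff.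
 exact: (f_equal2 +%R (f_equal2 +%R (M 0) (M 1)) (M 2)).
have SP : \sum_k P k y * (k == i)%:R = P i y.
 rewrite (bigD1 i)//= eqxx mulr1 big1 ?addr0// => j /negPf ->. by rewrite mulr0.
have cBl k : continuous (fun s : R => B k (z + s *: (y - z))) by apply: cont_comp_line; apply: sm_cont; exact: Cc_sm.
have cdB k : continuous (fun s : R => partial i (B k) (z + s *: (y - z))) by apply: cont_comp_line; apply: sm_cont; apply: sm_pd; exact: Cc_sm.
have cdB' k : continuous (fun s : R => partial k (B i) (z + s *: (y - z))) by apply: cont_comp_line; apply: sm_cont; apply: sm_pd; exact: Cc_sm.
rewrite dG big_split/= SP PE.
under eq_bigr do rewrite dP.
have csB k : continuous (fun s : R => s * partial i (B k) (z + s *: (y - z))) by move=> s; apply: cvgM; [exact: cvg_id|exact: cdB].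
have -> : \sum_k (crd y k - crd z k) * \int[leb]_(s in `[0, 1]) (s * partial i (B k) (z + s *: (y - z))) =
 \int[leb]_(s in `[0, 1]) (\sum_k (crd y k - crd z k) * (s * partial i (B k) (z + s *: (y - z)))).
 rewrite Rint_sum//; last by move=> k _; apply: itgZ => //; exact: cont_itg01.
 by apply: eq_bigr => k _; rewrite RintZ//; exact: cont_itg01.
rewrite -RintegralD//; last 2 first.
- by apply: itg_sum => // k _; apply: itgZ => //; exact: cont_itg01.
- exact: cont_itg01.
pose F (s : R) := s * B i (z + s *: (y - z)).
pose g (s : R) := \sum_k (crd (y - z) k * (s * partial k (B i) (z + s *: (y - z)))) + B i (z + s *: (y - z)).
have dF (s : R) : is_derive s (1 : R) F (g s).
 have sB := Cc_sm (cB i). have df : derivable (B i) (z + s *: (y - z)) (y - z) by exact: sm_derivable.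
 have := line_derive df; rewrite derive_pd; last exact: sm_diff.
 move=> D1; have D0 : is_derive s (1 : R) (id : R -> R) (1 : R) by exact: is_derive_id.
 have := is_deriveM D0 D1; rewrite /F /g.
 have -> : \sum_k crd (y - z) k * (s * partial k (B i) (z + s *: (y - z))) + B i (z + s *: (y - z)) =
  s *: (\sum_k crd (y - z) k * partial k (B i) (z + s *: (y - z))) + B i (z + s *: (y - z)) *: (1 : R).
  rewrite -[_ *: 1]/(_ * _) -[_ *: \sum_k _]/(_ * _) mulr1 mulr_sumr; congr (_ + _).
  by apply: eq_bigr => k _; rewrite mulrCA.
 by [].
have cg : continuous g.
 move=> s; apply: cvgD; last exact: cBl.
 apply: (@cont_sum3 (fun k s => crd (y - z) k * (s * partial k (B i) (z + s *: (y - z))))) => k t.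
 by apply: cvgM; [exact: cvg_cst|apply: cvgM; [exact: cvg_id|exact: cdB']].
have F1 : F 1 - F 0 = C i y by rewrite /F mul0r subr0 mul1r scale1r [z + _]addrC subrK; exact: BC1.
apply: (etrans _ F1); apply: (etrans _ (ftc1 dF cg)).
apply: eq_int => s; rewrite inE/= in_itv/= => s01; rewrite /g; congr (_ + _).
have zz : ball z r z by apply: ballxx.
have bs := ball_seg zz zy s01.
apply: eq_bigr => k _; rewrite crdD crdN !dB// curl//.
Qed.

Section Monodromy.
Variables (D : set sp) (c : 'I_3 -> sp -> R).
Hypothesis oD : open D.

Definition pot_on z (r : R) G := [/\ smooth G, ball z r `<=` D &
 forall w, ball z r w -> forall k, partial k G w = c k w].

Hypothesis lp : forall z, D z -> exists (r : R) G, 0 < r /\ pot_on z r G.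

Local Notation I01 := (`[0 : R, 1 : R]%classic).
Local Notation I2 := (I01 `*` I01).

Lemma I2_compact : compact (I2 : set (R * R)).
by apply: compact_setX; exact: segment_compact. Qed.

(** Uniformly fine pieces of a continuous image of the square lie in balls with
    a potential. *)
Lemma fine_cells (H : R * R -> sp) : {within I2, continuous H} -> H @` I2 `<=` D ->
 exists2 d : R, 0 < d & forall u, I2 u -> exists z r G, pot_on z r G /\
  forall v, I2 v -> `|u - v| < d -> ball z r (H v).
move=> cH HD.
have H0 : \forall d \near (0 : R)^'+, I2 `<=` [set u | exists z r G, pot_on z r G /\
  forall v, I2 v -> `|u - v| < d -> ball z r (H v)].
 have /compact_near_coveringP nc := I2_compact. apply: nc => u Iu; have Du : D (H u) by apply: HD; exists u.
 have [r [G [r0 PG]]] := lp Du. have : nbhs (H u) (ball (H u) r : set sp) by exact: nbhsx_ballx.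
 have cu' : H @ within I2 (nbhs u) --> H u by move/subspace_continuousP : cH; exact.
 move=> /cu' /nbhs_ballP[e /= e0 He]. have e2 : 0 < e / 2 by rewrite divr_gt0.
 exists (ball u (e / 2), [set d : R | d < e / 2]) => /=.
  by split; [exact: nbhsx_ballx|exact: nbhs_right_lt].
 move=> [w d] /= []; rewrite -ballE/= => uw de; exists (H u), r, G; split => // v Iv wv.
 apply: He => //; rewrite -ballE/=; have := ler_distD w u v; lra.
near (0 : R)^'+ => d.
have d0 : 0 < d by near: d; exact: nbhs_right_gt.
exists d => // u Iu.
have Hd : I2 `<=` [set u | exists z r G, pot_on z r G /\
  forall v, I2 v -> `|u - v| < d -> ball z r (H v)] by near: d.
exact: Hd.
Unshelve. all: by end_near. Qed.

Definition psum (p : R -> sp) (n : nat) : R :=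
 \sum_(0 <= k < n) lin_int c (p (k%:R / n%:R)) (p (k.+1%:R / n%:R)).

Lemma grid01 (n k : nat) : (0 < n)%N -> (k <= n)%N -> 0 <= (k%:R / n%:R : R) <= 1.
move=> n0 kn; have np : 0 < n%:R :> R by rewrite ltr0n.
by rewrite divr_ge0//= ler_pdivrMr// mul1r ler_nat.
Qed.

Lemma grid_step (n k : nat) : (0 < n)%N -> (k.+1%:R / n%:R : R) = k%:R / n%:R + n%:R^-1.
by move=> n0; rewrite -natr1 mulrDl mul1r. Qed.

Lemma fine_nat (d : R) : 0 < d -> exists2 N : nat, (0 < N)%N & forall n, (N <= n)%N -> n%:R^-1 < d.
move=> d0; exists (Num.bound d^-1).+1 => // n Nn.
have n0 : 0 < n%:R :> R by rewrite ltr0n (leq_trans _ Nn).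
rewrite -[ltRHS]invrK ltf_pV2 ?posrE ?invr_gt0//.
apply: lt_le_trans (archi_boundP _) _; first by rewrite invr_ge0 ltW.
by rewrite ler_nat (leq_trans _ Nn).
Qed.

Lemma lin_intxx x : lin_int c x x = 0.
rewrite /lin_int subrr /Rintegral integral0_eq// => s _; congr EFin.
by rewrite big1// => k _; rewrite /crd; elim/ord3 : k; rewrite mul0r.
Qed.

Lemma contractible_sum (p : R -> sp) (H : R * R -> sp) :
 {within I2, continuous H} -> H @` I2 `<=` D ->
 (forall s : R, 0 <= s <= 1 -> H (s, 0) = p s) ->
 (forall s : R, 0 <= s <= 1 -> H (s, 1) = p 0) ->
 (forall t : R, 0 <= t <= 1 -> H (0, t) = p 0 /\ H (1, t) = p 0) ->
 exists2 N : nat, (0 < N)%N & forall n, (N <= n)%N -> psum p n = 0.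
move=> cH HD Hb Ht Hs; have [d d0 Hd] := fine_cells cH HD.
have [N N0 HN] := fine_nat d0; exists N => // n Nn.
have n0 : (0 < n)%N by exact: leq_trans Nn.
have nd := HN n Nn; have ni : 0 <= n%:R^-1 :> R by rewrite invr_ge0.
pose g (k : nat) : R := k%:R / n%:R.
have g01 k : (k <= n)%N -> 0 <= g k <= 1 by exact: grid01.
pose row j := \sum_(0 <= k < n) lin_int c (H (g k, g j)) (H (g k.+1, g j)).
pose V k j := lin_int c (H (g k, g j)) (H (g k, g j.+1)).
have cell k j : (k < n)%N -> (j < n)%N ->
  lin_int c (H (g k, g j)) (H (g k.+1, g j)) + V k.+1 j = V k j + lin_int c (H (g k, g j.+1)) (H (g k.+1, g j.+1)).
 move=> kn jn.
 have I a b : (a <= n)%N -> (b <= n)%N -> I2 (g a, g b) by move=> an bn; split; rewrite /= in_itv/=; exact: g01.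
 have [z [r [G [[sG bD Gc] Hv]]]] := Hd _ (I k j (ltnW kn) (ltnW jn)).
 have near a b : (a = k \/ a = k.+1) -> (b = j \/ b = j.+1) -> ball z r (H (g a, g b)).
  have e m : `|g m - g m.+1| = n%:R^-1 by rewrite /g grid_step// opprD addrA subrr add0r normrN ger0_norm.
  move=> ha hb; apply: Hv.
   by apply: I; [case: ha => ->//; exact: ltnW|case: hb => ->//; exact: ltnW].
  rewrite prod_normE/= gt_max; apply/andP; split.
   by case: ha => ->; rewrite ?e// subrr normr0.
  by case: hb => ->; rewrite ?e// subrr normr0.
 have L x y := lin_int_grad (x := x) (y := y) sG Gc.
 have n1 := near k j (or_introl erefl) (or_introl erefl).
 have n2 := near k.+1 j (or_intror erefl) (or_introl erefl).
 have n3 := near k j.+1 (or_introl erefl) (or_intror erefl).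
 have n4 := near k.+1 j.+1 (or_intror erefl) (or_intror erefl). by rewrite /V !L//; ring.
have g0 : g 0%N = 0 by rewrite /g mul0r.
have gn : g n = 1 by rewrite /g divff// pnatr_eq0 -lt0n.
have rowS j : (j < n)%N -> row j = row j.+1.
 move=> jn.
 have tel : forall m, (m <= n)%N -> \sum_(0 <= k < m) lin_int c (H (g k, g j)) (H (g k.+1, g j)) + V m j =
   V 0%N j + \sum_(0 <= k < m) lin_int c (H (g k, g j.+1)) (H (g k.+1, g j.+1)).
  elim=> [|m IH] mn; first by rewrite !big_geq// add0r addr0.
  rewrite !big_nat_recr//= -addrA cell//; have := IH (ltnW mn); lra.
 have := tel n (leqnn n); rewrite -/(row j) -/(row j.+1).
 have [a1 a2] := Hs _ (g01 j (ltnW jn)); have [b1 b2] := Hs _ (g01 j.+1 jn).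
 by rewrite /V g0 gn a1 a2 b1 b2 lin_intxx addr0 add0r.
have row0 : row 0%N = psum p n.
 apply: eq_big_nat => k /andP[_ kn]; rewrite g0 !Hb//; first exact: (g01 k.+1). exact: (g01 k (ltnW kn)).
have rown : row n = 0.
 rewrite /row big_nat big1// => k /andP[_ kn]; rewrite gn !Ht ?lin_intxx//; first exact: (g01 k.+1).
 exact: (g01 k (ltnW kn)).
have : forall m, (m <= n)%N -> row 0%N = row m by elim=> // m IH mn; rewrite IH ?(ltnW mn)// rowS.
by move=> /(_ n (leqnn n)); rewrite row0 rown.
Qed.

(** Uniformly short pieces of a path lie in balls with a potential. *)
Lemma fine_path (p : R -> sp) : {within I01, continuous p} -> p @` I01 `<=` D ->
 exists2 N : nat, (0 < N)%N & forall n k, (N <= n)%N -> (k < n)%N -> exists z r G, pot_on z r G /\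
  forall s : R, I01 s -> `|k%:R / n%:R - s| <= n%:R^-1 -> ball z r (p s).
move=> cp pD; pose H (u : R * R) := p u.1.
have cH : {within I2, continuous H}.
 apply/subspace_continuousP => u [u1 u2] A.
 move/subspace_continuousP : cp => /(_ u.1 u1) cpu /cpu /nbhs_ballP[e/= e0 He].
 apply/nbhs_ballP; exists e => //= v uv [v1 v2]; apply: He => //; by case: uv.
have HD : H @` I2 `<=` D by move=> _ [[a b] [/= ha _] <-]; apply: pD; exists a.
have [d d0 Hd] := fine_cells cH HD.
have [N N0 HN] := fine_nat d0; exists N => // n k Nn kn.
have n0 : (0 < n)%N by exact: leq_trans Nn.
have I0 : I2 (k%:R / n%:R, 0) by split; rewrite /= in_itv//= ?lexx ?ler01//; exact: grid01 n0 (ltnW kn).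
have [z [r [G [PG Hv]]]] := Hd _ I0; exists z, r, G; split => // s Is sk.
have q : ball z r (H (s, 0)).
 apply: Hv; first by split; rewrite //= in_itv/= lexx ler01.
 by rewrite prod_normE/= subrr normr0 gt_max d0 andbT (le_lt_trans sk)// HN.
by [].
Qed.

(** The sums along a path do not depend on the subdivision once it is fine. *)
Lemma psum_refine (p : R -> sp) : {within I01, continuous p} -> p @` I01 `<=` D ->
 exists2 N : nat, (0 < N)%N & forall n m, (N <= n)%N -> (0 < m)%N -> psum p (n * m) = psum p n.
move=> cp pD; have [N N0 HN] := fine_path cp pD; exists N => // n m Nn m0.
have n0 : (0 < n)%N by exact: leq_trans Nn.
have nm0 : (0 < n * m)%N by rewrite muln_gt0 n0.
have nz : n%:R != 0 :> R by rewrite pnatr_eq0 -lt0n.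
have mz : m%:R != 0 :> R by rewrite pnatr_eq0 -lt0n.
pose g (k : nat) : R := k%:R / (n * m)%:R.
have gE k j : g (k * m + j)%N = k%:R / n%:R + j%:R / (n * m)%:R by rewrite /g natrD !natrM mulrDl; congr (_ + _); field; rewrite nz mz.
have block k : (k < n)%N -> \sum_(0 <= j < m) lin_int c (p (g (k * m + j)%N)) (p (g (k * m + j).+1)) =
  lin_int c (p (k%:R / n%:R)) (p (k.+1%:R / n%:R)).
 move=> kn; have [z [r [G [[sG bD Gc] Hv]]]] := HN n k Nn kn.
 have inb j : (j <= m)%N -> ball z r (p (g (k * m + j)%N)).
  move=> jm; apply: Hv.
   rewrite /= in_itv/=; apply: grid01 => //. apply: (@leq_trans (k * m + m)); first by rewrite leq_add2l.
   by rewrite -mulSnr leq_mul2r kn orbT.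
  rewrite gE opprD addrA subrr add0r normrN ger0_norm ?divr_ge0//.
  have -> : (j%:R / (n * m)%:R : R) = (j%:R / m%:R) * n%:R^-1 by rewrite natrM; field; rewrite nz mz.
  by rewrite ler_piMl ?invr_ge0// ler_pdivrMr ?ltr0n// mul1r ler_nat.
 have L x y := lin_int_grad (x := x) (y := y) sG Gc.
 have tel : forall i, (i <= m)%N -> \sum_(0 <= j < i) lin_int c (p (g (k * m + j)%N)) (p (g (k * m + j).+1)) =
   G (p (g (k * m + i)%N)) - G (p (g (k * m)%N)).
  elim=> [|i IH] im; first by rewrite big_geq// addn0 subrr.
  rewrite big_nat_recr//= IH ?(ltnW im)// L; [rewrite -addnS; ring|exact: inb (ltnW im)|].
  by rewrite -addnS; exact: inb.
 have g0 : g (k * m)%N = k%:R / n%:R by have := gE k 0%N; rewrite addn0 mul0r addr0.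
 have g1 : g (k * m + m)%N = k.+1%:R / n%:R by rewrite gE grid_step// natrM; congr (_ + _); field; rewrite nz mz.
 rewrite tel// L ?g0 ?g1//; first by rewrite -g0; have := inb 0%N (leq0n _); rewrite addn0.
 by rewrite -g1; exact: inb.
have all : forall k, (k <= n)%N -> \sum_(0 <= i < k * m) lin_int c (p (g i)) (p (g i.+1)) =
  \sum_(0 <= i < k) lin_int c (p (i%:R / n%:R)) (p (i.+1%:R / n%:R)).
 elim=> [|k IH] kn; first by rewrite mul0n !big_geq.
 rewrite (@big_cat_nat _ _ _ (k * m))//=; last by rewrite leq_mul2r leqnSn orbT.
 rewrite IH ?(ltnW kn)// big_nat_recr//= -block//; congr (_ + _).
 rewrite -{1}[(k * m)%N]add0n big_addn mulSn addnK. by apply: eq_bigr => j _; rewrite addnC.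
exact: all.
Qed.

Definition clamp (s : R) : R := (`|s| - `|s - 1| + 1) / 2.

Lemma clamp0 (s : R) : s <= 0 -> clamp s = 0.
move=> s0; rewrite /clamp ler0_norm// ler0_norm; last by rewrite subr_le0 (le_trans s0).
by field.
Qed.

Lemma clamp1 (s : R) : 1 <= s -> clamp s = 1.
move=> s1; rewrite /clamp ger0_norm; last exact: le_trans s1.
by rewrite ger0_norm ?subr_ge0//; field.
Qed.

Lemma clamp_id (s : R) : 0 <= s <= 1 -> clamp s = s.
by move=> /andP[s0 s1]; rewrite /clamp ger0_norm// ler0_norm ?subr_le0//; field.
Qed.

Lemma clamp01 (s : R) : 0 <= clamp s <= 1.
have [/clamp0 ->|/ltW s0] := leP s 0; first by rewrite lexx ler01.
have [s1|/ltW s1] := leP s 1; last by rewrite clamp1// lexx ler01.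
by rewrite clamp_id s0 s1.
Qed.

Lemma clamp_cont (a b : R) : continuous (fun s => clamp (a * s + b)).
have ca : continuous (fun s : R => a * s + b) by move=> t; apply: cvgD; [apply: cvgM; [exact: cvg_cst|exact: cvg_id]|exact: cvg_cst].
move=> s; apply: cvgM; last exact: cvg_cst.
apply: cvgD; last exact: cvg_cst.
apply: cvgB; first by apply: cvg_norm; exact: ca.
by apply: cvg_norm; apply: cvgB; [exact: ca|exact: cvg_cst].
Qed.

Lemma path_comp (p : R -> sp) (f : R -> R) : {within I01, continuous p} -> continuous f ->
 (forall s, 0 <= f s <= 1) -> continuous (fun s => p (f s)).
move=> cp cf f01 s A.
have If t : I01 (f t) by rewrite /= in_itv/=; exact: f01.
move/subspace_continuousP : cp => /(_ (f s) (If s)) cpu /cpu H.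
have : \forall t \near s, I01 (f t) -> A (p (f t)) by have := cf s _ H.
by apply: filterS => t; apply.
Qed.

(** A curl-free field on a simply connected set has a potential: its value at a
    point is the integral along a path from a base point, and the integral along
    the loop made of two such paths and a short segment vanishes. *)
Theorem monodromy : simply_connected D ->
 exists q : sp -> R, forall z (r : R) G, 0 < r -> pot_on z r G ->
 forall y, ball z r y -> q y = q z + (G y - G z).
move=> [conn loops]; have [[x0 Dx0]|nD] := pselect (exists x0, D x0); last first.
 by exists (fun=> 0) => z r G r0 [_ bD _]; exfalso; apply: nD; exists z; apply: bD; exact: ballxx.
have /choice[ga Hga] : forall x, exists p : R -> sp, D x ->
  [/\ {within I01, continuous p}, p @` I01 `<=` D, p 0 = x0 & p 1 = x].
 move=> x; have [Dx|nx] := pselect (D x); last by exists (fun=> x0) => /nx.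
 by have [p Hp] := conn _ _ Dx0 Dx; exists p.
have /choice[N HN] : forall x, exists N : nat, D x -> (0 < N)%N /\
  forall n m, (N <= n)%N -> (0 < m)%N -> psum (ga x) (n * m) = psum (ga x) n.
 move=> x; have [Dx|nx] := pselect (D x); last by exists 0%N => /nx. have [cp pD _ _] := Hga x Dx.
 by have [N N0 HN] := psum_refine cp pD; exists N.
pose q x := psum (ga x) (N x); exists q => z r G r0 [sG bD Gc] y zy.
have Dz : D z by apply: bD; exact: ballxx.
have Dy : D y by exact: bD.
have qE x n : D x -> (N x <= n)%N -> psum (ga x) n = q x.
 move=> Dx Nn; have [N0 H] := HN x Dx. have n0 : (0 < n)%N by exact: leq_trans Nn.
 by rewrite /q -(H (N x) n (leqnn _) n0) mulnC H.
have [cz zD z0 z1] := Hga z Dz; have [cy yD y0 y1] := Hga y Dy.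
pose L (s : R) : sp := ga z (clamp (3 * s + 0)) + clamp (3 * s + (- 1)) *: (y - z) +
 (ga y (1 - clamp (3 * s + (- 2))) - y).
have L1 (s : R) : 0 <= s <= 1 -> L (s / 3) = ga z s.
 move=> /andP[s0 s1]; rewrite /L mulrC mulfVK ?pnatr_eq0// addr0 clamp_id ?s0//.
 rewrite clamp0; last by rewrite subr_le0. rewrite clamp0; last by rewrite subr_le0 (le_trans s1)// ler1n.
 by rewrite scale0r subr0 y1 subrr !addr0.
have L2 (s : R) : 0 <= s <= 1 -> L ((1 + s) / 3) = z + s *: (y - z).
 move=> /andP[s0 s1]; rewrite /L mulrC mulfVK ?pnatr_eq0// addr0 clamp1 ?z1; last by rewrite lerDl.
 rewrite (_ : 1 + s + -1 = s); last by ring.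
 rewrite clamp_id ?s0// clamp0; last by rewrite subr_le0 -[leRHS]/(1 + 1) lerD2l.
 by rewrite subr0 y1 subrr addr0.
have L3 (s : R) : 0 <= s <= 1 -> L ((2 + s) / 3) = ga y (1 - s).
 move=> /andP[s0 s1]; rewrite /L mulrC mulfVK ?pnatr_eq0// addr0 clamp1 ?z1; last by lra.
 rewrite clamp1; last by lra. rewrite (_ : 2 + s + -2 = s); last by ring.
 by rewrite clamp_id ?s0// scale1r; apply: sp_ext => /=; ring.
have cL : continuous L.
 have c1 : continuous (fun s : R => ga z (clamp (3 * s + 0))) by apply: path_comp => //; [exact: clamp_cont|move=> s; exact: clamp01].
 have c2 : continuous (fun s : R => ga y (1 - clamp (3 * s + (- 2)))).
  apply: path_comp => // s; last by have /andP[a b] := clamp01 (3 * s + (- 2)); rewrite subr_ge0 b/= gerBl.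
  by apply: cvgB; [exact: cvg_cst|exact: clamp_cont].
 move=> s; apply: cvgD.
  by apply: cvgD; [exact: c1|apply: cvgZr_tmp; exact: clamp_cont].
 by apply: cvgB; [exact: c2|exact: cvg_cst].
have LD : L @` I01 `<=` D.
 move=> _ [s /= + <-]; rewrite in_itv/= => /andP[s0 s1]. have [a|a] := leP (3 * s) 1.
  rewrite -[s](_ : 3 * s / 3 = s); last by field.
  rewrite L1; first by apply: zD; exists (3 * s) => //=; rewrite in_itv/= a mulr_ge0. by rewrite a mulr_ge0.
 have [b|b] := leP (3 * s) 2.
  rewrite -[s](_ : (1 + (3 * s - 1)) / 3 = s); last by field.
  have t01 : 0 <= 3 * s - 1 <= 1 by apply/andP; split; lra.
  by rewrite L2//; apply: bD; apply: ball_seg => //; exact: ballxx.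
 rewrite -[s](_ : (2 + (3 * s - 2)) / 3 = s); last by field.
 have t01 : 0 <= 3 * s - 2 <= 1 by apply/andP; split; lra.
 by rewrite L3//; apply: yD; exists (1 - (3 * s - 2)) => //=; rewrite in_itv/=; apply/andP; split; lra.
have Z01 : 0 <= (0 : R) <= 1 by rewrite lexx ler01.
have O01 : 0 <= (1 : R) <= 1 by rewrite lexx ler01.
have Le : L 0 = L 1.
 rewrite -[0](_ : 0 / 3 = 0); last by rewrite mul0r.
 rewrite -[1 in RHS](_ : (2 + 1) / 3 = 1); last by field. by rewrite L1// L3// subrr z0 y0.
have [H [cH HD Hb Ht Hs]] := loops L (continuous_subspaceT cL) LD Le.
have [N1 _ HN1] := contractible_sum cH HD Hb Ht Hs.
have [N2 _ HN2] := fine_path cy yD.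
pose n := (maxn (maxn N1 N2) (maxn (N z) (N y))).
have nz : (N z <= n)%N by rewrite /n !leq_max leqnn ?orbT.
have ny : (N y <= n)%N by rewrite /n !leq_max leqnn ?orbT.
have n1 : (N1 <= n)%N by rewrite /n !leq_max leqnn ?orbT.
have n2 : (N2 <= n)%N by rewrite /n !leq_max leqnn ?orbT.
have n0 : (0 < n)%N by have [a _] := HN z Dz; exact: leq_trans nz.
clearbody n.
have nz0 : n%:R != 0 :> R by rewrite pnatr_eq0 -lt0n.
pose g (k : nat) : R := k%:R / (3 * n)%:R.
have g1 k : g k = (k%:R / n%:R) / 3 by rewrite /g natrM; field.
have g2 k : g (n + k)%N = (1 + k%:R / n%:R) / 3 by rewrite /g natrM natrD; field.
have g3 k : g (n + n + k)%N = (2 + k%:R / n%:R) / 3 by rewrite /g natrM !natrD; field.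
have := HN1 (3 * n)%N (leq_trans n1 (leq_pmull n (ltn0Sn 2))).
rewrite /psum -[in X in X = _ -> _]/(\sum_(0 <= k < 3 * n) lin_int c (L (g k)) (L (g k.+1))).
have -> : (3 * n = n + n + n)%N by rewrite -[3%N]/(1 + 1 + 1)%N !mulnDl mul1n.
rewrite (@big_cat_nat _ _ _ (n + n))//= ?leq_addr// (@big_cat_nat _ _ _ n)//= ?leq_addr//.
have -> : \sum_(0 <= k < n) lin_int c (L (g k)) (L (g k.+1)) = q z.
 rewrite -(qE _ _ Dz nz); apply: eq_big_nat => k /andP[_ kn].
 by rewrite !g1 !L1//; [exact: (@grid01 n k.+1)|exact: grid01 (ltnW kn)].
have -> : \sum_(n <= k < n + n) lin_int c (L (g k)) (L (g k.+1)) = G y - G z.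
 rewrite -{1}[n]add0n big_addn addnK. pose h (k : nat) := G (z + (k%:R / n%:R) *: (y - z)).
 rewrite (_ : G y - G z = h n - h 0%N); last first.
  by rewrite /h divff// scale1r mul0r scale0r addr0 [z + _]addrC subrK.
 rewrite -telescope_sumr//; apply: eq_big_nat => k /andP[_ kn].
 have e1 : g (k + n)%N = (1 + k%:R / n%:R) / 3 by rewrite addnC g2.
 have e2 : g (k + n).+1 = (1 + k.+1%:R / n%:R) / 3 by rewrite -addSn addnC g2.
 rewrite e1 e2 !L2; last 2 first.
 - exact: (@grid01 n k.+1).
 - exact: grid01 (ltnW kn). rewrite (lin_int_grad sG Gc)//; apply: ball_seg => //; try exact: ballxx.
  exact: grid01 (ltnW kn).
 exact: (@grid01 n k.+1).
have -> : \sum_(n + n <= k < n + n + n) lin_int c (L (g k)) (L (g k.+1)) = - q y.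
 rewrite -{1}[(n + n)%N]add0n big_addn addKn -(qE _ _ Dy ny) big_nat_rev add0n -sumrN.
 apply: eq_big_nat => k /andP[_ kn].
 have e1 : g (n - k.+1 + (n + n))%N = (2 + (n - k.+1)%:R / n%:R) / 3 by rewrite addnC g3.
 have e2 : g (n - k.+1 + (n + n)).+1%N = (2 + (n - k)%:R / n%:R) / 3 by rewrite -addSn -subSn// subSS addnC g3.
 rewrite e1 e2 !L3; last 2 first.
 - by apply: grid01 => //; exact: leq_subr.
 - by apply: grid01 => //; exact: leq_subr.
 have -> : 1 - (n - k)%:R / n%:R = k%:R / n%:R :> R by rewrite natrB ?(ltnW kn)//; field.
 have -> : 1 - (n - k.+1)%:R / n%:R = k.+1%:R / n%:R :> R by rewrite natrB//; field.
 have [z' [r' [G' [[sG' _ Gc'] Hv]]]] := HN2 n k n2 kn. have b1 : ball z' r' (ga y (k%:R / n%:R)).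
  apply: Hv; first by rewrite /= in_itv/=; exact: grid01 (ltnW kn). by rewrite subrr normr0 invr_ge0.
 have b2 : ball z' r' (ga y (k.+1%:R / n%:R)).
  apply: Hv; first by rewrite /= in_itv/=; exact: grid01.
  by rewrite grid_step// opprD addrA subrr add0r normrN ger0_norm ?invr_ge0.
 by rewrite !(lin_int_grad sG' Gc')// opprB.
by move=> E; apply/eqP; rewrite -subr_eq0 -[X in X == _]opprK oppr_eq0; apply/eqP; rewrite -E; ring.
Qed.

End Monodromy.

End Potentials.

(** * Square integrability of the potential *)
Section SquareIntegrals.
Context {R : realType}.
Local Notation sp := (R * R * R)%type.
Local Notation leb := (@leb1 R).
Implicit Types (f g phi : sp -> R) (x y h e z : sp) (D U L : set sp).

Lemma nsq_eq L f g : (forall x, L x -> f x = g x) -> nsq L f = nsq L g.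
by move=> fg; apply: eq_int => x /set_mem Lx; rewrite fg. Qed.

Lemma L2_eq L f g : measurable L -> (forall x, L x -> f x = g x) -> Lsq L f -> Lsq L g.
move=> mL fg Lf; apply: (@L2_dom _ L g f) => //; last by move=> x Lx; rewrite fg.
by apply: eq_measurable_fun (L2g_meas Lf) => x /set_mem; exact: fg.
Qed.

Lemma nsq_union A B f : measurable A -> measurable B -> [disjoint A & B] ->
 Lsq A f -> Lsq B f -> Lsq (A `|` B) f /\ nsq (A `|` B) f = nsq A f + nsq B f.
move=> mA mB AB LA LB; have mf : measf (A `|` B) f.
 by apply/measurable_funU => //; split; [case: LA|case: LB].
have E : (\int[leb3]_(x in A `|` B) (f x ^+ 2)%:E = (nsq A f + nsq B f)%:E)%E.
 rewrite ge0_integral_setU//; last 2 first.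
 - by apply/mEFinP; apply: measurable_funX.
 - by move=> x _; rewrite lee_fin sqr_ge0. by rewrite !nsqE3.
have LU : Lsq (A `|` B) f.
 split => //; apply/integrableP; split.
  by apply/mEFinP; apply: measurable_funX.
 rewrite (_ : (fun x => _) = fun x => (f x ^+ 2)%:E); first by rewrite E ltry.
 by apply/funext => x; rewrite gee0_abs// lee_fin sqr_ge0.
split => //; apply: EFin_inj; rewrite -E nsqE3//; exact: measurableU.
Qed.

Lemma nsq_shift L h f : measurable L -> measurable [set y | L (y - h)] ->
 Lsq [set y | L (y - h)] f ->
 Lsq L (fun y => f (y + h)) /\ nsq L (fun y => f (y + h)) = nsq [set y | L (y - h)] f.
set L' := [set y | _] => mL mL' Lf.
have [S1 S2] := L2_shift h (L2_zext mL' Lf).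
have E : (fun y => (f \_ L') (y + h)) = (fun y => f (y + h)) \_ L.
 apply/funext => y; rewrite !patchE.
 by congr (if _ then _ else _); apply/idP/idP => /set_mem H; apply/mem_set; move: H; rewrite /L'/= addrK.
rewrite E in S1 S2; split; last by rewrite -[LHS](nsq_zext _ mL) S2 nsq_zext.
apply: (@L2_eq L ((fun y => f (y + h)) \_ L)) => //.
 by move=> x Lx; rewrite patchE mem_set.
exact: (@L2_sub _ setT).
Qed.

Lemma nsq_exhaust (F : nat -> set sp) f (K : R) :
 {homo F : n m / (n <= m)%N >-> (n <= m)%O} -> (forall n, measurable (F n)) ->
 (forall n, Lsq (F n) f /\ nsq (F n) f <= K) -> Lsq (\bigcup_n F n) f /\ nsq (\bigcup_n F n) f <= K.
move=> hF mF HF; have mU : measurable (\bigcup_n F n) by exact: bigcup_measurable.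
have mf : measf (\bigcup_n F n) f by apply/measurable_fun_bigcup => // n; have [[]] := HF n.
have H : (\int[leb3]_(x in F i) (f x ^+ 2)%:E)%E @[i --> \oo] --> (\int[leb3]_(x in \bigcup_i F i) (f x ^+ 2)%:E)%E.
 apply: ge0_nondecreasing_set_cvg_integral => //.
  by move=> n; apply/mEFinP; apply: measurable_funX; have [[]] := HF n.
 by move=> n x _; rewrite lee_fin sqr_ge0.
have B : (\int[leb3]_(x in \bigcup_n F n) (f x ^+ 2)%:E <= K%:E)%E.
 rewrite -(cvg_lim _ H)//; apply: lime_le; first by apply/cvg_ex; eexists; exact: H.
 by near=> n; have [L N] := HF n; rewrite nsqE3// lee_fin.
have LU : Lsq (\bigcup_n F n) f.
 split => //; apply/integrableP; split.
  by apply/mEFinP; apply: measurable_funX.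
 rewrite (_ : (fun x => _) = fun x => (f x ^+ 2)%:E); first exact: le_lt_trans B (ltry _).
 by apply/funext => x; rewrite gee0_abs// lee_fin sqr_ge0.
by split => //; rewrite -lee_fin -nsqE3.
Unshelve. all: by end_near. Qed.

(** A square bound holding uniformly near each point of a compact set holds on
    the set; the constants are those of a finite subcover. *)
Lemma cover_bound (P : (sp -> R) -> R -> Prop) (K U : set sp) : compact K -> measurable U -> U `<=` K ->
 (forall f (N : R), P f N -> 0 <= N) ->
 (forall x, K x -> exists2 r : R, 0 < r & exists2 C : R, 0 <= C & forall f (N : R), P f N ->
  Lsq (U `&` ball x r) f /\ nsq (U `&` ball x r) f <= C * N) ->
 exists2 C : R, 0 <= C & forall f (N : R), P f N -> Lsq U f /\ nsq U f <= C * N.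
move=> cK mU UK P0 loc.
have /choice[rC HrC] : forall x, exists rC : R * R, K x -> [/\ 0 < rC.1, 0 <= rC.2 &
  forall f (N : R), P f N -> Lsq (U `&` ball x rC.1) f /\ nsq (U `&` ball x rC.1) f <= rC.2 * N].
 move=> x; have [Kx|nK] := pselect (K x); last by exists (0, 0) => /nK.
 by have [r r0 [C C0 H]] := loc _ Kx; exists (r, C).
have [n [c [chi [Kc cchi chi0 chi1]]]] := @partition_of_unity R K (fun x => (rC x).1) cK
 (fun x Kx => let: And3 r0 _ _ := HrC x Kx in r0).
have /choice[M HM] : forall i, exists M : R, (i < n)%N -> 0 <= M /\ forall x, `|chi i x| <= M.
 move=> i; have [/cchi/Cc_bd[M M0 HM]|_] := boolP (i < n)%N; last by exists 0. by exists M.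
pose C := \sum_(i < n) `|M i ^+ 2 * (rC (c i)).2|.
have C0 : 0 <= C by apply: sumr_ge0 => i _.
exists (4 ^+ n * C); first by rewrite mulr_ge0// exprn_ge0.
move=> f N PfN; have N0 := P0 _ _ PfN.
have Hi i : (i < n)%N -> Lsq U (fun x => chi i x * f x) /\ nsq U (fun x => chi i x * f x) <= C * N.
 move=> i_n; have [r0 C'0 H] := HrC _ (Kc _ i_n); have [L B] := H _ _ PfN.
 have [M0 Mb] := HM i i_n; set V := U `&` ball (c i) (rC (c i)).1.
 have mV : measurable V by apply: measurableI => //; exact: mball. have Lc : Lsq V (fun x => chi i x * f x).
  apply: (@L2g_bound _ _ _ leb3 V mV (chi i) f (M i)) => //. exact: Cc_meas (cchi _ i_n) mV.
 have E : (fun x => chi i x * f x) \_ U = (fun x => chi i x * f x) \_ V.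
  apply/funext => x; rewrite !patchE /V in_setI; case: (x \in U) => //=.
  have [//|xV] := boolP (x \in (ball (c i) (rC (c i)).1 : set sp)).
  rewrite chi0 ?mul0r// leNgt; apply/negP => xr; move/negP : xV; apply.
  by apply/mem_set; rewrite -ballE/= distrC.
 have LU : Lsq U (fun x => chi i x * f x).
  apply: (@L2_eq U ((fun x => chi i x * f x) \_ U)) => //.
   by move=> x Ux; rewrite patchE mem_set.
  by rewrite E; apply: (@L2_sub _ setT) => //; exact: L2_zext.
 split => //; rewrite -(nsq_zext _ mU) E nsq_zext//.
 have : nsq V (fun x => chi i x * f x) <= M i ^+ 2 * nsq V f.
  rewrite -nsqZ//; apply: nsq_mono => //; first by case: Lc.
   exact: (@L2gZ _ _ _ leb3 V mV).
  by move=> x _; rewrite !exprMn ler_wpM2r ?sqr_ge0// -real_normK ?num_real// lerXn2r ?nnegrE.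
 move=> /le_trans; apply; apply: (@le_trans _ _ (M i ^+ 2 * ((rC (c i)).2 * N))).
  by rewrite ler_wpM2l// sqr_ge0.
 rewrite mulrA ler_wpM2r// /C (bigD1 (Ordinal i_n))//= -[leLHS]addr0 lerD ?ler_norm//.
 by apply: sumr_ge0 => j _.
have [L B] := nsq_bigsum mU (mulr_ge0 C0 N0) Hi.
have E x : U x -> \sum_(i < n) chi i x * f x = f x by move=> /UK Kx; rewrite -mulr_suml chi1// mul1r.
by split; [exact: L2_eq E L|rewrite -(nsq_eq E) -mulrA].
Qed.

End SquareIntegrals.

Section LocalPotentials.
Context {R : realType}.
Local Notation sp := (R * R * R)%type.
Local Notation leb := (@leb1 R).
Implicit Types (f g phi : sp -> R) (x y h e z : sp) (D U L : set sp).
Variables (D : set sp) (c : 'I_3 -> sp -> R) (q : sp -> R).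
Hypothesis oD : open D.

Definition potential := forall z, D z -> exists2 r : R, 0 < r & exists2 G, smooth G &
 forall w, ball z r w -> q w = G w /\ forall k, partial k G w = c k w.

Hypothesis qc : potential.

Lemma potential_near z : D z -> exists2 G, smooth G &
 \forall w \near z, q w = G w /\ forall k, c k w = partial k G w.
move=> /qc[r r0 [G sG HG]]; exists G => //.
have : nbhs z (ball z r : set sp) by exact: nbhsx_ballx.
by apply: filterS => w /HG[-> H]; split => // k; rewrite H.
Qed.

Lemma potential_cont z : D z -> {for z, continuous q}.
move=> /potential_near[G sG HG].
have E : \forall w \near z, G w = q w by apply: filterS HG => w [].
suff : q @ z --> q z by [].
have Ez : G z = q z := nbhs_singleton E; rewrite -Ez.
have cG : G @ z --> G z by exact: sm_cont.
move=> A /cG HA.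
have HA' : \forall w \near z, A (G w) := HA.
have H : \forall w \near z, A (q w) by apply: filterS2 HA' E => w AG <-.
exact: H.
Qed.

Lemma potential_grad_cont z k : D z -> {for z, continuous (c k)}.
move=> /potential_near[G sG HG].
have E : \forall w \near z, partial k G w = c k w by apply: filterS HG => w [_ ->].
suff : c k @ z --> c k z by [].
have Ez : partial k G z = c k z := nbhs_singleton E; rewrite -Ez.
have cG : partial k G @ z --> partial k G z by apply: sm_cont; exact: sm_pd.
move=> A /cG HA.
have HA' : \forall w \near z, A (partial k G w) := HA.
have H : \forall w \near z, A (c k w) by apply: filterS2 HA' E => w AG <-.
exact: H.
Qed.

Lemma potential_line y h (s : R) : D (y + s *: h) ->
 is_derive s (1 : R) (fun s : R => q (y + s *: h)) (\sum_k crd h k * c k (y + s *: h)).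
move=> /potential_near[G sG HG].
have cl := @cont_line R y h s.
apply: (@near_eq_is_derive _ _ _ (fun s : R => G (y + s *: h))).
 have H : \forall t \near s, q (y + t *: h) = G (y + t *: h) /\
   (forall k, c k (y + t *: h) = partial k G (y + t *: h)) by exact: (cl _ HG).
 by apply: filterS H => t [-> _].
have dG : derivable G (y + s *: h) h by exact: sm_derivable.
have := line_derive dG; rewrite derive_pd; last exact: sm_diff.
have [_ Hc] := nbhs_singleton HG.
by under eq_bigr do rewrite -Hc.
Qed.

Lemma potential_ftc y h (T : R) : 0 < T -> (forall s : R, 0 <= s <= T -> D (y + s *: h)) ->
 itg leb `[0, T] (fun s : R => \sum_k crd h k * c k (y + s *: h)) /\
 \int[leb]_(s in `[0, T]) (\sum_k crd h k * c k (y + s *: h)) = q (y + T *: h) - q y.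
move=> T0 HD; pose g (s : R) := \sum_k crd h k * c k (y + s *: h).
pose Q (s : R) := q (y + s *: h).
have cQ (s : R) : 0 <= s <= T -> {for s, continuous Q}.
 move=> /HD Ds; apply: (@continuous_comp _ _ _ (fun s : R => y + s *: h) q); first exact: cont_line.
 exact: potential_cont.
have cg : {within `[0, T], continuous g}.
 apply: continuous_in_subspaceT => s /set_mem/=; rewrite in_itv/= => /HD Ds.
 have ck k : {for s, continuous (fun s : R => crd h k * c k (y + s *: h))}.
  apply: cvgM; first exact: cvg_cst.
  apply: (@continuous_comp _ _ _ (fun s : R => y + s *: h) (c k)); first exact: cont_line.
  exact: potential_grad_cont.
 have -> : g = fun s => crd h 0 * c 0 (y + s *: h) + crd h 1 * c 1 (y + s *: h) + crd h 2 * c 2 (y + s *: h) by apply/funext => t; rewrite /g sum3.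
 by apply: cvgD; [apply: cvgD|]; exact: ck.
have z01 : 0 <= (0 : R) <= T by rewrite lexx ltW.
have o01 : 0 <= T <= T by rewrite lexx ltW.
split; first by apply: continuous_compact_integrable => //; exact: segment_compact.
rewrite /Rintegral (@continuous_FTC2 R g Q 0 T T0)//; first by rewrite /Q scale0r addr0.
 split; first by move=> s; rewrite in_itv/= => /andP[/ltW s0 /ltW s1]; have [] := potential_line (HD s _); rewrite ?s0.
 - exact/cvg_at_right_filter/cQ.
 - exact/cvg_at_left_filter/cQ.
move=> s; rewrite in_itv/= => /andP[/ltW s0 /ltW s1]; rewrite derive1E.
have s01 : 0 <= s <= T by rewrite s0.
by have [_ ->] := potential_line (HD s s01).
Qed.

(** The difference is the integral of the gradient along a segment, whose mean
    square is at most that of the gradient times [T^2]. *)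
Lemma shift_diff e (T : R) L M : `|e| <= 1 -> 0 < T -> measurable L -> measurable M -> M `<=` D ->
 (forall y, L y -> forall s : R, 0 <= s <= T -> M (y + s *: e)) ->
 (forall k, Lsq M (c k)) -> forall N : R, (forall k, nsq M (c k) <= N) ->
 Lsq L (fun y => q (y + T *: e) - q y) /\ nsq L (fun y => q (y + T *: e) - q y) <= 9 * T ^+ 2 * N.
move=> e1 T0 mL mM MD LM Lc N HN.
pose g y := \sum_k crd e k * c k y; pose g' := g \_ M.
have mc k : measf M (c k) by case: (Lc k).
have mg : measf M g.
 have -> : g = fun y => crd e 0 * c 0 y + crd e 1 * c 1 y + crd e 2 * c 2 y by apply/funext => t; rewrite /g sum3.
 by apply: measurable_funD; [apply: measurable_funD|]; exact: mfunM.
have e2 k x : M x -> crd e k ^+ 2 <= 1.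
 move=> _; rewrite -real_normK ?num_real// expr_le1//; exact: le_trans (abs_crd e k) e1.
have [Lg Bg] := @nsq_lin3 R M 1 (fun k _ => crd e k) c N mM ler01 e2 Lc HN mg.
have Lg' : Lsq setT g' by exact: L2_zext.
have E y : L y -> q (y + T *: e) - q y = \int[leb]_(s in `[0, T]) (1 * g' (y + s *: e)).
 move=> Ly; have [|_ <-] := @potential_ftc y e T T0; first by move=> s /(LM _ Ly)/MD.
 apply: eq_int => s; rewrite inE/= in_itv/= => s01. by rewrite mul1r /g' patchE mem_set//; exact: LM.
have mq : measf L (fun y => q (y + T *: e) - q y).
 have Dq := @ocont_meas3 R q D oD (fun z Dz => potential_cont (set_mem Dz)). have mD := mopen oD.
 have LD y : L y -> D y by move=> Ly; have := LM _ Ly 0; rewrite lexx ltW// scale0r addr0 => /(_ isT)/MD.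
 apply: measurable_funB; last exact: measurable_funS Dq. apply: (@measurable_comp _ _ _ _ _ _ D) => //.
  move=> _ [y Ly <-]; apply: MD; apply: LM => //; by rewrite lexx ltW.
 by have := @meas_affine R 1 (T *: e); under eq_fun do rewrite scale1r; exact: measurable_funTS.
have mi : measurable (`[0, T]%classic : set R) by exact: measurable_itv.
have i1 : itg leb `[0, T] (fun=> 1 : R) by apply: cont_itg01 => s; exact: cvg_cst.
have := @L2_average R _ _ leb `[0, T]%classic L (fun=> 1) (fun s y => g' (y + s *: e)) T
 (nsq setT g') mi mL T0.
move=> H; have {H} [] : Lsq L (fun y => \int[leb]_(s in `[0, T]) (1 * g' (y + s *: e))) /\
  nsq L (fun y => \int[leb]_(s in `[0, T]) (1 * g' (y + s *: e))) <= T ^+ 2 * nsq setT g'.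
 apply: H => //.
 - have mp : measf (setT : set sp) g' by case: Lg'.
  have := @meas_affine_pair R (fun=> 1) (fun s => s *: e) (measurable_cst _) _.
  move=> /(_ _)/(mfcomp mp) mm.
  have : measf (setT : set (R * sp)) (fun p : R * sp => g' (1 *: p.2 + p.1 *: e)).
   apply: mm => i; under eq_fun do rewrite crdZ. by apply: mfunM.
  by under eq_fun do rewrite scale1r.
 - by rewrite Rint_len.
 - exact: nsq_ge0.
 - move=> s _; have [Ls Ns] := L2_shift (s *: e) Lg'.
  rewrite -Ns -(nsqE3 measurableT Ls).
  have m2 : measf (setT : set sp) (fun y => (g' (y + s *: e) ^+ 2)%:E) by apply/mEFinP; apply: measurable_funX; case: Ls.
  apply: (@ge0_subset_integral _ _ _ leb3 L setT mL measurableT _ m2) => // x _. by rewrite lee_fin sqr_ge0.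
 - by apply: eq_measurable_fun mq => y /set_mem/E.
 move=> y Ly; have [|ii _] := @potential_ftc y e T T0; first by move=> s /(LM _ Ly)/MD.
 apply: eq_integrable ii => // s; rewrite inE/= in_itv/= => s01.
 by rewrite mul1r /g' patchE mem_set//; exact: LM.
move=> LE BE; split; first by apply: L2_eq LE => // y /E.
rewrite (nsq_eq E); apply: le_trans BE _; rewrite /g' nsq_zext//.
by rewrite -mulrA mulrCA ler_wpM2l ?sqr_ge0//; move: Bg; rewrite mulr1.
Qed.

End LocalPotentials.

Section Layers.
Context {R : realType}.
Local Notation sp := (R * R * R)%type.
Implicit Types (f g phi : sp -> R) (x y h e z : sp) (D U L : set sp).

Lemma nsq_split L f g : measurable L -> Lsq L f -> Lsq L g ->
 nsq L f <= 4 / 3 * nsq L g + 4 * nsq L (fun x => g x - f x).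
move=> mL Lf Lg; have Ld : Lsq L (fun x => g x - f x) by exact: (@L2gB _ _ _ leb3 L mL).
rewrite /nsq -!RintZ//; try exact: L2_itg.
rewrite -RintegralD//; try by apply: itgZ => //; exact: L2_itg.
apply: le_Rintegral => //; first exact: L2_itg.
 by apply: itgD => //; apply: itgZ => //; exact: L2_itg.
move=> x _; move: (f x) (g x) => a b; rewrite -subr_ge0.
have -> : 4 / 3 * b ^+ 2 + 4 * (b - a) ^+ 2 - a ^+ 2 = 3^-1 * (4 * b - 3 * a) ^+ 2 by field.
by rewrite mulr_ge0 ?sqr_ge0 ?invr_ge0.
Qed.

Lemma sum_contract (X e : nat -> R) (B E : R) : 0 <= B -> (forall k, 0 <= X k) ->
 (forall k, X k.+1 <= 2 / 3 * X k + B * e k) -> (forall n, \sum_(k < n) e k <= E) ->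
 forall n, \sum_(k < n) X k <= 3 * X 0%N + 3 * (B * E).
move=> B0 X0 HX HE n; set S := fun n => \sum_(k < n) X k.
have E0 : 0 <= E by have := HE 0%N; rewrite big_ord0.
case: n => [|n]; first by rewrite big_ord0 addr_ge0// ?mulr_ge0.
have SS : S n.+1 = X 0%N + \sum_(k < n) X k.+1 by rewrite /S big_ord_recl.
have le1 : \sum_(k < n) X k.+1 <= 2 / 3 * S n + B * E.
 apply: (@le_trans _ _ (\sum_(k < n) (2 / 3 * X k + B * e k))); first by apply: ler_sum => k _.
 rewrite big_split/= -!mulr_sumr; apply: lerD => //. by apply: ler_wpM2l => //; exact: HE.
have le2 : S n <= S n.+1 by rewrite /S big_ord_recr/= lerDl.
rewrite -/(S n.+1); lra.
Qed.

Lemma sum_lag (F : nat -> R) (E : R) n : (forall k, 0 <= F k <= E) ->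
 \sum_(k < n) (F k.+4 - F k) <= 4 * E.
move=> HF; have -> : \sum_(k < n) (F k.+4 - F k) =
  F n + F n.+1 + F n.+2 + F n.+3 - (F 0%N + F 1%N + F 2%N + F 3%N).
 elim: n => [|n IH]; first by rewrite big_ord0 subrr. by rewrite big_ord_recr/= IH; ring.
have H k := HF k; move: (H n) (H n.+1) (H n.+2) (H n.+3) (H 0%N) (H 1%N) (H 2) (H 3).
move=> /andP[_ a1] /andP[_ a2] /andP[_ a3] /andP[_ a4] /andP[b1 _] /andP[b2 _] /andP[b3 _] /andP[b4 _].
lra.
Qed.

Variables (D : set sp) (a c : 'I_3 -> sp -> R) (q : sp -> R) (A : R).
Hypotheses (oD : open D) (La : forall i, Lsq D (a i)) (qc : potential D c q) (A0 : 0 <= A).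

Definition energy U := \sum_l nsq U (a l).

(** Bounds of a field whose size at a point is controlled by the energy around
    it, like the gradient of a harmonic function. *)
Hypothesis hb : forall L L' (d : R), measurable L -> measurable L' -> L' `<=` D -> 0 < d ->
 (forall z x, L z -> `|x - z| < 3 * d -> L' x) ->
 forall i, Lsq L (c i) /\ nsq L (c i) <= A * d ^- 2 * energy L'.

Variables (x0 : sp) (ch : chart D x0) (r : R).
Hypotheses (r0 : 0 < r) (r_rad : 4 * r <= c_rad ch).

Local Notation e := (c_dir ch).
Local Notation t := (c_ht ch).
Local Notation K := (c_lip ch).

(** Projection onto the boundary along the direction of the chart. *)
Definition bproj y : sp := y - t y *: e.
Definition layer (w s s' : R) : set sp := [set y | `|bproj y - x0| < w /\ s < t y <= s'].

Lemma ht_cont : continuous t.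
have K0 : 0 < K by exact: lt_le_trans ltr01 (c_lip1 ch).
move=> y; apply/cvgrPdist_lt => eps eps0.
have : nbhs y (ball y (eps / K) : set sp) by apply: nbhsx_ballx; rewrite divr_gt0.
apply: filterS => z; rewrite -ballE/= => yz; apply: le_lt_trans (c_ht_lip ch y z) _.
by rewrite mulrC -ltr_pdivlMr.
Qed.

Lemma bproj_cont : continuous (fun y => `|bproj y - x0|).
move=> y; apply: cvg_norm; apply: cvgB; last exact: cvg_cst.
by apply: cvgB; [exact: cvg_id|apply: cvgZr_tmp; exact: ht_cont].
Qed.

Lemma mlayer w s s' : measurable (layer w s s').
have m1 := @cont_meas3 R _ setT bproj_cont measurableT.
have m2 := @cont_meas3 R _ setT ht_cont measurableT.
have -> : layer w s s' = ([set: sp] `&` (fun y => `|bproj y - x0|) @^-1` `]-oo, w[) `&`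
  ([set: sp] `&` t @^-1` `]s, s']).
 by apply/seteqP; split => y; rewrite /layer/= !in_itv/=; [case|case=> -[_ ?] [_ ?]].
by apply: measurableI; [apply: m1|apply: m2].
Qed.

Lemma bproj_shift y (s : R) : bproj (y + s *: e) = bproj y.
by rewrite /bproj c_htD scalerDl opprD addrACA subrr addr0. Qed.

Lemma layer_shift w s s' (T : R) : [set y | layer w s s' (y - T *: e)] = layer w (s + T) (s' + T).
have H y : y - T *: e = y + (- T) *: e by rewrite scaleNr.
apply/seteqP; split => y; rewrite /layer/= H bproj_shift c_htD => -[? /andP[? ?]];
 by split=> //; apply/andP; split; lra.
Qed.

Lemma layer_dom w s s' : w <= 2 * r -> 0 <= s -> s' <= 2 * r -> layer w s s' `<=` D.
move=> w2 s0 s2 y [py /andP[ty1 ty2]]; have ty0 : 0 < t y by exact: le_lt_trans ty1.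
apply/(c_dom (c := ch)) => //; apply: lt_le_trans r_rad.
have -> : y - x0 = (bproj y - x0) + t y *: e by rewrite /bproj addrAC subrK.
apply: le_lt_trans (ler_normD _ _) _; rewrite normrZ gtr0_norm//.
have : t y * `|e| <= t y by rewrite ler_piMr ?c_dir1// ltW.
lra.
Qed.

Let mD := mopen oD.

Lemma energy_ge0 U : 0 <= energy U. by apply: sumr_ge0 => l _; exact: nsq_ge0. Qed.

Lemma energy_le U V : measurable U -> measurable V -> U `<=` V -> V `<=` D -> energy U <= energy V.
move=> mU mV UV VD; apply: ler_sum => l _; apply: nsqS => //.
exact: (@L2_sub _ D).
Qed.

Lemma layer_cat w (s s' s'' : R) : s <= s' -> s' <= s'' ->
 layer w s s' `|` layer w s' s'' = layer w s s''.
move=> h1 h2; apply/seteqP; split => y; rewrite /layer/=.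
 by move=> [[p /andP[u v]]|[p /andP[u v]]]; split=> //; apply/andP; split;
  [|exact: le_trans v h2|exact: le_lt_trans h1 u|].
move=> [p /andP[u v]]; have [k|k] := leP (t y) s'; [left|right]; split=> //; apply/andP; split => //.
Qed.

Lemma layer_disj w (s s' s'' : R) : [disjoint layer w s s' & layer w s' s''].
apply/disj_setPS => y [[_ /andP[_ h1]] [_ /andP[h2 _]]].
by move: h2; rewrite ltNge h1.
Qed.

Lemma layer_nsq w (s s' s'' : R) f : s <= s' -> s' <= s'' ->
 Lsq (layer w s s') f -> Lsq (layer w s' s'') f ->
 Lsq (layer w s s'') f /\ nsq (layer w s s'') f = nsq (layer w s s') f + nsq (layer w s' s'') f.
move=> h1 h2; rewrite -(layer_cat w h1 h2); apply: nsq_union; try exact: mlayer.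
exact: layer_disj.
Qed.

Lemma energy_layer (s s' s'' : R) : 0 <= s -> s <= s' -> s' <= s'' -> s'' <= 2 * r ->
 energy (layer (2 * r) s s'') = energy (layer (2 * r) s s') + energy (layer (2 * r) s' s'').
move=> h0 h1 h2 h3; rewrite /energy -big_split/=; apply: eq_bigr => l _.
have L (u v : R) : 0 <= u -> v <= 2 * r -> Lsq (layer (2 * r) u v) (a l).
 move=> u0 v0; apply: (L2_sub mD (mlayer _ _ _) _ (La l)). by apply: layer_dom.
have Ls := L s s' h0 (le_trans h2 h3).
have Ls' := L s' s'' (le_trans h0 h1) h3.
by have [_ ->] := layer_nsq h1 h2 Ls Ls'.
Qed.

Definition lconst := (12 * 12) ^+ 2 * A * K ^+ 2.

Lemma lconst_ge0 : 0 <= lconst.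
by apply: mulr_ge0; [apply: mulr_ge0; [exact: sqr_ge0|exact: A0]|exact: sqr_ge0]. Qed.

(** Each half of a layer is a translate of the next one, so the square norm is
    halved up to the variation of [q] between them. *)
Lemma layer_step (s : R) : 0 < s -> 4 * s <= r -> Lsq (layer r (2 * s) (4 * s)) q ->
 Lsq (layer r s (2 * s)) q /\ nsq (layer r s (2 * s)) q <= 2 / 3 * nsq (layer r (2 * s) (4 * s)) q +
  lconst * energy (layer (2 * r) (s / 2) (8 * s)).
move=> s0 s4 L4; have K1 := c_lip1 ch; have K0 : 0 < K by lra.
set L := layer r s (2 * s); set M := layer r s (4 * s); set L' := layer (2 * r) (s / 2) (8 * s).
have mL : measurable L by exact: mlayer.
have mM : measurable M by exact: mlayer.
have mL' : measurable L' by exact: mlayer.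
have L'D : L' `<=` D by apply: layer_dom; lra.
have MD : M `<=` D by apply: layer_dom; lra.
pose d := s / (12 * K).
have d0 : 0 < d by rewrite divr_gt0// mulr_gt0.
have dK : K * (3 * d) = s / 4 by rewrite /d; field; rewrite gt_eqF.
have d3 : 3 * d <= s / 4 by rewrite -dK ler_peMl// mulr_ge0// ltW.
have sep z x : M z -> `|x - z| < 3 * d -> L' x.
 move=> [pz /andP[z1 z2]] xz.
 have tt : `|t x - t z| <= s / 4 by apply: le_trans (c_ht_lip ch x z) _; rewrite -dK ler_wpM2l// ltW.
 have [t1 t2] : t x - t z <= s / 4 /\ t z - t x <= s / 4 by move: tt; rewrite ler_norml => /andP[]; split; lra.
 split; last by apply/andP; split; lra.
 have -> : bproj x - x0 = (bproj z - x0) + ((x - z) - (t x - t z) *: e) by rewrite /bproj; apply: sp_ext => /=; rewrite -?[_ *: _ : R]/(_ * _)/=; ring.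
 apply: le_lt_trans (ler_normD _ _) _. have n1 : `|(x - z) - (t x - t z) *: e| <= `|x - z| + `|t x - t z|.
  apply: le_trans (ler_normB _ _) _; rewrite lerD2l normrZ ler_piMr// c_dir1//.
 lra.
have hM := hb mM mL' L'D d0 sep.
pose N := A * d ^- 2 * energy L'.
have N0 : 0 <= N by apply: mulr_ge0; [apply: mulr_ge0 => //; rewrite invr_ge0 exprn_ge0// ltW|exact: energy_ge0].
have diff T : (T = s \/ T = 2 * s) ->
  Lsq L (fun y => q (y + T *: e) - q y) /\
  nsq L (fun y => q (y + T *: e) - q y) <= lconst / 4 * energy L'.
 move=> HT; have T0 : 0 < T by case: HT => ->; lra. have T2 : T <= 2 * s by case: HT => ->; lra.
 have LM y : L y -> forall u : R, 0 <= u <= T -> M (y + u *: e).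
  move=> [py /andP[y1 y2]] u /andP[u0 uT]; rewrite /M /layer/= bproj_shift c_htD.
  by split => //; apply/andP; split; lra.
 have [D1 D2] := @shift_diff R D c q oD qc e T L M (c_dir1 ch) T0 mL mM MD LM
  (fun k => (hM k).1) N (fun k => (hM k).2).
 split => //; apply: le_trans D2 _.
 have TT : T ^+ 2 <= 4 * s ^+ 2 by rewrite (_ : 4 * s ^+ 2 = (2 * s) ^+ 2) ?lerXn2r ?nnegrE//; [exact: ltW|lra|ring].
 apply: (@le_trans _ _ (9 * (4 * s ^+ 2) * N)); first by apply: ler_wpM2r => //; apply: ler_wpM2l.
 have fact (u k b E : R) : u != 0 -> k != 0 ->
   9 * (4 * u ^+ 2) * (b * (u / (12 * k)) ^- 2 * E) = (12 * 12) ^+ 2 * b * k ^+ 2 / 4 * E.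
  by move=> u_neq0 k_neq0; field; rewrite u_neq0 k_neq0.
 by rewrite /N /d /lconst fact ?gt_eqF.
have half T : (T = s \/ T = 2 * s) -> Lsq (layer r (s + T) (2 * s + T)) q ->
  Lsq L q /\ nsq L q <= 4 / 3 * nsq (layer r (s + T) (2 * s + T)) q + lconst * energy L'.
 move=> HT; rewrite -layer_shift => LT; have [D1 D2] := diff T HT.
 have mS : measurable [set y | L (y - T *: e)] by rewrite layer_shift; exact: mlayer.
 have [S1 S2] := nsq_shift mL mS LT. have Lq : Lsq L q.
  apply: L2_eq mL _ (@L2gB _ _ _ leb3 L mL _ _ S1 D1) => y _; ring.
 split => //; apply: le_trans (nsq_split mL Lq S1) _; rewrite S2. by rewrite lerD2l; move: D2; lra.
have sub u v : 2 * s <= u -> v <= 4 * s -> Lsq (layer r u v) q.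
 move=> us vs; apply: (@L2_sub _ (layer r (2 * s) (4 * s))) => //; try exact: mlayer.
 by move=> y [py /andP[y1 y2]]; split=> //; apply/andP; split; lra.
have e1 : s + s = 2 * s by ring.
have e2 : 2 * s + s = 3 * s by ring.
have e3 : s + 2 * s = 3 * s by ring.
have e4 : 2 * s + 2 * s = 4 * s by ring.
have := half s (or_introl erefl); have := half (2 * s) (or_intror erefl); rewrite e1 e2 e3 e4.
have l1 : Lsq (layer r (2 * s) (3 * s)) q by apply: sub; lra.
have l2 : Lsq (layer r (3 * s) (4 * s)) q by apply: sub; lra.
move=> /(_ l2)[Lq H2] /(_ l1)[_ H1]; split => //.
have h23 : 2 * s <= 3 * s by rewrite ler_pM2r// ler_nat.
have h34 : 3 * s <= 4 * s by rewrite ler_pM2r// ler_nat.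
have [_ U] := layer_nsq h23 h34 l1 l2; rewrite U.
move: H1 H2; move: (nsq _ _) (nsq _ _) (nsq _ _) (lconst * _) => p1 p2 p3 p4; lra.
Qed.

Definition depth (k : nat) : R := r / 2 ^+ k.

Lemma depthS k : depth k = 2 * depth k.+1.
by rewrite /depth exprS; field; rewrite expf_neq0. Qed.

Lemma depth_gt0 k : 0 < depth k. by rewrite divr_gt0// exprn_gt0. Qed.

Lemma depth0 : depth 0 = r. by rewrite /depth expr0 divr1. Qed.

Lemma depth_le k : depth k <= r.
by elim: k => [|k IH]; [rewrite depth0|have := depth_gt0 k.+1; have := depthS k; lra]. Qed.

(** The contraction of [layer_step] is summed over dyadic layers; each point
    lies in boundedly many enlarged layers. *)
Lemma layer_bound : Lsq (layer r (r / 2) r) q ->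
 Lsq (layer r 0 r) q /\ nsq (layer r 0 r) q <= 3 * nsq (layer r (r / 2) r) q + 12 * lconst * energy D.
move=> L0; pose La' k := layer r (depth k.+1) (depth k).
have E0 : La' 0%N = layer r (r / 2) r by rewrite /La' depth0 /depth expr1.
pose en k := energy (layer (2 * r) (depth k.+3) (2 * depth k)).
have st k : Lsq (La' k) q -> Lsq (La' k.+1) q /\
  nsq (La' k.+1) q <= 2 / 3 * nsq (La' k) q + lconst * en k.
 have d1 := depthS k; have d2 := depthS k.+1; have d3 := depthS k.+2; have dk := depth_le k.
 have s4 : 4 * depth k.+2 <= r by lra. have := layer_step (depth_gt0 k.+2) s4; rewrite /La' /en.
 have -> : 2 * depth k.+2 = depth k.+1 by lra. have -> : 4 * depth k.+2 = depth k by lra.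
 have -> : 8 * depth k.+2 = 2 * depth k by lra. by have -> : depth k.+2 / 2 = depth k.+3 by lra.
have LL k : Lsq (La' k) q by elim: k => [|k /st[]//]; rewrite E0.
pose F k := energy (layer (2 * r) (2 * depth k) (2 * r)).
have F01 k : 0 <= F k <= energy D.
 rewrite energy_ge0/=; apply: energy_le => //; first exact: mlayer.
 by apply: layer_dom => //; have := depth_gt0 k; lra.
have enE k : en k = F k.+4 - F k.
 rewrite /en /F; have d4 := depthS k.+3; rewrite -d4.
 have d1 := depthS k; have d2 := depthS k.+1; have d3 := depthS k.+2.
 have p := depth_gt0 k.+3; have dk := depth_le k. have q1 : 0 <= depth k.+3 by exact: ltW.
 have q2 : depth k.+3 <= 2 * depth k by lra. have q3 : 2 * depth k <= 2 * r by lra.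
 by rewrite (energy_layer q1 q2 q3 (lexx _)) addrK.
have sumE n : \sum_(k < n) en k <= 4 * energy D by rewrite (eq_bigr (fun k : 'I_n => F k.+4 - F k)) ?sum_lag// => k _; exact: enE.
have bound := sum_contract lconst_ge0 (fun k => nsq_ge0 (La' k) q) (fun k => (st k (LL k)).2) sumE.
pose T n := layer r (depth n) r.
have TS n : Lsq (T n) q /\ nsq (T n) q = \sum_(k < n) nsq (La' k) q.
 elim: n => [|n [IL IE]].
  have -> : T 0%N = set0 by apply/seteqP; split => // y [_ /andP[]]; rewrite depth0 ltNge => /negP.
  by rewrite big_ord0 /nsq Rintegral_set0; split => //; split; [exact: measurable_fun_set0|exact: integrable_set0].
 have d1 := depthS n; have p := depth_gt0 n.+1; have dk := depth_le n.
 have hn : depth n.+1 <= depth n by lra. have [U1 U2] := layer_nsq hn dk (LL n) IL; split => //.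
 by rewrite U2 IE big_ord_recr/= addrC.
have [] := @nsq_exhaust R T q (3 * nsq (layer r (r / 2) r) q + 12 * lconst * energy D).
- move=> n m nm; apply/subsetPset => y [py /andP[u v]]; split => //; rewrite v andbT.
 apply: le_lt_trans u; rewrite /depth; apply: ler_wpM2l; first exact: ltW.
 by rewrite lef_pV2 ?posrE ?exprn_gt0// ler_weXn2l// ler1n.
- by move=> n; exact: mlayer.
- move=> n; have [TL ->] := TS n; split => //; apply: le_trans (bound n) _.
 by rewrite E0 lerD2l; move: (energy D) lconst => p1 p2; rewrite le_eqVlt; apply/orP; left; apply/eqP; ring.
have -> : \bigcup_n T n = layer r 0 r; last by [].
apply/seteqP; split => y.
 by move=> [n _ [py /andP[u v]]]; split => //; rewrite v andbT (lt_trans _ u)// depth_gt0.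
move=> [py /andP[u v]]; exists (Num.bound (r / t y)) => //; split=> //; rewrite v andbT.
rewrite /depth ltr_pdivrMr ?exprn_gt0// mulrC -ltr_pdivrMr//.
have := archi_boundP (ltW (divr_gt0 r0 u)) => /lt_trans; apply.
by rewrite -natrX ltr_nat ltn_expl.
Qed.

End Layers.

Lemma two_bounds (R : realType) (p1 p2 k m X : R) : p1 <= k * m * X -> p2 <= k * m * X ->
 2 * p1 + 2 * p2 <= 4 * k * m * X.
have -> : 4 * k * m * X = 4 * (k * m * X) by ring.
by move: (k * m * X) => t; lra.
Qed.

Lemma sq_diff_bound (R : realType) (p1 p2 p3 : R) : p1 ^+ 2 <= p3 -> p2 ^+ 2 <= p3 -> (p1 - p2) ^+ 2 <= 4 * p3.
move=> h1 h2; rewrite -subr_ge0.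
have -> : 4 * p3 - (p1 - p2) ^+ 2 = 2 * (p3 - p1 ^+ 2) + 2 * (p3 - p2 ^+ 2) + (p1 + p2) ^+ 2 by ring.
by apply: addr_ge0; [apply: addr_ge0; apply: mulr_ge0; rewrite ?ler0n ?subr_ge0|exact: sqr_ge0].
Qed.

Section PotentialBound.
Context {R : realType}.
Local Notation sp := (R * R * R)%type.
Implicit Types (f g phi q : sp -> R) (x y h e z : sp) (U L : set sp) (a : 'I_3 -> sp -> R).
Variables (D : set sp).
Hypotheses (oD : open D) (bD : bounded_set D).
Let mD := mopen oD.
Let kappa : R := \int[leb3]_x rho x.

Definition cc_free a := (forall i, Lsq D (a i)) /\
 forall v, (forall i, test_fun D (v i)) -> \int[leb3]_(x in D) (\sum_i a i x * cu (cu v) i x) = 0.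

Definition scale_at z : R := xget 0 [set d | adm D z d].

(** The curl of [a], which is harmonic, recovered by averaging. *)
Definition hcurl a (i : 'I_3) z := cc D a (scale_at z) i z.

Lemma scale_atP z : D z -> adm D z (scale_at z).
move=> /(adm_local oD)[d d0 Hd]; apply: (xgetPex 0); exists d; apply: Hd.
by rewrite subrr normr0 ltW.
Qed.

Lemma adm_D z (d : R) : adm D z d -> D z.
by move=> [d0 H]; apply: H; rewrite subrr normr0 mulr_ge0// ltW. Qed.

Lemma hcurlE a z (d : R) i : cc_free a -> adm D z d -> hcurl a i z = cc D a d i z.
move=> [La ca] hd; apply: (cc_indep oD La ca) => //.
by apply: scale_atP; exact: adm_D hd.
Qed.

Lemma rho_bound : exists2 M : R, 0 <= M & forall k x, `|partial k rho x| <= M.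
have [M0 p0 H0] := Cc_bd (Cc_pd 0 (@Cc_rho R)).
have [M1 p1 H1] := Cc_bd (Cc_pd 1 (@Cc_rho R)).
have [M2 p2 H2] := Cc_bd (Cc_pd 2 (@Cc_rho R)).
exists (M0 + M1 + M2); first by rewrite !addr_ge0.
move=> k x; elim/ord3 : k.
- by apply: le_trans (H0 x) _; rewrite -addrA lerDl addr_ge0.
- by apply: le_trans (H1 x) _; rewrite (addrC M0) -addrA lerDl addr_ge0.
- by apply: le_trans (H2 x) _; rewrite lerDr addr_ge0.
Qed.

Lemma pd_rho_d (d : R) k : partial k (rho_d d) = fun x => d^-1 ^+ 4 * partial k rho (d^-1 *: x).
have := pd_scale (d^-1 ^+ 3) (d^-1) k (Cc_sm (@Cc_rho R)).
by rewrite -exprSr.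
Qed.

Lemma pd_rho_d0 (d : R) k x : 0 < d -> 3 * d <= `|x| -> partial k (rho_d d) x = 0.
move=> d0 dx; rewrite -(pd_cst (0 : R) x k); apply: near_pd.
have d2 : 2 * d < `|x| by apply: lt_le_trans dx; rewrite ltr_pM2r// ltr_nat.
have /= H := open_nbhs_nbhs (conj (@open_norm_gt R (2 * d)) d2).
by apply: filterS H => y /= /ltW; exact: rho_d0.
Qed.

Lemma energy_comp a U i : nsq U (a i) <= energy a U.
rewrite /energy (bigD1 i)//= lerDl; apply: sumr_ge0 => j _; exact: nsq_ge0.
Qed.

(** The harmonic field is an average of [a] against a kernel with one derivative
    at scale [d], which costs a factor [1/d]. *)
Lemma field_bound : exists2 A : R, 0 <= A & forall a, cc_free a ->
 forall L L' (d : R), measurable L -> measurable L' -> L' `<=` D -> 0 < d ->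
 (forall z x, L z -> `|x - z| < 3 * d -> L' x) ->
 forall i, Lsq L (hcurl a i) /\ nsq L (hcurl a i) <= A * d ^- 2 * energy a L'.
have [M M0 HM] := rho_bound.
exists (kappa^-1 ^+ 2 * (4 * ((2 * 3) ^+ 3) ^+ 2 * M ^+ 2)).
 apply: mulr_ge0; first exact: sqr_ge0.
 by apply: mulr_ge0; [apply: mulr_ge0; [exact: ler0n|exact: sqr_ge0]|exact: sqr_ge0].
move=> a ca L L' d mL mL' L'D d0 sep i; have [La _] := ca.
have hd z : L z -> adm D z d.
 move=> Lz; split => // x xz; apply: L'D; apply: sep Lz _; apply: le_lt_trans xz _.
 by rewrite ltr_pM2r// ltr_nat.
have B k l : Lsq L (Am D a (partial k (rho_d d)) l) /\
  nsq L (Am D a (partial k (rho_d d)) l) <= ((2 * (3 * d)) ^+ 3) ^+ 2 * ((d^-1 ^+ 4 * M) ^+ 2 * energy a L').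
 have d3 : 0 < 3 * d by rewrite mulr_gt0.
 have dM : 0 <= d^-1 ^+ 4 * M by rewrite mulr_ge0// exprn_ge0// invr_ge0 ltW.
 have [||B1 B2] := moll_bound (a_itg oD bD La l) (a_L2 oD La l)
  (Cc_pd k (Cc_rho_d d0)) d3 dM _ _ mL mL' sep.
 - move=> h; rewrite pd_rho_d normrM ger0_norm ?exprn_ge0 ?invr_ge0 ?(ltW d0)//.
  by rewrite ler_wpM2l// exprn_ge0// invr_ge0 ltW.
 - by move=> h; exact: pd_rho_d0. split => //; apply: le_trans B2 _; apply: ler_wpM2l; first exact: sqr_ge0.
 apply: ler_wpM2l; first exact: sqr_ge0.
 rewrite (_ : nsq L' (a l \_ D) = nsq L' (a l)); first exact: energy_comp.
 by apply: nsq_eq => x L'x; rewrite patchE mem_set//; exact: L'D.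
have [L1 N1] := B (i + 1) (i + 2); have [L2 N2] := B (i + 2) (i + 1).
have LW : Lsq L (cc D a d i).
 exact: (@L2gZ _ _ _ leb3 L mL (kappa^-1) _ (@L2gB _ _ _ leb3 L mL _ _ L1 L2)).
have E x : L x -> cc D a d i x = hcurl a i x by move=> /hd H; rewrite (hcurlE i ca H).
split; first exact: L2_eq E LW.
rewrite -(nsq_eq E).
have -> : nsq L (cc D a d i) = kappa^-1 ^+ 2 *
  nsq L (fun x => Am D a (partial (i + 1) (rho_d d)) (i + 2) x - Am D a (partial (i + 2) (rho_d d)) (i + 1) x).
 by rewrite -nsqZ//; exact: (@L2gB _ _ _ leb3 L mL _ _ L1 L2).
rewrite -[leRHS]mulrA -[leRHS]mulrA; apply: ler_wpM2l; first exact: sqr_ge0.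
apply: le_trans (nsq_sub mL L1 L2) _.
have fact (d1 m E1 : R) : d1 != 0 -> ((2 * (3 * d1)) ^+ 3) ^+ 2 * ((d1^-1 ^+ 4 * m) ^+ 2 * E1) =
  ((2 * 3) ^+ 3) ^+ 2 * m ^+ 2 * (d1 ^- 2 * E1) by move=> d1_neq0; field.
rewrite fact ?gt_eqF// in N1; rewrite fact ?gt_eqF// in N2.
exact: two_bounds N1 N2.
Qed.

(** Balls on which all the potentials below are smooth, whatever the data. *)
Lemma field_potential z (d : R) a : cc_free a -> 0 < d -> (forall y, `|y - z| <= d -> adm D y d) ->
 exists G, pot_on D (hcurl a) z d G.
move=> ca d0 hd; have [La cca] := ca.
have zd y : ball z d y -> adm D y d by rewrite -ballE/= distrC => /ltW; exact: hd.
have [||G sG HG] := @local_potential R (cc D a d) z d d0.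
- by move=> k; exact: cc_smooth.
- by move=> y /zd hy k l; exact: cc_curl.
exists G; split; [exact: sG|by move=> y zy; exact: adm_D (zd y zy)|].
by move=> w zw k; rewrite (hcurlE k ca (zd _ zw)); exact: HG.
Qed.

Variable zs : sp.
Hypothesis Dzs : D zs.

Definition sol a q := [/\ cc_free a, q zs = 0 & forall z (r : R) G, 0 < r ->
 pot_on D (hcurl a) z r G -> forall y, ball z r y -> q y = q z + (G y - G z)].

Lemma sol_exists a : simply_connected D -> cc_free a -> exists q, sol a q.
move=> sc ca; have [|q Hq] := @monodromy R D (hcurl a) _ sc.
 move=> z /(adm_local oD)[d d0 Hd]; have [G PG] := field_potential ca d0 Hd. by exists d, G.
exists (fun y => q y - q zs); split => //; first by rewrite subrr.
by move=> z r G r0 PG y zy; rewrite (Hq _ _ _ r0 PG _ zy); ring.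
Qed.

Lemma sol_local z : D z -> exists2 d : R, 0 < d & (forall y, `|y - z| <= d -> adm D y d) /\
 forall a q, sol a q -> exists2 G, smooth G &
 forall w, ball z d w -> q w = G w /\ forall k, partial k G w = hcurl a k w.
move=> /(adm_local oD)[d d0 Hd]; exists d => //; split => // a q [ca _ Hq].
have [G PG] := field_potential ca d0 Hd; have [sG _ HG] := PG.
exists (fun y => G y + (q z - G z)); first by apply: smoothD => //; exact: sm_cst.
move=> w zw; split; first by rewrite (Hq _ _ _ d0 PG _ zw); ring.
move=> k; rewrite -HG// pdD ?pd_cst ?addr0//; exact: sm_diff.
Qed.

Lemma sol_potential a q : sol a q -> potential D (hcurl a) q.
move=> S z /sol_local[d d0 [_ H]]; have [G sG HG] := H _ _ S.
by exists d => //; exists G.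
Qed.

Definition sol_energy q (N : R) := exists2 a, sol a q & energy a D <= N.

Lemma sol_energy_ge0 q (N : R) : sol_energy q N -> 0 <= N.
by move=> [a _]; apply: le_trans; exact: energy_ge0. Qed.

Definition good x := exists2 r : R, 0 < r & ball x r `<=` D /\ exists2 C : R, 0 <= C &
 forall q (N : R), sol_energy q N -> Lsq (ball x r) q /\ nsq (ball x r) q <= C * N.

Lemma hcurl_pt (d : R) : 0 < d -> exists2 C : R, 0 <= C & forall a y k, cc_free a ->
 adm D y d -> hcurl a k y ^+ 2 <= C * energy a D.
move=> d0; pose S := \sum_k nsq setT (partial k (rho_d d)).
have S0 : 0 <= S by apply: sumr_ge0 => k _; exact: nsq_ge0.
exists (kappa^-1 ^+ 2 * (4 * S)).
 by apply: mulr_ge0; [exact: sqr_ge0|apply: mulr_ge0].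
move=> a y k ca hy; have [La _] := ca.
have B i l : Am D a (partial i (rho_d d)) l y ^+ 2 <= S * energy a D.
 have := moll_pt y (a_L2 oD La l) (Cc_pd i (Cc_rho_d d0)).
 rewrite nsq_zext// => /le_trans; apply; rewrite mulrC.
 apply: ler_pM; [exact: nsq_ge0|exact: nsq_ge0| |exact: energy_comp].
 by rewrite /S (bigD1 i)//= lerDl; apply: sumr_ge0 => j _; exact: nsq_ge0.
rewrite (hcurlE k ca hy).
have -> : cc D a d k y ^+ 2 = kappa^-1 ^+ 2 * (Am D a (partial (k + 1) (rho_d d)) (k + 2) y -
  Am D a (partial (k + 2) (rho_d d)) (k + 1) y) ^+ 2 by exact: exprMn.
rewrite -[leRHS]mulrA; apply: ler_wpM2l; first exact: sqr_ge0.
by rewrite -[leRHS]mulrA; exact: sq_diff_bound (B _ _) (B _ _).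
Qed.

Lemma good_base : good zs.
have [d d0 [Hd HG]] := sol_local Dzs; exists d => //; split.
 by move=> y; rewrite -ballE/= distrC => /ltW/Hd/adm_D.
have [C C0 HC] := hcurl_pt d0.
exists ((3 * d) ^+ 2 * C * nsq (ball zs d) (fun=> 1)).
 by apply: mulr_ge0; [apply: mulr_ge0 => //; exact: sqr_ge0|exact: nsq_ge0].
move=> q N [a S EN]; have [G sG Gq] := HG _ _ S; have [ca q0 _] := S.
have N0 : 0 <= N by exact: le_trans (energy_ge0 a D) EN.
have mB := mball zs d.
have LG := sm_L2_ball zs d0 sG.
have Lq : Lsq (ball zs d) q by apply: L2_eq mB _ LG => y /Gq[].
split => //; have L1 := sm_L2_ball zs d0 (sm_cst (1 : R)).
pose K := 3 * Num.sqrt (C * N) * d.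
have K2 : K ^+ 2 = (3 * d) ^+ 2 * C * N by rewrite /K !exprMn sqr_sqrtr ?mulr_ge0//; ring.
rewrite mulrAC -K2 -nsqZ//; apply: nsq_mono => //; first by case: Lq.
 exact: (@L2gZ _ _ _ leb3 (ball zs d) mB).
move=> y zy; rewrite mulr1 -[q y ^+ 2]real_normK ?num_real//.
have sK : 0 <= K by rewrite /K !mulr_ge0// ?sqrtr_ge0// ltW.
rewrite lerXn2r ?nnegrE//.
have seg (s : R) : 0 <= s <= 1 -> ball zs d (zs + s *: (y - zs)) by apply: ball_seg => //; exact: ballxx.
have H := @mvt_le R G (Num.sqrt (C * N)) zs (y - zs) (fun s _ => @sm_diff R G _ sG).
have -> : q y = G (zs + (y - zs)) - G zs by rewrite [zs + _]addrC subrK; have [<- _] := Gq _ zy; have [<- _] := Gq _ (ballxx zs d0); rewrite q0 subr0.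
apply: le_trans (H _) _; last first.
 rewrite /K ler_wpM2l ?mulr_ge0 ?sqrtr_ge0//. by move: zy; rewrite -ballE/= distrC => /ltW.
move=> s /seg zw i; have [_ ->] := Gq _ zw.
rewrite -sqrtr_sqr ler_sqrt ?mulr_ge0//.
apply: le_trans (HC _ _ i ca _) _; last exact: ler_wpM2l.
by apply: Hd; move: zw; rewrite -ballE/= distrC => /ltW.
Qed.

Lemma good_closed y : D y -> closure good y -> good y.
move=> Dy cy; have [d d0 [Hd HG]] := sol_local Dy.
have [x [[r r0 [rD [C C0 HC]]] xy]] := cy _ (nbhsx_ballx y d d0).
move: xy; rewrite -ballE/= => xy.
pose m := Num.min r (d - `|y - x|); pose c := m / d.
have m0 : 0 < m by rewrite /m lt_min r0 subr_gt0.
have cd : c * d = m by rewrite /c mulfVK// gt_eqF.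
have c0 : 0 < c by exact: divr_gt0.
have c1 : c <= 1.
 rewrite /c ler_pdivrMr// mul1r /m ge_min; apply/orP; right. by rewrite lerBlDr lerDl.
have sub : ball x (c * d) `<=` ball y d.
 move=> w; rewrite cd -!ballE/= => xw; apply: le_lt_trans (ler_distD x y w) _.
 rewrite -ltrBrDl; apply: lt_le_trans xw _; by rewrite /m ge_min lexx orbT.
have sub' : ball x (c * d) `<=` ball x r by apply: le_ball; rewrite cd /m ge_min lexx.
have [C' C'0 HP] := poincare d0 c0 c1 sub.
have [A A0 HA] := field_bound.
exists d => //; split.
 by move=> w; rewrite -ballE/= distrC => /ltW/Hd/adm_D.
have A0' : 0 <= A * (d / 3) ^- 2 by apply: mulr_ge0 => //; rewrite invr_ge0 sqr_ge0.
exists (C' * (A * (d / 3) ^- 2 + C)).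
 by apply: mulr_ge0 => //; apply: addr_ge0.
move=> q N SN; have [a S EN] := SN; have [G sG Gq] := HG _ _ S; have [ca _ _] := S.
have N0 := sol_energy_ge0 SN.
have mB z s := @mball R z s.
have LG := sm_L2_ball y d0 sG.
have Eq w : ball y d w -> G w = q w by move=> /Gq[->].
split; first exact: L2_eq Eq LG.
rewrite -(nsq_eq Eq) -mulrA; apply: HP => //.
- move=> k; have d3 : 0 < d / 3 by rewrite divr_gt0.
 have h2 : ball y (2 * d) `<=` D.
  have [_ H] : adm D y d by apply: Hd; rewrite subrr normr0 ltW.
  by move=> w; rewrite -ballE/= distrC => /ltW; exact: H.
 have sep z w : ball y d z -> `|w - z| < 3 * (d / 3) -> ball y (2 * d) w.
  rewrite -!ballE/= [3 * _]mulrC mulfVK ?pnatr_eq0// (distrC w) => yz zw.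
  by apply: le_lt_trans (ler_distD z y w) _; rewrite mulr_natl mulr2n ltrD.
 have [Lk Nk] := HA a ca _ _ _ (mB y d) (mB y (2 * d)) h2 d3 sep k.
 have -> : nsq (ball y d) (partial k G) = nsq (ball y d) (hcurl a k) by apply: nsq_eq => w /Gq[_ ->].
 apply: le_trans Nk _; rewrite [leRHS]mulrDl; apply: (@le_trans _ _ (A * (d / 3) ^- 2 * N)).
  apply: ler_wpM2l => //; apply: le_trans EN; apply: ler_sum => l _.
  by have [La _] := ca; exact: (nsqS mD (mB y (2 * d)) h2 (La l)).
 by rewrite lerDl mulr_ge0.
have [Lr Nr] := HC q N SN.
have -> : nsq (ball x (c * d)) G = nsq (ball x (c * d)) q by apply: nsq_eq => w /sub; exact: Eq.
apply: le_trans (nsqS (mB _ _) (mB _ _) sub' Lr) _; apply: le_trans Nr _.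
by rewrite [leRHS]mulrDl lerDr mulr_ge0.
Qed.

Hypotheses (cD : connected D) (LD : lipschitz_boundary D).

(** Transporting the bound from ball to ball with the Poincare inequality, the
    points around which it holds are open and closed in [D]. *)
Lemma good_all x : D x -> good x.
have gD w : good w -> D w by move=> [r r0 [H _]]; apply: H; exact: ballxx.
have og : open good.
 rewrite openE => w [r r0 [rD [C C0 HC]]]; apply/nbhs_ballP; exists r => //= y wy.
 have yr : 0 < r - `|w - y| by move: wy; rewrite -ballE/= subr_gt0.
 have sub : ball y (r - `|w - y|) `<=` ball w r.
  move=> z; rewrite -!ballE/= => yz; apply: le_lt_trans (ler_distD y w z) _. by rewrite -ltrBrDl.
 exists (r - `|w - y|) => //; split; first by move=> z /sub; exact: rD.
 exists C => // q N SN; have [Lq Nq] := HC q N SN.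
 split; first by apply: (L2_sub (mball w r) (mball _ _) sub Lq).
 exact: le_trans (nsqS (mball w r) (mball _ _) sub Lq) Nq.
have E : good = D.
 apply: cD.
 - by exists zs; exact: good_base.
 - by exists good => //; apply/seteqP; split=> w; [move=> H; split => //; exact: gD|case].
 - exists (closure good); first exact: closed_closure.
  apply/seteqP; split=> w; first by move=> H; split; [exact: gD|exact: subset_closure].
  by move=> [Dw cw]; exact: good_closed.
by rewrite E.
Qed.

Lemma sol_bound_near_bd x0 : boundary D x0 -> exists2 r : R, 0 < r & exists2 C : R, 0 <= C &
 forall q (N : R), sol_energy q N -> Lsq (D `&` ball x0 r) q /\ nsq (D `&` ball x0 r) q <= C * N.
move=> bx; have [ch] := charts oD LD bx.
pose r := c_rad ch / 4; have r0 : 0 < r by rewrite divr_gt0// c_rad0.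
have r4 : 4 * r <= c_rad ch by rewrite /r mulrC divfK// pnatr_eq0.
have [A A0 HA] := field_bound.
pose K0 := [set y | `|bproj ch y - x0| <= r /\ r / 2 <= c_ht ch y <= r].
have L0K : layer ch r (r / 2) r `<=` K0 by move=> y [/ltW p /andP[/ltW u v]]; split => //; rewrite u.
have K0D : K0 `<=` D.
 move=> y [p /andP[u v]]; apply: (@layer_dom R D x0 ch r r4 (2 * r) (r / 4) (2 * r) (lexx _) _ (lexx _)); first by rewrite divr_ge0// ltW.
 split; first by apply: le_lt_trans p _; lra. by apply/andP; split; lra.
have cK : compact K0.
 have [M HM] := cl_bounded bD.
 move=> HM'; apply: (subclosed_compact _ (@compact_cball R M)); last first.
  by move=> y /K0D Dy; apply: HM'; exact: subset_closure.
 have -> : K0 = (fun y => `|bproj ch y - x0|) @^-1` [set t | t <= r] `&`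
   (c_ht ch @^-1` [set t | r / 2 <= t] `&` c_ht ch @^-1` [set t | t <= r]).
  by apply/seteqP; split => y; [move=> [p /andP[u v]]|move=> [p [u v]]; split => //; rewrite u].
 apply: closedI; [|apply: closedI]; apply: closed_comp.
 - by move=> y _; exact: bproj_cont.
 - exact: closed_le.
 - by move=> y _; exact: ht_cont.
 - exact: closed_ge.
 - by move=> y _; exact: ht_cont.
 - exact: closed_le.
have mL := mlayer ch r (r / 2) r.
have [|C C0 HC] := cover_bound cK mL L0K sol_energy_ge0; first last.
 pose K := c_lip ch; have K1 : 1 <= K := c_lip1 ch. have K2 : 0 < 2 * K by lra.
 exists (r / (2 * K)); first by rewrite divr_gt0.
 have B0 : 0 <= 3 * C + 12 * lconst A ch by apply: addr_ge0; apply: mulr_ge0 => //; exact: lconst_ge0.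
 exists (3 * C + 12 * lconst A ch) => // q N SN; have [a S EN] := SN; have [ca _ _] := S.
 have [La _] := ca; have [LL NL] := HC q N SN.
 have [L1 N1] := layer_bound oD La (sol_potential S) A0 (HA a ca) r0 r4 LL.
 have sub : D `&` ball x0 (r / (2 * K)) `<=` layer ch r 0 r.
  move=> y [Dy]; rewrite -ballE/= distrC => yx.
  have tK : `|c_ht ch y| <= K * `|y - x0| by have := c_ht_lip ch y x0; rewrite c_ht0 subr0.
  have Kr : 2 * K * `|y - x0| < r by rewrite mulrC -ltr_pdivlMr.
  have yK : `|y - x0| <= K * `|y - x0| by rewrite ler_peMl. have n0 := normr_ge0 (y - x0).
  have ty : 0 < c_ht ch y.
   apply/(c_dom (c := ch)) => //; apply: lt_le_trans r4; lra.
  split; last by rewrite ty/=; move: tK; rewrite gtr0_norm//; lra.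
  have -> : bproj ch y - x0 = (y - x0) - c_ht ch y *: c_dir ch by rewrite /bproj addrAC.
  apply: le_lt_trans (ler_normB _ _) _; rewrite normrZ.
  have := ler_piMr (normr_ge0 (c_ht ch y)) (c_dir1 ch); lra.
 have mS : measurable (D `&` ball x0 (r / (2 * K))) by apply: measurableI => //; exact: mball.
 have mL0 := mlayer ch r 0 r. split; first exact: (L2_sub mL0 mS sub L1).
 apply: le_trans (nsqS mL0 mS sub L1) _; apply: le_trans N1 _.
 rewrite [leRHS]mulrDl; apply: lerD; first by rewrite -mulrA ler_wpM2l.
 by apply: ler_wpM2l => //; apply: mulr_ge0 => //; exact: lconst_ge0.
move=> x /K0D/good_all[s s0 [sD [C1 C10 H1]]]; exists s => //; exists C1 => // q N SN.
have [Lq Nq] := H1 q N SN; have mB := mball x s.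
have mS : measurable (layer ch r (r / 2) r `&` ball x s) by exact: measurableI.
have sub : layer ch r (r / 2) r `&` ball x s `<=` ball x s by move=> y [].
split; first exact: (L2_sub mB mS sub Lq).
exact: le_trans (nsqS mB mS sub Lq) Nq.
Qed.

Theorem sol_bound : exists2 C : R, 0 <= C & forall q (N : R), sol_energy q N ->
 Lsq D q /\ nsq D q <= C * N.
apply: (cover_bound (closure_compact bD) mD (@subset_closure _ D) sol_energy_ge0).
move=> x cx; have [/good_all[s s0 [sD [C C0 H]]]|/sol_bound_near_bd bx] := closure_bd oD cx; last exact: bx.
exists s => //; exists C => // q N SN; have [Lq Nq] := H q N SN.
suff -> : D `&` ball x s = ball x s by [].
by apply/seteqP; split => y; [case|move=> b; split => //; exact: sD].
Qed.

End PotentialBound.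

Lemma nine_fact (R : realType) (t1 t2 t3 t4 : R) : t1 <= t4 -> t2 <= t4 -> t3 <= t4 ->
 3 * (t1 + t2 + t3) <= 9 * t4.
by lra. Qed.

Lemma split_fact (R : realType) (k t1 t2 t3 u1 u2 u3 : R) : k != 0 ->
 k^-1 * (t1 + t2 + t3) - (u1 + u2 + u3) = k^-1 * ((t1 - k * u1) + (t2 - k * u2) + (t3 - k * u3)).
by move=> k0; field. Qed.

Lemma small0 (R : realType) (t K : R) : 0 <= K -> (forall e : R, 0 < e -> t ^+ 2 <= e * K) -> t = 0.
move=> K0 H; apply/eqP; rewrite -[_ == 0]negbK; apply/negP => t0.
have p : 0 < t ^+ 2 by rewrite lt_neqAle sqr_ge0 eq_sym sqrf_eq0 t0.
have k : 0 < 2 * (K + 1) by lra.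
have := H _ (divr_gt0 p k); rewrite mulrAC ler_pdivlMr// ler_pM2l//; lra.
Qed.

Lemma curl_alg (R : realType) (T : 'I_3 -> 'I_3 -> 'I_3 -> R) :
 \sum_i (T (i + 1) (i + 2) i - T (i + 2) (i + 1) i) = \sum_i (T i (i + 1) (i + 2) - T i (i + 2) (i + 1)).
by rewrite !sum3 !ord3E; ring. Qed.

(** * The weak divergence identity *)
Section WeakIdentity.
Context {R : realType}.
Local Notation sp := (R * R * R)%type.
Implicit Types (f g phi q b : sp -> R) (x y h e z : sp) (U L : set sp).
Variables (D : set sp) (a : 'I_3 -> sp -> R).
Hypotheses (oD : open D) (bD : bounded_set D) (ca : cc_free D a).
Let mD := mopen oD.
Let kappa : R := \int[leb3]_x rho x.
Let La := ca.1.

Lemma test_local v f : test_fun D v ->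
 (forall x, D x -> exists2 g, smooth g & \forall y \near x, f y = g y) -> test_fun D (fun x => f x * v x).
move=> tv fl; have [sv cK KD] := tv.
apply: (test_funP _ cK KD) => [|x nx]; last first.
 by have /nbhs_singleton -> := test_near0 tv nx; rewrite mulr0.
apply: locally_smooth => x; have [Dx|nD] := pselect (D x).
 have [g sg fg] := fl x Dx; exists (fun y => g y * v y); first exact: smoothM. by apply: filterS fg => y ->.
exists (fun=> 0); first exact: sm_cst.
have nx : ~ closure [set x | v x != 0] x by move=> /KD.
by apply: filterS (test_near0 tv nx) => y ->; rewrite mulr0.
Qed.

Lemma test_itg v : test_fun D v -> itg3 D v.
by move=> tv; apply: (@integrableS _ _ _ leb3 setT) => //; exact: Cc_itg (test_Cc tv).
Qed.

Lemma test_int_pd v i : test_fun D v -> \int[leb3]_(x in D) partial i v x = 0.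
move=> tv; rewrite -[RHS](int_pd0 i (test_Cc tv)).
have := int_test (fun=> 1) (test_pd i tv).
by under eq_int do rewrite mul1r; under [in RHS]eq_int do rewrite mul1r.
Qed.

Lemma potential_weak c q v i : potential D c q -> test_fun D v ->
 itg3 D (fun x => c i x * v x) /\ itg3 D (fun x => q x * partial i v x) /\
 \int[leb3]_(x in D) (c i x * v x) = - \int[leb3]_(x in D) (q x * partial i v x).
move=> qc tv.
have ql x : D x -> exists2 g, smooth g & \forall y \near x, q y = g y by move=> /(potential_near qc)[G sG HG]; exists G => //; apply: filterS HG => y [].
have cl x : D x -> exists2 g, smooth g & \forall y \near x, c i y = g y.
 move=> /(potential_near qc)[G sG HG]; exists (partial i G); first exact: sm_pd.
 by apply: filterS HG => y [_].
have t1 := test_itg (test_local tv cl); have t2 := test_itg (test_local (test_pd i tv) ql).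
split => //; split => //; apply/eqP; rewrite -subr_eq0 opprK -RintegralD//; apply/eqP.
rewrite -[RHS](test_int_pd i (test_local tv ql)); apply: eq_int => x /set_mem Dx.
have [G sG HG] := potential_near qc Dx.
have E : partial i (fun y => q y * v y) x = partial i (fun y => G y * v y) x by apply: near_pd; apply: filterS HG => y [->].
have [-> Hc] := nbhs_singleton HG.
have M := @pdM R G v x i (@sm_diff R G x sG) (@sm_diff R v x (test_sm tv)).
rewrite Hc; apply: (etrans _ (esym (etrans E M))).
by move: (partial i G x) (G x) (partial i v x) (v x) => p1 p2 p3 p4; ring.
Qed.

(** Rescaling at constant integral. *)
Definition dilate b (d : R) x := d^-1 ^+ 3 * b (d^-1 *: x).

Lemma Cc_dilate b (d : R) : 0 < d -> Cc b -> Cc (dilate b d).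
move=> d0 [sb [r br]]; split; first exact: sm_scale.
exists (d * r) => x dx; rewrite /dilate br ?mulr0// normrZ gtr0_norm ?invr_gt0//.
by rewrite mulrC ltr_pdivlMr// mulrC.
Qed.

Lemma int_dilate b (d : R) : 0 < d -> Cc b -> \int[leb3]_x dilate b d x = \int[leb3]_x b x.
move=> d0 cb; have dn : d^-1 != 0 by rewrite invr_neq0// gt_eqF.
have [I ->] := int_affine 0 dn (Cc_itg cb).
rewrite gtr0_norm ?invr_gt0// -RintZ//; apply: eq_int => x _.
by rewrite /dilate addr0.
Qed.

Lemma AmZ (k : R) phi l z : Cc phi -> Am D a (fun x => k * phi x) l z = k * Am D a phi l z.
move=> cp; have E psi : Am D a psi l z = \int[leb3]_(x in D) (a l x * psi (z - x)) by exact: AmE.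
rewrite (E (fun x => k * phi x)) (E phi) -RintZ//; last first.
 apply: (@L2g_mul _ _ _ leb3 D mD); first exact: La.
 by apply: (@L2_sub _ setT) => //; apply: L2_reflect; exact: Cc_L2.
by apply: eq_int => x _; rewrite mulrCA.
Qed.

(** Averages against concentrating kernels converge to multiples of [a]; the sign
    of the kernel is handled by splitting. *)
Lemma average_pos b (r : R) l : Cc b -> (forall x, 0 <= b x) -> 0 < \int[leb3]_x b x ->
 0 < r -> (forall x, r <= `|x| -> b x = 0) -> forall e : R, 0 < e -> exists2 d0 : R, 0 < d0 &
 forall d : R, 0 < d < d0 ->
 Lsq setT (fun z => Am D a (dilate b d) l z - (\int[leb3]_x b x) * (a l \_ D) z) /\
 nsq setT (fun z => Am D a (dilate b d) l z - (\int[leb3]_x b x) * (a l \_ D) z) <= e.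
set be := \int[leb3]_x b x => cb b0 be0 r0 br e e0.
have Lf := a_L2 oD La l; have If := a_itg oD bD La l.
have e1 : 0 < e / be ^+ 2 by rewrite divr_gt0// exprn_gt0.
have [s s0 Hs] := L2_translation Lf e1.
exists (s / r) => [|d /andP[d0 ds]]; first by rewrite divr_gt0.
have cd := Cc_dilate d0 cb.
pose b' x := be^-1 * dilate b d x.
have cb' : Cc b' by have [s1 [t Ht]] := cd; split; [exact: smoothZ|exists t => x /Ht; rewrite /b' => ->; rewrite mulr0].
have [||||L N] := moll_close If Lf cb' (r := d * r) (K := e / be ^+ 2).
- by move=> x; rewrite /b' /dilate; apply: mulr_ge0; [rewrite invr_ge0 ltW|
  apply: mulr_ge0; [rewrite exprn_ge0// invr_ge0 ltW|exact: b0]].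
- by rewrite RintZ// ?int_dilate ?mulVf ?gt_eqF//; exact: Cc_itg.
- move=> x dx; rewrite /b' /dilate br ?mulr0// normrZ gtr0_norm ?invr_gt0//.
 by rewrite mulrC ler_pdivlMr// mulrC.
- move=> h hd; apply: Hs; apply: lt_trans hd _; by rewrite -ltr_pdivlMr.
have E : (fun z => Am D a (dilate b d) l z - be * (a l \_ D) z) =
  fun z => be * (moll (a l \_ D) b' z - (a l \_ D) z).
 apply/funext => z; have -> : moll (a l \_ D) b' z = be^-1 * Am D a (dilate b d) l z by exact: AmZ.
 by rewrite mulrBr mulrA mulfV ?mul1r// gt_eqF.
rewrite E; split; first exact: (@L2gZ _ _ _ leb3 setT measurableT).
rewrite nsqZ//; apply: (@le_trans _ _ (be ^+ 2 * (e / be ^+ 2))).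
 by apply: ler_wpM2l => //; exact: sqr_ge0.
by rewrite mulrC mulfVK// expf_neq0// gt_eqF.
Qed.

Lemma average_rho l (e : R) : 0 < e -> exists2 d0 : R, 0 < d0 & forall d : R, 0 < d < d0 ->
 Lsq setT (fun z => Am D a (rho_d d) l z - kappa * (a l \_ D) z) /\
 nsq setT (fun z => Am D a (rho_d d) l z - kappa * (a l \_ D) z) <= e.
move=> e0; have cr := @Cc_rho R; have [M M0 HM] := Cc_bd cr.
have r4 : (0 : R) < 4 by [].
have cc4 : Cc (cut (0 : sp) 4) by exact: Cc_cut.
pose b2 x := (M + 1) * cut 0 4 x; pose b1 x := rho x + b2 x.
have M1 : 0 < M + 1 by rewrite ltr_wpDl.
have c2 : Cc b2 by have [s1 [t Ht]] := cc4; split; [exact: smoothZ|exists t => x /Ht; rewrite /b2 => ->; rewrite mulr0].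
have c1 : Cc b1 by exact: CcD.
have z2 x : 4 <= `|x| -> b2 x = 0 by move=> h; rewrite /b2 cut_0 ?mulr0// subr0.
have z1 x : 4 <= `|x| -> b1 x = 0 by move=> h; rewrite /b1 z2// addr0 rho_0// (le_trans _ h)// ler_nat.
have p2 x : 0 <= b2 x by apply: mulr_ge0; [exact: ltW|exact: cut_ge0].
have lo x : cut 0 4 x <= b1 x.
 have [h|h] := leP 2 `|x|.
  by rewrite /b1 /b2 rho_0// add0r ler_peMl ?cut_ge0// lerDr.
 have -> : cut (0 : sp) 4 x = 1 by rewrite cut_1// subr0 ltW//; apply: lt_le_trans h _; rewrite ler_pdivlMr// -natrM ler_nat.
 rewrite /b1 /b2; have -> : cut (0 : sp) 4 x = 1.
  by rewrite cut_1// subr0 ltW//; apply: lt_le_trans h _; rewrite ler_pdivlMr// -natrM ler_nat.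
 by have := HM x; rewrite ler_norml => /andP[h1 _]; rewrite mulr1 addrA lerDr -lerBlDr sub0r.
have p1 x : 0 <= b1 x by apply: le_trans (lo x); exact: cut_ge0.
have I2 : 0 < \int[leb3]_x b2 x by rewrite RintZ//; [apply: mulr_gt0 => //; exact: int_cut_gt0|exact: Cc_itg].
have I1 : 0 < \int[leb3]_x b1 x.
 apply: lt_le_trans (int_cut_gt0 (0 : sp) r4) _; apply: le_Rintegral => //; exact: Cc_itg.
have kE : kappa = \int[leb3]_x b1 x - \int[leb3]_x b2 x.
 rewrite -RintegralB//; try exact: Cc_itg. by apply: eq_int => x _; rewrite /b1 addrK.
have e4 : 0 < e / 4 by rewrite divr_gt0.
have [d1 d10 H1] := average_pos l c1 p1 I1 r4 z1 e4.
have [d2 d20 H2] := average_pos l c2 p2 I2 r4 z2 e4.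
exists (Num.min d1 d2) => [|d /andP[d0]]; first by rewrite lt_min d10.
rewrite lt_min => /andP[dd1 dd2].
have [|L1 N1] := H1 d; first by rewrite d0.
have [|L2 N2] := H2 d; first by rewrite d0.
have E : (fun z => Am D a (rho_d d) l z - kappa * (a l \_ D) z) = fun z =>
 (Am D a (dilate b1 d) l z - (\int[leb3]_x b1 x) * (a l \_ D) z) -
 (Am D a (dilate b2 d) l z - (\int[leb3]_x b2 x) * (a l \_ D) z).
 apply/funext => z; have AB := AmB oD La l z (Cc_dilate d0 c1) (Cc_dilate d0 c2).
 have RE : (fun x => dilate b1 d x - dilate b2 d x) = rho_d d by apply/funext => x; rewrite /dilate -mulrBr /b1 addrK.
 rewrite RE in AB; rewrite AB kE.
 by move: (Am _ _ _ _ _) (Am _ _ _ _ _) (\int[_]_x _) (\int[_]_x _) (patch _ _ _ _) => t1 t2 t3 t4 t5; ring.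
rewrite E; split; first exact: (@L2gB _ _ _ leb3 setT measurableT).
apply: le_trans (nsq_sub measurableT L1 L2) _.
move: N1 N2; move: (nsq _ _) (nsq _ _) => n1 n2; lra.
Qed.

Lemma test_itg_mul v f : smooth f -> test_fun D v -> itg3 D (fun x => f x * v x).
move=> sf tv; have -> : (fun x => f x * v x) = (fun x => v x * f x) by apply/funext => x; exact: mulrC.
by apply: test_itg; exact: test_mul.
Qed.

Lemma curl_ibp (A v : 'I_3 -> sp -> R) : (forall i, smooth (A i)) -> (forall i, test_fun D (v i)) ->
 \int[leb3]_(x in D) (\sum_i cu A i x * v i x) = \int[leb3]_(x in D) (\sum_i A i x * cu v i x).
move=> sA tv; have tp k m : test_fun D (partial k (v m)) by exact: test_pd.
pose T j k m := \int[leb3]_(x in D) (A j x * partial k (v m) x).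
have I1 k j m : itg3 D (fun x => partial k (A j) x * v m x) by apply: test_itg_mul => //; exact: sm_pd.
have I2 k j m : itg3 D (fun x => A j x * partial k (v m) x) by exact: test_itg_mul.
have E1 i x : cu A i x * v i x = partial (i + 1) (A (i + 2)) x * v i x - partial (i + 2) (A (i + 1)) x * v i x.
 exact: mulrBl.
have E2 i x : A i x * cu v i x = A i x * partial (i + 1) (v (i + 2)) x - A i x * partial (i + 2) (v (i + 1)) x.
 exact: mulrBr.
have J1 i : \int[leb3]_(x in D) (cu A i x * v i x) = T (i + 1) (i + 2) i - T (i + 2) (i + 1) i.
 under eq_int do rewrite E1; rewrite RintegralB//.
 have a1 := int_ibp_test (i + 1) (tv i) (sA (i + 2)); have a2 := int_ibp_test (i + 2) (tv i) (sA (i + 1)).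
 by apply: (etrans (f_equal2 (fun s t => s - t) a1 a2)); rewrite /T opprK addrC.
have J2 i : \int[leb3]_(x in D) (A i x * cu v i x) = T i (i + 1) (i + 2) - T i (i + 2) (i + 1) by under eq_int do rewrite E2; rewrite RintegralB.
have K1 i : itg3 D (fun x => cu A i x * v i x) by rewrite (funext (E1 i)); exact: itgB.
have K2 i : itg3 D (fun x => A i x * cu v i x) by rewrite (funext (E2 i)); exact: itgB.
have S1 := etrans (@Rint_sum _ _ _ leb3 D mD _ (index_enum _) predT _ (fun i _ => K1 i)) (eq_bigr _ (fun i _ => J1 i)).
have S2 := etrans (@Rint_sum _ _ _ leb3 D mD _ (index_enum _) predT _ (fun i _ => K2 i)) (eq_bigr _ (fun i _ => J2 i)).
exact: (etrans S1 (etrans (curl_alg T) (esym S2))).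
Qed.

Lemma hcurl_weak v : (forall i, test_fun D (v i)) ->
 \int[leb3]_(x in D) (\sum_i hcurl D a i x * v i x) = \int[leb3]_(x in D) (\sum_i a i x * cu v i x).
move=> tv; have tc i : test_fun D (cu v i) by exact: test_cu.
pose S := \sum_l nsq D (cu v l).
have S0 : 0 <= S by apply: sumr_ge0 => l _; exact: nsq_ge0.
have Sl l : nsq D (cu v l) <= S by rewrite /S (bigD1 l)//= lerDl; apply: sumr_ge0 => j _; exact: nsq_ge0.
apply/eqP; rewrite -subr_eq0; apply/eqP.
apply: (@small0 R _ (kappa^-1 ^+ 2 * (9 * S))).
 by apply: mulr_ge0; [exact: sqr_ge0|apply: mulr_ge0].
move=> e e0.
pose K := closure [set x | v 0 x != 0] `|` closure [set x | v 1 x != 0] `|` closure [set x | v 2 x != 0].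
have cK : compact K by apply: compactU; [apply: compactU|]; have [_ ? _] := tv 0; have [_ ? _] := tv 1; have [_ ? _] := tv 2.
have KD : K `<=` D by move=> x [[]|]; [have [_ _] := tv 0|have [_ _] := tv 1|have [_ _] := tv 2]; exact.
have vK i x : ~ K x -> v i x = 0.
 move=> nK; have : ~ closure [set x | v i x != 0] x.
  by move=> H; apply: nK; elim/ord3 : i H => H; [left; left|left; right|right].
 by move=> /(test_near0 (tv i))/nbhs_singleton.
have [eta eta0 Heta] := compact_margin cK oD KD.
have [d1 d10 H1] := average_rho 0 e0; have [d2 d20 H2] := average_rho 1 e0; have [d3 d30 H3] := average_rho 2 e0.
pose m := Num.min (Num.min d1 d2) (Num.min d3 eta).
have m0 : 0 < m by rewrite /m !lt_min d10 d20 d30.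
pose d := m / 4; have d0 : 0 < d by rewrite divr_gt0.
have dm : d < m by rewrite /d ltr_pdivrMr// ltr_pMr// ltr1n.
have [dd1 dd2 dd3 d2e] : [/\ d < d1, d < d2, d < d3 & 2 * d < eta].
 have : m <= d1 /\ m <= d2 /\ m <= d3 /\ m <= eta by rewrite /m !ge_min !lexx !orbT.
 by move=> [h1 [h2 [h3 h4]]]; rewrite /d in dm *; split; lra.
pose A l := Am D a (rho_d d) l.
have cr := Cc_rho_d d0.
have sA l : smooth (A l) by exact: Am_smooth.
have HA l : Lsq setT (fun z => A l z - kappa * (a l \_ D) z) /\
  nsq setT (fun z => A l z - kappa * (a l \_ D) z) <= e.
 by elim/ord3 : l; [apply: H1|apply: H2|apply: H3]; rewrite d0.
have cE i x : D x -> hcurl D a i x * v i x = kappa^-1 * (cu A i x * v i x).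
 move=> Dx; have [Kx|nK] := pselect (K x); last by rewrite vK// !mulr0. have hx : adm D x d.
  split => // y yx; apply: (Heta x y Kx); rewrite distrC; exact: le_lt_trans yx d2e.
 rewrite (hcurlE oD i ca hx) mulrA; congr (_ * _). rewrite /cc; congr (_ * _); rewrite /Wm /cu.
 have P k l : Am D a (partial k (rho_d d)) l x = partial k (A l) x by rewrite /A Am_pd.
 exact: (f_equal2 (fun s t => s - t) (P _ _) (P _ _)).
have ic i : itg3 D (fun x => cu A i x * v i x).
 apply: test_itg_mul => //; apply: smoothB; apply: sm_pd; exact: sA.
have iA i : itg3 D (fun x => A i x * cu v i x) by exact: test_itg_mul.
have Lc i : Lsq D (cu v i) by exact: test_L2.
have ia i : itg3 D (fun x => a i x * cu v i x) by apply: L2g_mul => //; exact: La.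
have -> : \int[leb3]_(x in D) (\sum_i hcurl D a i x * v i x) =
  kappa^-1 * \int[leb3]_(x in D) (\sum_i A i x * cu v i x).
 rewrite -curl_ibp// -RintZ//; last by apply: itg_sum.
 apply: eq_int => x /set_mem Dx; rewrite mulr_sumr; apply: eq_bigr => i _; exact: cE.
pose s i := \int[leb3]_(x in D) ((A i x - kappa * (a i \_ D) x) * cu v i x).
have sE i : s i = \int[leb3]_(x in D) (A i x * cu v i x) - kappa * \int[leb3]_(x in D) (a i x * cu v i x).
 rewrite -RintZ// -RintegralB//; last exact: itgZ. by apply: eq_int => x Dx; rewrite patchE Dx mulrBl mulrA.
have s2 i : s i ^+ 2 <= e * S.
 have [L N] := HA i; have LD := @L2_sub _ setT D _ measurableT mD (@subsetT _ D) L.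
 have := @sip_CS _ _ _ leb3 D mD _ _ LD (Lc i); rewrite -!nsq_sip => /le_trans; apply.
 apply: ler_pM; [exact: nsq_ge0|exact: nsq_ge0| |exact: Sl].
 exact: le_trans (nsqS measurableT mD (@subsetT _ D) L) N.
rewrite !Rint_sum//.
have -> : kappa^-1 * \sum_i \int[leb3]_(x in D) (A i x * cu v i x) - \sum_i \int[leb3]_(x in D) (a i x * cu v i x) =
  kappa^-1 * (s 0 + s 1 + s 2).
 pose TA i := \int[leb3]_(x in D) (A i x * cu v i x). pose Ta i := \int[leb3]_(x in D) (a i x * cu v i x).
 have Q : kappa^-1 * \sum_i TA i - \sum_i Ta i = kappa^-1 * (s 0 + s 1 + s 2) by rewrite !sum3 !sE; apply: split_fact; exact: kappa_neq0.
 exact: Q.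
rewrite exprMn [leRHS]mulrCA; apply: ler_wpM2l; first exact: sqr_ge0.
apply: le_trans (sq_sum3 _ _ _) _.
have -> : e * (9 * S) = 9 * (e * S) by rewrite mulrCA.
exact: nine_fact (s2 _) (s2 _) (s2 _).
Qed.

(** The curl of [a] is replaced by the gradient of [q] before integrating by
    parts. *)
Lemma weak_identity q v : potential D (hcurl D a) q -> (forall i, test_fun D (v i)) ->
 \int[leb3]_(x in D) (\sum_i a i x * cu v i x) =
 - \int[leb3]_(x in D) (q x * \sum_i partial i (v i) x).
move=> qc tv; rewrite -hcurl_weak//.
have H i := potential_weak i qc (tv i).
rewrite Rint_sum//; last by move=> i _; have [] := H i.
under [in RHS]eq_int do rewrite mulr_sumr.
rewrite Rint_sum//; last by move=> i _; have [_ []] := H i.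
by rewrite -sumrN; apply: eq_bigr => i _; have [_ [_]] := H i.
Qed.

End WeakIdentity.

Lemma cu_alg (R : realType) (k a b c d : R) : (k * a + b) - (k * c + d) = k * (a - c) + (b - d).
ring. Qed.

Lemma cauchy_fact (R : realType) (C e b1 b2 b3 : R) : 0 <= C -> 0 < e ->
 b1 < e / (4 * (C + 1)) -> b2 < e / (4 * (C + 1)) -> b3 <= 2 * b1 + 2 * b2 -> C * b3 < e.
move=> C0 e0; have c4 : 0 < 4 * (C + 1) by lra.
set t := e / _; have t0 : 0 < t by exact: divr_gt0.
have te : e = t * (4 * (C + 1)) by rewrite /t divfK// gt_eqF.
move=> h1 h2 h3; have h4 : C * b3 <= C * (4 * t) by apply: ler_wpM2l => //; lra.
by apply: le_lt_trans h4 _; rewrite te; move: (mulr_ge0 C0 (ltW t0)) => p; lra.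
Qed.

Lemma quarter_fact (R : realType) (e b1 b2 : R) : b1 <= e / 4 -> b2 <= e / 4 -> 2 * b1 + 2 * b2 <= e.
by lra. Qed.

Lemma bound_fact (R : realType) (C e B b1 b2 b3 b4 b5 c : R) : 0 <= C -> 0 < e -> 0 <= B ->
 b1 <= e / (4 * C + 2) -> b2 <= e / (4 * C + 2) -> b3 <= 2 * b1 + 2 * b4 -> b4 <= C * b5 ->
 b5 <= 2 * c + 2 * b2 -> c <= B -> b3 <= (4 * C + 2) * B + e.
move=> C0 e0 B0; have k : 0 < 4 * C + 2 by lra.
set t := e / _; have te : e = t * (4 * C + 2) by rewrite /t divfK// gt_eqF.
move=> h1 h2 h3 h4 h5 h6; have h7 : C * b5 <= C * (2 * B + 2 * t) by apply: ler_wpM2l => //; lra.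
by rewrite te; lra.
Qed.

Lemma sub4 (V : zmodType) (a b c d : V) : (a - b) - (c - d) = (a - c) - (b - d).
by rewrite !opprD !opprK -!addrA; congr (_ + _); rewrite addrCA. Qed.

Lemma sub_common (V : zmodType) (a b c : V) : a - b = (a - c) - (b - c).
by rewrite sub4 subrr subr0. Qed.

Lemma sub_mid (V : zmodType) (a b c d : V) : a - (b - d) = (a - (b - c)) - (c - d).
by rewrite -[RHS]addrA -opprD addrA subrK. Qed.

(** * The curl curl problem *)
Section Fields.
Context {R : realType}.
Local Notation sp := (R * R * R)%type.
Local Notation fld := ('I_3 -> R * R * R -> R).
Implicit Types (f g p q : sp -> R) (x y : sp) (u v w c : fld).
Variables (D : set sp).
Hypotheses (oD : open D) (bD : bounded_set D).
Let mD := mopen oD.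

Definition fL u := forall i, Lsq D (u i).
Definition fip u v : R := \sum_i sip leb3 D (u i) (v i).
Definition fsq u : R := \sum_i nsq D (u i).
Definition tst v := forall i, test_fun D (v i).
Definition grd p : fld := fun i => partial i p.

Lemma fipE u v : fip u v = \sum_i sip leb3 D (u i) (v i). by []. Qed.

Lemma fsqE u : fsq u = fip u u.
by apply: eq_bigr => i _; rewrite nsq_sip. Qed.

Lemma fsq_ge0 u : 0 <= fsq u.
by apply: sumr_ge0 => i _; exact: nsq_ge0. Qed.

Lemma fsq_comp u i : nsq D (u i) <= fsq u.
by rewrite /fsq (bigD1 i)//= lerDl; apply: sumr_ge0 => j _; exact: nsq_ge0. Qed.

Lemma fsq_le u (K : R) : (forall i, nsq D (u i) <= K) -> fsq u <= 3 * K.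
by move=> H; have := H 0; have := H 1; have := H 2; rewrite /fsq sum3; lra. Qed.

Lemma fL0 : fL 0. by move=> i; exact: L2g0. Qed.

Lemma fLP (k : R) u v : fL u -> fL v -> fL (k *: u + v).
by move=> Lu Lv i; exact: (@L2gP _ _ _ leb3 D mD k _ _ (Lu i) (Lv i)). Qed.

Lemma fipC u v : fL u -> fL v -> fip u v = fip v u.
by move=> _ _; apply: eq_bigr => i _; exact: sipC. Qed.

Lemma fipP (k : R) u v w : fL u -> fL v -> fL w -> fip (k *: u + v) w = k * fip u w + fip v w.
move=> Lu Lv Lw; rewrite /fip mulr_sumr -big_split/=; apply: eq_bigr => i _.
exact: (@sipP _ _ _ leb3 D mD k _ _ _ (Lu i) (Lv i) (Lw i)).
Qed.

Lemma fip_ge0 u : fL u -> 0 <= fip u u.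
by move=> _; rewrite -fsqE fsq_ge0. Qed.

Lemma fip_complete (u : nat -> fld) : (forall n, fL (u n)) -> ssip_cauchy fip u ->
 exists2 v, fL v & ssip_lim fip u v.
move=> Lu cu.
have /choice[v Hv] : forall i, exists vi : sp -> R, Lsq D vi /\ forall e : R, 0 < e ->
  exists N, forall n, (N <= n)%N -> nsq D (fun x => u n i x - vi x) < e.
 move=> i; have [|vi Lvi Hvi] := @L2g_complete _ _ _ leb3 D mD (fun n => u n i) (fun n => Lu n i).
  move=> e e0; have [N HN] := cu e e0; exists N => m n Nm Nn.
  by apply: le_lt_trans (HN m n Nm Nn); rewrite -fsqE -nsq_sip; exact: (fsq_comp (u m - u n) i).
 by exists vi.
exists v; first by move=> i; case: (Hv i).
move=> e e0; have e3 : 0 < e / 4 by rewrite divr_gt0.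
have [_ /(_ _ e3)[N0 H0]] := Hv 0; have [_ /(_ _ e3)[N1 H1]] := Hv 1; have [_ /(_ _ e3)[N2 H2]] := Hv 2.
exists (maxn N0 (maxn N1 N2)) => n; rewrite !geq_max => /and3P[n0 n1 n2].
have B i : nsq D ((u n - v) i) <= e / 4 by apply: ltW; elim/ord3 : i; [exact: H0|exact: H1|exact: H2].
by rewrite -fsqE; apply: le_lt_trans (fsq_le B) _; lra.
Qed.

Lemma fLD u v : fL u -> fL v -> fL (u + v). exact: (@ssip_LD _ _ _ fLP). Qed.
Lemma fLB u v : fL u -> fL v -> fL (u - v). exact: (@ssip_LB _ _ _ fLP). Qed.
Lemma fLZ (k : R) u : fL u -> fL (k *: u). exact: (@ssip_LZ _ _ _ fL0 fLP). Qed.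

Lemma fipB u v w : fL u -> fL v -> fL w -> fip (u - v) w = fip u w - fip v w.
exact: (@ssip_B _ _ _ _ fipP). Qed.

Lemma fip_CS u v : fL u -> fL v -> fip u v ^+ 2 <= fsq u * fsq v.
by rewrite !fsqE; exact: (@ssip_CS _ _ _ _ fL0 fLP fipC fipP fip_ge0). Qed.

Lemma fsqD u v : fL u -> fL v -> fsq (u + v) <= 2 * fsq u + 2 * fsq v.
move=> Lu Lv; rewrite /fsq !mulr_sumr -big_split/=; apply: ler_sum => i _; exact: nsq_add.
Qed.

Lemma fsqB u v : fL u -> fL v -> fsq (u - v) <= 2 * fsq u + 2 * fsq v.
move=> Lu Lv; rewrite /fsq !mulr_sumr -big_split/=; apply: ler_sum => i _; exact: nsq_sub.
Qed.

Lemma fsqC u v : fsq (u - v) = fsq (v - u).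
by apply: eq_bigr => i _; apply: eq_int => x _; rewrite -sqrrN opprB. Qed.

Lemma fsqZ (k : R) u : fL u -> fsq (k *: u) = k ^+ 2 * fsq u.
by move=> Lu; rewrite /fsq mulr_sumr; apply: eq_bigr => i _; exact: nsqZ. Qed.

Lemma tst0 : tst 0. by move=> i; exact: test_0. Qed.
Lemma tstP (k : R) u v : tst u -> tst v -> tst (k *: u + v).
by move=> tu tv i; exact: test_P. Qed.
Lemma tstB u v : tst u -> tst v -> tst (u - v).
by move=> tu tv; rewrite addrC -scaleN1r; exact: tstP. Qed.
Lemma tst_L u : tst u -> fL u. by move=> tu i; exact: test_L2. Qed.
Lemma tst_cu v : tst v -> tst (cu v). by move=> tv i; exact: test_cu. Qed.
Lemma tst_grd p : test_fun D p -> tst (grd p). by move=> tp i; exact: test_pd. Qed.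

Lemma pdP (k : R) f g i : smooth f -> smooth g ->
 partial i (k *: f + g) = k *: partial i f + partial i g.
move=> sf sg; apply/funext => x.
have H := pd_lin k (-1) i x sf sg.
have E : (fun x => k * f x - (-1) * g x) = (k *: f + g) by apply/funext => y; rewrite mulN1r opprK.
by rewrite E in H; rewrite H mulN1r opprK.
Qed.

Lemma grdP (k : R) p q : test_fun D p -> test_fun D q -> grd (k *: p + q) = k *: grd p + grd q.
by move=> tp tq; apply/funext => i; apply: pdP; [exact: test_sm tp|exact: test_sm tq]. Qed.

Lemma grdB p q : test_fun D p -> test_fun D q -> grd (p - q) = grd p - grd q.
by move=> tp tq; rewrite addrC -scaleN1r grdP// scaleN1r addrC. Qed.

Lemma cuP (k : R) u v : tst u -> tst v -> cu (k *: u + v) = k *: cu u + cu v.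
move=> tu tv; apply/funext => i; apply/funext => x.
have P j l : partial j ((k *: u + v) l) x = k * partial j (u l) x + partial j (v l) x.
 have sul : smooth (u l) by exact: test_sm (tu l). have svl : smooth (v l) by exact: test_sm (tv l).
 exact: (congr1 (fun F => F x) (pdP k j sul svl)).
have E := f_equal2 (fun s t => s - t) (P (i + 1) (i + 2)) (P (i + 2) (i + 1)).
apply: (etrans E); exact: cu_alg.
Qed.

Lemma cuB u v : tst u -> tst v -> cu (u - v) = cu u - cu v.
by move=> tu tv; rewrite addrC -scaleN1r cuP// scaleN1r addrC. Qed.

Lemma cu_grd p : test_fun D p -> cu (grd p) = 0.
move=> tp; apply/funext => i; apply/funext => x.
by have /= C := Cc_pdC (i + 1) (i + 2) (test_Cc tp); rewrite /cu /grd C subrr.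
Qed.

Lemma test_nsq f : test_fun D f -> nsq setT f = nsq D f.
move=> tf; have := int_test f tf; rewrite /nsq.
by under eq_int do rewrite -expr2; under [in RHS]eq_int do rewrite -expr2.
Qed.

(** Poincare inequality for test functions, from their primitive along a line. *)
Lemma poincare_test : exists2 C : R, 0 <= C & forall p, test_fun D p -> nsq D p <= C * fsq (grd p).
have [M M1 HM] := cl_bounded bD.
pose h := 2 * M + 1; have h0 : 0 < h by rewrite /h; lra.
pose e : sp := bas 0.
exists (h ^+ 2); first exact: sqr_ge0.
move=> p tp; have cp := test_Cc tp.
have E y : D y -> p y = vp e h (partial 0 p) y.
 move=> Dy; have := vp_ftc e y (ltW h0) cp.
 have -> : (fun y => \sum_k crd e k * partial k p y) = partial 0 p.
  apply/funext => z; rewrite sum3.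
  have [e0 e1 e2] : [/\ crd e 0 = 1, crd e 1 = 0 & crd e 2 = 0] by rewrite !crdE.
  by rewrite e0 e1 e2 mul1r !mul0r !addr0.
 suff z0 : p (y - h *: e) = 0 by rewrite z0 subr0.
 apply: (test_out tp) => Dz; have h2 := HM _ (subset_closure Dz); have h1 := HM _ (subset_closure Dy).
 have a1 : `|h *: e| = h.
  rewrite normrZ gtr0_norm// norm_spE/= !normr0 normr1. by rewrite !max_l ?ler01 ?mulr1.
 have := ler_normB y (y - h *: e); rewrite subKr a1 /h; lra.
have [L N] := vp_nsq e h0 (Cc_pd 0 cp).
rewrite (nsq_eq E); apply: le_trans (nsqS measurableT mD (@subsetT _ D) L) _.
apply: le_trans N _; apply: ler_wpM2l; first exact: sqr_ge0.
by rewrite test_nsq; [exact: (fsq_comp (grd p) 0)|exact: test_pd].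
Qed.

(** [g] is the projection of [u] on the closure of the gradients of test
    functions, and [p] its potential. *)
Definition proj_grad u p (g : fld) := [/\ Lsq D p, fL g,
 forall e : R, 0 < e -> exists P, [/\ test_fun D P, nsq D (fun x => p x - P x) <= e & fsq (g - grd P) <= e] &
 forall P, test_fun D P -> fip g (grd P) = fip u (grd P)].

Lemma proj_exists u : fL u -> exists p (g : fld), proj_grad u p g.
move=> Lu; have [C C0 HC] := poincare_test.
have tgL P : test_fun D P -> fL (grd P) by move=> tP; exact: tst_L (tst_grd tP).
have [g [s Ss [Lg lims Hg _]]] := @riesz_range R fld (sp -> R) fL fip fL0 fLP fipC fipP fip_ge0 fip_complete
 (test_fun D) grd (fun P => fip u (grd P)) (Num.sqrt (fip u u)) (@test_0 R D) (@test_P R D) tgL grdP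
 (fun k P Q tP tQ => etrans (congr1 (fip u) (grdP k tP tQ)) (etrans (fipC Lu (fLP k (tgL _ tP) (tgL _ tQ)))
  (etrans (fipP k (tgL _ tP) (tgL _ tQ) Lu) (f_equal2 +%R (congr1 ( *%R k) (fipC (tgL _ tP) Lu)) (fipC (tgL _ tQ) Lu)))))
 (fun P tP => @ssip_le R fld fL fip fL0 fLP fipC fipP fip_ge0 u (grd P) Lu (tgL _ tP)).
have cs : forall e : R, 0 < e -> exists N, forall m n, (N <= m)%N -> (N <= n)%N ->
  sip leb3 D (fun x => s m x - s n x) (fun x => s m x - s n x) < e.
 move=> e e0; have C1 : 0 < 4 * (C + 1) by rewrite mulr_gt0// ltr_wpDl.
 have [N HN] := lims _ (divr_gt0 e0 C1); exists N => m n Nm Nn; rewrite -nsq_sip.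
 have tmn : test_fun D (s m - s n) by rewrite addrC -scaleN1r; exact: test_P.
 apply: le_lt_trans (HC _ tmn) _; rewrite (grdB (Ss m) (Ss n)).
 have -> : grd (s m) - grd (s n) = (grd (s m) - g) - (grd (s n) - g) by rewrite opprB addrA subrK.
 have h1 : fsq (grd (s m) - g) < e / (4 * (C + 1)) by rewrite fsqE; exact: HN m Nm.
 have h2 : fsq (grd (s n) - g) < e / (4 * (C + 1)) by rewrite fsqE; exact: HN n Nn.
 exact: cauchy_fact C0 e0 h1 h2 (fsqB (fLB (tgL _ (Ss m)) Lg) (fLB (tgL _ (Ss n)) Lg)).
have [p Lp Hp] := @L2g_complete _ _ _ leb3 D mD s (fun n => test_L2 oD (Ss n)) cs.
exists p, g; split => //.
move=> e e0; have [N1 H1] := lims e e0; have [N2 H2] := Hp e e0.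
exists (s (maxn N1 N2)); split => //.
 have := H2 _ (leq_maxr N1 N2); rewrite -nsq_sip => /ltW; apply: le_trans.
 by rewrite le_eqVlt; apply/orP; left; apply/eqP; apply: eq_int => x _; rewrite -sqrrN opprB.
by have := H1 _ (leq_maxl N1 N2); rewrite -fsqE fsqC => /ltW.
Qed.

Definition grad_limit (g : fld) := forall e : R, 0 < e -> exists2 P, test_fun D P & fsq (g - grd P) <= e.

Lemma grad_limit_orth u (g : fld) : fL u -> fL g -> grad_limit g ->
 (forall P, test_fun D P -> fip u (grd P) = 0) -> fip u g = 0.
move=> Lu Lg lg H; apply: (@small0 R _ (fsq u)) => [|e e0]; first exact: fsq_ge0.
have [P tP HP] := lg e e0; have LP := tst_L (tst_grd tP).
have -> : fip u g = fip u (g - grd P) by rewrite fipC// [RHS]fipC//; [rewrite fipB// [fip (grd P) u]fipC// H// subr0|exact: fLB].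
apply: le_trans (fip_CS Lu (fLB Lg LP)) _; rewrite mulrC; apply: ler_wpM2r => //; exact: fsq_ge0.
Qed.

Hypotheses (D0 : D !=set0) (LD : lipschitz_boundary D) (cbD : connected (boundary D)).

Lemma friedrichs : exists2 C : R, 0 <= C & forall u, tst u ->
 exists2 P, test_fun D P & fsq (u - grd P) <= C * fsq (cu u).
have [C C0 H] := friedrichs_test oD bD D0 LD cbD; exists (3 * C); first exact: mulr_ge0.
move=> u tu; have [|P tP HP] := H u (fsq (cu u)) tu.
 have t1 i : nsq setT (cu u i) <= fsq (cu u) by rewrite test_nsq; [exact: fsq_comp|exact: test_cu].
 have c0 : cu u 0 = rot u 1 2 by rewrite /cu !ord3E. have c1 : cu u 1 = rot u 2 0 by rewrite /cu !ord3E.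
 have c2 : cu u 2 = rot u 0 1 by rewrite /cu !ord3E.
 have rN k l : nsq setT (rot u k l) = nsq setT (rot u l k) by apply: eq_int => x _; rewrite -sqrrN opprB.
 have r0 k : nsq setT (rot u k k) <= fsq (cu u).
  have -> : nsq setT (rot u k k) = 0.
   rewrite /nsq /Rintegral integral0_eq// => x _; congr EFin. by rewrite /rot subrr expr0n.
  exact: fsq_ge0.
 have r01 : nsq setT (rot u 0 1) <= fsq (cu u) by rewrite -c2; exact: t1.
 have r12 : nsq setT (rot u 1 2) <= fsq (cu u) by rewrite -c0; exact: t1.
 have r20 : nsq setT (rot u 2 0) <= fsq (cu u) by rewrite -c1; exact: t1.
 have r10 := r01; have r21 := r12; have r02 := r20. rewrite rN in r10; rewrite rN in r21; rewrite rN in r02.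
 move=> k l; elim/ord3 : k; elim/ord3 : l;
  [exact: r0|exact: r01|exact: r02|exact: r10|exact: r0|exact: r12|exact: r20|exact: r21|exact: r0].
by exists P => //; rewrite -mulrA; apply: fsq_le.
Qed.

(** Subtracting its projection makes a test field divergence-free, with the same
    curl; it is then controlled by this curl. *)
Lemma friedrichs_proj : exists2 C : R, 0 <= C & forall u (g : fld), tst u -> fL g -> grad_limit g ->
 (forall P, test_fun D P -> fip g (grd P) = fip u (grd P)) -> fsq (u - g) <= C * fsq (cu u).
have [C C0 HC] := friedrichs; exists C => // u g tu Lg lg Hg.
have Lu := tst_L tu; have Lv := fLB Lu Lg; have [P tP HP] := HC u tu.
have LP := tst_L (tst_grd tP).
have orth Q : test_fun D Q -> fip (u - g) (grd Q) = 0 by move=> tQ; rewrite fipB//; [rewrite Hg// subrr|exact: tst_L (tst_grd tQ)].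
have E : fsq (u - g) = fip (u - g) (u - grd P).
 rewrite fsqE; have e1 := fipB Lu Lg Lv; have e2 := fipB Lu LP Lv.
 have o1 := grad_limit_orth Lv Lg lg orth; have o2 := orth P tP.
 rewrite (fipC Lv (fLB Lu LP)) e2 e1 (fipC Lg Lv) (fipC LP Lv) o1 o2//.
have CS := fip_CS Lv (fLB Lu LP); rewrite -E in CS.
have n0 := fsq_ge0 (u - g); move: n0; rewrite le_eqVlt => /predU1P[<-|n0].
 by apply: mulr_ge0 => //; exact: fsq_ge0.
by apply: le_trans HP; move: CS; rewrite expr2 ler_pM2l.
Qed.

Definition tlim w c := forall e : R, 0 < e -> exists t, [/\ tst t, fsq (w - t) <= e & fsq (c - cu t) <= e].

Lemma curlcurl_solve : exists2 C : R, 0 <= C & forall (l : fld -> R) (B : R), 0 <= B ->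
 (forall (k : R) u v, tst u -> tst v -> l (k *: u + v) = k * l u + l v) ->
 (forall v, tst v -> `|l v| <= B * Num.sqrt (fip (cu v) (cu v))) ->
 exists w c, [/\ fL w /\ fL c, tlim w c, forall v, tst v -> fip c (cu v) = l v,
  forall P, test_fun D P -> fip w (grd P) = 0 & fsq c <= B ^+ 2 /\ fsq w <= C * B ^+ 2].
have [C C0 HC] := friedrichs_proj; exists (4 * C + 2); first by rewrite addr_ge0// mulr_ge0.
move=> l B B0 lP lB.
have cuL v : tst v -> fL (cu v) by move=> tv; exact: tst_L (tst_cu tv).
have [c [s Ss [Lc lims Hc Bc]]] := @riesz_range R fld fld fL fip fL0 fLP fipC fipP fip_ge0 fip_complete
 tst (@cu R) l B tst0 tstP cuL cuP lP lB.
have {}Bc : fsq c <= B ^+ 2.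
 have := Bc B0; rewrite -fsqE => h; rewrite -[fsq c]sqr_sqrtr ?fsq_ge0//.
 by rewrite lerXn2r ?nnegrE ?sqrtr_ge0.
have /choice[pg Hpg] : forall n, exists pg : (sp -> R) * fld, proj_grad (s n) pg.1 pg.2 by move=> n; have [p [g H]] := proj_exists (tst_L (Ss n)); exists (p, g).
pose g n := (pg n).2.
have Lg n : fL (g n) by have [] := Hpg n.
have lg n : grad_limit (g n) by move=> e e0; have [_ _ H _] := Hpg n; have [P [tP _ HP]] := H e e0; exists P.
have og n P : test_fun D P -> fip (g n) (grd P) = fip (s n) (grd P) by have [_ _ _ H] := Hpg n; exact: H.
have Ls n := tst_L (Ss n).
pose x n := s n - g n; have Lx n : fL (x n) by exact: fLB.
have lg2 m n : grad_limit (g m - g n).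
 move=> e e0; have e4 : 0 < e / 4 by rewrite divr_gt0.
 have [P tP HP] := lg m _ e4; have [Q tQ HQ] := lg n _ e4.
 exists (P - Q); first by rewrite addrC -scaleN1r; exact: test_P.
 have -> : g m - g n - grd (P - Q) = (g m - grd P) - (g n - grd Q) by rewrite grdB//; exact: sub4.
 apply: le_trans (fsqB (fLB (Lg m) (tst_L (tst_grd tP))) (fLB (Lg n) (tst_L (tst_grd tQ)))) _.
 by move: HP HQ; exact: quarter_fact.
have cx : ssip_cauchy fip x.
 move=> e e0; have C1 : 0 < 4 * (C + 1) by rewrite mulr_gt0// ltr_wpDl.
 have [N HN] := lims _ (divr_gt0 e0 C1); exists N => m n Nm Nn; rewrite -fsqE.
 have -> : x m - x n = (s m - s n) - (g m - g n) by exact: sub4. have tmn := tstB (Ss m) (Ss n).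
 have h1 : fsq (cu (s m) - c) < e / (4 * (C + 1)) by rewrite fsqE; exact: HN m Nm.
 have h2 : fsq (cu (s n) - c) < e / (4 * (C + 1)) by rewrite fsqE; exact: HN n Nn.
 have h3 : fsq (cu (s m - s n)) <= 2 * fsq (cu (s m) - c) + 2 * fsq (cu (s n) - c).
  have -> : cu (s m - s n) = (cu (s m) - c) - (cu (s n) - c) by rewrite (cuB (Ss m) (Ss n)); exact: sub_common.
  exact: fsqB (fLB (cuL _ (Ss m)) Lc) (fLB (cuL _ (Ss n)) Lc).
 apply: le_lt_trans (HC _ _ tmn (fLB (Lg m) (Lg n)) (lg2 m n) _) (cauchy_fact C0 e0 h1 h2 h3).
 move=> P tP; have LP := tst_L (tst_grd tP). by rewrite (fipB (Lg m) (Lg n) LP) (fipB (Ls m) (Ls n) LP) !og.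
have [w Lw limx] := fip_complete Lx cx.
have near e : 0 < e -> exists n, fsq (w - x n) <= e /\ fsq (c - cu (s n)) <= e.
 move=> e0; have [N1 H1] := limx e e0; have [N2 H2] := lims e e0; exists (maxn N1 N2); split.
  by rewrite fsqC fsqE ltW//; apply: H1; exact: leq_maxl.
 by rewrite fsqC fsqE ltW//; apply: H2; exact: leq_maxr.
exists w, c; split => //.
- move=> e e0; have e4 : 0 < e / 4 by rewrite divr_gt0.
 have [n [h1 h2]] := near _ e4; have [P tP HP] := lg n _ e4; have tg := tst_grd tP.
 exists (s n - grd P); split; first exact: tstB.
  have -> : w - (s n - grd P) = (w - x n) - (g n - grd P).
   exact: sub_mid.
  apply: le_trans (fsqB (fLB Lw (Lx n)) (fLB (Lg n) (tst_L tg))) _. exact: quarter_fact h1 HP.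
 rewrite (cuB (Ss n) tg) cu_grd// subr0; apply: le_trans h2 _.
 by rewrite ler_pdivrMr// ler_peMr ?(ltW e0)// ler1n.
- move=> P tP; have LP := tst_L (tst_grd tP).
 apply: (@small0 R _ (fsq (grd P))) => [|e e0]; first exact: fsq_ge0. have [n [h1 _]] := near e e0.
 have -> : fip w (grd P) = fip (w - x n) (grd P) by rewrite (fipB Lw (Lx n) LP) (fipB (Ls n) (Lg n) LP) og// subrr subr0.
 by apply: le_trans (fip_CS (fLB Lw (Lx n)) LP) _; apply: ler_wpM2r => //; exact: fsq_ge0.
split => //; apply/ler_addgt0Pr => e e0.
have K0 : 0 < 4 * C + 2 by rewrite ltr_wpDl// mulr_ge0.
have [n [h1 h2]] := near (e / (4 * C + 2)) (divr_gt0 e0 K0).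
have h3 : fsq w <= 2 * fsq (w - x n) + 2 * fsq (x n).
 have := fsqD (fLB Lw (Lx n)) (Lx n). by have -> : (w - x n) + x n = w by exact: subrK.
have h4 := HC _ _ (Ss n) (Lg n) (lg n) (og n).
have h5 : fsq (cu (s n)) <= 2 * fsq c + 2 * fsq (c - cu (s n)).
 have := fsqB Lc (fLB Lc (cuL _ (Ss n))). by have -> : c - (c - cu (s n)) = cu (s n) by exact: subKr.
exact: bound_fact C0 e0 (sqr_ge0 B) h1 h2 h3 h4 h5 Bc.
Qed.

End Fields.

Lemma dual_fact (R : realType) (s t e a b : R) : s ^+ 2 <= e * a -> t ^+ 2 <= e * b ->
 (s - t) ^+ 2 <= e * (2 * a + 2 * b).
move=> h1 h2; rewrite -subr_ge0.
have -> : e * (2 * a + 2 * b) - (s - t) ^+ 2 = 2 * (e * a - s ^+ 2) + 2 * (e * b - t ^+ 2) + (s + t) ^+ 2 by ring.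
by apply: addr_ge0; [apply: addr_ge0; apply: mulr_ge0; rewrite ?ler0n ?subr_ge0|exact: sqr_ge0].
Qed.

(** * Weak derivatives and the dual of divergence-free fields *)
Section Transfer.
Context {R : realType}.
Local Notation sp := (R * R * R)%type.
Local Notation fld := ('I_3 -> R * R * R -> R).
Local Notation vfield := (R * R * R -> 'rV[R]_3).
Implicit Types (f p q : sp -> R) (w c : fld) (u v : vfield).
Variables (D : set sp).
Hypotheses (oD : open D) (bD : bounded_set D).
Let mD := mopen oD.
Local Notation fL := (fL D).
Local Notation fip := (fip D).
Local Notation fsq := (fsq D).
Local Notation tst := (tst D).

Definition cmp v : fld := fun i x => v x 0 i.
Definition mkv w : vfield := fun x => \row_i w i x.

Lemma cmp_mkv w : cmp (mkv w) = w.
by apply/funext => i; apply/funext => x; rewrite /cmp mxE. Qed.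

Lemma mkv_cmp v : mkv (cmp v) = v.
by apply/funext => x; apply/rowP => i; rewrite mxE. Qed.

Lemma L2_cmp v : L2 D v <-> fL (cmp v).
by split => [H i|H i j]; [exact: H|rewrite (ord1 i); exact: H]. Qed.

Lemma L2_mkv w : fL w -> L2 D (mkv w).
by move=> Lw; apply/L2_cmp; rewrite cmp_mkv. Qed.

Lemma fip_int w c : fL w -> fL c -> \int[leb3]_(x in D) (\sum_i w i x * c i x) = fip w c.
move=> Lw Lc; apply: (@Rint_sum _ _ _ leb3 D mD _ (index_enum _) predT) => i _.
exact: (@L2g_mul _ _ _ leb3 D mD _ _ (Lw i) (Lc i)).
Qed.

Lemma ip_cmp u v : L2 D u -> L2 D v -> ip D u v = fip (cmp u) (cmp v).
move=> /L2_cmp Lu /L2_cmp Lv; rewrite -fip_int//.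
by apply: eq_int => x _; rewrite /dot big_ord1.
Qed.

Lemma cmp_curl v : cmp (curl v) = cu (cmp v).
by apply/funext => i; apply/funext => x; rewrite /cmp /curl mxE. Qed.

Lemma cmp_grad q : cmp (grad q) = grd q.
by apply/funext => i; apply/funext => x; rewrite /cmp /grad mxE. Qed.

Lemma cmpP (k : R) u v : cmp (fun x => k *: u x + v x) = k *: cmp u + cmp v.
by apply/funext => i; apply/funext => x; rewrite /cmp !mxE. Qed.

Lemma norm0_cmp v : L2 D v -> norm0 D v ^+ 2 = fsq (cmp v).
by move=> Lv; rewrite /norm0 ip_cmp// -fsqE sqr_sqrtr ?fsq_ge0. Qed.

Lemma tst_mkv w : tst w -> test_field D (mkv w).
move=> tw i; have -> : (fun x => mkv w x 0 i) = w i by apply/funext => x; rewrite mxE.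
exact: tw.
Qed.

Lemma fip_eq0 w c : fL w -> fL c -> fsq w = 0 -> fip w c = 0.
move=> Lw Lc w0; have := fip_CS oD Lw Lc; rewrite w0 mul0r => h.
by apply/eqP; rewrite -sqrf_eq0 eq_le h sqr_ge0.
Qed.

(** Fields at distance zero have the same products. *)
Lemma fip_congr w w' c : fL w -> fL w' -> fL c -> fsq (w - w') = 0 -> fip w c = fip w' c.
move=> Lw Lw' Lc E; apply/eqP; rewrite -subr_eq0 -(fipB oD Lw Lw' Lc); apply/eqP.
by apply: fip_eq0 => //; exact: fLB.
Qed.

Lemma fsq_congr w w' : fL w -> fL w' -> fsq (w - w') = 0 -> fsq w = fsq w'.
move=> Lw Lw' E; rewrite !fsqE (fip_congr Lw Lw' Lw E) (fipC Lw' Lw).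
exact: fip_congr.
Qed.

Lemma orth_tests w : fL w -> (forall v : fld, tst v -> fip w v = 0) -> fsq w = 0.
move=> Lw H; apply: (@small0 R _ (3 * fsq w)); first by rewrite mulr_ge0// fsq_ge0.
move=> e e0; have /choice[v Hv] : forall i, exists vi, test_fun D vi /\ nsq D (fun x => w i x - vi x) <= e.
 by move=> i; have [vi tv hv] := test_dense oD (Lw i) e0; exists vi; split => //; exact: ltW.
have tv : tst v by move=> i; case: (Hv i).
have Lv := tst_L oD tv.
have E : fsq w = fip w (w - v) by rewrite fsqE (fipC Lw (fLB oD Lw Lv)) (fipB oD Lw Lv Lw) (fipC Lv Lw) (H v tv) subr0.
rewrite [in leLHS]E; apply: le_trans (fip_CS oD Lw (fLB oD Lw Lv)) _.
have hd : fsq (w - v) <= 3 * e by apply: fsq_le => i; case: (Hv i).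
rewrite mulrA [leRHS]mulrC (mulrC e); apply: ler_wpM2l => //; exact: fsq_ge0.
Qed.

Definition is_wcurl w c := forall v : fld, tst v -> fip c v = fip w (cu v).

Lemma weak_curlE u c : L2 D u -> fL c -> is_weak_curl D u (mkv c) <-> is_wcurl (cmp u) c.
move=> Lu Lc; have L2c := L2_mkv Lc; split=> H v tv.
 have := H (mkv v) (tst_mkv tv); have tv' := tst_L oD tv.
 rewrite !ip_cmp//; [by rewrite cmp_curl !cmp_mkv|by apply/L2_cmp; rewrite cmp_curl cmp_mkv; exact: tst_L (tst_cu tv)|exact: L2_mkv].
have tc : tst (cmp v) by exact: tv.
rewrite !ip_cmp//; [by rewrite cmp_curl cmp_mkv; exact: H|by apply/L2_cmp; rewrite cmp_curl; exact: tst_L (tst_cu tc)|].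
by apply/L2_cmp; exact: tst_L tc.
Qed.

Definition wc u := cmp (weak_curl D u).

Lemma wcurlP u : Hcurl D u -> fL (wc u) /\ is_wcurl (cmp u) (wc u).
move=> [Lu ex]; have [Lc Hc] := xgetPex (fun=> 0) ex : [set c | L2 D c /\ is_weak_curl D u c] (weak_curl D u).
have Lc' : fL (wc u) by apply/L2_cmp.
by split => //; apply/(weak_curlE Lu Lc'); rewrite mkv_cmp.
Qed.

Lemma wcurl_unique w c c' : fL c -> fL c' -> is_wcurl w c -> is_wcurl w c' -> fsq (c - c') = 0.
move=> Lc Lc' H H'; apply: orth_tests; first exact: fLB.
by move=> v tv; rewrite (fipB oD Lc Lc' (tst_L oD tv)) H// H'// subrr.
Qed.

Lemma wcurl_Hcurl u c : L2 D u -> fL c -> is_wcurl (cmp u) c -> Hcurl D u /\ fsq (wc u - c) = 0.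
move=> Lu Lc H; have Hu : Hcurl D u.
 by split => //; exists (mkv c); split; [exact: L2_mkv|exact/weak_curlE].
have [L W] := wcurlP Hu; split => //; exact: wcurl_unique W H.
Qed.

Lemma limit_dual w c a b : fL w -> fL c -> fL a -> fL b -> tlim D w c ->
 (forall t, tst t -> fip (cu t) a = fip t b) -> fip c a = fip w b.
move=> Lw Lc La Lb lim H; apply/eqP; rewrite -subr_eq0; apply/eqP.
apply: (@small0 R _ (2 * fsq a + 2 * fsq b)); first by rewrite addr_ge0// mulr_ge0// fsq_ge0.
move=> e e0; have [t [tt h1 h2]] := lim e e0.
have Lt := tst_L oD tt; have Lct := tst_L oD (tst_cu tt).
have -> : fip c a - fip w b = fip (c - cu t) a - fip (w - t) b by rewrite (fipB oD Lc Lct La) (fipB oD Lw Lt Lb) H// opprB addrA subrK.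
have b1 := fip_CS oD (fLB oD Lc Lct) La; have b2 := fip_CS oD (fLB oD Lw Lt) Lb.
have b3 : fsq (c - cu t) * fsq a <= e * fsq a by apply: ler_wpM2r => //; exact: fsq_ge0.
have b4 : fsq (w - t) * fsq b <= e * fsq b by apply: ler_wpM2r => //; exact: fsq_ge0.
exact: dual_fact (le_trans b1 b3) (le_trans b2 b4).
Qed.

Lemma fip_cu_tst (t v : fld) : tst t -> tst v -> fip (cu t) v = fip t (cu v).
move=> tt tv; rewrite -!fip_int//; try exact: tst_L; try exact: tst_L (tst_cu _).
by apply: curl_ibp => // i; exact: test_sm (tt i).
Qed.

Lemma H1_wcurl v : H1field D v -> Hcurl D v.
move=> Hv; have Lv : L2 D v by apply/L2_cmp => i; case: (Hv i).
have /choice[g Hg] : forall i, exists g, L2 D g /\ is_weak_grad D (fun x => v x 0 i) g by move=> i; case: (Hv i).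
have Lg j k : Lsq D (fun x => g j x 0 k) by case: (Hg j) => H _; exact: H.
pose c : fld := fun i x => g (i + 2) x 0 (i + 1) - g (i + 1) x 0 (i + 2).
have Lc : fL c by move=> i; exact: (@L2gB _ _ _ leb3 D mD _ _ (Lg _ _) (Lg _ _)).
have G j k t : test_fun D t -> \int[leb3]_(x in D) (g j x 0 k * t x) = - \int[leb3]_(x in D) (v x 0 j * partial k t x).
 move=> tt; pose T : fld := fun i => if i == k then t else fun=> 0.
 have tT : tst T by move=> i; rewrite /T; case: ifP => _ //; exact: test_0.
 have [L W] := Hg j; have := W (mkv T) (tst_mkv tT). rewrite ip_cmp//; last by apply: L2_mkv; exact: tst_L.
 rewrite cmp_mkv fipE (bigD1 k)//= [X in _ + X]big1 ?addr0; last first.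
  move=> i /negPf ik; rewrite /sip /Rintegral integral0_eq// => x _; congr EFin. by rewrite /T ik mulr0.
 have Tk : T k = t by rewrite /T eqxx.
 move=> W'; have -> : \int[leb3]_(x in D) (g j x 0 k * t x) = sip leb3 D (cmp (g j) k) (T k) by rewrite Tk.
 rewrite W'; congr (- _); apply: eq_int => x _; congr (_ * _).
 rewrite /div (bigD1 k)//= [X in _ + X]big1 ?addr0; last first.
  move=> i /negPf ik; have -> : (fun y => mkv T y 0 i) = fun=> 0 by apply/funext => y; rewrite mxE /T ik.
  exact: pd_cst.
 by have -> : (fun y => mkv T y 0 k) = t by apply/funext => y; rewrite mxE /T eqxx.
have W : is_wcurl (cmp v) c.
 move=> t tt; pose T j k m := \int[leb3]_(x in D) (v x 0 j * partial k (t m) x).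
 have Lvj j : Lsq D (fun x => v x 0 j) by exact: Lv.
 have Lt k m : Lsq D (partial k (t m)) by apply: test_L2 => //; exact: test_pd.
 have Ltt m : Lsq D (t m) by apply: test_L2.
 have I1 j k m : itg3 D (fun x => g j x 0 k * t m x) by exact: (@L2g_mul _ _ _ leb3 D mD).
 have I2 j k m : itg3 D (fun x => v x 0 j * partial k (t m) x) by exact: (@L2g_mul _ _ _ leb3 D mD).
 have A1 i : sip leb3 D (c i) (t i) = T (i + 1) (i + 2) i - T (i + 2) (i + 1) i.
  have E x : c i x * t i x = g (i + 2) x 0 (i + 1) * t i x - g (i + 1) x 0 (i + 2) * t i x by exact: mulrBl.
  rewrite /sip; under eq_int do rewrite E; rewrite RintegralB//.
  have a1 := G (i + 2) (i + 1) (t i) (tt i); have a2 := G (i + 1) (i + 2) (t i) (tt i).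
  by apply: (etrans (f_equal2 (fun s r => s - r) a1 a2)); rewrite /T opprK addrC.
 have A2 i : sip leb3 D (cmp v i) (cu t i) = T i (i + 1) (i + 2) - T i (i + 2) (i + 1).
  have E x : cmp v i x * cu t i x = v x 0 i * partial (i + 1) (t (i + 2)) x - v x 0 i * partial (i + 2) (t (i + 1)) x.
   exact: mulrBr.
  by rewrite /sip; under eq_int do rewrite E; rewrite RintegralB.
 have S1 : fip c t = _ := eq_bigr _ (fun i _ => A1 i).
 have S2 : fip (cmp v) (cu t) = _ := eq_bigr _ (fun i _ => A2 i).
 exact: (etrans S1 (etrans (curl_alg T) (esym S2))).
by have [] := wcurl_Hcurl Lv Lc W.
Qed.

Lemma limit_Hcurl0 u c : L2 D u -> fL c -> tlim D (cmp u) c ->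
 Hcurl0 D u /\ fsq (wc u - c) = 0.
move=> Lu Lc lim; have Lu' : fL (cmp u) by apply/L2_cmp.
have W : is_wcurl (cmp u) c.
 move=> v tv; apply: (limit_dual Lu' Lc (tst_L oD tv) (tst_L oD (tst_cu tv)) lim) => t tt.
 exact: fip_cu_tst.
have [Hu E] := wcurl_Hcurl Lu Lc W; split => //; split => // v Hv.
have Hcv := H1_wcurl Hv; have [Lcv Wv] := wcurlP Hcv.
have [Lv _] := Hcv; have Lv' : fL (cmp v) by apply/L2_cmp.
have [Lwu _] := wcurlP Hu.
have L1 : L2 D (weak_curl D u) by apply/L2_cmp.
have L2' : L2 D (weak_curl D v) by apply/L2_cmp.
rewrite /tangential_trace (ip_cmp L1 Lv) (ip_cmp Lu L2') (fip_congr Lwu Lc Lv' E).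
rewrite (limit_dual Lu' Lc Lv' Lcv lim) ?subrr// => t tt.
have Lt := tst_L oD tt; have Lct := tst_L oD (tst_cu tt).
by rewrite (fipC Lct Lv') (fipC Lt Lcv) Wv.
Qed.

Hypothesis (LD : lipschitz_boundary D).

(** The approximations are taken at each precision [1/n]. *)
Lemma Hcurl0_limit u : Hcurl0 D u -> tlim D (cmp u) (wc u).
move=> [Hu tr]; have [Lu _] := Hu; have Lu' : fL (cmp u) by apply/L2_cmp.
have [Lc W] := wcurlP Hu; have L1 : L2 D (weak_curl D u) by apply/L2_cmp.
have trace psi : (forall i, Cc (psi i)) ->
  \int[leb3]_(x in D) (\sum_i wc u i x * psi i x) = \int[leb3]_(x in D) (\sum_i cmp u i x * cu psi i x).
 move=> cp; have Lcs f : Cc f -> Lsq D f.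
  by move=> cf; apply: (@L2_sub _ setT) => //; exact: Cc_L2.
 have Lp : fL psi by move=> i; exact: Lcs. have Lcp : fL (cu psi) by move=> i; apply: Lcs; exact: Cc_cu.
 have L2p := L2_mkv Lp. have Hp : H1field D (mkv psi).
  move=> i; have E : (fun x => mkv psi x 0 i) = psi i by apply/funext => x; rewrite mxE.
  rewrite E; split; first exact: Lp. exists (grad (psi i)); have Lg : L2 D (grad (psi i)).
   by apply/L2_cmp; rewrite cmp_grad => k; apply: Lcs; exact: Cc_pd.
  split => // v tv; have tc : tst (cmp v) by exact: tv. have Lv : L2 D v by apply/L2_cmp; exact: tst_L.
  rewrite ip_cmp// cmp_grad.
  have I k : itg3 D (fun x => psi i x * partial k (cmp v k) x) by apply: (@L2g_mul _ _ _ leb3 D mD) => //; apply: test_L2 => //; exact: test_pd.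
  have J k : sip leb3 D (grd (psi i) k) (cmp v k) = - \int[leb3]_(x in D) (psi i x * partial k (cmp v k) x).
   exact: int_ibp_test (tc k) (Cc_sm (cp i)).
  rewrite fipE (eq_bigr _ (fun k _ => J k)) sumrN; congr (- _).
  rewrite -(@Rint_sum _ _ _ leb3 D mD _ (index_enum _) predT) => [|k _]; last exact: I.
  by apply: eq_int => x _; rewrite /div mulr_sumr.
 have Wp : is_wcurl (cmp (mkv psi)) (cu psi).
  rewrite cmp_mkv => t tt; have Lt := tst_L oD tt; have Lct := tst_L oD (tst_cu tt).
  rewrite -!fip_int//; apply: curl_ibp => // i; exact: Cc_sm.
 have [Hcp Ep] := wcurl_Hcurl L2p Lcp Wp; have [Lwp _] := wcurlP Hcp.
 have L2w : L2 D (weak_curl D (mkv psi)) by apply/L2_cmp.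
 have := tr (mkv psi) Hp; rewrite /tangential_trace (ip_cmp L1 L2p) (ip_cmp Lu L2w) cmp_mkv.
 move/eqP; rewrite subr_eq0 => /eqP E; rewrite !fip_int//; apply: (etrans E).
 by rewrite (fipC Lu' Lwp) (fip_congr Lwp Lcp Lu' Ep); exact: fipC.
move=> e e0; have e3 : 0 < e / 3 by rewrite divr_gt0.
have [t [tt h1 h2]] := test_dense_curl oD bD LD Lu' Lc trace e3.
exists t; split => //; rewrite fsqC; apply: le_trans (fsq_le _) _; try eassumption.
 by rewrite mulrC divfK.
by rewrite mulrC divfK.
Qed.

End Transfer.

Lemma dual_alg (R : realType) (a b c d : R) : a - - c = (a - - d) - - (c - d).
ring. Qed.

Lemma le1_fact (R : realType) (t : R) : t ^+ 2 = 1 -> 0 <= t -> t <= 1.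
by move=> h t0; rewrite -(expr_le1 (n := 2))// h. Qed.

Lemma half_fact (R : realType) (e a b : R) : 0 < e -> a <= e / 4 -> b <= e / 4 -> a + b < e.
by lra. Qed.

Lemma lin_sub (R : realType) (V : lmodType R) (k : R) (a b a' b' : V) :
 (k *: a + a') - (k *: b + b') = k *: (a - b) + (a' - b').
by rewrite scalerBr opprD addrACA. Qed.

Lemma lin_fact (R : realType) (e k a b : R) : 0 < 2 * k ^+ 2 + 2 -> a <= e / (2 * k ^+ 2 + 2) ->
 b <= e / (2 * k ^+ 2 + 2) -> 2 * (k ^+ 2 * a) + 2 * b <= e.
move=> k0; set t := e / _; have te : e = t * (2 * k ^+ 2 + 2) by rewrite /t divfK// gt_eqF.
move=> h1 h2; have h3 : k ^+ 2 * a <= k ^+ 2 * t by apply: ler_wpM2l => //; exact: sqr_ge0.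
by rewrite te; lra.
Qed.

Section Dual.
Context {R : realType}.
Local Notation sp := (R * R * R)%type.
Local Notation fld := ('I_3 -> R * R * R -> R).
Local Notation vfield := (R * R * R -> 'rV[R]_3).
Implicit Types (f p q : sp -> R) (w c : fld) (u v : vfield).
Variables (D : set sp).
Hypotheses (oD : open D) (bD : bounded_set D) (LD : lipschitz_boundary D).
Let mD := mopen oD.
Local Notation fL := (fL D).
Local Notation fip := (fip D).
Local Notation fsq := (fsq D).
Local Notation tst := (tst D).
Local Notation wc := (wc D).

Lemma div_cu (v : fld) x : tst v -> \sum_i partial i (cu v i) x = 0.
move=> tv; pose T j k m := partial j (partial k (v m)) x.
have sv k m : smooth (partial k (v m)) by apply: sm_pd; exact: test_sm (tv m).
have E i : partial i (cu v i) x = T i (i + 1) (i + 2) - T i (i + 2) (i + 1).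
 have Q := pd_diff i (sv (i + 1) (i + 2)) (sv (i + 2) (i + 1)). exact: (congr1 (fun F => F x) Q).
have S j k m : T j k m = T k j m.
 have Q : partial j (partial k (v m)) = partial k (partial j (v m)) by exact: Cc_pdC (test_Cc (tv m)).
 exact: (congr1 (fun F => F x) Q).
rewrite (eq_bigr _ (fun i _ => E i)) -(curl_alg T) big1// => i _.
by rewrite (S (i + 1)) subrr.
Qed.

Lemma weak_gradP q : H1 D q -> L2 D (weak_grad D q) /\ is_weak_grad D q (weak_grad D q).
by move=> [_ ex]; exact: (xgetPex (fun=> 0) ex). Qed.

Lemma div_mkv w x : div (mkv w) x = \sum_i partial i (w i) x.
apply: eq_bigr => i _; congr (partial i _ x).
by apply/funext => y; rewrite mxE.
Qed.

Lemma weak_grad_curl q : H1 D q -> Hcurl D (weak_grad D q) /\ fsq (wc (weak_grad D q)) = 0.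
move=> Hq; have [L W] := weak_gradP Hq; have [|H E] := wcurl_Hcurl oD L (@fL0 R D).
 move=> v tv; have tc := tst_cu tv; have Lc := tst_L oD tc.
 have := W (mkv (cu v)) (tst_mkv tc); rewrite (ip_cmp oD L (L2_mkv Lc)) cmp_mkv => ->.
 have -> : \int[leb3]_(x in D) (q x * div (mkv (cu v)) x) = 0.
  rewrite /Rintegral integral0_eq// => x _; congr EFin. by rewrite div_mkv div_cu// mulr0.
 rewrite oppr0; apply: (fip_eq0 oD (@fL0 R D) (tst_L oD tv)).
 by rewrite fsqE (@ssip_0 _ _ _ _ (@fL0 R D) (@fipP R D oD))//; exact: fL0.
by split => //; move: E; rewrite subr0.
Qed.

Lemma fsq0 : fsq 0 = 0.
by rewrite fsqE (@ssip_0 _ _ _ _ (@fL0 R D) (@fipP R D oD))//; exact: fL0. Qed.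

Lemma fsq_shift w w' c : fL w -> fL w' -> fL c -> fsq (w - w') = 0 -> fsq (w - c) = fsq (w' - c).
move=> Lw Lw' Lc E; apply: (fsq_congr oD (fLB oD Lw Lc) (fLB oD Lw' Lc)).
by have <- : w - w' = (w - c) - (w' - c) by exact: sub_common.
Qed.

Lemma proj_H1_0 w p (g : fld) : proj_grad D w p g -> H1_0 D p /\ fsq (cmp (weak_grad D p) - g) = 0.
move=> [Lp Lg lim _]; have L2g' := L2_mkv Lg.
have W : is_weak_grad D p (mkv g).
 move=> v tv; have tc : tst (cmp v) by exact: tv. have Lv := tst_L oD tc; have L2v : L2 D v by apply/L2_cmp.
 rewrite (ip_cmp oD L2g' L2v) cmp_mkv; pose dv x := div v x. have tdv : test_fun D dv.
  have -> : dv = fun x => partial 0 (cmp v 0) x + partial 1 (cmp v 1) x + partial 2 (cmp v 2) x by apply/funext => x; rewrite /dv /div sum3.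
  by apply: test_add; [apply: test_add|]; apply: test_pd; exact: tc.
 have Ldv := test_L2 oD tdv. apply/eqP; rewrite -subr_eq0; apply/eqP.
 apply: (@small0 R _ (2 * fsq (cmp v) + 2 * nsq D dv)).
  by rewrite addr_ge0// mulr_ge0// ?fsq_ge0 ?nsq_ge0.
 move=> e e0; have [P [tP h1 h2]] := lim e e0. have LP := test_L2 oD tP; have LgP := tst_L oD (tst_grd tP).
 have LpP : Lsq D (fun x => p x - P x) by exact: (@L2gB _ _ _ leb3 D mD).
 have GP : fip (grd P) (cmp v) = - sip leb3 D P dv.
  have J k : sip leb3 D (grd P k) (cmp v k) = - \int[leb3]_(x in D) (P x * partial k (cmp v k) x).
   exact: int_ibp_test (tc k) (test_sm tP).
  rewrite fipE (eq_bigr _ (fun k _ => J k)) sumrN; congr (- _).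
  have I k : itg3 D (fun x => P x * partial k (cmp v k) x).
   apply: (@L2g_mul _ _ _ leb3 D mD) => //; apply: test_L2 => //; apply: test_pd; exact: tc.
  rewrite -(@Rint_sum _ _ _ leb3 D mD _ (index_enum _) predT) => [|k _]; last exact: I.
  by apply: eq_int => x _; rewrite /dv /div mulr_sumr.
 have E2 : sip leb3 D (fun x => p x - P x) dv = sip leb3 D p dv - sip leb3 D P dv.
  rewrite /sip -RintegralB//; try exact: (@L2g_mul _ _ _ leb3 D mD).
  by apply: eq_int => x _; rewrite mulrBl.
 have -> : fip g (cmp v) - - (\int[leb3]_(x in D) (p x * div v x)) =
   fip (g - grd P) (cmp v) - - sip leb3 D (fun x => p x - P x) dv.
  rewrite (fipB oD Lg LgP Lv) GP E2; exact: dual_alg.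
 have b1 := fip_CS oD (fLB oD Lg LgP) Lv; have b2 := @sip_CS _ _ _ leb3 D mD _ _ LpP Ldv.
 rewrite -!nsq_sip in b2. apply: dual_fact.
  by apply: le_trans b1 _; apply: ler_wpM2r => //; exact: fsq_ge0.
 by rewrite sqrrN; apply: le_trans b2 _; apply: ler_wpM2r => //; exact: nsq_ge0.
have H1p : H1 D p by split => //; exists (mkv g).
have [Lw Ww] := weak_gradP H1p; have Lw' : fL (cmp (weak_grad D p)) by apply/L2_cmp.
have E : fsq (cmp (weak_grad D p) - g) = 0.
 apply: (orth_tests oD (fLB oD Lw' Lg)) => v tv; have Lv := tst_L oD tv.
 have a1 := Ww _ (tst_mkv tv); have a2 := W _ (tst_mkv tv).
 rewrite (ip_cmp oD Lw (L2_mkv Lv)) cmp_mkv in a1. rewrite (ip_cmp oD L2g' (L2_mkv Lv)) !cmp_mkv in a2.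
 by rewrite (fipB oD Lw' Lg Lv) a1 a2 subrr.
split => //; split => // e e0; have e4 : 0 < e / 4 by rewrite divr_gt0.
have [P [tP h1 h2]] := lim _ e4; exists P; split => //.
have LgP := tst_L oD (tst_grd tP).
have Ed : cmp (fun x => weak_grad D p x - grad P x) = cmp (weak_grad D p) - grd P by apply/funext => i; apply/funext => x; rewrite /cmp /grad !mxE.
have L2d : L2 D (fun x => weak_grad D p x - grad P x) by apply/L2_cmp; rewrite Ed; exact: fLB.
rewrite (norm0_cmp oD L2d) Ed (fsq_shift Lw' Lg LgP E).
exact: half_fact e0 h1 h2.
Qed.

Lemma limit_lin (k : R) w c w' c' : fL w -> fL c -> fL w' -> fL c' ->
 tlim D w c -> tlim D w' c' -> tlim D (k *: w + w') (k *: c + c').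
move=> Lw Lc Lw' Lc' l1 l2 e e0; have k0 : 0 < 2 * k ^+ 2 + 2 by rewrite ltr_wpDl// mulr_ge0// sqr_ge0.
have e1 := divr_gt0 e0 k0; have [t [tt h1 h2]] := l1 _ e1; have [s [ts h3 h4]] := l2 _ e1.
have B a b a' b' : fL a -> fL b -> fL a' -> fL b' -> fsq (a - b) <= e / (2 * k ^+ 2 + 2) ->
  fsq (a' - b') <= e / (2 * k ^+ 2 + 2) -> fsq ((k *: a + a') - (k *: b + b')) <= e.
 move=> La Lb La' Lb' i1 i2.
 have -> : (k *: a + a') - (k *: b + b') = k *: (a - b) + (a' - b') by exact: lin_sub.
 apply: le_trans (fsqD oD (fLZ oD k (fLB oD La Lb)) (fLB oD La' Lb')) _.
 by rewrite (fsqZ oD k (fLB oD La Lb)); exact: lin_fact k0 i1 i2.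
exists (k *: t + s); split; first exact: tstP.
 exact: B Lw (tst_L oD tt) Lw' (tst_L oD ts) h1 h3.
rewrite (cuP k tt ts).
exact: B Lc (tst_L oD (tst_cu tt)) Lc' (tst_L oD (tst_cu ts)) h2 h4.
Qed.

Lemma limit_tst (v : fld) : tst v -> tlim D v (cu v).
by move=> tv e e0; exists v; rewrite !subrr fsq0; split => //; exact: ltW. Qed.

Lemma Hcurl_norm_sq u : Hcurl D u -> Hcurl_norm D u ^+ 2 = fsq (cmp u) + fsq (wc u).
move=> Hu; have [L _] := Hu; have [Lw _] := wcurlP oD Hu.
have L2w : L2 D (weak_curl D u) by apply/L2_cmp.
rewrite /Hcurl_norm sqr_sqrtr ?addr_ge0 ?sqr_ge0//.
by rewrite (norm0_cmp oD L) (norm0_cmp oD L2w).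
Qed.

Lemma K0c_div u : K0c D u -> forall P, test_fun D P -> fip (cmp u) (grd P) = 0.
move=> [[[Lu _] _] Hd] P tP; have := Hd P tP.
have LgP : L2 D (grad P) by apply/L2_cmp; rewrite cmp_grad; exact: tst_L (tst_grd tP).
rewrite (ip_cmp oD Lu LgP) cmp_grad.
have -> : \int[leb3]_(x in D) (0 * P x) = 0 by rewrite /Rintegral integral0_eq// => x _; rewrite mul0r.
by move/eqP; rewrite eq_sym oppr_eq0 => /eqP.
Qed.

(** Limits of test fields and of their curls that are orthogonal to gradients of
    test functions. *)
Lemma limit_K0c u c : L2 D u -> fL c -> tlim D (cmp u) c ->
 (forall P, test_fun D P -> fip (cmp u) (grd P) = 0) ->
 K0c D u /\ Hcurl_norm D u ^+ 2 = fsq (cmp u) + fsq c.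
move=> Lu Lc lim Hd; have [H0 E] := limit_Hcurl0 oD Lu Lc lim; have [Hu _] := H0.
have [Lw _] := wcurlP oD Hu; split.
 split => // P tP; have LgP : L2 D (grad P).
  by apply/L2_cmp; rewrite cmp_grad; exact: tst_L (tst_grd tP).
 rewrite (ip_cmp oD Lu LgP) cmp_grad Hd// oppr0. by rewrite /Rintegral integral0_eq// => x _; rewrite mul0r.
by rewrite Hcurl_norm_sq// (fsq_congr oD Lw Lc E).
Qed.

Lemma K0c_lin (k : R) u v : K0c D u -> K0c D v -> K0c D (fun x => k *: u x + v x) /\
 Hcurl_norm D (fun x => k *: u x + v x) ^+ 2 = fsq (k *: cmp u + cmp v) + fsq (k *: wc u + wc v).
move=> Ku Kv; have [[Hu tu] _] := Ku; have [[Hv tv] _] := Kv.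
have [Lu _] := Hu; have [Lv _] := Hv; have [Lcu _] := wcurlP oD Hu; have [Lcv _] := wcurlP oD Hv.
have Lu' : fL (cmp u) by apply/L2_cmp.
have Lv' : fL (cmp v) by apply/L2_cmp.
rewrite -cmpP; apply: limit_K0c.
- by apply/L2_cmp; rewrite cmpP; exact: fLP.
- exact: fLP.
- by rewrite cmpP; apply: limit_lin => //; apply: Hcurl0_limit.
move=> P tP; have LgP := tst_L oD (tst_grd tP).
by rewrite cmpP (fipP oD k Lu' Lv' LgP) !K0c_div// mulr0 addr0.
Qed.

Lemma K0c_0 : K0c D (fun=> 0) /\ Hcurl_norm D (fun=> 0) = 0.
have c0 : cmp (fun=> 0 : 'rV[R]_3) = 0 :> fld by apply/funext => i; apply/funext => x; rewrite /cmp mxE.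
have L0 : L2 D (fun=> 0 : 'rV[R]_3) by apply/L2_cmp; rewrite c0; exact: fL0.
have t0 := @tst0 R D.
have [] := @limit_K0c (fun=> 0) 0 L0 (@fL0 R D).
- rewrite c0 => e e0; exists 0; split => //; rewrite ?subrr ?fsq0 ?ltW//.
 have -> : cu (0 : fld) = 0.
  apply/funext => i; apply/funext => x; have Z j : partial j (fun=> (0 : R)) x = 0 by exact: pd_cst.
  exact: (etrans (f_equal2 (fun s t => s - t) (Z _) (Z _)) (subrr _)).
 by rewrite subrr fsq0.
- move=> P tP; rewrite c0; apply: (fip_eq0 oD (@fL0 R D) (tst_L oD (tst_grd tP))); exact: fsq0.
move=> K; rewrite c0 fsq0 addr0 => /eqP; rewrite sqrf_eq0 => /eqP N.
by split.
Qed.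

Lemma dual_bound (l : vfield -> R) : K0c_dual D l -> 0 <= K0c_dual_norm D l /\
 forall u, K0c D u -> `|l u| <= K0c_dual_norm D l * Hcurl_norm D u.
move=> [lP [M HM] _]; have [K0 N0] := K0c_0.
have H0 : Hcurl0 D (fun=> 0 : 'rV[R]_3) by case: K0.
have l0 : l (fun=> 0) = 0.
 have := lP 1 _ _ H0 H0; rewrite (_ : (fun x => _) = fun=> 0).
  by rewrite mul1r => /eqP; rewrite -subr_eq0 opprD addrA subrr sub0r oppr_eq0 => /eqP.
 by apply/funext => x; rewrite scaler0 addr0.
set S := [set `|l w| | w in [set w | K0c D w /\ Hcurl_norm D w <= 1]].
have S0 : S 0 by exists (fun=> 0); rewrite ?l0 ?normr0//; split => //; rewrite N0.
have nn u : 0 <= Hcurl_norm D u by exact: sqrtr_ge0.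
have hS : has_ubound S.
 exists `|M| => _ [w [Kw w1] <-]; apply: le_trans (HM w Kw) _.
 apply: (@le_trans _ _ (`|M| * Hcurl_norm D w)); first by apply: ler_wpM2r => //; exact: ler_norm.
 by rewrite ler_piMr.
have p0 : 0 <= K0c_dual_norm D l by apply: ub_le_sup.
split => // u Ku; have := nn u; rewrite le_eqVlt => /predU1P[n0|n0].
 by have := HM u Ku; rewrite -n0 !mulr0.
pose u1 x := (Hcurl_norm D u)^-1 *: u x + (0 : 'rV[R]_3).
have [K1 N1] := K0c_lin (Hcurl_norm D u)^-1 Ku K0.
have [[Hu _] _] := Ku; have [[Hz _] _] := K0; have [Lu _] := Hu; have [Lcu _] := wcurlP oD Hu.
have [Lcz _] := wcurlP oD Hz.
have Lu' : fL (cmp u) by apply/L2_cmp.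
have z1 : fsq (cmp (fun=> 0 : 'rV[R]_3)) = 0 /\ fsq (wc (fun=> 0)) = 0.
 have := Hcurl_norm_sq Hz; rewrite N0 expr0n/= => /esym/eqP.
 by rewrite paddr_eq0 ?fsq_ge0// => /andP[/eqP-> /eqP->].
have Lz : fL (cmp (fun=> 0 : 'rV[R]_3)) by have [] := Hz => /L2_cmp.
have drop a b : fL a -> fL b -> fsq b = 0 -> fsq (a + b) = fsq a.
 move=> La Lb b0; apply: (fsq_congr oD (fLD oD La Lb) La).
 by have -> : a + b - a = b by rewrite addrC; exact: addKr.
have LZ a : fL a -> fL ((Hcurl_norm D u)^-1 *: a) by exact: fLZ.
have N2 : Hcurl_norm D u1 ^+ 2 = 1.
 rewrite N1 (drop _ _ (LZ _ Lu') Lz z1.1) (drop _ _ (LZ _ Lcu) Lcz z1.2) (fsqZ oD _ Lu') (fsqZ oD _ Lcu).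
 by rewrite -mulrDr -(Hcurl_norm_sq Hu) -exprMn mulVf ?expr1n//; exact: lt0r_neq0.
have N3 : Hcurl_norm D u1 <= 1 by exact: le1_fact N2 (nn u1).
have S1 : S `|l u1| by exists u1; [split|].
have : `|l u1| <= K0c_dual_norm D l by apply: ub_le_sup.
rewrite /u1 lP//; [|by case: Ku].
by rewrite l0 addr0 normrM gtr0_norm ?invr_gt0// mulrC ler_pdivrMr.
Qed.

Hypotheses (D0 : D !=set0) (cbD : connected (boundary D)).

(** Functionals in the dual are bounded on test fields by the curl alone, since
    they do not see the gradient part. *)
Lemma dual_tests : exists2 C : R, 0 <= C & forall (l : vfield -> R), K0c_dual D l ->
 forall v : fld, tst v -> `|l (mkv v)| <= K0c_dual_norm D l * Num.sqrt C * Num.sqrt (fip (cu v) (cu v)).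
have [C C0 HC] := friedrichs_proj oD bD D0 LD cbD; exists (C + 1); first by rewrite addr_ge0.
move=> l Kl v tv; have [lP _ lg] := Kl; have [M0 HM] := dual_bound Kl.
have Lv := tst_L oD tv; have Lcv := tst_L oD (tst_cu tv).
have [p [g Hp]] := proj_exists oD bD Lv; have [H10 E] := proj_H1_0 Hp.
have [Lp Lg lim orth] := Hp.
have [L2w _] := weak_gradP H10.1; have Lw : fL (cmp (weak_grad D p)) by apply/L2_cmp.
have lw : tlim D (cmp (weak_grad D p)) 0.
 move=> e e0; have [P [tP h1 h2]] := lim e e0; have tg := tst_grd tP.
 exists (grd P); split => //; first by rewrite (fsq_shift Lw Lg (tst_L oD tg) E).
 by rewrite (cu_grd tP) subrr fsq0 ltW.
have [Hw0 _] := limit_Hcurl0 oD L2w (@fL0 R D) lw.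
have lv : tlim D (cmp (mkv v)) (cu v) by rewrite cmp_mkv; exact: limit_tst.
have [Hv0 _] := limit_Hcurl0 oD (L2_mkv Lv) Lcv lv.
pose v0 x := (-1) *: weak_grad D p x + mkv v x.
have E0 : cmp v0 = (-1) *: cmp (weak_grad D p) + v by rewrite cmpP cmp_mkv.
have Ed : fsq (cmp v0) = fsq (v - g).
 have -> : cmp v0 = v - cmp (weak_grad D p) by rewrite E0 scaleN1r addrC.
 exact: (etrans (fsqC _ _ _) (etrans (fsq_shift Lw Lg Lv E) (fsqC _ _ _))).
have L2v0 : L2 D v0 by apply/L2_cmp; rewrite E0; exact: fLP.
have lim0 : tlim D (cmp v0) ((-1) *: 0 + cu v) by rewrite E0; apply: limit_lin => //; [exact: fL0|move: lv; rewrite cmp_mkv].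
have [|Kv0 Nv0] := limit_K0c L2v0 (fLP oD _ (@fL0 R D) Lcv) lim0.
 move=> P tP; have LgP := tst_L oD (tst_grd tP).
 rewrite E0 (fipP oD _ Lw Lv LgP) (fip_congr oD Lw Lg LgP E) orth// mulN1r addrC subrr//.
have lE : l v0 = l (mkv v) by rewrite lP// lg// mulr0 add0r.
rewrite -lE; apply: le_trans (HM _ Kv0) _; rewrite -mulrA; apply: ler_wpM2l => //.
rewrite -sqrtrM ?addr_ge0// -[leLHS]ger0_norm ?sqrtr_ge0// -sqrtr_sqr; apply: ler_wsqrtr.
rewrite Nv0 Ed scaler0 add0r -fsqE mulrDl mul1r lerD2r.
apply: HC => //; by move=> e e0; have [P [tP _ h]] := lim e e0; exists P.
Qed.

End Dual.

(** * Tensors with zero divergence *)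
Section MatrixAlgebra.
Context {R : realType}.
Implicit Types (A : 'M[R]_3) (r : 'rV[R]_3).

Lemma spnE r : [/\ spn r 0 0 = 0, spn r 1 1 = 0, spn r 2 2 = 0,
 [/\ spn r 0 1 = - r 0 2, spn r 0 2 = r 0 1 & spn r 1 0 = r 0 2] &
 [/\ spn r 1 2 = - r 0 0, spn r 2 0 = - r 0 1 & spn r 2 1 = r 0 0]].
by rewrite /spn !mxE. Qed.

Lemma half_double A : 2^-1 *: (A + A) = A.
by apply/matrixP => i j; rewrite !mxE; move: (A i j) => t; field. Qed.

Lemma skw_sum (t : R) r : skw (t%:M + spn r) = spn r.
rewrite /skw [(_ + _)^T]linearD/= tr_scalar_mx spn_skew opprD opprK addrACA subrr add0r.
exact: half_double.
Qed.

Lemma sym_sum (t : R) r : sym (t%:M + spn r) = t%:M.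
rewrite /sym [(_ + _)^T]linearD/= tr_scalar_mx spn_skew addrACA subrr addr0.
exact: half_double.
Qed.

Lemma dev_scalar (t : R) : dev (t%:M) = 0.
rewrite /dev mxtrace_scalar -[t *+ 3]mulr_natl mulrA mulVf ?pnatr_eq0// mul1r.
exact: subrr.
Qed.

Lemma tr_sum (t : R) r : \tr (t%:M + spn r) = 3 * t.
rewrite linearD/= mxtrace_scalar /mxtrace sum3; have [-> -> -> _ _] := spnE r.
by rewrite !addr0 mulr_natl.
Qed.

(** Splitting into trace, symmetric traceless and skew parts. *)
Lemma mx_split A i j : A i j = (\tr A / 3)%:M i j + dev (sym A) i j + spn (spn_inv (skw A)) i j.
have skA : (skw A)^T = - skw A by rewrite /skw linearZ/= linearB/= trmxK -scalerN opprB.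
rewrite spn_invK// /dev.
have trs : \tr (sym A) = \tr A by rewrite /sym mxtraceZ mxtraceD mxtrace_tr; move: (\tr A) => t; field.
have e1 : (\tr A / 3)%:M i j = (\tr A / 3) *+ (i == j) by rewrite mxE.
have e2 : (sym A - (3^-1 * \tr (sym A))%:M) i j = 2^-1 * (A i j + A j i) - (\tr A / 3) *+ (i == j) by rewrite trs (mulrC 3^-1) !mxE.
have e3 : skw A i j = 2^-1 * (A i j - A j i) by rewrite !mxE.
by rewrite e1 e2 e3; move: (_ *+ _) (A i j) (A j i) => s a b; field.
Qed.

Lemma spn_invE A : [/\ spn_inv A 0 0 = A 2 1, spn_inv A 0 1 = A 0 2 & spn_inv A 0 2 = A 1 0].
by rewrite /spn_inv /row3 !mxE. Qed.

Lemma spn_row r (P : 'I_3 -> R) i : \sum_j spn r i j * P j =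
 \sum_j r 0 j * ((j + 2 == i)%:R * P (j + 1) - (j + 1 == i)%:R * P (j + 2)).
have [s00 s11 s22 [s01 s02 s10] [s12 s20 s21]] := spnE r.
rewrite !sum3 !ord3E.
have [e0 e1 e2] : [/\ ((0 : 'I_3) == 0) = true, ((1 : 'I_3) == 1) = true & ((2 : 'I_3) == 2) = true] by [].
have [e01 e02 e12] : [/\ ((0 : 'I_3) == 1) = false, ((0 : 'I_3) == 2) = false & ((1 : 'I_3) == 2) = false] by [].
have [e10 e20 e21] : [/\ ((1 : 'I_3) == 0) = false, ((2 : 'I_3) == 0) = false & ((2 : 'I_3) == 1) = false] by [].
elim/ord3 : i; rewrite ?e0 ?e1 ?e2 ?e01 ?e02 ?e12 ?e10 ?e20 ?e21 ?s00 ?s11 ?s22 ?s01 ?s02 ?s10 ?s12 ?s20 ?s21 /= ?mulr1n ?mulr0n;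
 by move: (r 0 0) (r 0 1) (r 0 2) (P 0) (P 1) (P 2) => a b c x y z; ring.
Qed.

Lemma split_pt A (P : 'I_3 -> 'I_3 -> R) : \sum_i P i i = 0 ->
 \sum_i spn_inv (skw A) 0 i * (P (i + 1) (i + 2) - P (i + 2) (i + 1)) =
 \sum_i (\sum_j A i j * P j i - \sum_j dev (sym A) i j * P j i).
move=> P0; pose r := spn_inv (skw A).
have row i : \sum_j A i j * P j i - \sum_j dev (sym A) i j * P j i =
  \tr A / 3 * P i i + \sum_j spn r i j * P j i.
 have T : \tr A / 3 * P i i = \sum_j (\tr A / 3)%:M i j * P j i.
  rewrite (bigD1 i)//= mxE eqxx mulr1n big1 ?addr0// => j /negPf ij. by rewrite mxE eq_sym ij mulr0n mul0r.
 rewrite T -sumrB -big_split/=; apply: eq_bigr => j _.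
 by rewrite (mx_split A i j) -/r -mulrDl -mulrBl; congr (_ * _); rewrite addrAC addrK.
rewrite (eq_bigr _ (fun i _ => row i)) big_split/= -mulr_sumr P0 mulr0 add0r.
have sr i := spn_row r (fun j => P j i) i.
rewrite (eq_bigr _ (fun i _ => sr i)) !sum3 !ord3E -/r.
have [e0 e1 e2] : [/\ ((0 : 'I_3) == 0) = true, ((1 : 'I_3) == 1) = true & ((2 : 'I_3) == 2) = true] by [].
have [e01 e02 e12] : [/\ ((0 : 'I_3) == 1) = false, ((0 : 'I_3) == 2) = false & ((1 : 'I_3) == 2) = false] by [].
have [e10 e20 e21] : [/\ ((1 : 'I_3) == 0) = false, ((2 : 'I_3) == 0) = false & ((2 : 'I_3) == 1) = false] by [].
rewrite e0 e1 e2 e01 e02 e12 e10 e20 e21 /= ?mulr1n ?mulr0n.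
move: (r 0 0) (r 0 1) (r 0 2) (P 0 1) (P 0 2) (P 1 0) (P 1 2) (P 2 0) (P 2 1) (P 0 0) (P 1 1) (P 2 2).
by move=> a b c p1 p2 p3 p4 p5 p6 p7 p8 p9; ring.
Qed.

Lemma spn_entry i j : exists s k, (forall r, spn r i j = s * r 0 k) /\ s ^+ 2 <= 1.
have z : (0 : R) ^+ 2 <= 1 by rewrite expr0n ler01.
have o : (1 : R) ^+ 2 <= 1 by rewrite expr1n.
have n : (- 1 : R) ^+ 2 <= 1 by rewrite sqrrN expr1n.
have E r := spnE r.
elim/ord3 : i; elim/ord3 : j; [exists 0, 0|exists (-1), 2|exists 1, 1|exists 1, 2|exists 0, 0|exists (-1), 0|
 exists (-1), 1|exists 1, 0|exists 0, 0]; split => // r; have [s00 s11 s22 [s01 s02 s10] [s12 s20 s21]] := E r;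
 by rewrite ?mul0r ?mul1r ?mulN1r.
Qed.

End MatrixAlgebra.

Lemma direct_fact (R : realType) (C e a b c d f : R) : 0 <= C -> a <= e -> b <= e ->
 c <= 2 * 0 + 2 * b -> d <= 2 * a + 2 * f -> f <= C * c -> d <= e * (2 + 4 * C).
move=> C0 h1 h2 h3 h4 h5; have : C * c <= C * (2 * e) by apply: ler_wpM2l => //; lra.
lra.
Qed.

Section Final.
Context {R : realType}.
Local Notation sp := (R * R * R)%type.
Local Notation fld := ('I_3 -> R * R * R -> R).
Local Notation vfield := (R * R * R -> 'rV[R]_3).
Implicit Types (f p q : sp -> R) (w c : fld) (u v phi : vfield) (sg : sp -> 'M[R]_3).
Variables (D : set sp).
Hypotheses (D0 : D !=set0) (oD : open D) (cD : connected D) (bD : bounded_set D)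
 (LD : lipschitz_boundary D) (sc : simply_connected D) (cbD : connected (boundary D)).
Let mD := mopen oD.
Local Notation fL := (fL D).
Local Notation fip := (fip D).
Local Notation fsq := (fsq D).
Local Notation tst := (tst D).
Local Notation wc := (wc D).

Lemma ae3I (P Q : set sp) : (\forall x \ae leb3, P x) -> (\forall x \ae leb3, Q x) ->
 \forall x \ae leb3, P x /\ Q x.
exact: (@filterI _ _ (ae_filter_ringOfSetsType (@leb3 R)) P Q). Qed.

Lemma ae3T (P : set sp) : (forall x, P x) -> \forall x \ae leb3, P x.
exact: (@filterE _ _ (ae_filter_ringOfSetsType (@leb3 R)) P). Qed.

Lemma nsq0_ae f : Lsq D f -> nsq D f = 0 -> f = (fun=> 0) %[ae leb3 in D].
move=> Lf f0; apply: L2_zero => // q tq.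
have := @sip_CS _ _ _ leb3 D mD _ _ Lf (test_L2 oD tq); rewrite -!nsq_sip f0 mul0r => h.
by apply/eqP; rewrite -sqrf_eq0 eq_le h sqr_ge0.
Qed.

Lemma ae_nsq f g : Lsq D f -> Lsq D g -> f = g %[ae leb3 in D] ->
 nsq D (fun x => f x - g x) = 0.
move=> Lf Lg fg; have Ld : Lsq D (fun x => f x - g x) by exact: (@L2gB _ _ _ leb3 D mD).
have L0 := @L2g0 _ _ _ leb3 D.
rewrite (nsq_ae mD Ld L0); first by rewrite /nsq /Rintegral integral0_eq// => x _; rewrite expr0n.
by move: fg; apply: ae3S => x H /H ->; rewrite subrr.
Qed.

Lemma ae_fsq u v : L2 D u -> L2 D v -> u = v %[ae leb3 in D] -> fsq (cmp u - cmp v) = 0.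
move=> Lu Lv uv; apply: big1 => i _; apply: ae_nsq; [exact: Lu|exact: Lv|].
by move: uv; apply: ae3S => x H /H; rewrite /cmp => ->.
Qed.

Lemma fsq_ae u : L2 D u -> fsq (cmp u) = 0 -> u = (fun=> 0) %[ae leb3 in D].
move=> Lu E; have H i : cmp u i = (fun=> 0) %[ae leb3 in D].
 apply: nsq0_ae; first exact: Lu. by apply/eqP; rewrite eq_le nsq_ge0 andbT -E; exact: fsq_comp.
have F := ae3I (ae3I (H 0) (H 1)) (H 2); move: F; apply: ae3S => x [[h0 h1] h2] Dx.
apply/rowP => i; rewrite mxE; elim/ord3 : i; [exact: h0|exact: h1|exact: h2].
Qed.

Definition skwp sg : vfield := fun x => spn_inv (skw (sg x)).

Lemma L2_mx sg i j : L2 D sg -> Lsq D (fun x => sg x i j). by move=> H; exact: H. Qed.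

Lemma skwE (A : 'M[R]_3) i j : skw A i j = 2^-1 * A i j + - 2^-1 * A j i.
by rewrite /skw !mxE mulrBr mulNr. Qed.

Lemma L2_skw sg : L2 D sg -> L2 D (skwp sg).
move=> Ls; apply/L2_cmp => i.
have L j k : Lsq D (fun x => skw (sg x) j k).
 have -> : (fun x => skw (sg x) j k) = fun x => 2^-1 * sg x j k + (- 2^-1) * sg x k j by apply/funext => x; exact: skwE.
 apply: (@L2gP _ _ _ leb3 D mD); first exact: L2_mx. by apply: (@L2gZ _ _ _ leb3 D mD); exact: L2_mx.
have E k : cmp (skwp sg) k = fun x => spn_inv (skw (sg x)) 0 k by [].
elim/ord3 : i; rewrite E.
- by have -> : (fun x => spn_inv (skw (sg x)) 0 0) = fun x => skw (sg x) 2 1 by apply/funext => x; have [] := spn_invE (skw (sg x)).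
- by have -> : (fun x => spn_inv (skw (sg x)) 0 1) = fun x => skw (sg x) 0 2 by apply/funext => x; have [] := spn_invE (skw (sg x)).
- by have -> : (fun x => spn_inv (skw (sg x)) 0 2) = fun x => skw (sg x) 1 0 by apply/funext => x; have [] := spn_invE (skw (sg x)).
Qed.

(** The skew part of a tensor of the first space is orthogonal to curls of
    divergence-free test fields: row-wise the divergence couples it to the
    trace only. *)
Lemma skw_orth sg v : H0_div_devsym D sg -> test_field D v ->
 fip (cmp (skwp sg)) (cu (cu (cmp v))) = 0.
move=> [Ls _ Hd Hdev] tv; have tc : tst (cu (cmp v)) by apply: tst_cu; exact: tv.
set z := cu (cmp v); have Lsk := L2_skw Ls; have Lsk' : fL (cmp (skwp sg)) by apply/L2_cmp.
have Lz k i : Lsq D (partial k (z i)) by apply: test_L2 => //; apply: test_pd; exact: tc.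
have Lsym i j : Lsq D (fun x => sym (sg x) i j).
 have -> : (fun x => sym (sg x) i j) = fun x => 2^-1 * sg x i j + 2^-1 * sg x j i by apply/funext => x; rewrite /sym !mxE mulrDr.
 apply: (@L2gP _ _ _ leb3 D mD); first exact: L2_mx. by apply: (@L2gZ _ _ _ leb3 D mD); exact: L2_mx.
have Ltr : Lsq D (fun x => \tr (sg x)).
 have -> : (fun x => \tr (sg x)) = fun x => sg x 0 0 + sg x 1 1 + sg x 2 2 by apply/funext => x; rewrite /mxtrace sum3.
 by apply: (@L2gD _ _ _ leb3 D mD); [apply: (@L2gD _ _ _ leb3 D mD)|]; exact: L2_mx.
have trs x : \tr (sym (sg x)) = \tr (sg x) by rewrite /sym mxtraceZ mxtraceD mxtrace_tr; move: (\tr (sg x)) => t; field.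
have Ldev i j : Lsq D (fun x => dev (sym (sg x)) i j).
 have -> : (fun x => dev (sym (sg x)) i j) = fun x => (- (3^-1 *+ (i == j))) * \tr (sg x) + sym (sg x) i j.
  apply/funext => x; have -> : dev (sym (sg x)) i j = sym (sg x) i j - (3^-1 * \tr (sg x)) *+ (i == j).
   by rewrite /dev trs; move: (sym (sg x)) => B; rewrite !mxE.
  by rewrite addrC mulNr mulrnAl.
 exact: (@L2gP _ _ _ leb3 D mD).
have dev0 i j : nsq D (fun x => dev (sym (sg x)) i j) = 0.
 rewrite (@nsq_eq R D _ (fun x => dev (sym (sg x)) i j - 0)); last by move=> x _; rewrite subr0.
 apply: ae_nsq; [exact: Ldev|exact: L2g0|]. by move: Hdev; apply: ae3S => x H /H ->; rewrite mxE.
have J i : \int[leb3]_(x in D) (\sum_j sg x i j * partial j (z i) x) = 0.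
 have tzi : test_fun D (z i) by exact: tc. have := Hd i (z i) tzi. have Lrow : L2 D (fun x => row i (sg x)).
  apply/L2_cmp => j; have -> : cmp (fun x => row i (sg x)) j = fun x => sg x i j by apply/funext => x; rewrite /cmp mxE.
  exact: L2_mx.
 have Lg : L2 D (grad (z i)) by apply/L2_cmp; rewrite cmp_grad; exact: tst_L (tst_grd tzi).
 have -> : \int[leb3]_(x in D) (0 * z i x) = 0 by rewrite /Rintegral integral0_eq// => x _; rewrite mul0r.
 rewrite (ip_cmp oD Lrow Lg) cmp_grad -fip_int//; [|by apply/L2_cmp|exact: tst_L (tst_grd tzi)].
 move/eqP; rewrite eq_sym oppr_eq0 => /eqP E; rewrite -[RHS]E; apply: eq_int => x _.
 by apply: eq_bigr => j _; rewrite /cmp mxE.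
pose d i := \int[leb3]_(x in D) (\sum_j dev (sym (sg x)) i j * partial j (z i) x).
have d0 i : d i = 0.
 have := @fip_int R D oD (fun j x => dev (sym (sg x)) i j) (grd (z i)) (Ldev i) (fun k => Lz k i).
 have F : fsq (fun j x => dev (sym (sg x)) i j) = 0 by apply: big1 => j _; exact: dev0.
 move=> E; exact: (etrans E (fip_eq0 oD (Ldev i) (fun k => Lz k i) F)).
have Isk i : itg3 D (fun x => cmp (skwp sg) i x * cu z i x).
 apply: (@L2g_mul _ _ _ leb3 D mD); [exact: Lsk'|exact: tst_L (tst_cu tc) i].
have Is i : itg3 D (fun x => \sum_j sg x i j * partial j (z i) x) by apply: (@itg_sum _ _ _ leb3 D mD) => j _; apply: (@L2g_mul _ _ _ leb3 D mD) => //; exact: L2_mx.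
have Id i : itg3 D (fun x => \sum_j dev (sym (sg x)) i j * partial j (z i) x) by apply: (@itg_sum _ _ _ leb3 D mD) => j _; apply: (@L2g_mul _ _ _ leb3 D mD).
rewrite -fip_int//; last exact: tst_L (tst_cu tc).
have pt x : \sum_i cmp (skwp sg) i x * cu z i x =
  \sum_i (\sum_j sg x i j * partial j (z i) x - \sum_j dev (sym (sg x)) i j * partial j (z i) x).
 have tv' : tst (cmp v) by exact: tv. have dz : \sum_i partial i (z i) x = 0 by exact: (div_cu x tv').
 exact: (@split_pt R (sg x) (fun j i => partial j (z i) x) dz).
under eq_int do rewrite pt.
rewrite (@Rint_sum _ _ _ leb3 D mD _ (index_enum _) predT) => [|i _]; last exact: (@itgB _ _ _ leb3 D mD).
by apply: big1 => i _; rewrite RintegralB// J -/(d i) d0 subrr.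
Qed.

Lemma skw_sum_orth phi sg u (v : fld) : L2 D phi -> L2 D u -> H0_div_devsym D sg -> tst v ->
 phi = (fun x => skwp sg x + u x) %[ae leb3 in D] ->
 fip (cmp phi) (cu (cu v)) = fip (cmp u) (cu (cu v)).
move=> Lp Lu Hs tv E; have [Ls _ _ _] := Hs; have Lsk := L2_skw Ls.
have Lp' : fL (cmp phi) by apply/L2_cmp.
have Lu' : fL (cmp u) by apply/L2_cmp.
have Lsk' : fL (cmp (skwp sg)) by apply/L2_cmp.
have Es : cmp (fun x => skwp sg x + u x) = cmp (skwp sg) + cmp u by apply/funext => i; apply/funext => x; rewrite /cmp mxE.
have Lsum : L2 D (fun x => skwp sg x + u x) by apply/L2_cmp; rewrite Es; exact: fLD.
have F := ae_fsq Lp Lsum E; rewrite Es in F.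
have Lz := tst_L oD (tst_cu (tst_cu tv)).
rewrite (fip_congr oD Lp' (fLD oD Lsk' Lu') Lz F).
rewrite (@ssip_D _ _ _ _ (@fipP R D oD) _ _ _ Lsk' Lu' Lz).
have := skw_orth Hs (tst_mkv tv); rewrite cmp_mkv => ->.
exact: add0r.
Qed.

Lemma fip0r w : fL w -> fip w 0 = 0.
move=> Lw; rewrite (fipC Lw (@fL0 R D)).
exact: (@ssip_0 _ _ _ _ (@fL0 R D) (@fipP R D oD)).
Qed.

Lemma directness sg u : H0_div_devsym D sg -> K0c D u -> skwp sg = u %[ae leb3 in D] ->
 u = (fun=> 0) %[ae leb3 in D].
move=> Hs Ku E; have [Hu0 _] := Ku; have [Hu _] := Hu0; have [Lu _] := Hu.
have Lu' : fL (cmp u) by apply/L2_cmp.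
have [Lc W] := wcurlP oD Hu; have lim := Hcurl0_limit oD bD LD Hu0.
have [Ls _ _ _] := Hs; have Lsk := L2_skw Ls; have Lsk' : fL (cmp (skwp sg)) by apply/L2_cmp.
have orth (v : fld) : tst v -> fip (cmp u) (cu (cu v)) = 0.
 move=> tv; have Lz := tst_L oD (tst_cu (tst_cu tv)). rewrite -(fip_congr oD Lsk' Lu' Lz (ae_fsq Lsk Lu E)).
 by have := skw_orth Hs (tst_mkv tv); rewrite cmp_mkv.
have c0 : fsq (wc u) = 0.
 rewrite fsqE (limit_dual oD Lu' Lc Lc (@fL0 R D) lim) ?fip0r// => t tt.
 have Lt := tst_L oD tt; rewrite fip0r//.
 by rewrite (fipC (tst_L oD (tst_cu tt)) Lc) (W _ (tst_cu tt)) orth.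
apply: (fsq_ae Lu); have [C C0 HC] := friedrichs oD bD D0 LD cbD.
apply: (@small0 R _ (fsq (cmp u) * (2 + 4 * C))).
 by apply: mulr_ge0; [exact: fsq_ge0|rewrite addr_ge0// mulr_ge0].
move=> e e0; have [t [tt h1 h2]] := lim e e0; have [P tP HP] := HC t tt.
have Lt := tst_L oD tt; have Lct := tst_L oD (tst_cu tt); have LP := tst_L oD (tst_grd tP).
have h3 : fsq (cu t) <= 2 * fsq (wc u) + 2 * fsq (wc u - cu t).
 have := fsqB oD Lc (fLB oD Lc Lct). by have -> : wc u - (wc u - cu t) = cu t by exact: subKr.
have h4 : fsq (cmp u - grd P) <= 2 * fsq (cmp u - t) + 2 * fsq (t - grd P).
 have := fsqD oD (fLB oD Lu' Lt) (fLB oD Lt LP).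
 by have -> : cmp u - t + (t - grd P) = cmp u - grd P by rewrite addrA subrK.
have F : fsq (cmp u) = fip (cmp u) (cmp u - grd P).
 rewrite fsqE [RHS](fipC Lu' (fLB oD Lu' LP)) (fipB oD Lu' LP Lu') (fipC LP Lu').
 by rewrite (K0c_div oD Ku tP) subr0.
rewrite [in leLHS]F; apply: le_trans (fip_CS oD Lu' (fLB oD Lu' LP)) _.
rewrite [leRHS]mulrCA; apply: ler_wpM2l; first exact: fsq_ge0.
rewrite c0 in h3; exact: direct_fact C0 h1 h2 h3 h4 HP.
Qed.

Lemma sum_curlcurl phi sg u : L2 D phi -> H0_div_devsym D sg -> K0c D u ->
 phi = (fun x => skwp sg x + u x) %[ae leb3 in D] -> Hcurlcurl D phi.
move=> Lp Hs Ku E; split => //; have [Hu0 _] := Ku; have [Hu _] := Hu0; have [Lu _] := Hu.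
have [Lc W] := wcurlP oD Hu; have L2c : L2 D (weak_curl D u) by apply/L2_cmp.
have lE v : Hcurl D v -> fL (wc v) /\ ip D (weak_curl D u) (weak_curl D v) = fip (wc u) (wc v) by move=> Hv; have [Lv _] := wcurlP oD Hv; split => //; rewrite ip_cmp//; apply/L2_cmp.
exists (fun v => ip D (weak_curl D u) (weak_curl D v)); split; first split.
- move=> k v1 v2 [H1 _] [H2 _]; have [L1 ->] := lE _ H1; have [L2' ->] := lE _ H2.
 have [_ W1] := wcurlP oD H1; have [_ W2] := wcurlP oD H2.
 have [/L2_cmp Lv1 _] := H1; have [/L2_cmp Lv2 _] := H2.
 have Lv : L2 D (fun x => k *: v1 x + v2 x) by apply/L2_cmp; rewrite cmpP; exact: fLP.
 have [|Hv Ev] := wcurl_Hcurl oD Lv (fLP oD k L1 L2').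
  move=> t tt; have Lt := tst_L oD tt; have Lct := tst_L oD (tst_cu tt).
  by rewrite cmpP (fipP oD k L1 L2' Lt) (fipP oD k Lv1 Lv2 Lct) W1// W2.
 have [Lw ->] := lE _ Hv.
 rewrite (fipC Lc Lw) (fip_congr oD Lw (fLP oD k L1 L2') Lc Ev) (fipP oD k L1 L2' Lc).
 by rewrite (fipC L1 Lc) (fipC L2' Lc).
- exists (Num.sqrt (fsq (wc u))) => v [[Hv _] _]; have [Lv ->] := lE _ Hv.
 apply: abs_le_sq; first by apply: mulr_ge0; exact: sqrtr_ge0.
 rewrite exprMn sqr_sqrtr ?fsq_ge0//; apply: le_trans (fip_CS oD Lc Lv) _.
 apply: ler_wpM2l; first exact: fsq_ge0. by rewrite (Hcurl_norm_sq oD Hv) lerDr fsq_ge0.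
- move=> q [Hq _]; have [Hg Eg] := weak_grad_curl oD Hq; have [Lg ->] := lE _ Hg.
 by rewrite (fipC Lc Lg); exact: fip_eq0.
move=> v tv; have tc : tst (cmp v) by exact: tv.
have Lv : L2 D v by apply/L2_cmp; exact: tst_L.
have Lcv := tst_L oD (tst_cu tc).
have [|Hv Ev] := wcurl_Hcurl oD Lv Lcv; first by move=> t tt; exact: fip_cu_tst.
have [Lw ->] := lE _ Hv.
rewrite (fipC Lc Lw) (fip_congr oD Lw Lcv Lc Ev) (fipC Lcv Lc) (W _ (tst_cu tc)).
have Lcc : L2 D (curl (curl v)) by apply/L2_cmp; rewrite !cmp_curl; exact: tst_L (tst_cu (tst_cu tc)).
by rewrite (ip_cmp oD Lp Lcc) !cmp_curl (skw_sum_orth Lp Lu Hs tc E).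
Qed.

End Final.

Lemma final_bound1 (R : realType) (Cb Cs Cd X Y E w n : R) : 0 <= Cb -> 0 <= Cs -> 0 <= Cd -> 0 <= X -> 0 <= Y ->
 w <= Cs * (Y * Cd) -> E <= 2 * X + 2 * w -> n <= 9 * (8 * (Cb * E) + 2 * E) ->
 n <= ((72 * Cb + 18) * (2 * (1 + Cs * Cd)) + (Cs * Cd + Cd)) * (X + Y).
move=> Cb0 Cs0 Cd0 X0 Y0 h1 h2 h3; have p := mulr_ge0 Cs0 Cd0; have pY := mulr_ge0 p Y0; have pX := mulr_ge0 p X0.
have h4 : E <= 2 * (1 + Cs * Cd) * (X + Y).
 have : Cs * (Y * Cd) = Cs * Cd * Y by ring. by move: pX pY; move: (Cs * Cd) => s; lra.
have h5 : 0 <= 72 * Cb + 18 by lra.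
have h6 : (72 * Cb + 18) * E <= (72 * Cb + 18) * (2 * (1 + Cs * Cd) * (X + Y)) by apply: ler_wpM2l.
have h7 : 9 * (8 * (Cb * E) + 2 * E) = (72 * Cb + 18) * E by ring.
have h8 : 0 <= (Cs * Cd + Cd) * (X + Y) by apply: mulr_ge0; apply: addr_ge0.
rewrite mulrDl -[_ * (2 * _) * _]mulrA; rewrite h7 in h3; lra.
Qed.

Lemma final_bound2 (R : realType) (Cb Cs Cd X Y w c : R) : 0 <= Cb -> 0 <= Cs -> 0 <= Cd -> 0 <= X -> 0 <= Y ->
 w <= Cs * (Y * Cd) -> c <= Y * Cd ->
 w + c <= ((72 * Cb + 18) * (2 * (1 + Cs * Cd)) + (Cs * Cd + Cd)) * (X + Y).
move=> Cb0 Cs0 Cd0 X0 Y0 h1 h2; have p := mulr_ge0 Cs0 Cd0.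
have h5 : 0 <= 72 * Cb + 18 by lra.
have h8 : 0 <= (72 * Cb + 18) * (2 * (1 + Cs * Cd)) * (X + Y) by apply: mulr_ge0; [apply: mulr_ge0 => //; lra|apply: addr_ge0].
have h9 : 0 <= (Cs * Cd + Cd) * X by apply: mulr_ge0 => //; apply: addr_ge0.
have h10 : Cs * (Y * Cd) + Y * Cd = (Cs * Cd + Cd) * Y by ring.
by rewrite mulrDl [X in _ <= _ + X]mulrDr; lra.
Qed.

(** * The decomposition *)
Section Decomposition.
Context {R : realType}.
Local Notation sp := (R * R * R)%type.
Local Notation fld := ('I_3 -> R * R * R -> R).
Local Notation vfield := (R * R * R -> 'rV[R]_3).
Implicit Types (f p q : sp -> R) (w c a : fld) (u v phi : vfield) (sg : sp -> 'M[R]_3).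
Variables (D : set sp).
Hypotheses (D0 : D !=set0) (oD : open D) (cD : connected D) (bD : bounded_set D)
 (LD : lipschitz_boundary D) (sc : simply_connected D) (cbD : connected (boundary D)).
Let mD := mopen oD.
Local Notation fL := (fL D).
Local Notation fip := (fip D).
Local Notation fsq := (fsq D).
Local Notation tst := (tst D).
Local Notation wc := (wc D).

Lemma L2_cst (k : R) : Lsq D (fun=> k).
have [M M1 HM] := cl_bounded bD; have M0 : 0 < M + 1 by lra.
have LB := sm_L2_ball (0 : sp) M0 (sm_cst k).
apply: (L2_sub (mball _ _) mD _ LB) => x Dx.
have := HM x (subset_closure Dx); rewrite -ballE/= sub0r normrN; lra.
Qed.

Lemma center q : Lsq D q -> exists k : R, \int[leb3]_(x in D) (q x - k) = 0 /\
 Lsq D (fun x => q x - k) /\ nsq D (fun x => q x - k) <= 4 * nsq D q.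
move=> Lq; have L1 := L2_cst 1; have fin := fin_D oD bD.
pose I := \int[leb3]_(x in D) q x; pose m := nsq D (fun=> 1).
have iq := L2_itg_loc fin mD Lq; have i1 := L2_itg_loc fin mD L1.
have m0 : 0 <= m by exact: nsq_ge0.
have mE : \int[leb3]_(x in D) (1 : R) = m by apply: eq_int => x _; rewrite expr1n.
have CS : I ^+ 2 <= nsq D q * m.
 have := @sip_CS _ _ _ leb3 D mD _ _ Lq L1; rewrite -!nsq_sip.
 by rewrite (_ : sip leb3 D q (fun=> 1) = I)//; apply: eq_int => x _; rewrite mulr1.
have km : I / m * m = I /\ (I / m) ^+ 2 * m <= nsq D q.
 have [mz|mz] := eqVneq m 0.
  rewrite mz !mulr0 in CS *; split; last exact: nsq_ge0.
  by apply/esym/eqP; rewrite -sqrf_eq0 eq_le CS sqr_ge0.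
 split; first by rewrite divfK. have mp : 0 < m by rewrite lt_neqAle eq_sym mz.
 have -> : (I / m) ^+ 2 * m = I ^+ 2 / m by field. by rewrite ler_pdivrMr.
exists (I / m); have Lk := L2_cst (I / m).
have Lkc : Lsq D (fun x => q x - I / m) by exact: (@L2gB _ _ _ leb3 D mD).
split; last split => //.
 rewrite RintegralB//; last exact: L2_itg_loc. have -> : \int[leb3]_(x in D) (I / m) = I / m * m.
  have -> : I / m * m = I / m * \int[leb3]_(x in D) (1 : R) by rewrite mE.
  by rewrite -RintZ//; apply: eq_int => x _; rewrite mulr1.
 by rewrite km.1 subrr.
apply: le_trans (nsq_sub mD Lq Lk) _.
have -> : nsq D (fun=> I / m) = (I / m) ^+ 2 * m by rewrite /m -nsqZ//; apply: nsq_eq => x _; rewrite mulr1.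
by have := km.2; move: (nsq D q) (_ * m) => s t h; lra.
Qed.

Definition tensor (q : sp -> R) a : sp -> 'M[R]_3 := fun x => (q x)%:M + spn (mkv a x).

Lemma tensor_entry q a i j : exists (d s : R) k, [/\ forall x, tensor q a x i j = d * q x + s * a k x,
 d ^+ 2 <= 1 & s ^+ 2 <= 1].
have [s [k [E s1]]] := @spn_entry R i j; exists ((i == j)%:R), s, k; split => //.
 by move=> x; rewrite /tensor mxE mxE E mxE mulr_natl.
by case: (i == j); rewrite ?expr1n// expr0n ler01.
Qed.

Lemma tensor_L2 q a : Lsq D q -> fL a -> L2 D (tensor q a) /\
 norm0 D (tensor q a) ^+ 2 <= 9 * (2 * nsq D q + 2 * fsq a).
move=> Lq La.
have H i j : Lsq D (fun x => tensor q a x i j) /\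
  nsq D (fun x => tensor q a x i j) <= 2 * nsq D q + 2 * fsq a.
 have [d [s [k [E d1 s1]]]] := tensor_entry q a i j.
 have Ld : Lsq D (fun x => d * q x) by exact: (@L2gZ _ _ _ leb3 D mD).
 have Ls : Lsq D (fun x => s * a k x) by exact: (@L2gZ _ _ _ leb3 D mD).
 rewrite (funext E); split; first exact: (@L2gD _ _ _ leb3 D mD).
 apply: le_trans (nsq_add mD Ld Ls) _; rewrite (nsqZ d mD Lq) (nsqZ s mD (La k)).
 apply: lerD; (apply: ler_wpM2l; first exact: ler0n).
  by rewrite ler_piMl ?nsq_ge0.
 by apply: le_trans (fsq_comp D a k); rewrite ler_piMl ?nsq_ge0.
have LT : L2 D (tensor q a) by move=> i j; case: (H i j).
split => //; have E : ip D (tensor q a) (tensor q a) = \sum_i \sum_j nsq D (fun x => tensor q a x i j).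
 have I i j : itg3 D (fun x => tensor q a x i j * tensor q a x i j) by apply: (@L2g_mul _ _ _ leb3 D mD); case: (H i j).
 have I' i : itg3 D (fun x => \sum_j tensor q a x i j * tensor q a x i j) by apply: (@itg_sum _ _ _ leb3 D mD) => j _; exact: I.
 rewrite /ip /dot (@Rint_sum _ _ _ leb3 D mD _ (index_enum _) predT) => [|i _]; last exact: I'.
 apply: eq_bigr => i _. rewrite (@Rint_sum _ _ _ leb3 D mD _ (index_enum _) predT) => [|j _]; last exact: I.
 by apply: eq_bigr => j _; apply: eq_int => x _; rewrite expr2.
rewrite /norm0 E sqr_sqrtr; last by apply: sumr_ge0 => i _; apply: sumr_ge0 => j _; exact: nsq_ge0.
apply: (@le_trans _ _ (\sum_(i < 3) \sum_(j < 3) (2 * nsq D q + 2 * fsq a))).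
 by apply: ler_sum => i _; apply: ler_sum => j _; case: (H i j).
rewrite !sum3; move: (2 * nsq D q + 2 * fsq a) => t; rewrite le_eqVlt; apply/orP; left; apply/eqP; ring.
Qed.

(** Tested with the rows of a matrix field, its divergence is, up to sign, [(q,
    div v) + (a, curl v)]. *)
Lemma tensor_H0 q a (k : R) zs : cc_free D a -> Lsq D q -> sol D zs a q ->
 \int[leb3]_(x in D) (q x - k) = 0 -> Lsq D (fun x => q x - k) ->
 H0_div_devsym D (tensor (fun x => q x - k) a).
move=> ca Lq Sq I0 Lk; have [La _] := ca; have [LT _] := tensor_L2 Lk La.
have fin := fin_D oD bD.
split => //.
- have E x : \tr (tensor (fun x => q x - k) a x) = 3 * (q x - k) by exact: tr_sum.
 under eq_int do rewrite E. by rewrite RintZ ?I0 ?mulr0//; exact: L2_itg_loc.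
- move=> i p tp.
 have -> : \int[leb3]_(x in D) (0 * p x) = 0 by rewrite /Rintegral integral0_eq// => x _; rewrite mul0r.
 have Lrow : L2 D (fun x => row i (tensor (fun x => q x - k) a x)).
  apply/L2_cmp => j; have -> : cmp (fun x => row i (tensor (fun x => q x - k) a x)) j =
   fun x => tensor (fun x => q x - k) a x i j by apply/funext => x; rewrite /cmp mxE.
  exact: LT.
 have tg := tst_grd tp; have Lg' := tst_L oD tg. have Lg : L2 D (grad p) by apply/L2_cmp; rewrite cmp_grad.
 pose T : fld := fun j => if j == i then p else fun=> 0.
 have tT : tst T by move=> j; rewrite /T; case: ifP => _ //; exact: test_0.
 have pT l j x : partial l (T j) x = (j == i)%:R * partial l p x.
  rewrite /T; case: (j == i); first by rewrite mul1r. by rewrite mul0r; exact: pd_cst.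
 have dT x : \sum_j partial j (T j) x = partial i p x.
  rewrite (bigD1 i)//= pT eqxx mul1r big1 ?addr0// => j /negPf ji. by rewrite pT ji mul0r.
 have WI : \int[leb3]_(x in D) (\sum_j a j x * cu T j x) = - \int[leb3]_(x in D) (q x * partial i p x).
  rewrite (weak_identity oD bD ca (sol_potential oD bD Sq) tT); congr (- _).
  by apply: eq_int => x _; rewrite dT.
 have pt x : \sum_j cmp (fun x => row i (tensor (fun x => q x - k) a x)) j x * grd p j x =
   (\sum_j a j x * cu T j x) + (q x * partial i p x - k * partial i p x).
  have e1 j : cmp (fun x => row i (tensor (fun x => q x - k) a x)) j x * grd p j x =
    spn (mkv a x) i j * partial j p x + ((q x - k) *+ (i == j)) * partial j p x.
   by rewrite /cmp mxE /tensor mxE mxE mulrDl addrC.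
  rewrite (eq_bigr _ (fun j _ => e1 j)) big_split/= (spn_row (mkv a x) (fun j => partial j p x)); congr (_ + _).
   apply: eq_bigr => j _; rewrite mxE; congr (_ * _).
   exact: esym (f_equal2 (fun s t => s - t) (pT _ _ _) (pT _ _ _)).
  rewrite (bigD1 i)//= eqxx mulr1n big1 ?addr0 ?mulrBl// => j /negPf ji. by rewrite eq_sym ji mulr0n mul0r.
 rewrite (ip_cmp oD Lrow Lg) cmp_grad -fip_int//; last by apply/L2_cmp. have Lp := Lg' i.
 have ia : itg3 D (fun x => \sum_j a j x * cu T j x).
  apply: (@itg_sum _ _ _ leb3 D mD) => j _.
  by apply: (@L2g_mul _ _ _ leb3 D mD) => //; exact: (tst_L oD (tst_cu tT)).
 have iq : itg3 D (fun x => q x * partial i p x) by exact: (@L2g_mul _ _ _ leb3 D mD).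
 have ip1 : itg3 D (partial i p) by exact: L2_itg_loc.
 have ik : itg3 D (fun x => k * partial i p x) by exact: (@itgZ _ _ _ leb3 D mD).
 have E : \int[leb3]_(x in D) (\sum_j cmp (fun x => row i (tensor (fun x => q x - k) a x)) j x * grd p j x) = 0.
  under eq_int do rewrite pt. rewrite RintegralD//; last exact: (@itgB _ _ _ leb3 D mD).
  rewrite RintegralB// (@RintZ _ _ _ leb3 D mD k _ ip1) (test_int_pd i tp) mulr0 subr0.
  by rewrite WI addrC subrr.
 by rewrite E oppr0.
apply: ae3T => x _; have -> : sym (tensor (fun x => q x - k) a x) = (q x - k)%:M by exact: sym_sum.
exact: dev_scalar.
Qed.

Lemma decomposition : exists2 C : R, 0 <= C & forall phi, Hcurlcurl D phi -> exists sg u,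
 [/\ H0_div_devsym D sg, K0c D u, (forall x, phi x = skwp sg x + u x),
  norm0 D sg ^+ 2 <= C * (norm0 D phi ^+ 2 + K0c_dual_norm D (curlcurl D phi) ^+ 2) &
  Hcurl_norm D u ^+ 2 <= C * (norm0 D phi ^+ 2 + K0c_dual_norm D (curlcurl D phi) ^+ 2)].
have [Cs Cs0 Hsolve] := curlcurl_solve oD bD D0 LD cbD.
have [Cd Cd0 Hdual] := dual_tests oD bD LD D0 cbD.
have [zs Dzs] := D0; have [Cb Cb0 Hb] := sol_bound oD bD Dzs cD LD.
exists ((72 * Cb + 18) * (2 * (1 + Cs * Cd)) + (Cs * Cd + Cd)).
 by apply: addr_ge0; [apply: mulr_ge0; [|apply: mulr_ge0 => //]; apply: addr_ge0 => //; apply: mulr_ge0|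
  apply: addr_ge0 => //; exact: mulr_ge0].
move=> phi [Lphi ex]; have [Kl ccl] := xgetPex (fun=> 0) ex : [set l | K0c_dual D l /\ is_curlcurl D phi l] (curlcurl D phi).
set l := curlcurl D phi in Kl ccl *; set M := K0c_dual_norm D l.
have [lP _ _] := Kl; have [M0 _] := dual_bound oD bD LD Kl.
have Lphi' : fL (cmp phi) by apply/L2_cmp.
have B0 : 0 <= M * Num.sqrt Cd by apply: mulr_ge0 => //; exact: sqrtr_ge0.
have ltP (k : R) (v1 v2 : fld) : tst v1 -> tst v2 -> l (mkv (k *: v1 + v2)) = k * l (mkv v1) + l (mkv v2).
 move=> t1 t2; have H (v : fld) : tst v -> Hcurl0 D (mkv v).
  move=> tv; have := @limit_Hcurl0 R D oD (mkv v) (cu v) (L2_mkv (tst_L oD tv)) (tst_L oD (tst_cu tv)).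
  by rewrite cmp_mkv => /(_ (limit_tst oD tv))[].
 rewrite -(lP k _ _ (H _ t1) (H _ t2)); congr l. by apply/funext => x; apply/rowP => i; rewrite !mxE.
have [w [c [[Lw Lc] lim Hc Hdiv [Bc Bw]]]] := Hsolve (fun v : fld => l (mkv v)) _ B0 ltP (Hdual l Kl).
have BE : (M * Num.sqrt Cd) ^+ 2 = M ^+ 2 * Cd by rewrite exprMn sqr_sqrtr.
rewrite BE in Bc Bw.
have KN := @limit_K0c R D oD (mkv w) c (L2_mkv Lw) Lc; rewrite cmp_mkv in KN.
have [KW NW] := KN lim Hdiv.
pose a : fld := cmp phi - w; have La : fL a by exact: fLB.
have ca : cc_free D a.
 split => // v tv; have tc := tst_cu tv; have tcc := tst_cu tc; have Lcc := tst_L oD tcc.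
 rewrite (fip_int oD La Lcc) (fipB oD Lphi' Lw Lcc).
 have Lz : L2 D (curl (curl (mkv v))) by apply/L2_cmp; rewrite !cmp_curl cmp_mkv.
 have E1 : fip (cmp phi) (cu (cu v)) = l (mkv v) by rewrite (ccl (mkv v) (tst_mkv tv)) (ip_cmp oD Lphi Lz) !cmp_curl cmp_mkv.
 have E2 : fip c (cu v) = fip w (cu (cu v)) by apply: (limit_dual oD Lw Lc (tst_L oD tc) Lcc lim) => t tt; exact: fip_cu_tst.
 by rewrite E1 -E2 (Hc v tv) subrr.
have [q Sq] := sol_exists oD bD zs sc ca.
have [Lq Nq] : Lsq D q /\ nsq D q <= Cb * fsq a by apply: Hb; exists a.
have [k [I0 [Lk Nk]]] := center Lq.
exists (tensor (fun x => q x - k) a), (mkv w).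
have [_ NT] := tensor_L2 Lk La.
have X0 : 0 <= norm0 D phi ^+ 2 by exact: sqr_ge0.
have Y0 : 0 <= M ^+ 2 by exact: sqr_ge0.
have Ea : fsq a <= 2 * norm0 D phi ^+ 2 + 2 * fsq w by rewrite (norm0_cmp oD Lphi); exact: fsqB.
split => //.
- exact: tensor_H0 Sq I0 Lk.
- move=> x; rewrite /skwp /tensor skw_sum spnK; apply/rowP => i; rewrite !mxE.
 by rewrite -[a i x]/(phi x 0 i - w i x) subrK.
- apply: (final_bound1 Cb0 Cs0 Cd0 X0 Y0 Bw Ea); apply: le_trans NT _.
 by move: Nk Nq; move: (nsq D _) (nsq D q) (fsq a) (Cb * _) => n1 n2 n3 n4; lra.
- by rewrite NW; exact: (final_bound2 Cb0 Cs0 Cd0 X0 Y0 Bw Bc).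
Qed.

End Decomposition.

Theorem mainTheorem6 (R : realType) (Omega : set (R * R * R)) :
  bounded_lipschitz_domain Omega ->
  simply_connected Omega ->
  connected (boundary Omega) ->
  [/\ (* the sum of the two subspaces of L^2 is the whole space *)
      forall phi : R * R * R -> 'rV[R]_3, L2 Omega phi ->
        (Hcurlcurl Omega phi <->
         exists (sigma : R * R * R -> 'M[R]_3) (w : R * R * R -> 'rV[R]_3),
           [/\ H0_div_devsym Omega sigma, K0c Omega w &
               phi = (fun x => spn_inv (skw (sigma x)) + w x)
                 %[ae leb3 in Omega]]),
      (* the sum is direct *)
      forall (sigma : R * R * R -> 'M[R]_3) (w : R * R * R -> 'rV[R]_3),
        H0_div_devsym Omega sigma -> K0c Omega w ->
        (fun x => spn_inv (skw (sigma x))) = w %[ae leb3 in Omega] ->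
        w = (fun=> 0) %[ae leb3 in Omega] &
      (* the decomposition is stable *)
      exists C : R, forall phi : R * R * R -> 'rV[R]_3,
        Hcurlcurl Omega phi ->
        exists (sigma : R * R * R -> 'M[R]_3) (w : R * R * R -> 'rV[R]_3),
          [/\ H0_div_devsym Omega sigma, K0c Omega w,
              phi = (fun x => spn_inv (skw (sigma x)) + w x)
                %[ae leb3 in Omega] &
              norm0 Omega sigma + Hcurl_norm Omega w
                <= C * Hcurlcurl_norm Omega phi]].
Proof.
move=> [D0 oD cD bD LD] sc cbD.
have [C C0 HC] := decomposition D0 oD cD bD LD sc cbD.
split.
- move=> phi Lphi; split=> [H|[sigma [w [Hs Kw E]]]].
    have [sigma [w [Hs Kw E _ _]]] := HC phi H; exists sigma, w; split => //.
    by apply: ae3T => x _; exact: E.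
  exact: (sum_curlcurl oD Lphi Hs Kw E).
- by move=> sigma w Hs Kw E; exact: (directness D0 oD bD LD cbD Hs Kw E).
exists (2 * Num.sqrt C) => phi Hphi; have [sigma [w [Hs Kw E n1 n2]]] := HC phi Hphi.
exists sigma, w; split => //; first by apply: ae3T => x _; exact: E.
set S := norm0 Omega phi ^+ 2 + _ in n1 n2.
have sq t : 0 <= t -> t ^+ 2 <= C * S -> t <= Num.sqrt C * Num.sqrt S.
  by move=> t0 h; rewrite -sqrtrM// -[leLHS]ger0_norm// -sqrtr_sqr; exact: ler_wsqrtr.
apply: le_trans (lerD (sq (norm0 Omega sigma) (sqrtr_ge0 _) n1) (sq (Hcurl_norm Omega w) (sqrtr_ge0 _) n2)) _.
by rewrite -[leRHS]mulrA [leRHS]mulr_natl mulr2n.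
Qed.
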